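(* Let $k$ be a positive integer. If $Q_n\in\mathcal A_{k+1}^Q(\mathcal I_n,\varepsilon_n)$ and $I_n\subset\mathcal I_n$ are intervals with $|I_n|<\infty$ and $\sum_{n=1}^\infty\max(|I_n|^{-m},\varepsilon_n^m)<\infty$ for some finite positive constant $m\le k$, then $$\frac{N_{Q_n}(I_n)}{\mathbb E[N_{Q_n}(I_n)]}\xrightarrow{a.s.}1\quad\text{as }n\to\infty,$$ where $N_{Q_n}(I_n)$ is the number of real zeros of $Q_n$ on $I_n$.
   Context: $|I|$ is the length of an interval $I$. All processes $Q_n$ are defined on a common probability space. A real Gaussian analytic function (real GAF) is $Q(z)=\sum_{j\ge0}\omega_jq_j(z)$, $z\in\mathbb C$, where $\omega_j$ are i.i.d. standard real Gaussians and $q_j$ are analytic functions on $\mathbb C$, real-valued on $\mathbb R$, such that $\sum_j|q_j(z)|^2<\infty$ uniformly on compact subsets of $\mathbb C$. Linear functionals: for $\mathbf z=(x_1,y_1,\dots,x_k,y_k)\in\mathbb R^{2k}$, $\boldsymbol\xi=(\xi_1,\dots,\xi_k)\in\mathbb R^k$ and $I\subset\{1,\dots,k\}$, $L_I^{\mathbf z}Q(\boldsymbol\xi_I)=\sum_{j\in I}[x_jQ(\xi_j)+y_jQ'(\xi_j)]$, where $\boldsymbol\xi_I=(\xi_i)_{i\in I}$; $L^{\mathbf z}Q(\boldsymbol\xi)$ is the case $I=\{1,\dots,k\}$. For nonempty $I,J$, $d(\boldsymbol\xi_I,\boldsymbol\xi_J)=\inf_{i\in I,j\in J}|\xi_i-\xi_j|$.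 $\Psi_k$ is the set of non-increasing functions $\psi:[0,\infty)\to[0,\infty)$ with $\int_0^\infty\psi(x)x^{k-1}dx<\infty$. $Q$ is $2k$-nondegenerate if for any distinct real points $\zeta_1,\dots,\zeta_r$ and positive integers $m_1,\dots,m_r$ with $m_1+\dots+m_r\le 2k$, no nontrivial real linear combination of the random variables $Q^{(l)}(\zeta_i)$, $1\le i\le r$, $0\le l<m_i$, vanishes almost surely. For a positive integer $k$, $\mathcal A_k$ is the set of real GAFs $Q$ such that: (H1) $Q$ is $2k$-nondegenerate. (H2) For each $x\in\mathbb R$ there is a deterministic function $Q_x:\mathbb R\to(0,\infty)$ such that $\mathbb E[Q_x(t)Q(t+x)Q_x(s)Q(s+x)]=\mathbb E[Q(t)Q(s)]$ for all $t,s\in\mathbb R$. (H3) There exist finite positive constants $c_k,\tau_k$ and a function $\psi\in\Psi_k$ such that for all $\mathbf z\in\mathbb R^{2k}$, $\boldsymbol\xi\in\mathbb R^k$ and every partition $\{1,\dots,k\}=I\cup J$ into disjoint nonempty sets with $d:=d(\boldsymbol\xi_I,\boldsymbol\xi_J)\ge2\tau_k$, $$\big|\mathbb E[L_I^{\mathbf z}Q(\boldsymbol\xi_I)L_J^{\mathbf z}Q(\boldsymbol\xi_J)]\big|\le c_k\psi(d-\tau_k)\big(\mathbb E[|L_I^{\mathbf z}Q(\boldsymbol\xi_I)|^2]+\mathbb E[|L_J^{\mathbf z}Q(\boldsymbol\xi_J)|^2]\big).$$ For $n\ge1$ let $\mathcal I_n\subset\mathbb R$ be an interval (endpoints may depend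 on $n$) and $\varepsilon_n>0$ with $\varepsilon_n\to0$. For a positive integer $k$ and $Q\in\mathcal A_k$, $\mathcal A_k^Q(\mathcal I_n,\varepsilon_n)$ is the set of smooth centered Gaussian processes $\{Q_n(x):x\in\mathcal I_n\}$ satisfying (H4): for all $\mathbf z\in\mathbb R^{2k}$ and $\boldsymbol\xi\in\mathcal I_n^k$, $$(1-\varepsilon_n)\mathbb E[|L^{\mathbf z}Q(\boldsymbol\xi)|^2]\le\mathbb E[|L^{\mathbf z}Q_n(\boldsymbol\xi)|^2]\le(1+\varepsilon_n)\mathbb E[|L^{\mathbf z}Q(\boldsymbol\xi)|^2].$$ (In the claim these definitions are used with $k+1$ in place of $k$, so in particular $Q\in\mathcal A_{k+1}$.) *)

(* Defs.v *)
From HB Require Import structures.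
From mathcomp Require Import all_boot all_order all_algebra finmap.
From mathcomp Require Export complex.
From mathcomp Require Export all_classical all_reals all_analysis.

Set Implicit Arguments.
Unset Strict Implicit.
Unset Printing Implicit Defensive.

Import Order.TTheory GRing.Theory Num.Theory.
Import numFieldNormedType.Exports.

Local Open Scope classical_set_scope.
Local Open Scope ring_scope.
Local Open Scope complex_scope.

(* R[i] carries its topology through the alias (R[i])^o. *)
Definition analytic_at (R : realType) (f : (R[i])^o -> (R[i])^o)
    (z0 : (R[i])^o) : Prop :=
  exists a : nat -> R[i],
    \forall z \near z0,
      (fun n => \sum_(0 <= j < n) a j * (z - z0) ^+ j : (R[i])^o) @ \oo --> f z.

Definition entire (R : realType) (f : (R[i])^o -> (R[i])^o) : Prop :=
  forall z0, analytic_at f z0.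

Section random_variables.
Context {d : measure_display} {T : measurableType d} {R : realType}.
Variable P : probability T R.

Definition mutually_independent (X : nat -> {RV P >-> R}) : Prop :=
  forall (F : {fset nat}) (B : nat -> set R),
    (forall j, measurable (B j)) ->
    P (\bigcap_(j in [set` F]) (X j @^-1` B j)) =
      (\prod_(j <- F) P (X j @^-1` B j))%E.

Definition standard_gaussian (X : {RV P >-> R}) : Prop :=
  forall B : set R, measurable B -> distribution P X B = normal_prob 0 1 B.

(* A degenerate Gaussian variable is allowed; it is treated apart because
   normal_prob 0 0 is not the Dirac mass at 0. *)
Definition centered_gaussian (Y : T -> R) : Prop :=
  measurable_fun setT Y /\
  ((forall B : set R, measurable B -> P (Y @^-1` B) = \d_(0 : R) B) \/
   exists2 s : R, 0 < s &
     forall B : set R, measurable B -> P (Y @^-1` B) = normal_prob 0 s B).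

Definition centered_gaussian_process (I : set R) (X : R -> T -> R) : Prop :=
  forall (p : nat) (t a : 'I_p -> R), (forall i, I (t i)) ->
    centered_gaussian (fun w => \sum_i a i * X (t i) w).

(* The series defining Q is read as an equality of random entire functions:
   almost every path of Q is entire, and Q(z) is almost surely the sum of the
   series for each z.  As almost every path is continuous, this determines Q
   up to indistinguishability. *)
Definition real_GAF (Q : R[i] -> T -> R[i]) : Prop :=
  [/\ forall z, measurable_fun setT (fun w => complex.Re (Q z w)),
      forall z, measurable_fun setT (fun w => complex.Im (Q z w)),
      {ae P, forall w, entire (Q ^~ w)} &
      exists (omega : nat -> {RV P >-> R}) (q : nat -> R[i] -> R[i]),
      [/\ mutually_independent omega,
          forall j, standard_gaussian (omega j),
          forall j, entire (q j) /\
                    forall x : R, complex.Im (q j x%:C) = 0,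
          exists S : (R[i])^o -> (R[i])^o,
            {family compact,
              (fun n (z : (R[i])^o) =>
                 \sum_(0 <= j < n) `|q j z| ^+ 2 : (R[i])^o) @ \oo --> S} &
          forall z, {ae P, forall w,
            (fun n => \sum_(0 <= j < n) (omega j w)%:C * q j z : (R[i])^o)
              @ \oo --> (Q z w : (R[i])^o)}]].

(* Q is real-valued on the real line; this is its restriction to it. *)
Definition on_real (Q : R[i] -> T -> R[i]) : R -> T -> R :=
  fun x w => complex.Re (Q x%:C w).

(* L_I^z X(xi_I), the derivative X' being given separately so that the same
   formula serves processes on the line and processes on an interval. *)
Definition linear_functional (k : nat) (X X' : R -> T -> R) (x y xi : 'I_k -> R)
    (I : {set 'I_k}) (w : T) : R :=
  \sum_(j in I) (x j * X (xi j) w + y j * X' (xi j) w).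

End random_variables.

Section derivatives.
Context {T : Type} {R : realType}.

Definition path_derive (X : R -> T -> R) : R -> T -> R :=
  fun x w => derive1 (X ^~ w) x.

(* Derivatives along I: one-sided at an endpoint of I that belongs to I. *)
Definition quotient_in (f : R -> R) (x y : R) : R := (f y - f x) / (y - x).

Definition derive1_in (I : set R) (f : R -> R) (x : R) : R :=
  lim (quotient_in f x @ within I x^').

Definition smooth_on (I : set R) (f : R -> R) : Prop :=
  forall (l : nat) (x : R), I x ->
    cvg (quotient_in (iter l (derive1_in I) f) x @ within I x^').

Definition path_derive_in (I : set R) (X : R -> T -> R) : R -> T -> R :=
  fun x w => derive1_in I (X ^~ w) x.

End derivatives.

Definition index_dist (R : realType) (k : nat) (xi : 'I_k -> R)
    (I J : {set 'I_k}) : R :=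
  inf [set r | exists i j, [/\ i \in I, j \in J & r = `|xi i - xi j|]].

(* Only the values of psi on [0, +oo[ matter. *)
Definition Psi (R : realType) (k : nat) (psi : R -> R) : Prop :=
  [/\ forall x, 0 <= x -> 0 <= psi x,
      forall x y, 0 <= x -> x <= y -> psi y <= psi x &
      (\int[lebesgue_measure]_(x in `[0%R, +oo[) (psi x * x ^+ k.-1)%:E
        < +oo)%E].

Section class_A.
Context {d : measure_display} {T : measurableType d} {R : realType}.
Variables (P : probability T R) (Q : R[i] -> T -> R[i]).

Local Notation Qr := (on_real Q).
Local Notation L x y xi I := (linear_functional Qr (path_derive Qr) x y xi I).

Definition nondegenerate (p : nat) : Prop :=
  forall (r : nat) (zeta : 'I_r -> R) (m : 'I_r -> nat),
    injective zeta -> (forall i, (0 < m i)%N) -> (\sum_i m i <= p)%N ->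
    forall c : forall i, 'I_(m i) -> R,
      {ae P, forall w,
        \sum_i \sum_(l < m i) c i l * derive1n l (Qr ^~ w) (zeta i) = 0} ->
      forall i l, c i l = 0.

Definition normalized_stationary : Prop :=
  forall x : R, exists Qx : R -> R,
    (forall t, 0 < Qx t) /\
    forall t s : R,
      ('E_P[(fun w => Qx t * Qr (t + x) w * Qx s * Qr (s + x) w)%R] =
       'E_P[(fun w => Qr t w * Qr s w)%R])%E.

Definition decorrelation (k : nat) : Prop :=
  exists (c tau : R) (psi : R -> R),
    [/\ 0 < c, 0 < tau, Psi k psi &
    forall (x y xi : 'I_k -> R) (I J : {set 'I_k}),
      I :|: J = finset.setT -> I :&: J = finset.set0 ->
      I != finset.set0 -> J != finset.set0 ->
      2 * tau <= index_dist xi I J ->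
      (`|'E_P[(fun w => L x y xi I w * L x y xi J w)%R]| <=
       (c * psi (index_dist xi I J - tau))%:E *
       ('E_P[(fun w => `|L x y xi I w| ^+ 2)%R] +
        'E_P[(fun w => `|L x y xi J w| ^+ 2)%R]))%E].

Definition class_A (k : nat) : Prop :=
  [/\ real_GAF P Q, nondegenerate (2 * k), normalized_stationary &
      decorrelation k].

End class_A.

(* The class A_k^Q(I, eps).  Only the law of Q matters, so Q may live on
   a probability space P0 of its own. *)
Definition class_AQ (R : realType) (d0 : measure_display)
    (T0 : measurableType d0) (P0 : probability T0 R) (Q : R[i] -> T0 -> R[i])
    (d : measure_display) (T : measurableType d) (P : probability T R)
    (k : nat) (I : set R) (eps : R) (X : R -> T -> R) : Prop :=
  [/\ centered_gaussian_process P I X,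
      {ae P, forall w, smooth_on I (X ^~ w)} &
      forall x y xi : 'I_k -> R, (forall j, I (xi j)) ->
        let EQ := ('E_P0[(fun w =>
          `|linear_functional (on_real Q) (path_derive (on_real Q))
              x y xi finset.setT w| ^+ 2)%R])%E in
        let EX := ('E_P[(fun w =>
          `|linear_functional X (path_derive_in I X)
              x y xi finset.setT w| ^+ 2)%R])%E in
        ((1 - eps)%:E * EQ <= EX)%E /\ (EX <= (1 + eps)%:E * EQ)%E].

(* N_X(I): the number of zeros of X in I, +oo if there are infinitely many. *)
Definition nb_zeros (T : Type) (R : realType) (X : R -> T -> R) (I : set R)
    (w : T) : \bar R :=
  counting (I `&` [set x | X x w = 0]).

(* Main.v *)
(* Dividing by the standard deviation of Q turns Q into a stationary process Z
   with unit variance and correlation O(1/u^2).  By (H4) the quotient Y of Q_n is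
   L^2-close to Z on functionals of k+1 values and first derivatives; letting
   the k+1 points collide (Hermite interpolation) controls derivatives up to
   order 2k+1.  With d = max(1/|I_n|, eps_n), cut I_n into cells whose width is
   a small power of d.  Outside few cells, handled by small ball estimates and
   dyadic subdivision, a cell contains at most one zero, detected by a sign
   change; so the number of zeros is a linear statistic of products of signs of
   consecutive samples.  Signs are replaced by trigonometric polynomials, for
   which an independent copy can be reached by rotation, so that the statistic
   concentrates with error probability O(d^k).  Since m <= k these
   probabilities are summable, and Borel-Cantelli concludes because the mean is
   at least of order |I_n|. *)

Require Import Defs.
From HB Require Import structures.
From mathcomp Require Import all_boot all_order all_algebra finmap.
From mathcomp Require Import complex ring lra zify.
From mathcomp Require Import all_classical all_reals all_analysis.
From mathcomp Require Import measurable_realfun.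
Import Order.TTheory GRing.Theory Num.Theory.
Import numFieldNormedType.Exports.
Local Open Scope classical_set_scope.
Local Open Scope ring_scope.
Set Implicit Arguments.
Unset Strict Implicit.
Unset Printing Implicit Defensive.

(** Gaussian laws enter through the expectations of cos (s V + th). The phase th replaces complex
    exponentials, and sums of such cosines form an algebra, so equality in law is tested on
    trigonometric polynomials and no joint density is written. The zero count is not known to be
    measurable: it is sandwiched almost surely between integrable functions, and its integral is a
    supremum over simple functions. Scales: with K = d^(-1/72) and kap = 1 / K, cells have width
    about kap^16 and the smooth sign has slope about K^18. The squared slope times the averaged
    covariance, of order kap^72, is kap^36, so a deviation beyond kap^17 per cell has probability of
    order (kap^2)^q by moments of order 2 q, hence kap^(72 k) = d^k for q large. Summed over the
    cells, an error kap^17 costs only |I_n| kap. Samples close to 0 are too frequent for a Markov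
    bound of order d^k; their number is bounded by a product statistic with shift 0, which
    concentrates as well. The other exceptional events have means small enough for Markov's
    inequality. *)

Lemma cvgn_ge {R : realType} (u : nat -> R) (l C : R) :
  u @ \oo --> l -> (forall n, C <= u n) -> C <= l.
Proof.
by move=> ul uC; apply: (ler_cvg_to (cvg_cst C) ul); exact: nearW.
Qed.

(** * Expectations *)

Section expectation.
Context {d : measure_display} {T : measurableType d} {R : realType}.
Variable P : probability T R.
Implicit Types (f g : T -> R).

Definition intg f : Prop := P.-integrable setT (EFin \o f).
Definition Ex f : R := \int[P]_w f w.

Lemma intg_meas f : intg f -> measurable_fun setT f.
Proof. by move=> /integrableP[/measurable_EFinP]. Qed.

Lemma intg_le f g : measurable_fun setT f -> (forall w, `|f w| <= g w) ->
  intg g -> intg f.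
Proof.
move=> mf fg ig; apply: (le_integrable _ _ _ ig) => //.
  exact/measurable_EFinP.
by move=> x _ /=; rewrite lee_fin (le_trans (fg x))// ler_norm.
Qed.

Lemma intg_cst (c : R) : intg (cst c).
Proof. exact: finite_measure_integrable_cst. Qed.

Lemma intg_bnd f M : measurable_fun setT f -> (forall w, `|f w| <= M) -> intg f.
Proof. by move=> mf fM; apply: (intg_le mf fM); exact: intg_cst. Qed.

Lemma intgD f g : intg f -> intg g -> intg (fun w => f w + g w).
Proof. by move=> If Ig; have := integrableD measurableT If Ig. Qed.

Lemma intgZ c f : intg f -> intg (fun w => c * f w).
Proof. by move=> If; have := integrableZl measurableT c If. Qed.

Lemma intgB f g : intg f -> intg g -> intg (fun w => f w - g w).
Proof. by move=> If Ig; have := integrableB measurableT If Ig. Qed.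

Lemma intg_norm f : intg f -> intg (fun w => `|f w|).
Proof.
move=> If; apply: (@intg_le _ (fun w => `|f w|)) => //.
  by apply: measurableT_comp => //; exact: intg_meas.
  by move=> w; rewrite normr_id.
by have := integrable_norm If.
Qed.

Lemma intg_sum I (s : seq I) (p : pred I) (F : I -> T -> R) :
  (forall i, p i -> intg (F i)) -> intg (fun w => \sum_(i <- s | p i) F i w).
Proof.
move=> IF; elim: s => [|i s IH].
  by under [X in intg X]eq_fun do rewrite big_nil; exact: intg_cst.
under [X in intg X]eq_fun do rewrite big_cons.
by case pi : (p i) => //; apply: intgD => //; exact: IF.
Qed.

Lemma ExD f g : intg f -> intg g -> Ex (fun w => f w + g w) = Ex f + Ex g.
Proof. by move=> If Ig; exact: RintegralD. Qed.

Lemma ExB f g : intg f -> intg g -> Ex (fun w => f w - g w) = Ex f - Ex g.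
Proof. by move=> If Ig; exact: RintegralB. Qed.

Lemma ExZ c f : intg f -> Ex (fun w => c * f w) = c * Ex f.
Proof. by move=> If; exact: RintegralZl. Qed.

Lemma Ex_cst c : Ex (cst c) = c.
Proof.
transitivity (c * fine (P setT)); first exact: Rintegral_cst.
by rewrite probability_setT mulr1.
Qed.

Lemma Ex_sum I (s : seq I) (p : pred I) (F : I -> T -> R) :
  (forall i, p i -> intg (F i)) ->
  Ex (fun w => \sum_(i <- s | p i) F i w) = \sum_(i <- s | p i) Ex (F i).
Proof.
move=> IF; elim: s => [|i s IH].
  by under [X in Ex X]eq_fun do rewrite big_nil; rewrite Ex_cst big_nil.
under [X in Ex X]eq_fun do rewrite big_cons.
rewrite big_cons; case pi : (p i) => //.
by rewrite ExD ?IH//; [exact: IF|exact: intg_sum].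
Qed.

Lemma Ex_ge0 f : (forall w, 0 <= f w) -> 0 <= Ex f.
Proof. by move=> f0; apply: Rintegral_ge0. Qed.

Lemma Ex_le f g : intg f -> intg g -> (forall w, f w <= g w) -> Ex f <= Ex g.
Proof. by move=> If Ig fg; apply: le_Rintegral. Qed.

Lemma ExE f : intg f -> (\int[P]_w (f w)%:E)%E = (Ex f)%:E.
Proof. by move=> If; rewrite /Ex /Rintegral fineK//; exact: integrable_fin_num. Qed.

Lemma intg_lt f : measurable_fun setT f -> (forall w, 0 <= f w) ->
  (\int[P]_w (f w)%:E < +oo)%E -> intg f.
Proof.
move=> mf f0 fy; apply/integrableP; split; first exact/measurable_EFinP.
by under eq_integral do rewrite gee0_abs ?lee_fin//.
Qed.

Lemma Ex_dom_cvg (F : nat -> T -> R) f g :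
  (forall n, measurable_fun setT (F n)) -> measurable_fun setT f -> intg g ->
  (forall n w, `|F n w| <= g w) ->
  {ae P, forall w, F ^~ w @ \oo --> f w} ->
  Ex (F n) @[n --> \oo] --> Ex f.
Proof.
move=> mF mf Ig Fg Ff.
have [||||If _ h] := @dominated_convergence _ _ _ P setT measurableT
    (fun n w => (F n w)%:E) (fun w => (f w)%:E) (EFin \o g) _ _ _ Ig.
- by move=> n; exact/measurable_EFinP.
- exact/measurable_EFinP.
- apply: filterS Ff => w h _; apply: cvg_EFin => //; exact: nearW.
- by apply: aeW => w n _; rewrite lee_fin.
rewrite -/(intg f) in If; rewrite (ExE If) in h.
exact: (fine_cvg h).
Qed.

Lemma Ex_bnd_cvg (F : nat -> T -> R) f M :
  (forall n, measurable_fun setT (F n)) -> measurable_fun setT f ->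
  (forall n w, `|F n w| <= M) ->
  {ae P, forall w, F ^~ w @ \oo --> f w} ->
  Ex (F n) @[n --> \oo] --> Ex f.
Proof. by move=> mF mf Fg Ff; apply: (Ex_dom_cvg mF mf (intg_cst M)). Qed.

(** A bound on the expectations along the sequence also yields integrability of the limit; Gaussian
    moments are obtained in this way from expectations of bounded functions. *)
Lemma Ex_fatou (F : nat -> T -> R) f C :
  (forall n, intg (F n)) -> (forall n w, 0 <= F n w) ->
  (forall w, F ^~ w @ \oo --> f w) -> (forall n, Ex (F n) <= C) ->
  intg f /\ Ex f <= C.
Proof.
move=> IF F0 Ff FC.
have f0 w : 0 <= f w by apply: (cvgn_ge (Ff w)).
have mf : measurable_fun setT f.
  by apply: (measurable_fun_cvg (fun n => intg_meas (IF n))) => w _; exact: Ff.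
have h : (\int[P]_w (f w)%:E <= C%:E)%E.
  have := @fatou _ _ _ P setT measurableT (fun n w => (F n w)%:E).
  rewrite (_ : (fun x => _) = fun w => (f w)%:E); last first.
    apply/funext => w; have Fw : (F n w)%:E @[n --> \oo] --> (f w)%:E.
      by apply: cvg_EFin; [exact: nearW|exact: Ff].
    by rewrite (cvg_limn_einf_sup Fw).1.
  move=> h; apply: (le_trans (h _ _)).
  - by move=> n; apply/measurable_EFinP; exact: intg_meas.
  - by move=> n w _; rewrite lee_fin.
  - rewrite limn_einf_lim; apply: lime_le; first exact: is_cvg_einfs.
    apply: nearW => n; apply: le_trans (ereal_inf_lbound _) _.
      by exists n => //=; exact: leqnn.
    by rewrite ExE// lee_fin.
have If : intg f by apply: intg_lt => //; exact: le_lt_trans h (ltry _).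
by split=> //; rewrite -lee_fin -ExE.
Qed.

Lemma intg_sqr_mul f g : measurable_fun setT f -> measurable_fun setT g ->
  intg (fun w => f w ^+ 2) -> intg (fun w => g w ^+ 2) ->
  intg (fun w => f w * g w).
Proof.
move=> mf mg If Ig; apply: (@intg_le _ (fun w => f w ^+ 2 + g w ^+ 2)).
- exact: measurable_funM.
- move=> w; rewrite normrM -(real_normK (num_real (f w))).
  by rewrite -(real_normK (num_real (g w))); nra.
- exact: intgD.
Qed.

(** The quadratic polynomial E[(t f + g)^2] in t is nonnegative. If its leading coefficient [a] is
    nonzero, its value at - c / a gives the bound. *)
Lemma Ex_cauchy f g : measurable_fun setT f -> measurable_fun setT g ->
  intg (fun w => f w ^+ 2) -> intg (fun w => g w ^+ 2) ->
  Ex (fun w => f w * g w) ^+ 2 <= Ex (fun w => f w ^+ 2) * Ex (fun w => g w ^+ 2).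
Proof.
move=> mf mg If Ig; have Ifg := intg_sqr_mul mf mg If Ig.
set a := Ex (fun w => f w ^+ 2); set b := Ex (fun w => g w ^+ 2); set c := Ex _.
have H t : 0 <= a * t ^+ 2 + 2 * c * t + b.
  have -> : a * t ^+ 2 + 2 * c * t + b = Ex (fun w => (t * f w + g w) ^+ 2).
    rewrite (_ : (fun w => _) =
      fun w => t ^+ 2 * f w ^+ 2 + ((2 * t) * (f w * g w) + g w ^+ 2)); last first.
      by apply/funext => w; ring.
    rewrite ExD ?ExD ?ExZ//; rewrite -/a -/b -/c; first by ring.
    - exact: intgZ.
    - exact: intgZ.
    - by apply: intgD => //; exact: intgZ.
  by apply: Ex_ge0 => w; exact: sqr_ge0.
have a0 : 0 <= a by apply: Ex_ge0 => w; exact: sqr_ge0.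
have [a_eq|a_neq] := eqVneq a 0.
  rewrite a_eq mul0r; have [->|c0] := eqVneq c 0; first by rewrite expr0n.
  (* When [a] is 0 and [c] is not, the affine function would take the value -1 at this point. *)
  have := H (- (b + 1) / (2 * c)); rewrite a_eq mul0r add0r mulrCA divff.
    by rewrite mulr1; lra.
  by rewrite mulf_neq0.
have := H (- c / a); rewrite expr_div_n sqrrN => h.
have : 0 <= a * (a * (c ^+ 2 / a ^+ 2) + 2 * c * (- c / a) + b).
  exact: mulr_ge0.
have -> : a * (a * (c ^+ 2 / a ^+ 2) + 2 * c * (- c / a) + b) = a * b - c ^+ 2.
  by field.
by rewrite subr_ge0.
Qed.

Lemma Pr_markov f (a : R) : 0 < a -> intg f -> (forall w, 0 <= f w) ->
  (P [set w | (a <= f w)%R] <= (Ex f / a)%:E)%E.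
Proof.
move=> a0 If f0; have mf := intg_meas If.
have := @le_integral_abse _ _ _ P setT measurableT (EFin \o f) a.
move=> /(_ _ a0); rewrite setTI => h.
have /h : measurable_fun setT (EFin \o f) by exact/measurable_EFinP.
under eq_integral do rewrite gee0_abs ?lee_fin//=.
rewrite ExE// (_ : [set _ | _] = [set w | a <= f w]); last first.
  by apply/seteqP; split=> w /=; rewrite lee_fin ger0_norm.
move=> {}h; rewrite EFinM; rewrite lee_pdivlMr//.
by rewrite muleC.
Qed.
End expectation.

(** * The normal law *)

Section normal.
Context {R : realType}.
Local Notation mu := (@lebesgue_measure R).
Implicit Types (s t x : R) (f : R -> R).

(** The Radon-Nikodym derivative and the explicit density have the same integral over every
    measurable set, so they agree almost everywhere. *)
Lemma ge0_integral_normal_prob s (f : R -> \bar R) A :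
  (forall x, (0 <= f x)%E) -> measurable A -> measurable_fun setT f ->
  (\int[normal_prob 0 s]_(x in A) f x =
   \int[mu]_(x in A) (f x * (normal_pdf 0 s x)%:E))%E.
Proof.
move=> f0 mA mfT; have mf := measurable_funTS mfT : measurable_fun A f; have dom := normal_prob_dominates 0 s.
rewrite -(Radon_Nikodym_SigmaFinite.change_of_variables dom)//.
have RNE := Radon_Nikodym_SigmaFinite.f_integral dom.
apply: ae_eq_integral => //.
- apply: emeasurable_funM => //; apply: measurable_funTS.
  exact: measurable_int (Radon_Nikodym_SigmaFinite.f_integrable dom).
- apply: emeasurable_funM => //; apply: measurable_funTS.
  by apply/measurable_EFinP; exact: measurable_normal_pdf.
- apply: ae_eqe_mul2l => /=; apply: integral_ae_eq => //=.
  + apply: (@integrableS _ _ _ _ setT) => //.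
    exact: Radon_Nikodym_SigmaFinite.f_integrable.
  + by apply/measurable_EFinP/measurable_funTS; exact: measurable_normal_pdf.
  + by move=> E _ mE; rewrite -RNE.
Qed.

Lemma integral_normal_prob s f A : intg (normal_prob 0 s) f -> measurable A ->
  (\int[normal_prob 0 s]_(x in A) (f x)%:E =
   \int[mu]_(x in A) (f x * normal_pdf 0 s x)%:E)%E.
Proof.
move=> If mA; have mf := intg_meas If.
have mfE : measurable_fun setT (EFin \o f) by exact/measurable_EFinP.
rewrite integralE [RHS]integralE !ge0_integral_normal_prob//.
2: exact: measurable_funeneg.
2: exact: measurable_funepos.
congr (_ - _)%E; apply: eq_integral => x _; rewrite ?funepos.unlock ?funeneg.unlock
  -?EFinN -!EFin_max -EFinM; congr EFin.
- by rewrite maxr_pMl ?normal_pdf_ge0// mul0r.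
- by rewrite maxr_pMl ?normal_pdf_ge0// mul0r mulNr.
Qed.

Lemma Ex_normal s f : intg (normal_prob 0 s) f ->
  Ex (normal_prob 0 s) f = \int[mu]_x (f x * normal_pdf 0 s x).
Proof. by move=> If; rewrite /Ex /Rintegral integral_normal_prob. Qed.

Lemma pow_fact_le_expR (x : R) n : 0 <= x -> x ^+ n <= n`!%:R * expR x.
Proof.
move=> x0; case: n => [|n]; first by rewrite fact0 mul1r expr0 -[leLHS]expR0 ler_expR.
have := expR_ge1Dxn n x0; rewrite -ler_pdivrMl ?ltr0n ?fact_gt0// mulrC.
by move=> h; apply: le_trans h; rewrite lerDr.
Qed.

(** With u = x^2 / (4 s^2), half of the exponential absorbs the power through u^p <= p! e^u; what is
    left is a multiple of the density of deviation sqrt 2 s. *)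
Lemma normal_moment p : exists C, forall s, 0 < s ->
  intg (normal_prob 0 s) (fun x => x ^+ (p.*2)) /\
  Ex (normal_prob 0 s) (fun x => x ^+ (p.*2)) <= C * s ^+ (p.*2).
Proof.
exists (p`!%:R * 4 ^+ p * Num.sqrt 2) => s s0.
pose s2 := Num.sqrt 2 * s.
have s20 : 0 < s2 by rewrite mulr_gt0// sqrtr_gt0.
have mX : measurable_fun setT (fun x : R => x ^+ p.*2) by exact: measurable_funX.
have X0 x : 0 <= x ^+ p.*2 by rewrite -mul2n exprM exprn_ge0// sqr_ge0.
set C := p`!%:R * 4 ^+ p * Num.sqrt 2.
have C0 : 0 <= C by rewrite !mulr_ge0// exprn_ge0.
have H x : x ^+ p.*2 * normal_pdf 0 s x <=
           C * s ^+ p.*2 * normal_pdf 0 s2 x.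
  rewrite !normal_pdfE ?gt_eqF// /normal_peak /normal_fun subr0.
  set u := x ^+ 2 / (4 * s ^+ 2).
  have s4 : s2 ^+ 2 = 2 * s ^+ 2 by rewrite exprMn sqr_sqrtr.
  have -> : - x ^+ 2 / (s ^+ 2 *+ 2) = - u - u.
    by rewrite /u; field; rewrite gt_eqF.
  have -> : - x ^+ 2 / (s2 ^+ 2 *+ 2) = - u.
    by rewrite s4 /u; field; rewrite gt_eqF.
  have -> : x ^+ p.*2 = u ^+ p * (4 ^+ p * s ^+ p.*2).
    rewrite -mul2n !exprM -!exprMn; congr (_ ^+ _).
    by rewrite /u; field; rewrite gt_eqF.
  have -> : Num.sqrt (s2 ^+ 2 * pi *+ 2) = Num.sqrt 2 * Num.sqrt (s ^+ 2 * pi *+ 2).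
    by rewrite -sqrtrM// s4; congr Num.sqrt; rewrite !mulr2n; ring.
  have u0 : 0 <= u by rewrite divr_ge0 ?sqr_ge0// mulr_ge0// sqr_ge0.
  have := pow_fact_le_expR p u0; rewrite expRD.
  set a := (Num.sqrt (s ^+ 2 * pi *+ 2))^-1 => h.
  rewrite invfM -/a.
  have -> : C * s ^+ p.*2 * ((Num.sqrt 2)^-1 * a * expR (- u)) =
      (p`!%:R * expR u * expR (- u)) * expR (- u) * (4 ^+ p * s ^+ p.*2 * a).
    rewrite -(mulrA p`!%:R) -expRD subrr expR0 mulr1 /C.
    by field; rewrite gt_eqF// sqrtr_gt0.
  have -> : u ^+ p * (4 ^+ p * s ^+ p.*2) * (a * (expR (- u) * expR (- u))) =
    u ^+ p * expR (- u) * expR (- u) * (4 ^+ p * s ^+ p.*2 * a) by ring.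
  apply: ler_wpM2r.
    by rewrite !mulr_ge0// ?invr_ge0 ?sqrtr_ge0 ?exprn_ge0// ltW.
  by rewrite !ler_wpM2r// ?expR_ge0.
have mE : measurable_fun setT (fun x : R => (x ^+ p.*2)%:E) by exact/measurable_EFinP.
have L : (\int[normal_prob 0 s]_x (x ^+ p.*2)%:E <= (C * s ^+ p.*2)%:E)%E.
  rewrite ge0_integral_normal_prob//.
  apply: (@le_trans _ _ (\int[mu]_x ((C * s ^+ p.*2)%:E * (normal_pdf 0 s2 x)%:E))%E).
    apply: ge0_le_integral => //.
    - by move=> x _; rewrite -EFinM lee_fin mulr_ge0// normal_pdf_ge0.
    - apply: emeasurable_funM => //; apply/measurable_EFinP.
      exact: measurable_normal_pdf.
    - apply: emeasurable_funM => //; apply/measurable_EFinP.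
      exact: measurable_normal_pdf.
    - by move=> x _; rewrite -!EFinM lee_fin.
  rewrite ge0_integralZl_EFin//.
  - by rewrite integral_normal_pdf mule1.
  - by move=> x _; rewrite lee_fin normal_pdf_ge0.
  - by apply/measurable_EFinP; exact: measurable_normal_pdf.
  - by rewrite mulr_ge0// exprn_ge0// ltW.
have I : intg (normal_prob 0 s) (fun x => x ^+ p.*2).
  by apply: intg_lt => //; exact: le_lt_trans L (ltry _).
by split=> //; rewrite -lee_fin -ExE.
Qed.

Lemma is_derive_normal_pdf sd x : sd != 0 ->
  is_derive x 1 (normal_pdf 0 sd) (- (x / sd ^+ 2) * normal_pdf 0 sd x).
Proof.
move=> sd0; rewrite normal_pdfE// /normal_fun.
have -> : (fun y => normal_peak sd * expR (- (y - 0) ^+ 2 / (sd ^+ 2 *+ 2))) =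
  normal_peak sd *: (expR \o (fun y => (- (sd ^+ 2 *+ 2)^-1) *: y ^+ 2)).
  apply/funext => y /=; rewrite subr0 /GRing.scale /=; congr (_ * expR _).
  by rewrite mulrC mulNr mulrN.
apply: is_derive_eq.
rewrite /GRing.scale /= !subr0 !mulr1.
have -> : - (sd ^+ 2 *+ 2)^-1 * x ^+ 2 = - x ^+ 2 / (sd ^+ 2 *+ 2).
  by rewrite mulrC mulNr mulrN.
by field.
Qed.

Section characteristic_function.
Variables (sd : R).
Hypothesis sd0 : 0 < sd.
Local Notation N := (normal_prob 0 sd).

Lemma normal_intg_norm : intg N (fun x => `|x|).
Proof.
have [C /(_ sd sd0)[I _]] := normal_moment 1.
apply: (@intg_le _ _ _ N _ (fun x : R => 1 + x ^+ 2)).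
- exact: measurableT_comp.
- move=> x; rewrite normr_id -(real_normK (num_real x)); nra.
- by apply: intgD => //; exact: intg_cst.
Qed.

Lemma measurable_cos_affine (t th : R) : measurable_fun setT (fun x : R => cos (t * x + th)).
Proof.
apply: continuous_measurable_fun => x.
apply: (@continuous_comp _ _ _ (fun x : R => t * x + th) cos); last exact: continuous_cos.
by apply: cvgD; [apply: cvgMr; exact: cvg_id|exact: cvg_cst].
Qed.

Lemma normal_intg_cos (t th : R) : intg N (fun x => cos (t * x + th)).
Proof.
apply: (@intg_bnd _ _ _ N _ 1); first exact: measurable_cos_affine.
by move=> x; rewrite ler_norml cos_geN1 cos_le1.
Qed.

Lemma measurable_sin_affine (t th : R) : measurable_fun setT (fun x : R => sin (t * x + th)).
Proof.
under eq_fun do rewrite -cosBpihalf -addrA; exact: measurable_cos_affine.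
Qed.

Lemma normal_intg_xsin (t th : R) : intg N (fun x => x * sin (t * x + th)).
Proof.
apply: (@intg_le _ _ _ N _ (fun x => `|x|) _ _ normal_intg_norm).
  by apply: measurable_funM => //; exact: measurable_sin_affine.
move=> x; rewrite normrM ler_piMr// ler_norml sin_geN1 sin_le1//.
Qed.

Lemma is_derive_sin_affine (t th x : R) :
  is_derive x 1 (fun x => sin (t * x + th)) (t * cos (t * x + th)).
Proof.
rewrite (_ : (fun x => _) = sin \o (fun x => t *: x + cst th x)) //.
by apply: is_derive_eq; rewrite /GRing.scale /= addr0 mulr1 mulrC.
Qed.

Lemma is_derive_cos_affine (t th x : R) :
  is_derive x 1 (fun x => cos (t * x + th)) (- t * sin (t * x + th)).
Proof.
rewrite (_ : (fun x => _) = cos \o (fun x => t *: x + cst th x)) //.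
by apply: is_derive_eq; rewrite /GRing.scale /= addr0 mulr1; ring.
Qed.

(** Integration by parts: x times the density is - sd^2 times its derivative. *)
Lemma normal_stein (t th : R) :
  Ex N (fun x => x * sin (t * x + th)) = sd ^+ 2 * t * Ex N (fun x => cos (t * x + th)).
Proof.
(* [h] times the density is the derivative of [G], so its integral over [-n-1, n+1] is a boundary
   term, which tends to 0. *)
pose h x := t * cos (t * x + th) - (sd ^+ 2)^-1 * (x * sin (t * x + th)).
have Ih : intg N h by apply: intgB; [exact/intgZ/normal_intg_cos|exact/intgZ/normal_intg_xsin].
suff h0 : Ex N h = 0.
  move: h0; rewrite ExB; [|exact/intgZ/normal_intg_cos|exact/intgZ/normal_intg_xsin].
  rewrite (ExZ _ (normal_intg_cos t th)) (ExZ _ (normal_intg_xsin t th)).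
  move=> /eqP; rewrite subr_eq0 => /eqP H.
  by rewrite -mulrA H mulrA divff ?mul1r// sqrf_eq0 gt_eqF.
pose G x := sin (t * x + th) * normal_pdf 0 sd x.
pose B (n : nat) := `[- n.+1%:R, n.+1%:R]%classic : set R.
pose F n x := h x * \1_(B n) x.
have mB n : measurable (B n) by exact: measurable_itv.
have FE : Ex N (F n) @[n --> \oo] --> Ex N h.
  apply: (@Ex_dom_cvg _ _ _ N _ _ (fun x => `|h x|)).
  - move=> n; apply: measurable_funM; [exact: (intg_meas Ih)|].
    exact: (measurable_indic (mB n)).
  - exact: intg_meas Ih.
  - exact: intg_norm.
  - move=> n x; rewrite normrM ler_piMr// ger0_norm// indicE.
  - apply: aeW => x; apply: cvg_near_cst.
    near=> n; rewrite /F indicE mem_set ?mulr1//= /B/= in_itv/= -ler_norml.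
    near: n; exists (Num.truncn `|x|) => // n /= xn.
    by rewrite (le_trans (ltW (truncnS_gt _)))// ler_nat ltnS.
have FG n : Ex N (F n) = G n.+1%:R - G (- n.+1%:R).
  have -> : Ex N (F n) = fine (\int[N]_(x in B n) (h x)%:E)%E.
    rewrite /Ex /Rintegral [in RHS]integral_mkcond; congr fine.
    apply: eq_integral => x _; rewrite /F /restrict indicE.
    by case: ifP => _; rewrite ?mulr1 ?mulr0.
  rewrite integral_normal_prob//; last exact: mB.
  have dG x : is_derive x 1 G (h x * normal_pdf 0 sd x).
    have := is_derive_sin_affine t th x.
    have := @is_derive_normal_pdf sd x; rewrite gt_eqF// => /(_ isT) h1 h2.
    apply: is_derive_eq; rewrite /GRing.scale/= /h.
    by field; rewrite gt_eqF.

  have cpdf : continuous (normal_pdf 0 sd) by apply: continuous_normal_pdf; rewrite gt_eqF.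
  have cG : continuous G.
    by move=> x; apply: differentiable_continuous; apply/derivable1_diffP; exact: ex_derive.
  have ch : continuous h.
    move=> x; apply: cvgB.
      apply: cvgMr; apply: differentiable_continuous; apply/derivable1_diffP.
      exact: (ex_derive (is_derive := is_derive_cos_affine t th x)).
    apply: cvgMr; apply: cvgM; first exact: cvg_id.
    apply: differentiable_continuous; apply/derivable1_diffP.
    exact: (ex_derive (is_derive := is_derive_sin_affine t th x)).
  rewrite (@continuous_FTC2 _ _ G); first by [].
  - by rewrite gtrN// ltr0n.
  - by apply: continuous_subspaceT => x; apply: cvgM; [exact: ch|exact: cpdf].
  - split; first by move=> x _; exact: ex_derive.
      by apply: cvg_at_right_filter; exact: cG.
    by apply: cvg_at_left_filter; exact: cG.
  - by move=> x _; rewrite derive1E derive_val.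
have G0 (u : nat -> R) : (forall n, n.+1%:R <= `|u n|) -> G (u n) @[n --> \oo] --> 0.
  move=> nu.
  have pE x : normal_pdf 0 sd x = normal_peak sd * expR (- (x ^+ 2 / (sd ^+ 2 *+ 2))).
    by rewrite normal_pdfE ?gt_eqF// /normal_fun subr0 mulNr.
  pose K := normal_peak sd * (sd ^+ 2 *+ 2).
  have K0 : 0 <= K by rewrite mulr_ge0 ?normal_peak_ge0// mulrn_wge0// sqr_ge0.
  have GK n : `|G (u n)| <= K * n.+1%:R^-1.
    rewrite normrM (ger0_norm (normal_pdf_ge0 _ _ _)).
    apply: le_trans (ler_piMl (normal_pdf_ge0 _ _ _) _) _.
      by rewrite ler_norml sin_geN1 sin_le1.
    rewrite pE /K -mulrA ler_wpM2l ?normal_peak_ge0//.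
    set v := u n ^+ 2; set w := sd ^+ 2 *+ 2.
    have w0 : 0 < w by rewrite pmulrn_lgt0// exprn_gt0.
    have nv : n.+1%:R <= v.
      rewrite /v -(real_normK (num_real _)); have := nu n.
      have : 1 <= n.+1%:R :> R by rewrite ler1n.
      nra.
    have n0 : 0 < n.+1%:R :> R by [].
    have v0 : 0 < v by exact: lt_le_trans nv.
    rewrite expRN -[leRHS]invrK invfM invrK lef_pV2 ?posrE ?expR_gt0 ?divr_gt0//; last first.
      by rewrite mulr_gt0// invr_gt0.
    have := expR_ge1Dx (v / w).
    have : w^-1 * n.+1%:R <= v / w by rewrite mulrC ler_wpM2r// invr_ge0 ltW.
    lra.
  apply: norm_cvg0; apply: (@squeeze_cvgr _ _ _ _ (cst 0) (fun n => K * n.+1%:R^-1)).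
  - by apply: nearW => n; rewrite normr_ge0 GK.
  - exact: cvg_cst.
  - by rewrite -(mulr0 K); apply: cvgMr; exact: cvg_harmonic.
have L0 : Ex N (F n) @[n --> \oo] --> 0.
  under eq_fun do rewrite FG.
  by rewrite -(subr0 0); apply: cvgB; apply: G0 => n; rewrite ?normrN ger0_norm.
by rewrite -(cvg_lim _ FE)// (cvg_lim _ L0).
Unshelve. all: by end_near. Qed.

(** Differentiation in t under the integral and [normal_stein] give F' = - sd^2 t F, so F times exp
    (t^2 sd^2 / 2) is constant. The phase [th] covers sine and cosine at once. *)
Lemma normal_cf (t th : R) :
  Ex N (fun x => cos (t * x + th)) = expR (- (t ^+ 2 * sd ^+ 2 / 2)) * cos th.
Proof.
pose F t := Ex N (fun x => cos (t * x + th)).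
have dF (a : R) : is_derive a 1 F (- (sd ^+ 2 * a) * F a).
  pose f (t x : R) := cos (t * x + th).
  have df (u x : R) : is_derive u 1 (f ^~ x) (- x * sin (u * x + th)).
    rewrite /f; under [fun _ => _]eq_fun do rewrite mulrC.
    by rewrite (mulrC u); exact: is_derive_cos_affine.
  have aI : `]a - 1, a + 1[%classic a by rewrite /= in_itv/=; apply/andP; split; lra.
  have H1 : forall u, `]a - 1, a + 1[%classic u -> N.-integrable setT (EFin \o f u).
    by move=> u _; exact: normal_intg_cos.
  have H2 : forall u x, `]a - 1, a + 1[%classic u -> setT x -> derivable (f ^~ x) u 1.
    by move=> u x _ _; exact: ex_derive.
  have H3 : forall u x, `]a - 1, a + 1[%classic u -> setT x ->
      `|partial1of2 f u x| <= `|x|.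
    move=> u x _ _; rewrite /partial1of2 derive1E derive_val normrM normrN.
    by rewrite ler_piMr// ler_norml sin_geN1 sin_le1.
  apply: DeriveDef.
    exact: (derivable_under_integral measurableT aI H1 H2 (fun x => normr_ge0 x) normal_intg_norm H3).
  rewrite -derive1E (differentiation_under_integral measurableT aI H1 H2 (fun x => normr_ge0 x) normal_intg_norm H3).
  rewrite mulNr -normal_stein -mulN1r -ExZ; last exact: normal_intg_xsin.
  apply: eq_Rintegral => x _; rewrite /partial1of2 derive1E derive_val; ring.
pose g t := F t * expR (t ^+ 2 * sd ^+ 2 / 2).
have dg (a : R) : is_derive a 1 g 0.
  have -> : g = F * (expR \o (fun t => (sd ^+ 2 / 2) *: t ^+ 2)).
    apply/funext => u; rewrite /g /GRing.scale !fctE /=; congr (_ * expR _).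
    by ring.
  have := dF a => h; apply: is_derive_eq; rewrite /GRing.scale /=.
  by field.
have := is_derive_0_is_cst t 0 dg; rewrite /g /F expr0n/= !mul0r expR0 mulr1.
rewrite (_ : (fun x => cos (0 * x + th)) = cst (cos th)); last first.
  by apply/funext => x; rewrite mul0r add0r.
rewrite Ex_cst => H; rewrite -[X in _ = _ * X]H.
by rewrite mulrCA -expRD addNr expR0 mulr1.
Qed.

End characteristic_function.

(** Read from right to left, it writes a Gaussian bump as an average of cosines; this linearizes the
    bumps in [small_ball_aux]. *)
Lemma normal_cf1 (x : R) : Ex (normal_prob 0 1) (fun w => cos (w * x)) = expR (- (x ^+ 2 / 2)).
Proof.
have := normal_cf (@ltr01 R) x 0; rewrite cos0 mulr1 expr1n mulr1 => <-.
by congr Ex; apply/funext => w; rewrite addr0 mulrC.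
Qed.

Lemma normal_intg_exp_sqr (a : R) : 0 <= a ->
  intg (normal_prob 0 1) (fun w => expR (- (a * w ^+ 2 / 2))).
Proof.
move=> a0; have m0 : measurable_fun setT (fun w : R => expR (- (a * w ^+ 2 / 2))).
  apply: measurableT_comp => //; apply: measurableT_comp => //.
  by apply: measurable_funM => //; apply: measurable_funM => //; exact: measurable_funX.
apply: (@intg_bnd _ _ _ (normal_prob 0 1) _ 1) => //.
move=> w; rewrite ger0_norm ?expR_ge0// -expR0 ler_expR oppr_le0.
by rewrite divr_ge0// mulr_ge0// sqr_ge0.
Qed.

Lemma normal_exp_sqr (a : R) : 0 <= a ->
  Ex (normal_prob 0 1) (fun w => expR (- (a * w ^+ 2 / 2))) = (Num.sqrt (1 + a))^-1.
Proof.
move=> a0; have I := normal_intg_exp_sqr a0.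
rewrite Ex_normal//.
have s0 : 0 < Num.sqrt (1 + a) by rewrite sqrtr_gt0; lra.
set s := Num.sqrt (1 + a) in s0 *.
have s2 : s ^+ 2 = 1 + a by rewrite sqr_sqrtr//; lra.
(* The product of the two exponentials is, up to the factor 1 / s, the normal density of deviation 1
   / s. *)
transitivity (\int[mu]_x (s^-1 * normal_pdf 0 s^-1 x)).
  apply: eq_Rintegral => w _; rewrite !normal_pdfE ?gt_eqF ?invr_gt0// /normal_fun !subr0.
  rewrite /normal_peak.
  have -> : Num.sqrt (s^-1 ^+ 2 * pi *+ 2) = s^-1 * Num.sqrt (1 ^+ 2 * pi *+ 2).
    rewrite -[in RHS](@ger0_norm _ s^-1) ?invr_ge0 ?ltW// -sqrtr_sqr -sqrtrM ?sqr_ge0//.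
    by congr Num.sqrt; rewrite !mulr2n; ring.
  rewrite invfM invrK mulrCA -expRD !mulrA mulVf ?gt_eqF// mul1r.
  by congr (_ * expR _); rewrite exprVn s2; field; rewrite gt_eqF//; lra.
rewrite RintegralZl//; last exact: integrable_normal_pdf.
by rewrite /Rintegral integral_normal_pdf mulr1.
Qed.

End normal.

(** * Trigonometric polynomials of Gaussian variables *)

Section trigonometric_polynomials.
Context {R : realType}.
Implicit Types (f g : (nat -> R) -> R) (u : nat -> R).

Definition lincomb (s : seq (R * nat)) u := \sum_(y <- s) y.1 * u y.2.

Definition trig_sum (l : seq (R * seq (R * nat) * R)) u :=
  \sum_(x <- l) x.1.1 * cos (lincomb x.1.2 u + x.2).

(** An algebra of bounded functions of finitely many coordinates whose expectations are determined
    by the characteristic function of the family. Phases stand in for sines. *)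
Definition trigp f := exists l, forall u, f u = trig_sum l u.

Lemma lincomb_cat s t u : lincomb (s ++ t) u = lincomb s u + lincomb t u.
Proof. by rewrite /lincomb big_cat. Qed.

Definition scale_comb (c : R) (s : seq (R * nat)) := [seq (c * y.1, y.2) | y <- s].

Lemma lincombZ c s u : lincomb (scale_comb c s) u = c * lincomb s u.
Proof. by rewrite /lincomb big_map mulr_sumr; apply: eq_bigr => y _; rewrite /= mulrA. Qed.

Lemma trigp_cos c i th : trigp (fun u => cos (c * u i + th)).
Proof.
exists [:: (1, [:: (c, i)], th)] => u.
by rewrite /trig_sum big_seq1 mul1r /lincomb big_seq1.
Qed.

Lemma trigp_sin c i : trigp (fun u => sin (c * u i)).
Proof.
have [l lE] := trigp_cos c i (- (pi / 2)); exists l => u.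
by rewrite -lE cosBpihalf.
Qed.

Lemma trigp_cst c : trigp (fun=> c).
Proof.
exists [:: (c, [::], 0)] => u.
by rewrite /trig_sum big_seq1 /lincomb big_nil addr0 cos0 mulr1.
Qed.

Lemma trigpD f g : trigp f -> trigp g -> trigp (fun u => f u + g u).
Proof.
by move=> [l lE] [k kE]; exists (l ++ k) => u; rewrite lE kE /trig_sum big_cat.
Qed.

(** A product of two cosines is half the sum of the cosines of the sum and of the difference, so
    each pair of terms contributes two. *)
Lemma trigpM f g : trigp f -> trigp g -> trigp (fun u => f u * g u).
Proof.
move=> [l lE] [k kE].
exists (flatten [seq [:: (x.1.1 * y.1.1 / 2, x.1.2 ++ y.1.2, x.2 + y.2);
   (x.1.1 * y.1.1 / 2, x.1.2 ++ scale_comb (-1) y.1.2, x.2 - y.2)] | x <- l, y <- k]) => u.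
rewrite lE kE /trig_sum big_flatten /= big_allpairs_dep big_distrlr /=.
apply: eq_bigr => x _; apply: eq_bigr => y _.
rewrite big_cons big_seq1 /= !lincomb_cat lincombZ.
set a := lincomb x.1.2 u; set b := lincomb y.1.2 u.
have -> : a + b + (x.2 + y.2) = (a + x.2) + (b + y.2) by ring.
have -> : a + -1 * b + (x.2 - y.2) = (a + x.2) - (b + y.2) by ring.
by rewrite (cosD (a + _)) (cosB (a + _)); field.
Qed.

Lemma trigpZ c f : trigp f -> trigp (fun u => c * f u).
Proof. by move=> tf; apply: trigpM => //; exact: trigp_cst. Qed.

Lemma trigpB f g : trigp f -> trigp g -> trigp (fun u => f u - g u).
Proof.
move=> tf tg; have := trigpD tf (trigpZ (-1) tg).
by under [X in trigp X]eq_fun do rewrite mulN1r.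
Qed.

Lemma trigpX f n : trigp f -> trigp (fun u => f u ^+ n).
Proof.
move=> tf; elim: n => [|n IH]; first exact: trigp_cst.
by under [X in trigp X]eq_fun do rewrite exprS; exact: trigpM.
Qed.

Lemma trigp_sum n (F : nat -> (nat -> R) -> R) : (forall i, trigp (F i)) ->
  trigp (fun u => \sum_(i < n) F i u).
Proof.
move=> tF; elim: n => [|n IH].
  by under [X in trigp X]eq_fun do rewrite big_ord0; exact: trigp_cst.
by under [X in trigp X]eq_fun do rewrite big_ord_recr; exact: trigpD.
Qed.

Section expectation.
Context {d : measure_display} {T : measurableType d} (P : probability T R).
Variable U : T -> nat -> R.
Hypothesis mU : forall i, measurable_fun setT (U ^~ i).

Lemma measurable_lincomb s : measurable_fun setT (fun w => lincomb s (U w)).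
Proof.
rewrite /lincomb; apply: measurable_sum => y.
by apply: measurable_funM => //; exact: mU.
Qed.

Lemma measurable_cos_shift (V : T -> R) th : measurable_fun setT V ->
  measurable_fun setT (fun w => cos (V w + th)).
Proof.
move=> mV; apply: (measurableT_comp (f := cos)); last exact: measurable_funD.
by apply: continuous_measurable_fun; exact: continuous_cos.
Qed.

Lemma intg_cos_shift (V : T -> R) th : measurable_fun setT V ->
  intg P (fun w => cos (V w + th)).
Proof.
move=> mV; apply: (@intg_bnd _ _ _ P _ 1); first exact: measurable_cos_shift.
by move=> w; rewrite ler_norml cos_geN1 cos_le1.
Qed.

Lemma intg_trigp f : trigp f -> intg P (fun w => f (U w)).
Proof.
move=> [l lE]; under [X in intg _ X]eq_fun do rewrite lE.
apply: intg_sum => x _; apply: intgZ; apply: intg_cos_shift.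
exact: measurable_lincomb.
Qed.

End expectation.

Lemma Ex_trigp_eq d1 d2 (T1 : measurableType d1) (T2 : measurableType d2)
  (P1 : probability T1 R) (P2 : probability T2 R)
  (U : T1 -> nat -> R) (V : T2 -> nat -> R) f :
  (forall i, measurable_fun setT (U ^~ i)) ->
  (forall i, measurable_fun setT (V ^~ i)) ->
  (forall s th, Ex P1 (fun w => cos (lincomb s (U w) + th)) =
                Ex P2 (fun w => cos (lincomb s (V w) + th))) ->
  trigp f -> Ex P1 (fun w => f (U w)) = Ex P2 (fun w => f (V w)).
Proof.
move=> mU mV UV [l lE]; under [X in Ex P1 X]eq_fun do rewrite lE.
under [X in Ex P2 X]eq_fun do rewrite lE.
rewrite /trig_sum !Ex_sum; last 2 first.
- by move=> x _; apply/intgZ/intg_cos_shift; exact: measurable_lincomb.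
- by move=> x _; apply/intgZ/intg_cos_shift; exact: measurable_lincomb.
apply: eq_bigr => x _; rewrite !ExZ ?UV//; apply: intg_cos_shift; exact: measurable_lincomb.
Qed.

End trigonometric_polynomials.

(** * Gaussian variables through their characteristic functions *)

Section gauss.
Context {d : measure_display} {T : measurableType d} {R : realType}.
Variable P : probability T R.

(* The law is encoded by its characteristic function with an arbitrary phase;
   [v = 0] is allowed. *)
Definition gauss (V : T -> R) (v : R) : Prop :=
  [/\ measurable_fun setT V, 0 <= v &
   forall s th, Ex P (fun w => cos (s * V w + th)) =
     expR (- (s ^+ 2 * v / 2)) * cos th].

Lemma cvg_invS : (n.+1%:R)^-1 @[n --> \oo] --> (0 : R).
Proof. exact: cvg_harmonic. Qed.

(** Convergence of the variances is a conclusion. The limiting characteristic function tends to 1 at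
    0, so it is positive at some point 1 / (n + 1), and taking logarithms there recovers the limit
    of [v]. *)
Lemma gauss_lim (F : nat -> T -> R) (v : nat -> R) (V : T -> R) :
  (forall n, gauss (F n) (v n)) -> measurable_fun setT V ->
  {ae P, forall w, F ^~ w @ \oo --> V w} ->
  exists2 l, gauss V l & v @ \oo --> l.
Proof.
move=> gF mV FV.
have mF n : measurable_fun setT (F n) by have [] := gF n.
have mc (W : T -> R) s th : measurable_fun setT W -> measurable_fun setT (fun w => cos (s * W w + th)).
  by move=> mW; apply: measurable_cos_shift; exact: measurable_funM.
have cos1 (x : R) : `|cos x| <= 1 by rewrite ler_norml cos_geN1 cos_le1.
have H s th : expR (- (s ^+ 2 * v n / 2)) * cos th @[n --> \oo] --> Ex P (fun w => cos (s * V w + th)).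
  have := @Ex_bnd_cvg _ _ _ P (fun n w => cos (s * F n w + th)) (fun w => cos (s * V w + th)) 1.
  have -> : (fun n => Ex P (fun w => cos (s * F n w + th))) = (fun n => expR (- (s ^+ 2 * v n / 2)) * cos th).
    by apply/funext => n; have [_ _ ->] := gF n.
  apply; [by move=> n; exact: mc|exact: mc|by []|].
  apply: filterS FV => w Fw; apply: continuous_cvg; first exact: continuous_cos.
  by apply: cvgD; [apply: cvgMr|exact: cvg_cst].
pose c s := Ex P (fun w => cos (s * V w + 0)).
have c1 : c (n.+1%:R^-1) @[n --> \oo] --> (1 : R).
  have := @Ex_bnd_cvg _ _ _ P (fun n w => cos (n.+1%:R^-1 * V w + 0)) (cst 1) 1.
  rewrite Ex_cst; apply=> //; first by move=> n; exact: mc.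
  apply: aeW => w; rewrite /= -[X in _ --> X]cos0; apply: continuous_cvg; first exact: continuous_cos.
  under eq_fun do rewrite addr0; rewrite -(mul0r (V w)).
  by apply: cvgMl; exact: cvg_invS.
have [n0 cn0] : exists n, 0 < c (n.+1%:R^-1).
  have := cvgr_gt _ c1 0 ltr01 => -[N _ /(_ N (leqnn N)) h].
  by exists N.
set s0 := n0.+1%:R^-1 in cn0.
have s00 : 0 < s0 by rewrite invr_gt0.
pose l := - (2 / s0 ^+ 2) * ln (c s0).
have vl : v @ \oo --> l.
  have -> : v = fun n => - (2 / s0 ^+ 2) * ln (expR (- (s0 ^+ 2 * v n / 2)) * cos 0).
    by apply/funext => n; rewrite cos0 mulr1 expRK; field; rewrite gt_eqF.
  apply: cvgMr; apply: continuous_cvg; last exact: H.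
  exact: continuous_ln.
have l0 : 0 <= l by apply: (cvgn_ge vl) => n; have [] := gF n.
exists l => //; split=> // s th.
apply: (cvg_unique _ (H s th)) => //.
apply: cvgMl; apply: continuous_cvg; first exact: continuous_expR.
by apply: cvgN; apply: cvgMl; exact: cvgMr.
Qed.

Lemma cvgn_exp (u : nat -> R) (l : R) p : u @ \oo --> l -> u n ^+ p @[n --> \oo] --> l ^+ p.
Proof. by move=> ul; apply: (cvg_comp u (fun x => x ^+ p) ul); exact: exprn_continuous. Qed.

Lemma ler_even_exp (a b : R) p : `|a| <= `|b| -> a ^+ p.*2 <= b ^+ p.*2.
Proof.
move=> ab; rewrite -mul2n !exprM -(real_normK (num_real a)) -(real_normK (num_real b)).
by rewrite lerXn2r ?nnegrE ?exprn_ge0// lerXn2r ?nnegrE.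
Qed.

Lemma abs_sin_le (x : R) : `|sin x| <= `|x|.
Proof.
wlog x0 : x / 0 <= x.
  move=> H; have [/H//|/ltW x0] := leP 0 x.
  by have := H (- x); rewrite sinN !normrN oppr_ge0 => /(_ x0).
have cs : {within `[0, x], continuous (@sin R)}.
  by apply: continuous_subspaceT => y; exact: continuous_sin.
have ds (y : R) : y \in `]0, x[ -> is_derive y 1 sin (cos y) by move=> _; exact: is_derive_sin.
have [c _] := MVT_segment x0 ds cs.
rewrite sin0 !subr0 => ->; rewrite normrM ler_piMl// ler_norml cos_geN1 cos_le1//.
Qed.

Lemma abs_sin_scaled_le n (x : R) : `|n.+1%:R * sin (n.+1%:R^-1 * x)| <= `|x|.
Proof.
rewrite normrM ger0_norm// -ler_pdivlMl//.
by rewrite (le_trans (abs_sin_le _))// normrM ger0_norm.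
Qed.

Lemma cvg_sin_scaled (x : R) : n.+1%:R * sin (n.+1%:R^-1 * x) @[n --> \oo] --> x.
Proof.
have H : is_derive (0 : R) 1 (fun h => sin (h * x)) x.
  rewrite (_ : (fun h => _) = sin \o (fun h => x *: h)); last first.
    by apply/funext => h; rewrite /= /GRing.scale /= mulrC.
  by apply: is_derive_eq; rewrite /GRing.scale /= mulr0 cos0 mulr1 mul1r.
have /cvgr_dnbhsP := @ex_derive _ _ _ _ _ _ _ H.
have := @derive_val _ _ _ _ _ _ _ H; rewrite /derive => ->.
have U : (forall n, (n.+1%:R^-1 : R) != 0) /\ (n.+1%:R^-1 : R) @[n --> \oo] --> 0.
  by split; [move=> n; rewrite invr_neq0|exact: cvg_invS].
move=> /(_ _ U) /=; rewrite /GRing.scale/=.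
by under eq_fun do rewrite mulr1 addr0 mul0r sin0 subr0 invrK.
Qed.

(** Even powers are unbounded, so they are replaced by (n sin (x / n))^(2 p): trigonometric
    polynomials dominated by x^(2 p) and converging to it. Fatou's lemma passes to the limit. *)
Lemma gauss_sqr_moment d2 (T2 : measurableType d2) (P2 : probability T2 R) (V : T -> R) (Z : T2 -> R) p :
  measurable_fun setT V -> measurable_fun setT Z ->
  (forall s th, Ex P (fun w => cos (s * V w + th)) = Ex P2 (fun w => cos (s * Z w + th))) ->
  intg P2 (fun w => Z w ^+ p.*2) ->
  intg P (fun w => V w ^+ p.*2) /\
  Ex P (fun w => V w ^+ p.*2) <= Ex P2 (fun w => Z w ^+ p.*2).
Proof.
move=> mV mZ VZ IZ.
pose h n (u : nat -> R) := (n.+1%:R * sin (n.+1%:R^-1 * u 0%N)) ^+ p.*2.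
have th n : trigp (h n) by apply: trigpX; apply: trigpZ; exact: trigp_sin.
have X0 (x : R) : 0 <= x ^+ p.*2 by rewrite -mul2n exprM exprn_ge0// sqr_ge0.
have E n : Ex P (fun w => h n (fun=> V w)) = Ex P2 (fun w => h n (fun=> Z w)).
  apply: (Ex_trigp_eq (U := fun w _ => V w) (V := fun w _ => Z w)) => // s t.
  have lE (x : R) : lincomb s (fun=> x) = (\sum_(y <- s) y.1) * x by rewrite /lincomb mulr_suml.
  under [X in Ex P X]eq_fun do rewrite lE.
  under [X in Ex P2 X]eq_fun do rewrite lE.
  exact: VZ.
apply: (@Ex_fatou _ _ _ P (fun n w => h n (fun=> V w))).
- by move=> n; exact: (@intg_trigp _ _ _ P (fun w _ => V w) (fun=> mV) _ (th n)).
- by move=> n w; exact: X0.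
- by move=> w; apply: cvgn_exp; exact: cvg_sin_scaled.
- move=> n; rewrite E; apply: Ex_le => //.
    exact: (@intg_trigp _ _ _ P2 (fun w _ => Z w) (fun=> mZ) _ (th n)).
  by move=> w; apply: ler_even_exp; exact: abs_sin_scaled_le.
Qed.

Lemma gauss_moment p : exists C, forall V v, gauss V v ->
  intg P (fun w => V w ^+ p.*2) /\ Ex P (fun w => V w ^+ p.*2) <= C * v ^+ p.
Proof.
have [C HC] := @normal_moment R p; exists (Num.max C 1) => V v [mV v0 cV].
(* A degenerate variable is compared with the constant 0. The maximum with 1 matters for p = 0 only,
   where 0^0 = 1. *)
have [v_eq|v_neq] := eqVneq v 0.
  have [|||I H] := @gauss_sqr_moment _ _ P V (fun=> 0) p mV.
  - exact: measurable_cst.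
  - move=> s th; rewrite cV v_eq !mulr0 mul0r oppr0 expR0 mul1r.
    rewrite (_ : (fun w => _) = cst (cos th)) ?Ex_cst//.
    by apply/funext => w; rewrite add0r.
  - exact: intg_cst.
  split=> //; apply: le_trans H _; rewrite Ex_cst v_eq.
  case: (p) => [|n]; last by rewrite doubleS !expr0n /= mulr0.
  by rewrite !expr0 mulr1 le_max lexx orbT.
have sv : 0 < Num.sqrt v by rewrite sqrtr_gt0 lt_neqAle eq_sym v_neq.
have [I1 H1] := HC _ sv.
have [|||I H] := @gauss_sqr_moment _ _ (normal_prob 0 (Num.sqrt v)) V id p mV.
- exact: measurable_id.
- by move=> s th; rewrite normal_cf// sqr_sqrtr.
- exact: I1.
split=> //; apply: le_trans H _; apply: (le_trans H1).
rewrite -mul2n exprM sqr_sqrtr// ler_wpM2r ?exprn_ge0//.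
by rewrite le_max lexx.
Qed.

(** As sin^2 is half of one minus the cosine of the double angle, the expectation of (n sin (V /
    n))^2 is -1/2 times a difference quotient at 0 of exp (- 2 v h), with h = 1 / n^2. *)
Lemma gauss_var V v : gauss V v -> Ex P (fun w => V w ^+ 2) = v.
Proof.
move=> gV; have [mV v0 cV] := gV.
have [C /(_ V v gV)[I _]] := gauss_moment 1; rewrite /= in I.
pose h n w := (n.+1%:R * sin (n.+1%:R^-1 * V w)) ^+ 2.
have mh n : measurable_fun setT (h n).
  apply: measurable_funX; apply: measurable_funM => //.
  apply: (measurableT_comp (f := sin)); last exact: measurable_funM.
  by apply: continuous_measurable_fun; exact: continuous_sin.
have L : Ex P (h n) @[n --> \oo] --> Ex P (fun w => V w ^+ 2).
  apply: (Ex_dom_cvg mh _ I).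
  - exact: measurable_funX.
  - move=> n w; rewrite ger0_norm ?sqr_ge0//.
    exact: (@ler_even_exp _ _ 1 (abs_sin_scaled_le _ _)).
  - by apply: aeW => w; apply: cvgn_exp; exact: cvg_sin_scaled.
have hE n : Ex P (h n) = n.+1%:R ^+ 2 * ((1 - expR (- (n.+1%:R^-1 ^+ 2 * (2 * v)))) / 2).
  rewrite (_ : h n = fun w => n.+1%:R ^+ 2 * (2^-1 - 2^-1 * cos ((n.+1%:R^-1 * 2) * V w + 0))); last first.
    apply/funext => w; rewrite /h exprMn; congr (_ * _).
    have -> : n.+1%:R^-1 * 2 * V w + 0 = (n.+1%:R^-1 * V w) + (n.+1%:R^-1 * V w) by ring.
    by rewrite cosD -[cos _ * cos _]expr2 cos2sin2 -expr2; field.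
  have I2 : intg P (fun w => cos ((n.+1%:R^-1 * 2) * V w + 0)).
    by apply: intg_cos_shift; exact: measurable_funM.
  rewrite ExZ ?ExB ?ExZ ?cV ?cos0 ?mulr1 //.
  - rewrite (_ : Ex P (fun=> 2^-1) = 2^-1); last exact: Ex_cst.
    congr (_ * _); have -> : (n.+1%:R^-1 * 2) ^+ 2 * v / 2 = n.+1%:R^-1 ^+ 2 * (2 * v) by field.
    by field.
  - exact: intg_cst.
  - exact: intgZ.
  - by apply: intgB; [exact: intg_cst|exact: intgZ].
suff K : Ex P (h n) @[n --> \oo] --> v by exact: (cvg_unique _ L K).
under eq_fun do rewrite hE.
have H : is_derive (0 : R) 1 (fun h => expR (- (h * (2 * v)))) (- (2 * v)).
  rewrite (_ : (fun h => _) = expR \o (fun h => - (2 * v) *: h)); last first.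
    by apply/funext => u; rewrite /= /GRing.scale /= mulNr mulrC.
  by apply: is_derive_eq; rewrite /GRing.scale /= mulr0 expR0 mulr1 mul1r.
have /cvgr_dnbhsP := @ex_derive _ _ _ _ _ _ _ H.
have := @derive_val _ _ _ _ _ _ _ H; rewrite /derive => ->.
have U : (forall n, (n.+1%:R^-1 ^+ 2 : R) != 0) /\ (n.+1%:R^-1 ^+ 2 : R) @[n --> \oo] --> 0.
  split; first by move=> n; rewrite sqrf_eq0 invr_neq0.
  rewrite (_ : 0 = 0 ^+ 2 :> R); last by rewrite expr0n.
  by apply: cvgn_exp; exact: cvg_invS.
move=> /(_ _ U) /=; rewrite /GRing.scale/=.
under eq_fun do rewrite mulr1 addr0 mul0r oppr0 expR0.
move=> K; rewrite (_ : (fun n => _) = fun n : nat => - 2^-1 *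
    ((n.+1%:R^-1 ^+ 2)^-1 * (expR (- (n.+1%:R^-1 ^+ 2 * (2 * v))) - 1))); last first.
  by apply/funext => n; rewrite exprVn invrK; field.
have vE : - 2^-1 * - (2 * v) = v by field.
have := @cvgMr _ _ _ _ _ (- 2^-1) _ K; rewrite vE; apply.
Qed.

End gauss.

(** * Small balls *)

Section fubini.
Context {d1 d2 : measure_display} {T1 : measurableType d1} {T2 : measurableType d2}
  {R : realType} (P1 : probability T1 R) (P2 : probability T2 R).
Implicit Types f : T1 * T2 -> R.

Lemma Ex_fubini1 f : intg (P1 \x P2)%E f ->
  (forall x, intg P2 (fun y => f (x, y))) ->
  Ex (P1 \x P2)%E f = Ex P1 (fun x => Ex P2 (fun y => f (x, y))) /\
  intg P1 (fun x => Ex P2 (fun y => f (x, y))).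
Proof.
move=> If If2.
have H := integral12_prod_meas1 If.
have I := integrable_fubini_F If.
have E : fubini_F P2 (EFin \o f) = EFin \o (fun x => Ex P2 (fun y => f (x, y))).
  by apply/funext => x; rewrite /fubini_F/= ExE.
rewrite E in H I; split=> //.
by rewrite {1}/Ex /Rintegral -H.
Qed.

Lemma measurable_pair_l f x : measurable_fun setT f -> measurable_fun setT (fun y => f (x, y)).
Proof. by move=> mf; apply: measurableT_comp => //; exact: measurable_pair1. Qed.

Lemma measurable_pair_r f y : measurable_fun setT f -> measurable_fun setT (fun x => f (x, y)).
Proof. by move=> mf; apply: measurableT_comp => //; exact: measurable_pair2. Qed.

End fubini.

Lemma Ex_swap {d1 d2} {T1 : measurableType d1} {T2 : measurableType d2}
  {R : realType} (P1 : probability T1 R) (P2 : probability T2 R) (f : T1 * T2 -> R) M :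
  measurable_fun setT f -> (forall z, `|f z| <= M) ->
  Ex P1 (fun x => Ex P2 (fun y => f (x, y))) = Ex P2 (fun y => Ex P1 (fun x => f (x, y))) /\
  intg P2 (fun y => Ex P1 (fun x => f (x, y))).
Proof.
move=> mf fM; have If : intg (P1 \x P2)%E f by exact: intg_bnd fM.
have [|<- _] := Ex_fubini1 If.
  by move=> x; apply: (@intg_bnd _ _ _ P2 _ M) => //; exact: measurable_pair_l.
have I1 y : intg P1 (fun x => f (x, y)).
  by apply: (@intg_bnd _ _ _ P1 _ M) => //; exact: measurable_pair_r.
split.
  rewrite {1}/Ex /Rintegral -(integral21_prod_meas1 If) /Ex /Rintegral; congr fine.
  by apply: eq_integral => y _; rewrite /fubini_G/= ExE.
have mfs : measurable_fun setT (fun z : T2 * T1 => f (z.2, z.1)).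
  by apply: (measurableT_comp mf); exact: measurable_swap.
have [|| _ //] := @Ex_fubini1 _ _ _ _ _ P2 P1 (fun z => f (z.2, z.1)).
  by apply: intg_bnd (fun z => fM _).
by move=> y; exact: I1.
Qed.

Section small_ball.
Context {d : measure_display} {T : measurableType d} {R : realType}.
Variable P : probability T R.
Implicit Types (V : T -> R) (l : seq ((T -> R) * R)).

(** A smooth substitute for the indicator of a box: on the box |x.1| <= x.2 it is at least exp (-
    size / 2), and it is a product of averages of cosines. *)
Definition bumps l (w : T) := \prod_(x <- l) expR (- ((x.1 w / x.2) ^+ 2 / 2)).

Lemma bumps_ge0 l w : 0 <= bumps l w.
Proof. by apply: prodr_ge0 => x _; exact: expR_ge0. Qed.

Lemma bumps_le1 l w : bumps l w <= 1.
Proof.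
rewrite /bumps; elim: l => [|x l IH]; first by rewrite big_nil.
rewrite big_cons mulr_ile1 ?expR_ge0 ?bumps_ge0// -expR0 ler_expR oppr_le0.
by rewrite divr_ge0// sqr_ge0.
Qed.

Lemma measurable_bumps l : (forall x, List.In x l -> measurable_fun setT x.1) ->
  measurable_fun setT (bumps l).
Proof.
rewrite /bumps; elim: l => [|x l IH] ml.
  by under [X in measurable_fun _ X]eq_fun do rewrite big_nil; exact: measurable_cst.
under [X in measurable_fun _ X]eq_fun do rewrite big_cons.
apply: measurable_funM; last by apply: IH => y yl; apply: ml; right.
apply: (measurableT_comp (f := @expR R)) => //; apply: measurableT_comp => //.
apply: measurable_funM => //; apply: measurable_funX; apply: measurable_funM => //.
by apply: ml; left.
Qed.

Fixpoint lin_list (a : seq R) l (w : T) : R :=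
  match a, l with
  | c :: a', x :: l' => c * x.1 w + lin_list a' l' w
  | _, _ => 0
  end.

Definition sqr_list (a : seq R) : R := \sum_(c <- a) c ^+ 2.

Lemma small_ball_aux (lam : R) l : 0 < lam -> (forall x, List.In x l -> 0 < x.2) ->
  (forall x, List.In x l -> measurable_fun setT x.1) ->
  forall (W : T -> R) (e : R), measurable_fun setT W ->
  (forall a, size a = size l ->
     exists2 v, gauss P (fun w => W w + lin_list a l w) v & e + lam * sqr_list a <= v) ->
  Ex P (fun w => bumps l w * cos (W w)) <=
    expR (- (e / 2)) * \prod_(x <- l) (x.2 / Num.sqrt lam).
Proof.
move=> lam0; elim: l => [|x l IH] l0 ml W e mW H.
  have [v gv] := H [::] erefl; have [_ _ /(_ 1 0)] := gv.
  rewrite big_nil mulr1 cos0 mulr1 expr1n mul1r /bumps.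
  have -> : (fun w => cos (1 * (W w + lin_list [::] [::] w) + 0)) =
      (fun w => (\prod_(x <- [::] : seq ((T -> R) * R)) expR (- ((x.1 w / x.2) ^+ 2 / 2))) * cos (W w)).
    by apply/funext => w; rewrite big_nil mul1r /= !addr0 mul1r.
  by move=> ->; rewrite /sqr_list big_nil mulr0 addr0 => ev; rewrite ler_expR; lra.
set V := x.1; set r := x.2.
have r0 : 0 < r by apply: l0; left.
have mV : measurable_fun setT V by apply: ml; left.
have l0' y : List.In y l -> 0 < y.2 by move=> yl; apply: l0; right.
have ml' y : List.In y l -> measurable_fun setT y.1 by move=> yl; apply: ml; right.
have mb := measurable_bumps ml'.
pose N := normal_prob (0 : R) 1.
pose f (z : T * R) := bumps l z.1 * (cos (W z.1 + z.2 / r * V z.1) + cos (W z.1 - z.2 / r * V z.1)) / 2.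
have mf : measurable_fun setT f.
  have mz1 (g : T -> R) : measurable_fun setT g -> measurable_fun setT (fun z : T * R => g z.1).
    by move=> mg; apply: measurableT_comp.
  have mz2 : measurable_fun setT (fun z : T * R => z.2 / r) by apply: measurable_funM.
  have mc (g : T * R -> R) : measurable_fun setT g -> measurable_fun setT (fun z => cos (g z)).
    move=> mg; apply: (measurableT_comp (f := cos)) => //.
    by apply: continuous_measurable_fun; exact: continuous_cos.
  apply: measurable_funM => //; apply: measurable_funM; first exact: mz1.
  apply: measurable_funD; apply: mc.
    by apply: measurable_funD; [exact: mz1|apply: measurable_funM; [exact: mz2|exact: mz1]].
  by apply: measurable_funB; [exact: mz1|apply: measurable_funM; [exact: mz2|exact: mz1]].
have f1 z : `|f z| <= 1.
  rewrite /f -mulrA normrM (ger0_norm (bumps_ge0 _ _)).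
  apply: mulr_ile1; rewrite ?bumps_ge0 ?bumps_le1// normrM (@gtr0_norm _ 2^-1)//.
  rewrite ler_pdivrMr// mul1r (le_trans (ler_normD _ _))//.
  have := cos_le1 (W z.1 + z.2 / r * V z.1); have := cos_geN1 (W z.1 + z.2 / r * V z.1).
  have := cos_le1 (W z.1 - z.2 / r * V z.1); have := cos_geN1 (W z.1 - z.2 / r * V z.1).
  by move=> *; apply: lerD; rewrite ler_norml; apply/andP; split.
have fE w : bumps (x :: l) w * cos (W w) = Ex N (fun y => f (w, y)).
  rewrite (_ : (fun y => f (w, y)) = fun y => (bumps l w * cos (W w)) * cos (y * (V w / r))); last first.
    by apply/funext => y; rewrite /f /= cosD cosB (mulrCA y) (mulrC (V w)); field.
  rewrite ExZ ?normal_cf1 /bumps ?big_cons; first by rewrite -/V -/r; ring.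
  under [X in intg _ X]eq_fun do rewrite mulrC -[X in cos X]addr0.
  exact: normal_intg_cos.
under [X in Ex P X]eq_fun do rewrite fE.
have [-> IfN] := Ex_swap P N mf f1.
set C := \prod_(y <- l) (y.2 / Num.sqrt lam).
have C0 : 0 <= C.
  rewrite /C; elim: (l) l0' => [|y k IHk] k0; first by rewrite big_nil.
  rewrite big_cons mulr_ge0 ?IHk//; last by move=> z zk; apply: k0; right.
  by rewrite divr_ge0 ?sqrtr_ge0// ltW// k0//; left.
have B y : Ex P (fun w => f (w, y)) <= expR (- (e / 2)) * C * expR (- (lam / r ^+ 2 * y ^+ 2 / 2)).
  (* The signs s = 1 and s = -1 are those of the product formula; the variance bound sees only
     s^2. *)
  have K (s : R) : s ^+ 2 = 1 -> intg P (fun w => bumps l w * cos (W w + s * (y / r * V w))) /\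
      Ex P (fun w => bumps l w * cos (W w + s * (y / r * V w))) <=
        expR (- ((e + lam * (y / r) ^+ 2) / 2)) * C.
    move=> s2; have mW' : measurable_fun setT (fun w => W w + s * (y / r * V w)).
      by apply: measurable_funD => //; apply: measurable_funM => //; exact: measurable_funM.
    split.
      apply: (@intg_bnd _ _ _ P _ 1).
        by apply: measurable_funM => //; apply: (measurableT_comp (f := cos)) => //;
           apply: continuous_measurable_fun; exact: continuous_cos.
      move=> w; rewrite normrM (ger0_norm (bumps_ge0 _ _)).
      by apply: mulr_ile1; rewrite ?bumps_ge0 ?bumps_le1// ler_norml cos_geN1 cos_le1.
    apply: IH => // a sa; have [v gv vle] := H (s * (y / r) :: a) (congr1 S sa).
    exists v.
      rewrite (_ : (fun w => _) = (fun w => W w + lin_list (s * (y / r) :: a) (x :: l) w))//.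
      by apply/funext => w; rewrite /= addrA mulrA.
    move: vle; rewrite /sqr_list big_cons mulrDr addrA exprMn s2 mul1r; exact.
  have m1 : (-1) ^+ 2 = 1 :> R by rewrite sqrrN expr1n.
  have [I1 L1] := K 1 (expr1n _ _); have [I2 L2] := K (-1) m1.
  rewrite (_ : (fun w => f (w, y)) = fun w => 2^-1 * (bumps l w * cos (W w + 1 * (y / r * V w))
      + bumps l w * cos (W w + -1 * (y / r * V w)))); last first.
    by apply/funext => w; rewrite /f /= mul1r mulN1r; field.
  rewrite ExZ ?ExD//; last exact: intgD.
  have -> : expR (- (e / 2)) * C * expR (- (lam / r ^+ 2 * y ^+ 2 / 2)) =
      expR (- ((e + lam * (y / r) ^+ 2) / 2)) * C.
    rewrite mulrAC -expRD; congr (expR _ * _); field; exact: (lt0r_neq0 r0).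
  move: L1 L2; set A := Ex _ _; set A' := Ex _ _; lra.
have lr : 0 <= lam / r ^+ 2 by rewrite divr_ge0 ?sqr_ge0 ?ltW.
apply: (@le_trans _ _ (Ex N (fun y => expR (- (e / 2)) * C * expR (- (lam / r ^+ 2 * y ^+ 2 / 2))))).
  by apply: Ex_le => //; apply: intgZ; exact: normal_intg_exp_sqr.
rewrite ExZ; last first.
  exact: normal_intg_exp_sqr.
rewrite normal_exp_sqr// big_cons -/C -/r -mulrA.
rewrite ler_wpM2l ?expR_ge0// [leRHS]mulrC ler_wpM2l//.
have -> : r / Num.sqrt lam = (Num.sqrt (lam / r ^+ 2))^-1.
  rewrite sqrtrM ?ltW// sqrtrV ?sqr_ge0// sqrtr_sqr gtr0_norm// invfM invrK.
  by rewrite mulrC.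
rewrite lef_pV2 ?posrE ?sqrtr_gt0 ?divr_gt0 ?exprn_gt0//; last by rewrite ltr_pwDl// divr_ge0 ?sqr_ge0// ltW.
by rewrite ler_wsqrtr// lerDr.
Qed.

(** Markov's inequality for [bumps]. The hypothesis bounds the covariance matrix from below by lam,
    so correlated variables are allowed. *)
Lemma small_ball (lam : R) l : 0 < lam -> (forall x, List.In x l -> 0 < x.2) ->
  (forall x, List.In x l -> measurable_fun setT x.1) ->
  (forall a, size a = size l ->
     exists2 v, gauss P (lin_list a l) v & lam * sqr_list a <= v) ->
  (P [set w | forall x, List.In x l -> (`|x.1 w| <= x.2)%R] <=
   (expR ((size l)%:R / 2) * \prod_(x <- l) (x.2 / Num.sqrt lam))%:E)%E.
Proof.
move=> lam0 l0 ml H; set s := (size l)%:R / 2.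
have mb := measurable_bumps ml.
have Ib : intg P (bumps l).
  by apply: (@intg_bnd _ _ _ P _ 1) => // w; rewrite ger0_norm ?bumps_ge0 ?bumps_le1.
have bE : Ex P (bumps l) <= \prod_(x <- l) (x.2 / Num.sqrt lam).
  have := @small_ball_aux lam l lam0 l0 ml (cst 0) 0 (measurable_cst _).
  rewrite mul0r oppr0 expR0 mul1r; under [X in Ex P X]eq_fun do rewrite cos0 mulr1.
  by apply=> a sa; have [v gv vle] := H a sa; exists v; rewrite ?add0r//;
     under [X in gauss _ X]eq_fun do rewrite add0r.
have sub : [set w | forall x, List.In x l -> `|x.1 w| <= x.2] `<=` [set w | expR (- s) <= bumps l w].
  move=> w /= Hw; rewrite /s /bumps; elim: (l) l0 Hw => [|x k IH] k0 Hw.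
    by rewrite big_nil /= mul0r oppr0 expR0.
  rewrite big_cons /= -natr1 mulrDl opprD expRD mulrC.
  apply: ler_pM; rewrite ?expR_ge0//; last first.
    by apply: IH => y yk; [apply: k0; right|apply: Hw; right].
  rewrite ler_expR lerN2 ler_pM2r ?invr_gt0// -real_normK ?num_real// normrM expr_le1//.
  have x0 : 0 < x.2 by apply: k0; left.
  by rewrite normfV (gtr0_norm x0) ler_pdivrMr// mul1r; apply: Hw; left.
have mA : measurable [set w | forall x, List.In x l -> `|x.1 w| <= x.2].
  elim: (l) ml => [|x k IH] mk.
    rewrite [X in measurable X](_ : _ = setT); first exact: measurableT.
    by apply/seteqP; split=> // w _ x [].
  rewrite [X in measurable X](_ : _ = [set w | `|x.1 w| <= x.2] `&` [set w | forall x, List.In x k -> `|x.1 w| <= x.2]).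
    apply: measurableI; last by apply: IH => y yk; apply: mk; right.
    rewrite -[X in measurable X]setTI; apply: measurable_fun_le => //.
    by apply: measurableT_comp => //; apply: mk; left.
  apply/seteqP; split=> w /=; first by move=> h; split; [apply: h; left|move=> y yk; apply: h; right].
  by move=> [h1 h2] y [<-//|/h2].
have mB : measurable [set w | expR (- s) <= bumps l w].
  by rewrite -[X in measurable X]setTI; apply: measurable_fun_le.
apply: (le_trans (le_measure _ _ _ sub)); rewrite ?inE//.
apply: (le_trans (Pr_markov (expR_gt0 _) Ib (bumps_ge0 l))).
by rewrite lee_fin expRN invrK mulrC ler_wpM2l ?expR_ge0.
Qed.

End small_ball.

(** * Smooth Gaussian processes *)

Section smooth_functions.
Context {R : realType}.
Implicit Types (f g : R -> R) (O : set R) (u : nat -> R).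

Definition smooth_in O f := forall n t, O t -> derivable (derive1n n f) t 1.

Lemma is_derive_smooth O f n (t : R) : smooth_in O f -> O t ->
  is_derive t 1 (derive1n n f) (derive1n n.+1 f t).
Proof. by move=> sf Ot; apply: DeriveDef; [exact: sf|rewrite derive1nS derive1E]. Qed.

Lemma cvgnZ (c : R) u (l : R) : u @ \oo --> l -> c * u n @[n --> \oo] --> c * l.
Proof. by move=> ul; exact: (@cvgMr _ _ _ _ _ c l ul). Qed.

Lemma cvg_quotient f (t l : R) : is_derive t 1 f l ->
  forall u : nat -> R, (forall n, u n != 0) -> u @ \oo --> 0 ->
  (u n)^-1 * (f (t + u n) - f t) @[n --> \oo] --> l.
Proof.
move=> H u u0 ul; have /cvgr_dnbhsP := @ex_derive _ _ _ _ _ _ _ H.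
have := @derive_val _ _ _ _ _ _ _ H; rewrite /derive => ->.
move=> /(_ _ (conj u0 ul)) /=; rewrite /GRing.scale/=.
by under eq_fun do rewrite mulr1 [_ + t]addrC.
Qed.

Lemma is_derive_quotient f (t l : R) :
  (forall u : nat -> R, (forall n, u n != 0) -> u @ \oo --> 0 ->
    (u n)^-1 * (f (t + u n) - f t) @[n --> \oo] --> l) -> is_derive t 1 f l.
Proof.
move=> H; have K : h^-1 *: (f (h *: 1 + t) - f t) @[h --> (0 : R)^'] --> l.
  apply/cvgr_dnbhsP => u [u0 ul]; rewrite /GRing.scale/=.
  by under eq_fun do rewrite mulr1 [_ + t]addrC; exact: H.
apply: DeriveDef; first by apply/cvg_ex; exists l.
exact/cvg_lim.
Qed.

Lemma cvg_invS_scale (r : R) : r / n.+1%:R @[n --> \oo] --> (0 : R).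
Proof. by rewrite -(mulr0 r); apply: cvgnZ; exact: cvg_invS. Qed.

End smooth_functions.

Section processes.
Context {d : measure_display} {T : measurableType d} {R : realType}.
Variable P : probability T R.
Implicit Types (X : R -> T -> R) (O : set R) (l : seq (R * nat * R)) (V W : T -> R).

Definition pderive n X t w : R := derive1n n (X ^~ w) t.

Definition comb X l w : R := \sum_(y <- l) y.1.1 * pderive y.1.2 X y.2 w.

Definition points_in O l := forall y, y \in l -> O y.2.

(** Only combinations of values are required to be Gaussian; combinations of derivatives follow by
    [gauss_comb]. All paths are smooth, which [vanish_on] arranges by a change on a null set. *)
Definition gaussian_smooth O X :=
  [/\ open O, forall w, smooth_in O (X ^~ w) &
   forall s : seq (R * R), (forall y, y \in s -> O y.2) ->
     exists v, gauss P (fun w => \sum_(y <- s) y.1 * X y.2 w) v].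

Lemma comb_cat X l1 l2 w : comb X (l1 ++ l2) w = comb X l1 w + comb X l2 w.
Proof. by rewrite /comb big_cat. Qed.

Lemma comb1 X c n t w : comb X [:: (c, n, t)] w = c * pderive n X t w.
Proof. by rewrite /comb big_seq1. Qed.

Definition scale_pts (c : R) l := [seq (c * y.1.1, y.1.2, y.2) | y <- l].

Lemma combZ X c l w : comb X (scale_pts c l) w = c * comb X l w.
Proof. by rewrite /comb big_map mulr_sumr; apply: eq_bigr => y _; rewrite /= mulrA. Qed.

Lemma points_in_scale O c l : points_in O l -> points_in O (scale_pts c l).
Proof. by move=> Ol _ /mapP[y yl ->]; exact: Ol y yl. Qed.

Lemma points_in_cat O l1 l2 : points_in O l1 -> points_in O l2 -> points_in O (l1 ++ l2).
Proof. by move=> O1 O2 y; rewrite mem_cat => /orP[/O1|/O2]. Qed.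

Lemma points_in1 O c n t : O t -> points_in O [:: (c, n, t)].
Proof. by move=> Ot y; rewrite inE => /eqP ->. Qed.

Lemma points_in_cons O c n t l : O t -> points_in O l -> points_in O ((c, n, t) :: l).
Proof. by move=> Ot Ol y; rewrite inE => /predU1P[->|/Ol]. Qed.

Section process.
Variables (O : set R) (X : R -> T -> R).
Hypothesis gsX : gaussian_smooth O X.

Let oO : open O. Proof. by case: gsX. Qed.
Let sX w : smooth_in O (X ^~ w). Proof. by case: gsX. Qed.

Lemma near_points l : points_in O l ->
  exists2 r : R, 0 < r & forall y h, y \in l -> `|h| <= r -> O (y.2 + h).
Proof.
elim: l => [|x l IH] Ol; first by exists 1.
have [|r r0 Hr] := IH; first by move=> y yl; apply: Ol; rewrite inE yl orbT.
have Ox : O x.2 by apply: Ol; rewrite mem_head.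
have := open_nbhs_nbhs (conj oO Ox) => /nbhs_ballP[e /= e0 He].
exists (Num.min r (e / 2)); first by rewrite lt_min r0 divr_gt0.
move=> y h; rewrite inE le_min => /predU1P[->|yl] /andP[h1 h2].
  by apply: He; rewrite /ball /= opprD addNKr normrN; lra.
exact: Hr.
Qed.

(** For orders at most N + 1, replacing the top derivative by a difference quotient of step h lowers
    the maximal order by one. *)
Definition lower N (h : R) (y : R * nat * R) : seq (R * nat * R) :=
  if (y.1.2 <= N)%N then [:: y] else
    [:: (y.1.1 * h^-1, N, y.2 + h); (- (y.1.1 * h^-1), N, y.2)].

Lemma cvg_comb_lower N l (u : nat -> R) w : points_in O l ->
  (forall y, y \in l -> (y.1.2 <= N.+1)%N) ->
  (forall n, u n != 0) -> u @ \oo --> 0 ->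
  comb X (flatten [seq lower N (u n) y | y <- l]) w @[n --> \oo] --> comb X l w.
Proof.
move=> Ol lN u0 ul; elim: l Ol lN => [|y l IH] Ol lN.
  by under eq_fun do rewrite /comb /= big_nil; rewrite /comb big_nil; exact: cvg_cst.
have Oy : O y.2 by apply: Ol; rewrite mem_head.
have yN : (y.1.2 <= N.+1)%N by apply: lN; rewrite mem_head.
have A : comb X (lower N (u n) y) w @[n --> \oo] --> comb X [:: y] w.
  rewrite /lower; case: leqP => yN'; first exact: cvg_cst.
  have yE : y.1.2 = N.+1 by apply/eqP; rewrite eqn_leq yN.
  rewrite /comb big_seq1 yE.
  rewrite [X in X @ _ --> _](_ : _ = fun n => y.1.1 * ((u n)^-1 *
      (pderive N X (y.2 + u n) w - pderive N X y.2 w))); last first.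
    by apply/funext => n; rewrite big_cons big_seq1 /= mulNr -mulrBr mulrA.
  by apply: cvgnZ; exact: (cvg_quotient (is_derive_smooth N (@sX w) Oy) u0 ul).
have B : comb X (flatten [seq lower N (u n) y | y <- l]) w @[n --> \oo] --> comb X l w.
  by apply: IH => z zl; [apply: Ol|apply: lN]; rewrite inE zl orbT.
rewrite -cat1s comb_cat [X in X @ _ --> _](_ : _ = fun n => comb X (lower N (u n) y) w +
  comb X (flatten [seq lower N (u n) y | y <- l]) w).
  exact: cvgD.
by apply/funext => n; rewrite comb_cat.
Qed.

Lemma measurable_gauss V v : gauss P V v -> measurable_fun setT V.
Proof. by case. Qed.

(** Induction on the highest order of differentiation: difference quotients involve lower orders,
    and [gauss_lim] keeps the limit Gaussian. *)
Lemma gauss_comb l : points_in O l -> exists v, gauss P (comb X l) v.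
Proof.
have [N] : exists N, forall y, y \in l -> (y.1.2 <= N)%N.
  exists (\max_(y <- l) y.1.2)%N => y yl; exact: (@leq_bigmax_seq _ l xpredT (fun y : R * nat * R => y.1.2) y yl isT).
elim: N l => [|N IH] l lN Ol.
  have [_ _ /(_ [seq (y.1.1, y.2) | y <- l])[]] := gsX.
    by move=> _ /mapP[y yl ->]; exact: Ol y yl.
  move=> v gv; exists v; rewrite (_ : comb X l = fun w => \sum_(y <- [seq (y.1.1, y.2) | y <- l]) y.1 * X y.2 w)//.
  apply/funext => w; rewrite /comb big_map big_seq [RHS]big_seq; apply: eq_bigr => y yl.
  by have := lN y yl; rewrite leqn0 /pderive => /eqP ->.
have [r r0 Hr] := near_points Ol.
pose u n : R := r / n.+1%:R.
have u0 n : u n != 0 by rewrite mulf_neq0 ?invr_neq0 ?gt_eqF.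
have ur n : `|u n| <= r.
  rewrite /u ger0_norm; last by rewrite divr_ge0// ltW.
  by rewrite ler_pdivrMr// ler_peMr ?ler1n// ltW.
have Lpt n : points_in O (flatten [seq lower N (u n) y | y <- l]).
  move=> z /flattenP[s /mapP[y yl ->]]; rewrite /lower; case: ifP => _; rewrite !inE.
    by move=> /eqP ->; exact: Ol.
  by move=> /orP[] /eqP -> /=; [exact: Hr|exact: Ol].
have LN n y : y \in flatten [seq lower N (u n) y | y <- l] -> (y.1.2 <= N)%N.
  move=> /flattenP[s /mapP[z zl ->]]; rewrite /lower; case: ifP => zN; rewrite !inE.
    by move=> /eqP ->.
  by move=> /orP[] /eqP -> /=.
have gF n := IH _ (LN n) (Lpt n).
have [v gv] := choice gF.
have L w : comb X (flatten [seq lower N (u n) y | y <- l]) w @[n --> \oo] --> comb X l w.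
  by apply: cvg_comb_lower => //; exact: cvg_invS_scale.
have [||s gs _] := @gauss_lim _ _ _ P _ v (comb X l) gv.
- apply: (@measurable_fun_cvg _ _ _ setT (fun n => comb X (flatten [seq lower N (u n) y | y <- l]))).
    by move=> n; exact: measurable_gauss (gv n).
  by move=> w _; exact: L.
- exact: aeW.
- by exists s.
Qed.

Lemma comb_sqr l : points_in O l ->
  measurable_fun setT (comb X l) /\ intg P (fun w => comb X l w ^+ 2).
Proof.
move=> Ol; have [v gv] := gauss_comb Ol; split; first exact: measurable_gauss gv.
by have [C /(_ _ _ gv)[]] := @gauss_moment _ _ _ P 1.
Qed.

Lemma pderive_sqr n t : O t -> measurable_fun setT (pderive n X t) /\
  intg P (fun w => pderive n X t w ^+ 2).
Proof.
move=> Ot; have := comb_sqr (@points_in1 _ 1 n t Ot).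
by rewrite (_ : comb X _ = pderive n X t)//; apply/funext => w; rewrite comb1 mul1r.
Qed.

(** Pointwise convergence is enough for Gaussian variables: the differences are Gaussian and tend to
    0, so by [gauss_lim] their variances tend to the variance of 0. *)
Lemma comb_cvg_L2 (L : nat -> seq (R * nat * R)) l :
  (forall n, points_in O (L n)) -> points_in O l ->
  (forall w, comb X (L n) w @[n --> \oo] --> comb X l w) ->
  Ex P (fun w => (comb X (L n) w - comb X l w) ^+ 2) @[n --> \oo] --> 0.
Proof.
move=> OL Ol LC.
have H n : exists v, gauss P (fun w => comb X (L n) w - comb X l w) v.
  have [|v gv] := @gauss_comb (L n ++ scale_pts (-1) l).
    by apply: points_in_cat => //; exact: points_in_scale.
  exists v; rewrite (_ : (fun w => _) = comb X (L n ++ scale_pts (-1) l))//.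
  by apply/funext => w; rewrite comb_cat combZ mulN1r.
have [v gv] := choice H.
have [|l' gl vl] := gauss_lim gv (measurable_cst (0 : R)).
  apply: aeW => w; rewrite /= -(subrr (comb X l w)).
  by apply: cvgB; [exact: LC|exact: cvg_cst].
have -> : (fun n => Ex P (fun w => (comb X (L n) w - comb X l w) ^+ 2)) = v.
  by apply/funext => n; exact: gauss_var (gv n).
have := gauss_var gl; rewrite (_ : (fun w => _) = cst 0) ?Ex_cst.
  by move=> ->.
by apply/funext => w /=; rewrite expr0n.
Qed.

Lemma quotient_cvg_L2 n t (u : nat -> R) : O t -> (forall k, O (t + u k)) ->
  (forall k, u k != 0) -> u @ \oo --> 0 ->
  Ex P (fun w => ((u k)^-1 * (pderive n X (t + u k) w - pderive n X t w)
     - pderive n.+1 X t w) ^+ 2) @[k --> \oo] --> 0.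
Proof.
move=> Ot Otu u0 ul.
have := @comb_cvg_L2 (fun k => [:: ((u k)^-1, n, t + u k); (- (u k)^-1, n, t)]) [:: (1, n.+1, t)].
have E k w : comb X [:: ((u k)^-1, n, t + u k); (- (u k)^-1, n, t)] w =
    (u k)^-1 * (pderive n X (t + u k) w - pderive n X t w).
  by rewrite /comb big_cons big_seq1 /= mulNr mulrBr.
under eq_fun do under eq_fun do rewrite E comb1 mul1r.
apply.
- by move=> k; do 2 apply: points_in_cons => //.
- exact: points_in1.
- move=> w; under eq_fun do rewrite E; rewrite comb1 mul1r.
  exact: (cvg_quotient (is_derive_smooth n (@sX w) Ot) u0 ul).
Qed.

(** Difference quotients of the process converge in L^2, so by Cauchy-Schwarz the derivative goes
    inside the expectation against any square integrable [W]. *)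
Lemma derive_ExM n t W : O t -> measurable_fun setT W ->
  intg P (fun w => W w ^+ 2) ->
  is_derive t 1 (fun s => Ex P (fun w => pderive n X s w * W w))
    (Ex P (fun w => pderive n.+1 X t w * W w)).
Proof.
move=> Ot mW IW; apply: is_derive_quotient => u u0 ul.
have [r r0 Hr] := near_points (@points_in1 O 1 n t Ot).
have [N _ HN] : \forall k \near \oo, `|u k| <= r.
  have /cvgrPdist_le/(_ _ r0) := ul; apply: filterS => k.
  by rewrite sub0r normrN.
have Otu k : O (t + u (k + N)%N).
  by apply: (Hr (1, n, t)); rewrite ?mem_head//; apply: HN => /=; rewrite leq_addl.
rewrite -(cvg_shiftn N).
have uN : u (k + N)%N @[k --> \oo] --> 0 by rewrite (cvg_shiftn N u).
have D := quotient_cvg_L2 n Ot Otu (fun k => u0 (k + N)%N) uN.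
pose q k w := (u (k + N)%N)^-1 * (pderive n X (t + u (k + N)%N) w - pderive n X t w).
have mq k : measurable_fun setT (fun w => q k w - pderive n.+1 X t w) /\
    intg P (fun w => (q k w - pderive n.+1 X t w) ^+ 2).
  have := @comb_sqr ([:: ((u (k + N)%N)^-1, n, t + u (k + N)%N); (- (u (k + N)%N)^-1, n, t); (-1, n.+1, t)]).
  rewrite (_ : comb X _ = fun w => q k w - pderive n.+1 X t w); last first.
    by apply/funext => w; rewrite /comb !big_cons big_nil /= /q; ring.
  by apply; do 3 apply: points_in_cons => //.
have [mA IA] := pderive_sqr n.+1 Ot.
have [mB IB] := pderive_sqr n Ot.
have E k : (u (k + N)%N)^-1 * (Ex P (fun w => pderive n X (t + u (k + N)%N) w * W w) -
      Ex P (fun w => pderive n X t w * W w)) - Ex P (fun w => pderive n.+1 X t w * W w) =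
    Ex P (fun w => (q k w - pderive n.+1 X t w) * W w).
  have [mC IC] := pderive_sqr n (Otu k).
  have IAW := intg_sqr_mul mA mW IA IW; have IBW := intg_sqr_mul mB mW IB IW.
  have ICW := intg_sqr_mul mC mW IC IW.
  rewrite -ExB// -ExZ; last exact: intgB.
  rewrite -ExB//; last by apply: intgZ; exact: intgB.
  by congr Ex; apply/funext => w; rewrite /q; ring.
apply/cvgrPdist_le => /= e e0.
have B0 : 0 <= Ex P (fun w => W w ^+ 2) by apply: Ex_ge0 => w; exact: sqr_ge0.
set B := Ex P (fun w => W w ^+ 2) in B0.
have eB : 0 < e ^+ 2 / (B + 1) by rewrite divr_gt0 ?exprn_gt0//; lra.
have /cvgrPdist_le/(_ _ eB) := D; apply: filterS => k; rewrite sub0r normrN distrC E.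
set A := Ex P (fun w => (_ - _) ^+ 2) => AB.
have A0 : 0 <= A by apply: Ex_ge0 => w; exact: sqr_ge0.
have [mqk Iqk] := mq k.
have := Ex_cauchy mqk mW Iqk IW; rewrite -/B -[Ex P (fun w => _ ^+ 2)]/A => CS.
rewrite -(@ler_pXn2r _ 2) ?nnegrE ?(ltW e0)// real_normK ?num_real//.
apply: (le_trans CS); move: AB; rewrite ger0_norm// ler_pdivlMr; last by lra.
by apply: le_trans; rewrite ler_wpM2l//; lra.
Qed.

Lemma derive_cov i j s t : O s -> O t ->
  is_derive s 1 (fun s => Ex P (fun w => pderive i X s w * pderive j X t w))
    (Ex P (fun w => pderive i.+1 X s w * pderive j X t w)).
Proof. by move=> Os Ot; have [m I] := pderive_sqr j Ot; exact: derive_ExM. Qed.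

(** The mean value theorem is applied to the expectation of the derivative at s times [W], with [W]
    the increment itself: the difference of the end values is E[W^2], and Cauchy-Schwarz bounds the
    slope. *)
Lemma pderive_lipschitz n a b C : (forall t, a <= t <= b -> O t) ->
  (forall t, a <= t <= b -> Ex P (fun w => pderive n.+1 X t w ^+ 2) <= C ^+ 2) ->
  0 <= C -> a <= b ->
  Ex P (fun w => (pderive n X b w - pderive n X a w) ^+ 2) <= (C * (b - a)) ^+ 2.
Proof.
move=> Oab HC C0; rewrite le_eqVlt => /predU1P[->|ab].
  rewrite subrr mulr0 (_ : (fun w => _) = cst (0 ^+ 2)) ?Ex_cst//.
  by apply/funext => w; rewrite subrr.
have Oa : O a by apply: Oab; rewrite lexx ltW.
have Ob : O b by apply: Oab; rewrite lexx ltW.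
pose W w := pderive n X b w - pderive n X a w.
have [mW IW] : measurable_fun setT W /\ intg P (fun w => W w ^+ 2).
  have := @comb_sqr [:: (1, n, b); (-1, n, a)].
  rewrite (_ : comb X _ = W); first by apply; do 2 apply: points_in_cons => //.
  by apply/funext => w; rewrite /comb big_cons big_seq1 /W /=; ring.
have dF t : t \in `]a, b[ -> is_derive t 1 (fun s => Ex P (fun w => pderive n X s w * W w))
    (Ex P (fun w => pderive n.+1 X t w * W w)).
  rewrite in_itv/= => /andP[/ltW ta /ltW tb]; apply: derive_ExM => //.
  by apply: Oab; rewrite ta tb.
have cF : {within `[a, b], continuous (fun s => Ex P (fun w => pderive n X s w * W w))}.
  apply: derivable_within_continuous => t; rewrite in_itv/= => tab.
  by have := derive_ExM n (Oab t tab) mW IW => H; exact: ex_derive.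
have [c] := MVT ab dF cF; rewrite in_itv/= => /andP[/ltW ac /ltW cb].
have Oc : O c by apply: Oab; rewrite ac cb.
have [ma Ia] := pderive_sqr n Oa; have [mb Ib] := pderive_sqr n Ob.
have [mc Ic] := pderive_sqr n.+1 Oc.
rewrite -ExB; [|exact: intg_sqr_mul|exact: intg_sqr_mul].
rewrite (_ : (fun w => _ - _) = fun w => W w ^+ 2); last first.
  by apply/funext => w; rewrite -mulrBl -expr2.
have := Ex_cauchy mc mW Ic IW; set B := Ex P (fun w => W w ^+ 2).
have := HC c; rewrite ac cb => /(_ isT).
set A := Ex P (fun w => pderive n.+1 X c w ^+ 2); set D := Ex P (fun w => _ * W w).
move=> AC CS BE; rewrite -/B.
have B0 : 0 <= B by apply: Ex_ge0 => w; exact: sqr_ge0.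
have ba : 0 < b - a by rewrite subr_gt0.
have [->|B1] := eqVneq B 0; first by rewrite sqr_ge0.
have Bp : 0 < B by rewrite lt_neqAle eq_sym B1.
rewrite -(ler_pM2l Bp) -expr2 {1}BE !exprMn.
apply: (@le_trans _ _ (A * B * (b - a) ^+ 2)); first by rewrite ler_wpM2r ?sqr_ge0.
by rewrite (mulrC A) -mulrA ler_wpM2l// ler_wpM2r ?sqr_ge0.
Qed.

End process.

End processes.

(** * Zeros of smooth functions *)

Section zeros.
Context {R : realType}.
Implicit Types (f : R -> R) (a b u v x y z : R) (s : seq R).

Lemma smooth_in_cont f n u v x : smooth_in `]u, v[%classic f -> u < x < v ->
  {for x, continuous (derive1n n f)}.
Proof.
move=> sf uxv; apply: differentiable_continuous; apply/derivable1_diffP.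
by apply: sf; rewrite /= in_itv.
Qed.

Lemma smooth_in_cont_within f n u v x y : smooth_in `]u, v[%classic f -> u < x -> y < v ->
  {within `[x, y], continuous (derive1n n f)}.
Proof.
move=> sf ux yv; apply: derivable_within_continuous => z; rewrite in_itv/= => /andP[xz zy].
by apply: sf; rewrite /= in_itv/= (lt_le_trans ux)// (le_lt_trans zy).
Qed.

Lemma smooth_in_S f n u v x y : smooth_in `]u, v[%classic f -> u < x -> y < v -> x < y ->
  exists2 c, x < c < y & derive1n n f y - derive1n n f x = derive1n n.+1 f c * (y - x).
Proof.
move=> sf ux yv xy.
have H z : z \in `]x, y[ -> is_derive z 1 (derive1n n f) (derive1n n.+1 f z).
  rewrite in_itv/= => /andP[xz zy]; apply: (is_derive_smooth n sf).
  by rewrite /= in_itv/= (lt_trans ux)// (lt_trans zy).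
by have [c] := MVT xy H (@smooth_in_cont_within f n u v x y sf ux yv); rewrite in_itv/=; exists c.
Qed.

Lemma rolle_path f n u v x s : smooth_in `]u, v[%classic f ->
  path <%R x s -> (forall z, z \in x :: s -> u < z < v /\ derive1n n f z = 0) ->
  exists s', [/\ size s' = size s, path <%R x s' &
     forall z, z \in s' -> u < z < v /\ derive1n n.+1 f z = 0].
Proof.
move=> sf; elim: s x => [|y s IH] x; first by exists [::].
move=> /= /andP[xy ys] H.
have [/andP[ux xv] fx] := H x (mem_head _ _).
have [/andP[uy yv] fy] : u < y < v /\ derive1n n f y = 0 by apply: H; rewrite !inE eqxx orbT.
have [s' [ss' ps' H']] := IH y ys (fun z zs => H z (mem_behead (s := x :: y :: s) zs)).
have [c /andP[xc cy]] := smooth_in_S n sf ux yv xy.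
rewrite fx fy subrr => /esym/eqP; rewrite mulf_eq0 subr_eq0 (gt_eqF xy) orbF => /eqP fc.
exists (c :: s'); split; first by rewrite /= ss'.
  rewrite /= xc /=; case: s' ps' {ss' H'} => //= w s' /andP[yw ->].
  by rewrite (lt_trans cy yw).
move=> z; rewrite inE => /predU1P[->|/H'//]; split=> //.
by rewrite (lt_trans ux xc) (lt_trans cy yv).
Qed.

(** Rolle's theorem is repeated on the sorted zeros; each differentiation loses one of them, so m +
    1 zeros still leave one at order m. *)
Lemma rolle_iter f m u v s : smooth_in `]u, v[%classic f -> uniq s ->
  (m < size s)%N -> (forall z, z \in s -> u < z < v /\ f z = 0) ->
  forall j, (j <= m)%N -> exists2 z, u < z < v & derive1n j f z = 0.
Proof.
move=> sf us ms H.
suff K j : (j < size s)%N -> exists x s', [/\ size s = (j + (size s').+1)%N, path <%R x s' &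
    forall z, z \in x :: s' -> u < z < v /\ derive1n j f z = 0].
  move=> j jm; have [x [s' [_ _ /(_ x (mem_head _ _))[h1 h2]]]] := K j (leq_ltn_trans jm ms).
  by exists x.
elim: j => [|j IH] js.
  case E : (sort <=%R s) => [|x s'].
    by move: js; rewrite -(size_sort <=%R) E.
  exists x, s'; split; first by rewrite add0n -(size_sort <=%R) E.
    have : sorted <%R (sort <=%R s) by rewrite sort_lt_sorted.
    by rewrite E.
  by move=> z; rewrite -E mem_sort => /H.
have [x [s' [ss' ps' H']]] := IH (ltnW js).
have [s'' [ss'' ps'' H'']] := rolle_path sf ps' H'.
case: s'' ss'' ps'' H'' => [|y s''] ss'' ps'' H''.
  by move: js; rewrite ss' -ss'' /= addn1 ltnn.
exists y, s''; split; [by rewrite ss' -ss'' /= addnS| |exact: H''].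
by move: ps'' => /= /andP[].
Qed.

(** Descent on the order: the derivative of order m vanishes somewhere and varies by at most [B];
    each lower one vanishes somewhere too, and the mean value theorem from that zero costs a factor
    v - u. *)
Lemma derive_bound f m u v B : smooth_in `]u, v[%classic f -> 0 <= B ->
  (forall j, (j <= m)%N -> exists2 z, u < z < v & derive1n j f z = 0) ->
  (forall x y, u < x < v -> u < y < v -> `|derive1n m f x - derive1n m f y| <= B) ->
  forall j, (j <= m)%N -> forall x, u < x < v ->
    `|derive1n j f x| <= (v - u) ^+ (m - j) * B.
Proof.
move=> sf B0 H osc.
suff K i : (i <= m)%N -> forall x, u < x < v -> `|derive1n (m - i) f x| <= (v - u) ^+ i * B.
  by move=> j jm x ux; have := K (m - j)%N (leq_subr _ _) x ux; rewrite subKn.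
elim: i => [|i IH] im x uxv.
  have [z zuv z0] := H m (leqnn m); rewrite subn0 expr0 mul1r.
  by have := osc x z uxv zuv; rewrite z0 subr0.
have [z /andP[uz zv] z0] := H (m - i.+1)%N (leq_subr _ _).
have mi : (m - i.+1).+1 = (m - i)%N by rewrite subnSK.
have uv : 0 <= v - u by rewrite subr_ge0 ltW// (lt_trans uz zv).
case/andP: (uxv) => ux xv.
have aux c y y' : u < y -> y' < v -> y < c < y' -> `|derive1n (m - i.+1).+1 f c * (y' - y)| <= (v - u) ^+ i.+1 * B.
  move=> uy yv /andP[yc cy]; rewrite normrM mi exprS mulrC -mulrA.
  apply: ler_pM => //; last by apply: IH; rewrite ?(ltnW im)// (lt_trans uy yc) (lt_trans cy yv).
  by rewrite ger0_norm; lra.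
have [xz|zx|xz] := ltgtP x z.
- have [c h] := smooth_in_S (m - i.+1) sf ux zv xz.
  by rewrite z0 sub0r => E; rewrite -normrN E; exact: aux.
- have [c h] := smooth_in_S (m - i.+1) sf uz xv zx.
  by rewrite z0 subr0 => ->; exact: aux.
- by rewrite xz z0 normr0 mulr_ge0// exprn_ge0.
Qed.

(** The nodes are interior because smoothness is available on the open interval only. *)
Definition grid u v n i : R := u + (v - u) * (i.+1%:R / n.+2%:R).

Definition total_var (phi : R -> R) u v n : R :=
  \sum_(i < n) `|phi (grid u v n i.+1) - phi (grid u v n i)|.

Lemma grid_in u v n i : u < v -> (i <= n)%N -> u < grid u v n i < v.
Proof.
move=> uv i_n; have uv0 : 0 < v - u by rewrite subr_gt0.
have h0 : 0 < i.+1%:R / n.+2%:R :> R by rewrite divr_gt0.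
have h1 : i.+1%:R / n.+2%:R < 1 :> R by rewrite ltr_pdivrMr// mul1r ltr_nat.
have a0 := mulr_gt0 uv0 h0; rewrite -(gtr_pMr _ uv0) in h1.
rewrite /grid; move: a0 h1; set q := (v - u) * _ => a0 h1.
by apply/andP; split; lra.
Qed.

Lemma grid_step u v n i : grid u v n i.+1 - grid u v n i = (v - u) / n.+2%:R.
Proof.
have w0 : n.+2%:R != 0 :> R by rewrite pnatr_eq0.
by rewrite /grid -[i.+2%:R]natr1; move: w0; set w := n.+2%:R; set j := i.+1%:R => w0; field.
Qed.

Lemma total_var_ge (phi : R -> R) u v n i j : (i <= j <= n)%N ->
  `|phi (grid u v n j) - phi (grid u v n i)| <= total_var phi u v n.
Proof.
move=> /andP[ij jn]; rewrite /total_var.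
rewrite -(big_mkord xpredT (fun i => `|phi (grid u v n i.+1) - phi (grid u v n i)|)).
rewrite (big_cat_nat (leq0n i) (leq_trans ij jn)) /= (big_cat_nat ij jn) /=.
rewrite [X in _ <= X](_ : _ = \sum_(i <= k < j) `|phi (grid u v n k.+1) - phi (grid u v n k)| +
  (\sum_(0 <= k < i) `|phi (grid u v n k.+1) - phi (grid u v n k)| +
  \sum_(j <= k < n) `|phi (grid u v n k.+1) - phi (grid u v n k)|)); last by ring.
apply: (@le_trans _ _ (\sum_(i <= k < j) `|phi (grid u v n k.+1) - phi (grid u v n k)|)); last first.
  by rewrite lerDl addr_ge0// sumr_ge0.
by rewrite -(telescope_sumr (fun k => phi (grid u v n k)) ij) ler_norm_sum.
Qed.

Lemma grid_near u v x (r : R) : u < x < v -> 0 < r ->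
  \forall n \near \oo, exists2 i, (i <= n)%N & `|grid u v n i - x| < r.
Proof.
move=> /andP[ux xv] r0; have uv0 : 0 < v - u by lra.
pose th := (x - u) / (v - u).
have th0 : 0 < th by rewrite divr_gt0//; lra.
have th1 : th < 1 by rewrite ltr_pdivrMr//; lra.
exists (Num.truncn (th^-1) + Num.truncn ((v - u) / r))%N => // n /= Hn.
have n2 : 0 < n.+2%:R :> R by [].
have nth : 1 <= th * n.+2%:R.
  rewrite -ler_pdivrMl// mulr1 (le_trans (ltW (truncnS_gt _)))// ler_nat !ltnS.
  by apply: leq_trans (leqnSn _); apply: leq_trans Hn; exact: leq_addr.
have nr : (v - u) / n.+2%:R < r.
  rewrite ltr_pdivrMr// mulrC -ltr_pdivrMr// (lt_le_trans (truncnS_gt _))// ler_nat !ltnS.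
  by apply: leq_trans (leqnSn _); apply: leq_trans Hn; exact: leq_addl.
have /truncn_itv /andP[k1 k2] : 0 <= th * n.+2%:R by lra.
set k := Num.truncn _ in k1 k2.
have k0 : (0 < k)%N.
  by rewrite -ltnS -(ltr_nat R); apply: le_lt_trans k2.
have kn : (k < n.+2)%N.
  by rewrite -(ltr_nat R) (le_lt_trans k1)// gtr_pMl.
exists k.-1; first by rewrite -ltnS prednK.
rewrite /grid prednK//.
have -> : u + (v - u) * (k%:R / n.+2%:R) - x = (v - u) / n.+2%:R * (k%:R - th * n.+2%:R).
  by rewrite /th; field; rewrite gt_eqF// -(natrD _ 2 n) pnatr_eq0.
rewrite normrM ger0_norm ?divr_ge0 ?(ltW uv0)//.
apply: le_lt_trans nr; rewrite ler_piMr ?divr_ge0 ?(ltW uv0)// ler_norml.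
move: k2; rewrite -natr1 => k2; apply/andP; split; lra.
Qed.

(** By continuity, grid points near x and y almost realize the gap between [phi x] and [phi y], and
    the increments between them are part of the variation. *)
Lemma osc_total_var (phi : R -> R) u v x y b : u < x < v -> u < y < v ->
  {for x, continuous phi} -> {for y, continuous phi} ->
  b < `|phi x - phi y| -> \forall n \near \oo, b < total_var phi u v n.
Proof.
move=> uxv uyv cx cy bxy.
pose e := (`|phi x - phi y| - b) / 2.
have e0 : 0 < e by rewrite divr_gt0// subr_gt0.
have nb z : {for z, continuous phi} -> exists2 r : R, 0 < r & forall z', `|z' - z| < r -> `|phi z' - phi z| < e.
  move=> cz; have /cvgrPdist_lt/(_ _ e0)/nbhs_ballP[r /= r0 Hr] := cz.
  by exists r => // z' zz'; rewrite distrC; apply: Hr; rewrite /ball /= distrC.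
have [rx rx0 Hx] := nb _ cx; have [ry ry0 Hy] := nb _ cy.
have Gx := grid_near uxv rx0; have Gy := grid_near uyv ry0.
near=> n.
have [i i_n ix] : exists2 i, (i <= n)%N & `|grid u v n i - x| < rx by near: n.
have [j jn jy] : exists2 j, (j <= n)%N & `|grid u v n j - y| < ry by near: n.
have := Hx _ ix; have := Hy _ jy; move: bxy.
have : `|phi (grid u v n i) - phi (grid u v n j)| <= total_var phi u v n.
  case/orP: (leq_total i j) => ij; last by apply: total_var_ge; rewrite ij.
  by rewrite distrC; apply: total_var_ge; rewrite ij.
set p := phi x; set q := phi y; set p' := phi (grid _ _ _ i); set q' := phi (grid _ _ _ j).
rewrite /e -/p -/q => h1 h2 h3 h4; apply: lt_le_trans h1.
have : `|p - q| <= `|p' - p| + `|p' - q'| + `|q' - q|.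
  have -> : p - q = (- (p' - p)) + (p' - q') + (q' - q) by ring.
  by rewrite (le_trans (ler_normD _ _))// lerD2r (le_trans (ler_normD _ _))// normrN.
by move: h3 h4; rewrite -/p -/q => h3 h4 h5; lra.
Unshelve. all: by end_near. Qed.

(** [n] is the remaining depth and [r] the current level; the marking criterion may change with the
    level. *)
Fixpoint dyadic_count (Ev : nat -> R -> R -> bool) (n r : nat) u v : nat :=
  if n is n'.+1 then
    (Ev r u v + (dyadic_count Ev n' r.+1 u ((u + v) / 2) + dyadic_count Ev n' r.+1 ((u + v) / 2) v))%N
  else 0%N.

Lemma dyadic_count_mono (Ev : nat -> R -> R -> bool) n n' r u v : (n <= n')%N ->
  (dyadic_count Ev n r u v <= dyadic_count Ev n' r u v)%N.
Proof.
elim: n n' r u v => [//|n IH] [//|n'] r u v nn /=.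
by rewrite leq_add2l leq_add ?IH.
Qed.

(** An interval with at least [D] points is marked, and its mark pays 2 D + 1: the constant [D] of
    each half plus one point at the midpoint. At depth 0 the interval is shorter than the gap [g]
    and holds at most one point. *)
Lemma size_le_dyadic (Ev : nat -> R -> R -> bool) D (g a b : R) :
  (0 < D)%N -> 0 < g ->
  forall n r u v s, a <= u -> v <= b -> uniq s -> (forall z, z \in s -> u < z < v) ->
  (forall x y, x \in s -> y \in s -> x != y -> g <= `|x - y|) ->
  (forall r u v s', a <= u -> v <= b -> {subset s' <= s} -> uniq s' -> (D <= size s')%N ->
     (forall z, z \in s' -> u < z < v) -> Ev r u v) ->
  v - u < g * 2 ^+ n ->
  (size s <= D + D.*2.+1 * dyadic_count Ev n r u v)%N.
Proof.
move=> D0 g0; elim=> [|n IH] r u v s au vb us suv gap HE hn.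
  rewrite /= muln0 addn0; case: s us suv gap {HE} => [//|x [//|y s]] /= us suv gap.
  have xy : x != y by move: us; rewrite inE negb_or => /andP[/andP[]].
  have := gap x y; rewrite !inE !eqxx orbT xy => /(_ isT isT isT).
  have /andP[? ?] := suv x (mem_head _ _).
  have /andP[? ?] : u < y < v by apply: suv; rewrite !inE eqxx orbT.
  move: hn; rewrite expr0 mulr1 ler_normr => hn /orP[]; lra.
have [sD|Ds] := ltnP (size s) D; first by rewrite (leq_trans (ltnW sD))// leq_addr.
have uv : u < v.
  case: s Ds {us gap HE} suv => [|z s'] Ds suv; first by move: Ds; rewrite leqNgt D0.
  by have /andP[h1 h2] := suv z (mem_head _ _); exact: lt_trans h2.
have E : Ev r u v by apply: (HE r u v s).
set m := (u + v) / 2.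
have hn' : v - u < g * 2 ^+ n * 2 by rewrite -mulrA -exprSr.
pose p1 := [pred z : R | z < m]; pose p2 := [pred z : R | m < z].
have s12 : (size s <= (size [seq z <- s | p1 z]) + 1 + size [seq z <- s | p2 z])%N.
  rewrite !size_filter -(count_predC p1 s) -addnA leq_add2l.
  rewrite (@eq_count _ (predC p1) (predU (pred1 m) p2)); last first.
    by move=> z /=; rewrite -leNgt le_eqVlt eq_sym.
  rewrite (leq_trans (leq_addr (count (predI (pred1 m) p2) s) _))// count_predUI leq_add2r.
  by rewrite count_uniq_mem// leq_b1.
have I1 : (size [seq z <- s | p1 z] <= D + D.*2.+1 * dyadic_count Ev n r.+1 u m)%N.
  apply: IH => //; [by rewrite /m; lra|exact: filter_uniq| | | |by rewrite /m; lra].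
  - by move=> z; rewrite mem_filter => /andP[/= zm /suv/andP[-> _]].
  - by move=> x y; rewrite !mem_filter => /andP[_ xs] /andP[_ ys]; exact: gap.
  - move=> r' u' v' s' au' vb' ss'; apply: HE => // z /ss'; rewrite mem_filter => /andP[_ //].
have I2 : (size [seq z <- s | p2 z] <= D + D.*2.+1 * dyadic_count Ev n r.+1 m v)%N.
  apply: IH => //; [by rewrite /m; lra|exact: filter_uniq| | | |by rewrite /m; lra].
  - by move=> z; rewrite mem_filter => /andP[/= -> /suv/andP[_ ->]].
  - by move=> x y; rewrite !mem_filter => /andP[_ xs] /andP[_ ys]; exact: gap.
  - move=> r' u' v' s' au' vb' ss'; apply: HE => // z /ss'; rewrite mem_filter => /andP[_ //].
rewrite /= -/m E; move: s12 I1 I2.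
set c1 := dyadic_count _ _ _ u m; set c2 := dyadic_count _ _ _ m v.
rewrite !mulnDr muln1 -addnn; lia.
Qed.

Lemma uniq_gap s : uniq s ->
  exists2 g : R, 0 < g & forall x y, x \in s -> y \in s -> x != y -> g <= `|x - y|.
Proof.
elim: s => [|x s IH] /=; first by exists 1.
move=> /andP[xs /IH[g g0 Hg]].
have [h h0 Hh] : exists2 h : R, 0 < h & forall y, y \in s -> h <= `|x - y|.
  elim: s xs {IH Hg} => [|y s IH]; first by exists 1.
  rewrite inE negb_or => /andP[xy /IH[h h0 Hh]].
  exists (Num.min h `|x - y|); first by rewrite lt_min h0 normr_gt0 subr_eq0.
  by move=> z; rewrite inE ge_min => /predU1P[->|/Hh ->//]; rewrite lexx orbT.
exists (Num.min g h); first by rewrite lt_min g0.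
move=> y z; rewrite !inE ge_min => /predU1P[->|ys] /predU1P[->|zs]; rewrite ?eqxx// => yz.
- by rewrite (Hh z zs) orbT.
- by rewrite distrC (Hh y ys) orbT.
- by rewrite Hg.
Qed.

(** Oscillation is measured by variations on grids: they are finite sums of increments, with
    computable moments, and an inequality that holds eventually is handled by Fatou's lemma in
    [liminf_dom]. *)
Definition osc_gt (phi : R -> R) u v B := \forall n \near \oo, B < total_var phi u v n.

Lemma osc_le (phi : R -> R) u v B x y : ~ osc_gt phi u v B ->
  {in `]u, v[, forall z, {for z, continuous phi}} -> u < x < v -> u < y < v ->
  `|phi x - phi y| <= B.
Proof.
move=> H cphi xuv yuv; rewrite leNgt; apply/negP => h; apply: H.
by apply: osc_total_var h => //; apply: cphi; rewrite in_itv.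
Qed.

Lemma smooth_in_sub f (a b u v : R) : smooth_in `]a, b[%classic f -> a <= u -> v <= b ->
  smooth_in `]u, v[%classic f.
Proof.
move=> sf au vb n t /=; rewrite in_itv/= => /andP[ut tv]; apply: sf => /=.
by rewrite in_itv/= (le_lt_trans au)// (lt_le_trans tv).
Qed.

(** The conclusion is stated at the midpoint, a deterministic point, so that small ball estimates
    apply to it. *)
Lemma many_zeros f m u v B s : smooth_in `]u, v[%classic f -> uniq s ->
  (m < size s)%N -> (forall z, z \in s -> u < z < v /\ f z = 0) ->
  0 <= B -> ~ osc_gt (derive1n m f) u v B ->
  forall j, (j <= m)%N -> `|derive1n j f ((u + v) / 2)| <= (v - u) ^+ (m - j) * B.
Proof.
move=> sf us ms H B0 nosc j jm.
have uv : u < v.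
  case: s ms H {us} => [//|z s] _ /(_ z (mem_head _ _))[/andP[h1 h2] _].
  exact: lt_trans h2.
apply: (derive_bound sf B0 _ _ jm); last by lra.
  exact: rolle_iter H.
move=> x y xuv yuv; apply: osc_le nosc _ xuv yuv => z; rewrite in_itv => zuv.
exact: smooth_in_cont zuv.
Qed.

Lemma smooth_in_le f (a b u v : R) n B : smooth_in `]a, b[%classic f -> a < u -> v < b -> u < v ->
  (forall z, u < z < v -> `|derive1n n.+1 f z| <= B) ->
  `|derive1n n f v - derive1n n f u| <= B * (v - u).
Proof.
move=> sf au vb uv H; have [c cuv ->] := smooth_in_S n sf au vb uv.
rewrite normrM (@ger0_norm _ (v - u)); last by lra.
by rewrite ler_wpM2r//; [lra|exact: H].
Qed.

(** If the derivative vanished in the cell, it would be at most [B] in size there, and from a zero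
    of f the value at u would be at most B (v - u) <= rho. So once f has a zero, its derivative
    keeps a constant sign: the zero is unique and the end values have opposite signs. *)
Lemma good_cell f (a b u v B rho : R) s : smooth_in `]a, b[%classic f -> a < u -> v < b -> u < v ->
  0 <= B -> (v - u) * B <= rho -> rho < `|f u| -> f v != 0 -> ~ osc_gt (derive1n 1 f) u v B ->
  uniq s -> (forall z, z \in s -> u < z < v /\ f z = 0) -> (size s <= (f u * f v < 0)%R)%N.
Proof.
move=> sf au vb uv B0 Brho fu fv nosc us Hs.
case: s us Hs => [//|z s] us Hs.
have [/andP[uz zv] fz] := Hs z (mem_head _ _).
have sf' : smooth_in `]u, v[%classic f by apply: smooth_in_sub sf (ltW au) (ltW vb).
have cf x : u < x < v -> {for x, continuous (derive1n 1 f)} by move=> h; exact: smooth_in_cont h.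
have nz c : u < c < v -> derive1n 1 f c != 0.
  move=> cuv; apply/negP => /eqP c0.
  have zb : z < b by rewrite (lt_trans zv).
  have : `|derive1n 0 f z - derive1n 0 f u| <= B * (z - u).
    apply: (smooth_in_le sf) => // x /andP[ux xz].
    have xuv : u < x < v by rewrite ux (lt_trans xz).
    rewrite -[derive1n 1 f x]subr0 -{1}c0; apply: osc_le nosc _ xuv cuv => y.
    by rewrite in_itv => /cf.
  rewrite /= fz sub0r normrN => h; move: fu; apply/negP; rewrite -leNgt.
  by rewrite (le_trans h)// (le_trans _ Brho)// mulrC ler_wpM2r//; lra.
have same c1 c2 : u < c1 < v -> u < c2 < v -> c1 < c2 -> 0 < derive1n 1 f c1 * derive1n 1 f c2.
  move=> h1 h2 c12; rewrite ltNge; apply/negP => hle.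
  have cc : {within `[c1, c2], continuous (derive1n 1 f)}.
    by apply: smooth_in_cont_within sf' _ _; [case/andP: h1|case/andP: h2].
  have [] := @IVT R (derive1n 1 f) c1 c2 0 (ltW c12) cc.
    rewrite ge_min le_max; have [p1|p1] := leP (derive1n 1 f c1) 0.
      have n1 : derive1n 1 f c1 < 0 by rewrite lt_neqAle p1 nz.
      by move: hle; rewrite nmulr_rle0// => ->; rewrite orbT.
    by move: hle; rewrite pmulr_rle0// => ->; rewrite orbT (ltW p1).
  move=> c; rewrite in_itv/= => /andP[h3 h4] c0.
  have : derive1n 1 f c != 0.
    by apply: nz; move: h1 h2 => /andP[? _] /andP[_ ?]; apply/andP; split; lra.
  by rewrite /= c0 eqxx.
have az : a < z by apply: lt_trans uz.
have zb : z < b by apply: lt_trans vb.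
have [c1 c1u E1] := smooth_in_S 0 sf au zb uz.
have [c2 c2u E2] := smooth_in_S 0 sf az vb zv.
rewrite /= fz sub0r in E1; rewrite /= fz subr0 in E2.
have c12 := same c1 c2; rewrite /= in c12.
have -> : f u * f v < 0.
  have -> : f u = - (derive1 f c1 * (z - u)) by rewrite -E1 opprK.
  rewrite E2 mulNr oppr_lt0 mulrACA; move: c1u c2u => /andP[p1 p2] /andP[p3 p4].
  apply: mulr_gt0; last by rewrite mulr_gt0 ?subr_gt0.
  apply: c12; [by rewrite p1 (lt_trans p2)|by rewrite p4 andbT (lt_trans uz)|exact: lt_trans p3].
case: s us Hs => [//|y s] us Hs.
have [] := @rolle_iter f 1 u v (z :: y :: s) sf' us isT Hs 1 (leqnn _).
by move=> c /nz /eqP.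
Qed.

Lemma counting_ge (A : set R) s : uniq s -> (forall z, z \in s -> A z) ->
  ((size s)%:R%:E <= counting A :> \bar R)%E.
Proof.
move=> us sA; rewrite /counting; case: asboolP => [fA|_]; last by rewrite leey.
rewrite lee_fin ler_nat -(undup_id us) -card_fseq; apply: fsubset_leq_card.
by apply/fsubsetP => x; rewrite inE => xs; rewrite in_fset_set// inE; exact: sA.
Qed.

Lemma counting_le (A : set R) n : (forall s, uniq s -> (forall z, z \in s -> A z) -> (size s <= n)%N) ->
  (counting A <= n%:R%:E :> \bar R)%E.
Proof.
move=> H; rewrite /counting; case: asboolP => [fA|iA].
  rewrite lee_fin ler_nat; apply: H; first exact: fset_uniq.
  by move=> z; rewrite -/(z \in fset_set A) in_fset_set// inE.
have [B BA nB] := @infinite_set_fset _ A n.+1 iA.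
have := H (enum_fset B) (fset_uniq B) (fun z zB => BA z zB).
by rewrite leqNgt nB.
Qed.

Definition zero_set f a b : set R := `]a, b[%classic `&` [set x | f x = 0].

(** A strict sign change puts the zero inside the open interval, and these intervals are disjoint,
    so distinct indices give distinct zeros. *)
Lemma sign_changes_le f (a b : R) n (u v : nat -> R) : smooth_in `]a, b[%classic f ->
  (forall i, (i < n)%N -> a < u i /\ v i < b /\ u i < v i) ->
  (forall i j, (i < j < n)%N -> v i <= u j) ->
  (((\sum_(i < n) (f (u i) * f (v i) < 0)%R)%N%:R : R)%:E <= counting (zero_set f a b))%E.
Proof.
move=> sf uv vu.
have Z i : exists z, (i < n)%N -> f (u i) * f (v i) < 0 -> u i < z < v i /\ f z = 0.
  have [i_n|] := ltnP i n; last by exists 0.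
  have [h|] := ltrP (f (u i) * f (v i)) 0; last by exists 0 => _.
  have [ai [ib uvi]] := uv i i_n.
  have nu : f (u i) != 0 by apply/eqP => e; move: h; rewrite e mul0r ltxx.
  have nv : f (v i) != 0 by apply/eqP => e; move: h; rewrite e mulr0 ltxx.
  have cc := @smooth_in_cont_within f 0 _ _ _ _ sf ai ib.
  have [|z] := @IVT R f (u i) (v i) 0 (ltW uvi) cc.
    rewrite ge_min le_max; have [p1|p1] := leP (f (u i)) 0.
      have n1 : f (u i) < 0 by rewrite lt_neqAle p1 nu.
      by move: h; rewrite nmulr_rlt0// => /ltW ->; rewrite orbT.
    by move: h; rewrite pmulr_rlt0// => /ltW ->; rewrite orbT (ltW p1).
  rewrite in_itv/= => /andP[]; rewrite !le_eqVlt => /predU1P[uz|h1].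
    by move=> _ e; rewrite uz e eqxx in nu.
  move=> /predU1P[zv|h2] e; first by rewrite -zv e eqxx in nv.
  by exists z; rewrite h1 h2.
have [z Hz] := choice Z.
pose s := [seq z i | i <- [seq i <- iota 0 n | (f (u i) * f (v i) < 0)%R]].
have -> : (\sum_(i < n) (f (u i) * f (v i) < 0)%R)%N = size s.
  rewrite size_map size_filter -sum1_count -(big_mkord xpredT (fun i => nat_of_bool (f (u i) * f (v i) < 0)%R)).
  by rewrite [RHS]big_mkcond /= /index_iota subn0; apply: eq_bigr => i _; case: ifP.
apply: counting_ge.
  rewrite map_inj_in_uniq ?filter_uniq ?iota_uniq// => i j.
  have main i' j' : (i' < j')%N -> (j' < n)%N -> f (u i') * f (v i') < 0 -> f (u j') * f (v j') < 0 -> z i' < z j'.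
    move=> ij jn si sj; have [/andP[_ h1] _] := Hz i' (ltn_trans ij jn) si.
    have [/andP[h2 _] _] := Hz j' jn sj.
    by rewrite (lt_trans h1)// (le_lt_trans _ h2)// vu// ij.
  rewrite !mem_filter !mem_iota /= !add0n => /andP[si i_n] /andP[sj jn] e.
  have [ij|ji|//] := ltngtP i j.
    by have := main i j ij jn si sj; rewrite e ltxx.
  by have := main j i ji i_n sj si; rewrite e ltxx.
move=> y /mapP[i + ->]; rewrite mem_filter mem_iota /= add0n => /andP[si i_n].
have [/andP[h1 h2] fz] := Hz i i_n si; have [ai [ib _]] := uv i i_n.
by split=> //=; rewrite in_itv/= (lt_trans ai)// (lt_trans h2).
Qed.

(** * Zeros counted cell by cell *)

Section cells.
Variables (a b : R) (M : nat).
Hypotheses (ab : a < b) (M2 : (1 < M)%N).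

Definition node (i : nat) : R := a + (b - a) * (i%:R / M%:R).

Let M0 : 0 < M%:R :> R. Proof. by rewrite ltr0n; lia. Qed.

Lemma node0 : node 0 = a. Proof. by rewrite /node mul0r mulr0 addr0. Qed.
Lemma nodeM : node M = b. Proof. by rewrite /node divff ?gt_eqF// mulr1 addrC subrK. Qed.
Lemma node_lt i j : (i < j)%N -> node i < node j.
Proof. by move=> ij; rewrite /node ltrD2l ltr_pM2l ?subr_gt0// ltr_pM2r ?invr_gt0// ltr_nat. Qed.
Lemma node_le i j : (i <= j)%N -> node i <= node j.
Proof. by rewrite leq_eqVlt => /predU1P[->//|/node_lt/ltW]. Qed.
Lemma node_step i : node i.+1 - node i = (b - a) / M%:R.
Proof. by rewrite /node -natr1; field; rewrite gt_eqF. Qed.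

Lemma node_cover x : a < x < b -> exists2 i, (i < M)%N & node i <= x < node i.+1.
Proof.
move=> /andP[ax xb]; have ba : 0 < b - a by lra.
pose th := (x - a) / (b - a) * M%:R.
have th0 : 0 <= th by rewrite mulr_ge0 ?ltW// divr_gt0//; lra.
have /andP[h1 h2] := truncn_itv th0; exists (Num.truncn th).
  rewrite -(ltr_nat R) (le_lt_trans h1)// /th gtr_pMl// ltr_pdivrMr//; lra.
have E : x = a + (b - a) * (th / M%:R) by rewrite /th; field; rewrite !gt_eqF.
apply/andP; split; first by rewrite E lerD2l ler_wpM2l ?(ltW ba)// ler_wpM2r// invr_ge0 ltW.
by rewrite [ltLHS]E ltrD2l ltr_pM2l// ltr_pM2r ?invr_gt0.
Qed.

Variables (f : R -> R) (m : nat) (A : nat -> R) (B rho : R).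
Hypotheses (sf : smooth_in `]a, b[%classic f) (A0 : forall r, 0 <= A r) (B0 : 0 <= B)
  (m2 : (2 <= m)%N) (Brho : (b - a) / M%:R * B <= rho).

(** By [many_zeros], an interval with more than m zeros is of one of these kinds. Three derivatives
    are kept because their joint small ball probability carries the power h^(3 m), which is summable
    over the dyadic tree. *)
Definition bad_dyadic (r : nat) u v : bool :=
  `[< osc_gt (derive1n m f) u v ((v - u) * A r) \/
      forall j, (j < 3)%N -> `|derive1n j f ((u + v) / 2)| <= (v - u) ^+ (m - j) * ((v - u) * A r) >].

Definition near_zero i : bool := `|f (node i)| <= rho.
Definition big_osc i : bool := `[< osc_gt (derive1n 1 f) (node i) (node i.+1) B >].
Definition sign_change i : bool := f (node i) * f (node i.+1) < 0.
Definition dyadic_bad n i : nat := dyadic_count bad_dyadic n 0 (node i) (node i.+1).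

Lemma cell_zeros i s : (i < M)%N -> uniq s -> (forall z, z \in s -> node i < z < node i.+1 /\ f z = 0) ->
  exists n, (size s <= m.+1 + m.+1.*2.+1 * dyadic_bad n i)%N.
Proof.
move=> iM us Hs; have [g g0 Hg] := uniq_gap us.
have [n Hn] : exists n, node i.+1 - node i < g * 2 ^+ n.
  exists (Num.truncn ((node i.+1 - node i) / g)).+1.
  rewrite -ltr_pdivrMl// mulrC (lt_le_trans (truncnS_gt _))//.
  rewrite -natrX ler_nat ltnW// ltn_expl//.
have h0 : a <= node i by rewrite -[leLHS]node0 node_le.
have h1 : node i.+1 <= b by rewrite -[leRHS]nodeM node_le.
exists n; apply: (@size_le_dyadic _ m.+1 g (node i) (node i.+1)) => //.
  by move=> z /Hs[].
move=> r u v s' iu vi ss us' ms Hs'; apply/asboolP.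
have uv : u < v.
  case: s' ms Hs' {ss us'} => [//|z s'] _ /(_ z (mem_head _ _))/andP[p1 p2].
  exact: lt_trans p2.
have [|no] := pselect (osc_gt (derive1n m f) u v ((v - u) * A r)); first by left.
right=> j j3; apply: (many_zeros (s := s') (B := (v - u) * A r)) => //.
- by apply: smooth_in_sub sf _ _; lra.
- by move=> z zs; split; [exact: Hs'|have [] := Hs z (ss z zs)].
- by rewrite mulr_ge0//; lra.
- by rewrite (leq_trans _ m2)// -ltnS.
Qed.

(** [good_cell] needs smoothness at both ends, so the first and last cells are left to the dyadic
    count; this is the term 2 (m + 1). The factor 3 counts a node near 0 as a left end, as a right
    end and as a possible zero. [G] has to serve all depths, since the depth required depends on the
    gaps between zeros. *)
Lemma zeros_le (G : nat) : (forall n, \sum_(i < M) dyadic_bad n i <= G)%N ->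
  (counting (zero_set f a b) <=
   ((\sum_(1 <= i < M.-1) sign_change i + 2 * m.+1 + m.+1.*2.+1 *
    (3 * \sum_(1 <= i < M) near_zero i + \sum_(1 <= i < M.-1) big_osc i + G))%N%:R : R)%:E)%E.
Proof.
move=> HG; apply: counting_le => s us Hs.
have rho0 : 0 <= rho.
  by apply: le_trans Brho; rewrite mulr_ge0// divr_ge0 ?(ltW M0)// subr_ge0 ltW.
pose cell i := [seq z <- s | node i < z < node i.+1].
have H1 : (size s <= \sum_(0 <= i < M) size (cell i) + \sum_(1 <= i < M) count_mem (node i) s)%N.
  have -> : size s = (\sum_(x <- s) 1)%N by rewrite sum1_size.
  have -> : (\sum_(0 <= i < M) size (cell i))%N = (\sum_(x <- s) \sum_(0 <= i < M) (node i < x < node i.+1)%R)%N.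
    rewrite exchange_big /=; apply: eq_bigr => i _; rewrite size_filter -sum1_count big_mkcond /=.
    by apply: eq_bigr => x _; case: ifP.
  have -> : (\sum_(1 <= i < M) count_mem (node i) s)%N = (\sum_(x <- s) \sum_(1 <= i < M) (x == node i))%N.
    rewrite exchange_big /=; apply: eq_bigr => i _; rewrite -sum1_count big_mkcond /=.
    by apply: eq_bigr => x _; case: ifP.
  rewrite -big_split /= big_seq [X in (_ <= X)%N]big_seq; apply: leq_sum => x xs.
  have [/=] := Hs x xs; rewrite in_itv/= => axb _.
  have [i iM /andP[ix xi]] := node_cover axb.
  move: ix; rewrite le_eqVlt => /predU1P[ix|ix].
    have i0 : (0 < i)%N.
      rewrite lt0n; apply/negP => /eqP i0; move: axb; rewrite -ix i0 node0 ltxx//.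
    rewrite (@big_cat_nat _ _ _ i 1 M)//=; last exact: ltnW.
    by rewrite [X in (_ + (_ + X))%N]big_ltn// -ix eqxx !addn_gt0 !orbT.
  rewrite (@big_cat_nat _ _ _ i 0 M)//=; last exact: ltnW.
  by rewrite [X in (_ + X + _)%N]big_ltn// ix xi addnCA -addnA leq_addr.
have Hcell i : (i < M)%N -> uniq (cell i) /\ (forall z, z \in cell i -> node i < z < node i.+1 /\ f z = 0).
  move=> iM; split; first exact: filter_uniq.
  by move=> z; rewrite mem_filter => /andP[-> /Hs[_ ->]].
have N0 i : exists n, (i < M)%N -> (size (cell i) <= m.+1 + m.+1.*2.+1 * dyadic_bad n i)%N.
  have [iM|] := ltnP i M; last by exists 0%N.
  by have [us' Hs'] := Hcell i iM; have [n Hn] := cell_zeros iM us' Hs'; exists n.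
have [N HN] := choice N0.
have mono n n' i : (n <= n')%N -> (dyadic_bad n i <= dyadic_bad n' i)%N.
  exact: dyadic_count_mono.
(* One depth serves all cells because the count increases with the depth. *)
pose n := \max_(i < M) N i.
have HN' i : (i < M)%N -> (size (cell i) <= m.+1 + m.+1.*2.+1 * dyadic_bad n i)%N.
  move=> iM; apply: (leq_trans (HN i iM)); rewrite leq_add2l leq_mul2l mono ?orbT//.
  exact: (@leq_bigmax _ (fun i : 'I_M => N i) (Ordinal iM)).
have good i : (1 <= i < M.-1)%N -> (size (cell i) <= sign_change i +
    m.+1.*2.+1 * (near_zero i + near_zero i.+1 + big_osc i + dyadic_bad n i))%N.
  move=> /andP[i1 iM]; have iM' : (i < M)%N by lia.
  have [us' Hs'] := Hcell i iM'.
  (* A single raised flag already weighs more than the m + 1 zeros outside the dyadic count. *)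
  have weak p : (0 < p)%N -> (size (cell i) <= sign_change i + m.+1.*2.+1 * (p + dyadic_bad n i))%N.
    move=> p0; apply: (leq_trans (HN' i iM')); rewrite mulnDr addnA leq_add2r.
    rewrite (leq_trans _ (leq_addl _ _))// (leq_trans _ (leq_pmulr _ p0))//.
    by rewrite ltnW// ltnS -addnn leq_addr.
  case z1 : (near_zero i); first by apply: weak; rewrite !addn_gt0.
  case z2 : (near_zero i.+1); first by apply: weak; rewrite !addn_gt0 orbT.
  case o1 : (big_osc i); first by apply: weak; rewrite !addn_gt0 orbT.
  apply: (leq_trans _ (leq_addr _ _)); rewrite /sign_change.
  apply: (good_cell (B := B) (rho := rho) sf) us' Hs' => //.
  - by rewrite -[ltLHS]node0 node_lt.
  - by rewrite -[ltRHS]nodeM node_lt//; lia.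
  - exact: node_lt.
  - by rewrite node_step.
  - by rewrite ltNge -/(near_zero i) z1.
  - by apply/negP => /eqP f0; move: z2; rewrite /near_zero f0 normr0 rho0.
  - by apply/asboolPn; rewrite -/(big_osc i) o1.
have H2 : (\sum_(1 <= i < M) count_mem (node i) s <= \sum_(1 <= i < M) near_zero i)%N.
  apply: leq_sum => i _; rewrite count_uniq_mem//; case ns : (node i \in s) => //.
  have [_ f0] := Hs _ ns; rewrite /near_zero f0 normr0.
  by rewrite rho0.
have split3 (F : nat -> nat) : (\sum_(0 <= i < M) F i = F 0 + \sum_(1 <= i < M.-1) F i + F M.-1)%N.
  rewrite big_ltn; last by lia.
  by rewrite -{1}(prednK (n := M)) ?big_nat_recr//=; [rewrite addnA|lia|lia].
apply: (leq_trans H1); rewrite split3.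
have E0 : (size (cell 0) <= m.+1 + m.+1.*2.+1 * dyadic_bad n 0)%N by apply: HN'; lia.
have EM : (size (cell M.-1) <= m.+1 + m.+1.*2.+1 * dyadic_bad n M.-1)%N by apply: HN'; lia.
have EI : (\sum_(1 <= i < M.-1) size (cell i) <= \sum_(1 <= i < M.-1) sign_change i +
   m.+1.*2.+1 * (\sum_(1 <= i < M.-1) near_zero i + \sum_(1 <= i < M.-1) near_zero i.+1 +
    \sum_(1 <= i < M.-1) big_osc i + \sum_(1 <= i < M.-1) dyadic_bad n i))%N.
  rewrite -!big_split /= big_distrr /= -big_split /= big_nat [X in (_ <= X)%N]big_nat.
  by apply: leq_sum => i /good.
have Z1 : (\sum_(1 <= i < M.-1) near_zero i <= \sum_(1 <= i < M) near_zero i)%N.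
  have [M3|M3] := leqP 2 M.-1; last by rewrite big_geq//; lia.
  by rewrite (@big_cat_nat _ _ _ M.-1 1 M) ?leq_addr//; lia.
have Z2 : (\sum_(1 <= i < M.-1) near_zero i.+1 <= \sum_(1 <= i < M) near_zero i)%N.
  rewrite -(big_add1 _ _ 1 M.-1.+1 xpredT (fun i => nat_of_bool (near_zero i))) prednK; last by lia.
  by rewrite [X in (_ <= X)%N]big_ltn// leq_addl.
have := HG n; rewrite -(big_mkord xpredT (dyadic_bad n)) split3.
move: E0 EM EI Z1 Z2 H2.
set x0 := size (cell 0); set xM := size (cell M.-1); set xI := (\sum_(1 <= i < M.-1) size _)%N.
set z1 := (\sum_(1 <= i < M.-1) near_zero i)%N; set z2 := (\sum_(1 <= i < M.-1) near_zero i.+1)%N.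
set z := (\sum_(1 <= i < M) near_zero i)%N; set c := (\sum_(1 <= i < M) count_mem _ _)%N.
set sc := (\sum_(1 <= i < M.-1) sign_change i)%N; set o := (\sum_(1 <= i < M.-1) big_osc i)%N.
set d0 := dyadic_bad n 0; set dM := dyadic_bad n M.-1; set dI := (\sum_(1 <= i < M.-1) dyadic_bad n i)%N.
move=> E0 EM EI Z1 Z2 H2 HGn.
set w := m.+1.*2.+1 in E0 EM EI *.
have w1 : (1 <= w)%N by [].
have K1 : (w * (z1 + z2 + o + dI) <= w * (z + z + o + dI))%N by rewrite leq_mul2l; apply/orP; right; lia.
have K2 : (w * (d0 + dI + dM) <= w * G)%N by rewrite leq_mul2l HGn orbT.
have K3 : (c <= w * z)%N by rewrite (leq_trans H2)// leq_pmull.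
clearbody w; clear - E0 EM EI K1 K2 K3; lia.
Qed.

End cells.

End zeros.

(** * Trigonometric approximation of the sign *)

Section power_mean.
Context {R : realType}.

(** Chebyshev's sum inequality, from the nonnegativity of (x i - x j) (x i ^+ p - x j ^+ p). *)
Lemma sum_exprM_le n (x : 'I_n -> R) p : (forall i, 0 <= x i) ->
  (\sum_i x i) * (\sum_i x i ^+ p) <= n%:R * \sum_i x i ^+ p.+1.
Proof.
move=> x0; rewrite mulr_suml.
have E1 : \sum_i x i * (\sum_j x j ^+ p) = \sum_i \sum_j x i * x j ^+ p.
  by apply: eq_bigr => i _; rewrite mulr_sumr.
have E2 : \sum_i \sum_j x i * x j ^+ p = \sum_i \sum_j x j * x i ^+ p.
  by rewrite exchange_big.
have E3 : \sum_(i < n) \sum_(j < n) (x i ^+ p.+1 + x j ^+ p.+1) = 2 * (n%:R * \sum_i x i ^+ p.+1).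
  under eq_bigr do rewrite big_split /= sumr_const card_ord -mulr_natl.
  by rewrite big_split /= -mulr_sumr sumr_const card_ord -mulr_natl; ring.
rewrite E1 -(ler_pM2l (_ : 0 < 2))// -E3 mulr2n mulrDl mul1r {2}E2 -big_split /=.
apply: ler_sum => i _; rewrite -big_split /=; apply: ler_sum => j _.
rewrite !exprS -subr_ge0.
have -> : x i * x i ^+ p + x j * x j ^+ p - (x i * x j ^+ p + x j * x i ^+ p) =
  (x i - x j) * (x i ^+ p - x j ^+ p) by ring.
have [ij|ji] := leP (x i) (x j).
  by rewrite mulr_le0// subr_le0// lerXn2r// nnegrE.
by apply: mulr_ge0; rewrite subr_ge0 ?(ltW ji)// lerXn2r ?nnegrE// ltW.
Qed.

Lemma power_mean n (x : 'I_n -> R) p : (\sum_i x i) ^+ p.*2.+2 <= n%:R ^+ p.*2.+1 * \sum_i x i ^+ p.*2.+2.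
Proof.
have main q : (\sum_i `|x i|) ^+ q.+1 <= n%:R ^+ q * \sum_i `|x i| ^+ q.+1.
  elim: q => [|q IH]; first by rewrite expr0 mul1r expr1; under [leRHS]eq_bigr do rewrite expr1.
  rewrite exprS (le_trans (ler_wpM2l _ IH)) ?sumr_ge0//.
  rewrite mulrCA [n%:R ^+ q.+1]exprSr -mulrA ler_wpM2l ?exprn_ge0//.
  exact: sum_exprM_le.
have ev (y : R) : `|y| ^+ p.*2.+2 = y ^+ p.*2.+2.
  by rewrite -doubleS -mul2n !exprM real_normK ?num_real.
have -> : \sum_i x i ^+ p.*2.+2 = \sum_i `|x i| ^+ p.*2.+2 by apply: eq_bigr => i _; rewrite ev.
apply: le_trans (main _); rewrite -ev lerXn2r ?nnegrE ?normr_ge0 ?sumr_ge0//.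
exact: ler_norm_sum.
Qed.

End power_mean.

Lemma mvt_all {R : realType} (f f' : R -> R) (x y : R) : (forall z : R, is_derive z 1 f (f' z)) ->
  x < y -> exists2 c, x < c < y & f y - f x = f' c * (y - x).
Proof.
move=> df xy; have dH z : z \in `]x, y[ -> is_derive z 1 f (f' z) by [].
have [|c] := MVT xy dH; last by rewrite in_itv; exists c.
by apply: derivable_within_continuous => z _; have h := df z; exact: ex_derive.
Qed.

Section smooth_sign.
Context {R : realType}.
Implicit Types (y x r : R).

(** This is binom (2n, n) / 4^n, the coefficient for which the derivative of [sign_poly] collapses
    to a multiple of (1 - y^2)^n. *)
Fixpoint sign_coef n : R := if n is n'.+1 then sign_coef n' * (n'.*2.+1%:R / n'.*2.+2%:R) else 1.

(* The primitive vanishing at 0 of a multiple of (1 - y^2)^n, normalized to be 1 at 1. *)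
Fixpoint sign_poly n y : R :=
  if n is n'.+1 then sign_poly n' y + sign_coef n * (y * (1 - y ^+ 2) ^+ n) else y.

Lemma sign_coef_gt0 n : 0 < sign_coef n.
Proof. by elim: n => //= n IH; rewrite mulr_gt0// divr_gt0. Qed.

(** The left side decreases in n because (2 n + 1) (2 n + 3) <= (2 n + 2)^2. It makes the slope at 0
    of order sqrt n at most. *)
Lemma sign_coef_sqr n : sign_coef n ^+ 2 * n.*2.+1%:R <= 1.
Proof.
elim: n => [|n IH]; first by rewrite /= expr1n mulr1.
rewrite /= (le_trans _ IH)// exprMn -mulrA ler_wpM2l ?sqr_ge0//.
rewrite expr_div_n mulrAC ler_pdivrMr ?exprn_gt0//.
rewrite -!natrX -!natrM ler_nat; lia.
Qed.

Lemma sign_coefS n : sign_coef n.+1 * n.*2.+2%:R = sign_coef n * n.*2.+1%:R.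
Proof. by rewrite /= -!mulrA mulVf ?mulr1// pnatr_eq0. Qed.

Definition sign_slope n : R := n.*2.+1%:R * sign_coef n.

Lemma sign_slope_ge0 n : 0 <= sign_slope n.
Proof. by rewrite mulr_ge0// ltW// sign_coef_gt0. Qed.

Lemma sign_slope_le n : sign_slope n <= Num.sqrt n.*2.+1%:R.
Proof.
rewrite -(@ler_pXn2r _ 2) ?nnegrE ?sign_slope_ge0 ?sqrtr_ge0// sqr_sqrtr// /sign_slope.
rewrite exprMn expr2 -mulrA ler_piMr// mulrC; exact: sign_coef_sqr.
Qed.

Lemma is_derive_sign_poly n y : is_derive y 1 (sign_poly n) (sign_slope n * (1 - y ^+ 2) ^+ n).
Proof.
elim: n => [|n IH].
  by rewrite /sign_slope expr0 /= !mulr1; exact: is_derive_id.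
pose g : R -> R := cst 1 - id ^+ 2.
have -> : sign_poly n.+1 = sign_poly n + (sign_coef n.+1 \*: (id * g ^+ n.+1)).
  by apply/funext => x; rewrite /g /= !fctE.
have h := is_deriveB (is_derive_cst (1 : R) y 1) (is_deriveX 2 (is_derive_id y (1 : R))).
have h2 := is_deriveM (is_derive_id y (1 : R)) (is_deriveX n.+1 h).
have h3 := is_deriveD IH (is_deriveZ (sign_coef n.+1) h2).
apply: (is_derive_eq h3); rewrite /sign_slope [_ * sign_coef n]mulrC -sign_coefS.
rewrite /GRing.scale /= !fctE /= !mulr1 sub0r expr1 ![(1 - _) ^+ n.+1]exprS.
have -> : n.+1.*2.+1%:R = n.*2.+2%:R + 1 :> R by rewrite doubleS natr1.
have -> : n.+1%:R = n.*2.+2%:R / 2 :> R.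
  by rewrite -doubleS -mul2n natrM mulrAC divff ?mul1r.
by set c := _ * (_ / _); set q := (1 - y ^+ 2) ^+ n; field.
Qed.

Lemma sign_poly0 n : sign_poly n 0 = 0.
Proof. by elim: n => //= n ->; rewrite mul0r mulr0 addr0. Qed.

Lemma sign_poly1 n : sign_poly n 1 = 1.
Proof. by elim: n => //= n ->; rewrite expr1n subrr expr0n /= !mulr0 addr0. Qed.

Lemma sign_polyN n y : sign_poly n (- y) = - sign_poly n y.
Proof. by elim: n => //= n ->; rewrite sqrrN mulNr mulrN opprD. Qed.

Lemma sign_poly_mvt n x y : x < y -> exists2 c, x < c < y &
  sign_poly n y - sign_poly n x = sign_slope n * (1 - c ^+ 2) ^+ n * (y - x).
Proof.
move=> xy; exact: (mvt_all (is_derive_sign_poly n)).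
Qed.

(** The derivative is nonnegative and decreasing on [0, 1], so by the mean value theorem the deficit
    at y is at most the derivative at y. *)
Lemma sign_poly_bounds n y : 0 <= y <= 1 ->
  0 <= sign_poly n y <= 1 /\ 1 - sign_poly n y <= sign_slope n * (1 - y ^+ 2) ^+ n.
Proof.
move=> /andP[y0 y1].
have s0 := sign_slope_ge0 n.
have aux (c : R) : 0 <= c <= 1 -> 0 <= (1 - c ^+ 2) ^+ n.
  by move=> /andP[c0 c1]; rewrite exprn_ge0// subr_ge0 exprn_ile1.
have ge0 : 0 <= sign_poly n y.
  move: y0; rewrite le_eqVlt => /predU1P[<-|y0]; first by rewrite sign_poly0.
  have [c /andP[c0 cy]] := sign_poly_mvt n y0; rewrite sign_poly0 !subr0 => ->.
  rewrite mulr_ge0 ?(ltW y0)// mulr_ge0// aux// (ltW c0) (le_trans (ltW cy))//.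
have le1 : sign_poly n y <= 1 /\ 1 - sign_poly n y <= sign_slope n * (1 - y ^+ 2) ^+ n.
  move: y1; rewrite le_eqVlt => /predU1P[->|y1].
    by rewrite sign_poly1 subrr lexx mulr_ge0// aux// ler01 lexx.
  have [c /andP[yc c1]] := sign_poly_mvt n y1; rewrite sign_poly1.
  have c0 : 0 <= c by rewrite (le_trans y0)// ltW.
  have p0 := aux c; rewrite c0 (ltW c1) in p0; have {}p0 := p0 isT.
  move=> E; rewrite -subr_ge0 E; split.
    by rewrite mulr_ge0 ?subr_ge0 ?(ltW y1)// mulr_ge0.
  rewrite (@le_trans _ _ (sign_slope n * (1 - c ^+ 2) ^+ n))//.
    by apply: ler_piMr; [exact: mulr_ge0|lra].
  rewrite ler_wpM2l// lerXn2r ?nnegrE ?subr_ge0 ?exprn_ile1 ?(ltW c1) ?(ltW y1)//.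
  by rewrite lerD2l lerN2 lerXn2r ?nnegrE// ltW.
by rewrite ge0; case: le1 => -> ->.
Qed.

Lemma sign_poly_norm n y : `|y| <= 1 -> `|sign_poly n y| <= 1.
Proof.
move=> y1; have [y0|y0] := leP 0 y.
  have [|/andP[h1 h2] _] := @sign_poly_bounds n y; first by rewrite y0 (le_trans (ler_norm _)).
  by rewrite ger0_norm.
have [|/andP[h1 h2] _] := @sign_poly_bounds n (- y).
  by rewrite oppr_ge0 (ltW y0) (le_trans (ler_norm _))// normrN.
by rewrite -normrN -sign_polyN ger0_norm.
Qed.

Variables (n : nat) (r : R).
Hypothesis r0 : 0 < r.

(** Composition with the sine bounds the function on the whole line and makes it a trigonometric
    polynomial. It approximates the sign on [-r, r] away from 0 only. *)
Definition chi x : R := sign_poly n (sin (r^-1 * x)).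
Definition dchi x : R := sign_slope n * cos (r^-1 * x) ^+ n.*2.+1 / r.

Lemma chi_trigp i : trigp (fun u => chi (u i)).
Proof.
rewrite /chi; elim: n => [|p IH] /=; first exact: trigp_sin.
apply: trigpD => //; apply: trigpZ; apply: trigpM; first exact: trigp_sin.
by apply: trigpX; apply: trigpB; [exact: trigp_cst|apply: trigpX; exact: trigp_sin].
Qed.

Lemma is_derive_chi x : is_derive x 1 chi (dchi x).
Proof.
have h1 := is_derive_sign_poly n (sin (r^-1 * x)).
have := is_derive_sin_affine r^-1 0 x; rewrite addr0.
rewrite (_ : (fun x0 : R => _) = (fun x => sin (r^-1 * x))); last by apply/funext => z; rewrite addr0.
move=> h2; have := is_derive1_comp h1 h2; rewrite /chi => h; apply: is_derive_eq.
rewrite /dchi sin2cos2 opprB addrCA subrr addr0 -exprM mul2n exprS; ring.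
Qed.

Lemma chi_norm x : `|chi x| <= 1.
Proof. by rewrite sign_poly_norm// ler_norml sin_geN1 sin_le1. Qed.

Lemma dchi_norm x : `|dchi x| <= sign_slope n / r.
Proof.
rewrite /dchi 2!normrM (ger0_norm (sign_slope_ge0 n)) (@gtr0_norm _ r^-1) ?invr_gt0//.
rewrite ler_wpM2r ?invr_ge0 ?(ltW r0)// ler_piMr ?sign_slope_ge0// normrX.
by rewrite exprn_ile1// ler_norml cos_geN1 cos_le1.
Qed.

Lemma chi0 : chi 0 = 0. Proof. by rewrite /chi mulr0 sin0 sign_poly0. Qed.

Lemma chi_lip x y : `|chi x - chi y| <= sign_slope n / r * `|x - y|.
Proof.
wlog yx : x y / y < x.
  move=> H; have [/H//|xy|->] := ltgtP y x; last by rewrite !subrr normr0 mulr0.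
  by rewrite distrC (distrC x); exact: H.
have [c _ ->] := mvt_all is_derive_chi yx.
by rewrite normrM ler_wpM2r// dchi_norm.
Qed.

Lemma chi_le x : `|chi x| <= sign_slope n / r * `|x|.
Proof. by have := chi_lip x 0; rewrite chi0 !subr0. Qed.

Lemma chiN x : chi (- x) = - chi x.
Proof. by rewrite /chi mulrN sinN sign_polyN. Qed.

Lemma sin_ge_half (y : R) : 0 <= y <= 1 -> y / 2 <= sin y.
Proof.
move=> /andP[]; rewrite le_eqVlt => /predU1P[<-|y0] y1; first by rewrite mul0r sin0.
have [c] := mvt_all (@is_derive_sin R) y0.
rewrite sin0 !subr0 => /andP[c0 cy] ->.
rewrite mulrC ler_wpM2r ?(ltW y0)//.
have cE : c = c / 2 + c / 2 by lra.
rewrite cE cosD; have := cos2Dsin2 (c / 2); rewrite -!expr2.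
have : `|sin (c / 2)| <= `|c / 2| by exact: abs_sin_le.
rewrite (@ger0_norm _ (c / 2)); last by lra.
set s := sin _; set k := cos _ => h1 h2.
have : s ^+ 2 <= (c / 2) ^+ 2.
  by rewrite -[s ^+ 2]real_normK ?num_real// lerXn2r ?nnegrE//; lra.
have : (c / 2) ^+ 2 <= (1 / 2) ^+ 2 by rewrite lerXn2r ?nnegrE//; lra.
by lra.
Qed.

(** From sin y >= y / 2 on [0, 1] and 1 - t^2 <= exp (- t^2). *)
Lemma chi_pos x : 0 <= x <= r -> 0 <= chi x /\
  1 - chi x <= sign_slope n * expR (- (n%:R * (x / r) ^+ 2 / 4)).
Proof.
move=> /andP[x0 xr].
have y01 : 0 <= r^-1 * x <= 1 by rewrite mulr_ge0 ?invr_ge0 ?(ltW r0)//= ler_pdivrMl// mulr1.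
have sy := sin_ge_half y01.
have s0 : 0 <= sin (r^-1 * x) <= 1 by rewrite sin_le1 andbT; case/andP: y01 => h _; lra.
have [/andP[-> _] h] := sign_poly_bounds n s0; split=> //; apply: (le_trans h).
rewrite ler_wpM2l ?sign_slope_ge0//.
have -> : - (n%:R * (x / r) ^+ 2 / 4) = n%:R * - ((r^-1 * x / 2) ^+ 2).
  by field; rewrite gt_eqF.
rewrite expRM_natl lerXn2r ?nnegrE ?expR_ge0//.
apply: (@le_trans _ _ (1 - (r^-1 * x / 2) ^+ 2)); last exact: expR_ge1Dx.
by rewrite lerD2l lerN2 lerXn2r ?nnegrE//; case/andP: y01 => h0 _; lra.
Qed.

End smooth_sign.

(** * Concentration *)

Section jensen.
Context {d : measure_display} {T : measurableType d} {R : realType} (P : probability T R).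

(** Cauchy-Schwarz repeated j times; hence the exponents that are powers of 2 in the concentration
    bounds. *)
Lemma Ex_jensen (X : T -> R) M j : measurable_fun setT X -> (forall w, `|X w| <= M) ->
  Ex P X ^+ (2 ^ j) <= Ex P (fun w => X w ^+ (2 ^ j)).
Proof.
elim: j X M => [|j IH] X M mX XM.
  by rewrite expn0 expr1; under [X in _ <= Ex P X]eq_fun do rewrite expr1.
have X2 w : `|X w ^+ 2| <= M ^+ 2 by rewrite normrX lerXn2r ?nnegrE// (le_trans _ (XM w)).
rewrite expnS exprM; under [X in _ <= Ex P X]eq_fun do rewrite exprM.
apply: le_trans (IH _ _ _ X2); last exact: measurable_funX.
have I1 : intg P (fun w => X w ^+ 2) by apply: intg_bnd X2; exact: measurable_funX.
have := @Ex_cauchy _ _ _ P X (cst 1) mX (measurable_cst _) I1.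
rewrite /= expr1n -[fun=> 1]/(cst 1) Ex_cst mulr1.
under [X in Ex P X ^+ 2]eq_fun do rewrite mulr1.
move=> /(_ (intg_cst P 1)) h; rewrite lerXn2r ?nnegrE ?sqr_ge0//.
by apply: Ex_ge0 => w; exact: sqr_ge0.
Qed.

End jensen.

(** * Rotation of a Gaussian family to an independent copy *)

Section gaussian_family.
Context {d : measure_display} {T : measurableType d} {R : realType} (P : probability T R).
Variable U : T -> nat -> R.
Hypothesis gU : forall s, exists v, gauss P (fun w => lincomb s (U w)) v.

Definition cov i j := Ex P (fun w => U w i * U w j).

Lemma gU1 i : exists v, gauss P (fun w => U w i) v.
Proof.
have [v gv] := gU [:: (1, i)]; exists v.
by rewrite (_ : (fun w => U w i) = (fun w => lincomb [:: (1, i)] (U w)))//; apply/funext => w; rewrite /lincomb big_seq1 mul1r.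
Qed.

Lemma mU i : measurable_fun setT (fun w => U w i).
Proof. by have [v []] := gU1 i. Qed.

Lemma intg_cov i j : intg P (fun w => U w i * U w j).
Proof.
have I k : intg P (fun w => U w k ^+ 2).
  by have [v gv] := gU1 k; have [C /(_ _ _ gv)[]] := @gauss_moment _ _ _ P 1.
by apply: intg_sqr_mul; [exact: mU|exact: mU|exact: I|exact: I].
Qed.

Definition lin_var s := \sum_(x <- s) \sum_(y <- s) x.1 * y.1 * cov x.2 y.2.

Lemma gauss_lincomb s : gauss P (fun w => lincomb s (U w)) (lin_var s).
Proof.
have [v gv] := gU s; rewrite (_ : lin_var s = v)// -(gauss_var gv).
rewrite (_ : (fun w => _) = fun w => \sum_(x <- s) \sum_(y <- s) x.1 * y.1 * (U w x.2 * U w y.2)); last first.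
  apply/funext => w; rewrite expr2 /lincomb mulr_suml; apply: eq_bigr => x _.
  by rewrite mulr_sumr; apply: eq_bigr => y _; ring.
have I x y : intg P (fun w => x.1 * y.1 * (U w x.2 * U w y.2)) by apply: intgZ; exact: intg_cov.
rewrite Ex_sum; last by move=> x _; apply: intg_sum => y _; exact: I.
apply: eq_bigr => x _; rewrite Ex_sum; last by move=> y _; exact: I.
by apply: eq_bigr => y _; rewrite ExZ//; exact: intg_cov.
Qed.

Local Notation PP := (P \x P)%E.

Lemma mU1 i : measurable_fun setT (fun z : T * T => U z.1 i).
Proof. by apply: (measurableT_comp (mU i)); exact: measurable_fst. Qed.

Lemma mU2 i : measurable_fun setT (fun z : T * T => U z.2 i).
Proof. by apply: (measurableT_comp (mU i)); exact: measurable_snd. Qed.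

Lemma measurable_lincomb1 s : measurable_fun setT (fun z : T * T => lincomb s (U z.1)).
Proof. by apply: (@measurable_lincomb _ _ _ (fun z : T * T => U z.1)); exact: mU1. Qed.

Lemma measurable_lincomb2 s : measurable_fun setT (fun z : T * T => lincomb s (U z.2)).
Proof. by apply: (@measurable_lincomb _ _ _ (fun z : T * T => U z.2)); exact: mU2. Qed.

Lemma gauss_pair_cf s t th :
  Ex PP (fun z => cos (lincomb s (U z.1) + lincomb t (U z.2) + th)) =
  expR (- ((lin_var s + lin_var t) / 2)) * cos th.
Proof.
have [m1 _ c1] := gauss_lincomb s; have [m2 _ c2] := gauss_lincomb t.
have mF : measurable_fun setT (fun z : T * T => cos (lincomb s (U z.1) + lincomb t (U z.2) + th)).
  by apply: measurable_cos_shift; apply: measurable_funD; [exact: measurable_lincomb1|exact: measurable_lincomb2].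
have bF (x : R) : `|cos x| <= 1 by rewrite ler_norml cos_geN1 cos_le1.
have IF : intg PP (fun z => cos (lincomb s (U z.1) + lincomb t (U z.2) + th)).
  by apply: (@intg_bnd _ _ _ _ _ 1) => // z.
have [|-> _] := @Ex_fubini1 _ _ _ _ _ P P _ IF.
  move=> x; apply: (@intg_bnd _ _ _ _ _ 1) => //; exact: (measurable_pair_l x mF).
rewrite (_ : (fun x => _) = fun x => expR (- (lin_var t / 2)) * cos (1 * lincomb s (U x) + th)); last first.
  apply/funext => x /=; have := c2 1 (lincomb s (U x) + th); rewrite expr1n !mul1r => <-.
  by congr Ex; apply/funext => y; congr cos; ring.
rewrite ExZ; last first.
  by apply: intg_cos_shift; apply: measurable_funM.
rewrite c1 expr1n mul1r mulrA -expRD; congr (expR _ * _); ring.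
Qed.

Lemma gauss_prod s t :
  gauss PP (fun z => lincomb s (U z.1) + lincomb t (U z.2)) (lin_var s + lin_var t).
Proof.
have [_ v1 _] := gauss_lincomb s; have [_ v2 _] := gauss_lincomb t.
split; [|exact: addr_ge0|].
  by apply: measurable_funD; [exact: measurable_lincomb1|exact: measurable_lincomb2].
move=> r th.
rewrite (_ : (fun w => _) = fun z => cos (lincomb (scale_comb r s) (U z.1) + lincomb (scale_comb r t) (U z.2) + th)).
  rewrite gauss_pair_cf.
  have V u : lin_var (scale_comb r u) = r ^+ 2 * lin_var u.
    rewrite /lin_var /scale_comb big_map mulr_sumr; apply: eq_bigr => x _.
    by rewrite big_map mulr_sumr; apply: eq_bigr => y _ /=; ring.
  by rewrite !V -mulrDr.
by apply/funext => z; rewrite !lincombZ mulrDr.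
Qed.

Lemma intgPP_sqr p i : intg PP (fun z => U z.1 i ^+ p.*2) /\ intg PP (fun z => U z.2 i ^+ p.*2).
Proof.
have [C HC] := @gauss_moment _ _ _ PP p; split.
  have [] := HC _ _ (gauss_prod [:: (1, i)] [::]).
  by rewrite (_ : (fun w => _) = (fun z => U z.1 i ^+ p.*2))//; apply/funext => z; rewrite /lincomb big_seq1 big_nil addr0 mul1r.
have [] := HC _ _ (gauss_prod [::] [:: (1, i)]).
by rewrite (_ : (fun w => _) = (fun z => U z.2 i ^+ p.*2))//; apply/funext => z; rewrite /lincomb big_seq1 big_nil add0r mul1r.
Qed.

Definition rot (t : R) (z : T * T) i := cos t * U z.1 i + sin t * U z.2 i.

(** Two rotated copies are coded on the odd and even indices of one family, so that trigonometric
    polynomials of a single sequence see their joint law. *)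
Definition rot_pair a t (z : T * T) i := if odd i then rot t z i./2 else rot (t + a) z i./2.

Lemma measurable_rot t i : measurable_fun setT (fun z => rot t z i).
Proof.
apply: measurable_funD; apply: measurable_funM => //; [exact: mU1|exact: mU2].
Qed.

Lemma measurable_rot_pair a t i : measurable_fun setT (fun z => rot_pair a t z i).
Proof. by rewrite /rot_pair; case: (odd i); exact: measurable_rot. Qed.

Lemma rot0 z : rot 0 z = U z.1.
Proof. by apply/funext => i; rewrite /rot cos0 sin0 mul1r mul0r addr0. Qed.

Lemma rot_pihalf z : rot (pi / 2) z = U z.2.
Proof. by apply/funext => i; rewrite /rot cos_pihalf sin_pihalf mul1r mul0r add0r. Qed.

(** The covariance between two rotated copies depends only on the difference of the angles, through
    cos (x - y) = cos x cos y + sin x sin y, so the pair is stationary in t. *)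
Lemma rot_pair_cf a t s th :
  Ex PP (fun z => cos (lincomb s (rot_pair a t z) + th)) =
  Ex PP (fun z => cos (lincomb s (rot_pair a 0 z) + th)).
Proof.
suff H r : Ex PP (fun z => cos (lincomb s (rot_pair a r z) + th)) =
    expR (- ((\sum_(x <- s) \sum_(y <- s) x.1 * y.1 * cov x.2./2 y.2./2 *
      cos ((if odd x.2 then 0 else a) - (if odd y.2 then 0 else a))) / 2)) * cos th by rewrite !H.
pose ang i := if odd i then r else r + a.
rewrite (_ : (fun z => _) = fun z =>
   cos (lincomb [seq (y.1 * cos (ang y.2), y.2./2) | y <- s] (U z.1) +
        lincomb [seq (y.1 * sin (ang y.2), y.2./2) | y <- s] (U z.2) + th)).
  rewrite gauss_pair_cf; congr (expR (- (_ / 2)) * _).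
  rewrite /lin_var !big_map -big_split /=; apply: eq_bigr => x _.
  rewrite !big_map -big_split /=; apply: eq_bigr => y _.
  have -> : (if odd x.2 then 0 else a) - (if odd y.2 then 0 else a) = ang x.2 - ang y.2.
    by rewrite /ang; case: ifP; case: ifP => _ _; ring.
  by rewrite cosB; ring.
apply/funext => z; congr (cos (_ + _)); rewrite /lincomb !big_map -big_split /=.
by apply: eq_bigr => y _; rewrite /rot_pair /rot /ang; case: ifP => _; ring.
Qed.

Lemma trigp_reindex (k : nat -> nat) F : trigp F -> trigp (fun u : nat -> R => F (fun i => u (k i))).
Proof.
move=> [l lE]; exists [seq (x.1.1, [seq (y.1, k y.2) | y <- x.1.2], x.2) | x <- l] => u.
rewrite lE /trig_sum big_map; apply: eq_bigr => x _ /=.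
by rewrite /lincomb big_map.
Qed.

Section rotation.
Variables (F : (nat -> R) -> R) (N : nat) (c : nat -> (nat -> R) -> R) (k : nat -> nat) (L : R).
Hypotheses (tF : trigp F)
  (dF : forall u h, is_derive (0 : R) 1 (fun t : R => F (fun i => cos t * u i + sin t * h i))
     (\sum_(m < N) c m u * h (k m)))
  (lF : forall u v, `|F u - F v| <= L * \sum_(m < N) `|u (k m) - v (k m)|)
  (L0 : 0 <= L) (cL : forall m u, `|c m u| <= L)
  (mc : forall m, measurable_fun setT (fun w => c m (U w))).

Lemma Ex_rot_pair a t p : Ex PP (fun z => (F (rot t z) - F (rot (t + a) z)) ^+ p) =
  Ex PP (fun z => (F (rot 0 z) - F (rot a z)) ^+ p).
Proof.
pose G (u : nat -> R) := (F (fun i => u i.*2.+1) - F (fun i => u i.*2)) ^+ p.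
have tG : trigp G.
  apply: trigpX; apply: trigpB; first exact: (@trigp_reindex (fun i => i.*2.+1)).
  exact: (@trigp_reindex (fun i => i.*2)).
have E r : (fun z => (F (rot r z) - F (rot (r + a) z)) ^+ p) = fun z => G (rot_pair a r z).
  apply/funext => z; rewrite /G; congr ((F _ - F _) ^+ p); apply/funext => i; rewrite /rot_pair /=.
    by rewrite odd_double /= uphalf_double.
  by rewrite odd_double /= doubleK.
have := E 0; rewrite add0r => ->; rewrite E.
apply: Ex_trigp_eq tG => [i|i|s th]; last exact: rot_pair_cf.
  exact: measurable_rot_pair.
exact: measurable_rot_pair.
Qed.

Lemma measurable_F t : measurable_fun setT (fun z => F (rot t z)).
Proof.
apply: intg_meas; apply: (@intg_trigp _ _ _ PP (fun z => rot t z)) tF => i; exact: measurable_rot.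
Qed.

Lemma intg_rot_pair a r p : intg PP (fun z => (F (rot r z) - F (rot (r + a) z)) ^+ p).
Proof.
pose G (u : nat -> R) := (F (fun i => u i.*2.+1) - F (fun i => u i.*2)) ^+ p.
have tG : trigp G.
  apply: trigpX; apply: trigpB; first exact: (@trigp_reindex (fun i => i.*2.+1)).
  exact: (@trigp_reindex (fun i => i.*2)).
rewrite (_ : (fun z => _) = fun z => G (rot_pair a r z)).
  by apply: (@intg_trigp _ _ _ PP (fun z => rot_pair a r z)) tG => i; exact: measurable_rot_pair.
apply/funext => z; rewrite /G; congr ((F _ - F _) ^+ p); apply/funext => i; rewrite /rot_pair /=.
  by rewrite odd_double /= uphalf_double.
by rewrite odd_double /= doubleK.
Qed.

(** The quarter turn from the first copy to the second is cut into n + 1 equal rotations. By the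
    power mean inequality and stationarity, the moment of the sum is at most the moment of n + 1
    times the first step. *)
Lemma rot_steps n p : Ex PP (fun z => (F (U z.1) - F (U z.2)) ^+ p.*2.+2) <=
  Ex PP (fun z => (n.+1%:R * (F (rot 0 z) - F (rot (pi / 2 / n.+1%:R) z))) ^+ p.*2.+2).
Proof.
set a := pi / 2 / n.+1%:R.
have aE : n.+1%:R * a = pi / 2 by rewrite /a mulrC divfK ?pnatr_eq0.
have E z : F (rot 0 z) - F (rot (pi / 2) z) = \sum_(i < n.+1) (F (rot (i%:R * a) z) - F (rot (i%:R * a + a) z)).
  have := telescope_sumr (fun i => F (rot (i%:R * a) z)) (leq0n n.+1).
  rewrite mul0r aE -(opprB (F (rot (pi / 2) z))) => <-.
  rewrite big_mkord -sumrN; apply: eq_bigr => i _; rewrite opprB.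
  by rewrite -natr1 mulrDl mul1r.
under eq_fun do rewrite -rot0 -rot_pihalf E.
have I := intg_rot_pair a.
apply: (@le_trans _ _ (Ex PP (fun z => n.+1%:R ^+ p.*2.+1 *
    \sum_(i < n.+1) (F (rot (i%:R * a) z) - F (rot (i%:R * a + a) z)) ^+ p.*2.+2))).
  apply: Ex_le => [| |z]; last exact: power_mean.
    by under eq_fun do rewrite -E; have := intg_rot_pair (pi / 2) 0 p.*2.+2; rewrite add0r.
  by apply: intgZ; apply: intg_sum => i _; exact: I.
rewrite ExZ; last by apply: intg_sum => i _; exact: I.
rewrite Ex_sum; last by move=> i _; exact: I.
under eq_bigr do rewrite Ex_rot_pair.
rewrite sumr_const card_ord mulrnAr -mulrnAl -[X in X * _]mulr_natr -exprSr.
under [X in _ <= Ex _ X]eq_fun do rewrite exprMn.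
by rewrite ExZ//; have := I 0 p.*2.+2; rewrite add0r.
Qed.

Definition grad (z : T * T) := \sum_(m < N) c m (U z.1) * U z.2 (k m).

Lemma measurable_grad : measurable_fun setT grad.
Proof.
apply: measurable_sum => m; apply: measurable_funM; last exact: mU2.
by apply: (measurableT_comp (mc m)); exact: measurable_fst.
Qed.

Lemma intg_sum_pow d' (T' : measurableType d') (P' : probability T' R) n (V : 'I_n -> T' -> R) p :
  (forall m, measurable_fun setT (V m)) -> (forall m, intg P' (fun z => V m z ^+ p.*2.+2)) ->
  intg P' (fun z => (\sum_m V m z) ^+ p.*2.+2).
Proof.
move=> mV IV; apply: (@intg_le _ _ _ _ _ (fun z => n%:R ^+ p.*2.+1 * \sum_m V m z ^+ p.*2.+2)).
- by apply: measurable_funX; exact: measurable_sum.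
- move=> z; rewrite ger0_norm; first exact: power_mean.
  by rewrite -doubleS -mul2n exprM exprn_ge0// sqr_ge0.
- by apply: intgZ; apply: intg_sum => m _; exact: IV.
Qed.

Lemma even_pow_norm (x : R) p : `|x| ^+ p.*2.+2 = x ^+ p.*2.+2.
Proof. by rewrite -doubleS -mul2n !exprM real_normK ?num_real. Qed.

Definition rot_bound (z : T * T) := \sum_(m < N) (`|U z.1 (k m)| + `|U z.2 (k m)|).

Lemma rot_bound_ge0 z : 0 <= rot_bound z.
Proof. by apply: sumr_ge0 => m _; exact: addr_ge0. Qed.

Lemma intg_rot_bound p : intg PP (fun z => rot_bound z ^+ p.*2.+2).
Proof.
apply: intg_sum_pow => m.
  by apply: measurable_funD; apply: (measurableT_comp (@normr_measurable R setT)); [exact: mU1|exact: mU2].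
have [I1 I2] := intgPP_sqr p.+1 (k m).
rewrite (_ : (fun z => _) = fun z => (\sum_(i < 2) (if i == ord0 then `|U z.1 (k m)| else `|U z.2 (k m)|)) ^+ p.*2.+2); last first.
  by apply/funext => z; rewrite !big_ord_recl big_ord0 /= addr0.
apply: intg_sum_pow => i; case: (i == ord0).
- by apply: (measurableT_comp (@normr_measurable R setT)); exact: mU1.
- by apply: (measurableT_comp (@normr_measurable R setT)); exact: mU2.
- by under eq_fun do rewrite even_pow_norm.
- by under eq_fun do rewrite even_pow_norm.
Qed.

Lemma abs_1_cos_le (u : R) : 0 < u -> `|1 - cos u| <= u.
Proof.
move=> u0; have [c0 _] := mvt_all (@is_derive_cos R) u0; rewrite cos0 subr0 => E.
by rewrite distrC E normrM normrN (gtr0_norm u0) ler_piMl ?(ltW u0)// ler_norml sin_geN1 sin_le1.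
Qed.

Lemma rot_dominated n z :
  `|n.+1%:R * (F (rot 0 z) - F (rot (pi / 2 / n.+1%:R) z))| <= L * (pi / 2) * rot_bound z.
Proof.
set a := pi / 2 / n.+1%:R; have a0 : 0 < a by rewrite divr_gt0 ?divr_gt0 ?pi_gt0.
have aE : n.+1%:R * a = pi / 2 by rewrite /a mulrC divfK ?pnatr_eq0.
rewrite normrM ger0_norm// (le_trans (ler_wpM2l _ (lF _ _)))//.
rewrite mulrCA -mulrA ler_wpM2l// -aE -mulrA ler_wpM2l// /rot_bound mulr_sumr.
apply: ler_sum => m _; rewrite rot0 /rot.
have -> : U z.1 (k m) - (cos a * U z.1 (k m) + sin a * U z.2 (k m)) =
  (1 - cos a) * U z.1 (k m) - sin a * U z.2 (k m) by ring.
rewrite (le_trans (ler_normB _ _))// mulrDr lerD// normrM ler_wpM2r// ?abs_1_cos_le//.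
by rewrite (le_trans (abs_sin_le _))// gtr0_norm.
Qed.

Lemma even_powN (x : R) p : (- x) ^+ p.*2.+2 = x ^+ p.*2.+2.
Proof. by rewrite -[LHS]even_pow_norm normrN even_pow_norm. Qed.

Lemma intg_grad p : intg PP (fun z => grad z ^+ p.*2.+2).
Proof.
apply: (@intg_le _ _ _ _ _ (fun z => L ^+ p.*2.+2 * rot_bound z ^+ p.*2.+2)).
- by apply: measurable_funX; exact: measurable_grad.
- move=> z; rewrite normrX -exprMn lerXn2r ?nnegrE ?mulr_ge0 ?rot_bound_ge0//.
  rewrite (le_trans (ler_norm_sum _ _ _))// /rot_bound mulr_sumr; apply: ler_sum => m _.
  by rewrite normrM ler_pM// lerDr.
- by apply: intgZ; exact: intg_rot_bound.
Qed.

(** As n grows, n + 1 times the first step tends to - (pi / 2) [grad], dominated thanks to the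
    Lipschitz bound. This is the Maurey-Pisier argument with sums in place of the integral over the
    angle. *)
Lemma rot_limit p : Ex PP (fun z => (F (U z.1) - F (U z.2)) ^+ p.*2.+2) <=
  (pi / 2) ^+ p.*2.+2 * Ex PP (fun z => grad z ^+ p.*2.+2).
Proof.
rewrite -ExZ; last exact: intg_grad.
apply: cvgn_ge (rot_steps ^~ p).
apply: (@Ex_dom_cvg _ _ _ PP _ _ (fun z => (L * (pi / 2)) ^+ p.*2.+2 * rot_bound z ^+ p.*2.+2)).
- move=> n; apply: measurable_funX; apply: measurable_funM => //.
  by apply: measurable_funB; exact: measurable_F.
- by apply: measurable_funM => //; apply: measurable_funX; exact: measurable_grad.
- by apply: intgZ; exact: intg_rot_bound.
- move=> n z; rewrite normrX -exprMn lerXn2r ?nnegrE ?rot_dominated//.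
  by rewrite mulr_ge0 ?rot_bound_ge0// mulr_ge0// divr_ge0// pi_ge0.
apply: aeW => z; rewrite -exprMn -even_powN; apply: cvgn_exp.
have pi2 : 0 < pi / 2 :> R by rewrite divr_gt0 ?pi_gt0.
have u0 n : pi / 2 / n.+1%:R != 0 :> R by rewrite mulf_neq0 ?gt_eqF ?invr_gt0.
have := @cvgnZ _ (- (pi / 2)) _ _ (cvg_quotient (dF (U z.1) (U z.2)) u0 (@cvg_invS_scale R _)).
move=> h; rewrite -mulNr [X in X @ _ --> _](_ : _ = fun n : nat => - (pi / 2) *
   ((pi / 2 / n.+1%:R)^-1 * (F (rot (0 + pi / 2 / n.+1%:R) z) - F (rot 0 z)))); first exact: h.
apply/funext => n; rewrite add0r; set x := F _; set y := F _.
have e : pi / 2 * (pi / 2 / n.+1%:R)^-1 = n.+1%:R :> R.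
  by rewrite invf_div mulrC divfK ?gt_eqF.
by rewrite mulNr mulrA e -mulrN opprB.
Qed.

(** For a fixed first copy, [grad] is a Gaussian combination of the second copy with coefficients at
    most [L], whence the bound on its variance. *)
Lemma Ex_grad C p : (forall V v, gauss P V v ->
    intg P (fun w => V w ^+ p.+1.*2) /\ Ex P (fun w => V w ^+ p.+1.*2) <= C * v ^+ p.+1) -> 0 <= C ->
  Ex PP (fun z => grad z ^+ p.*2.+2) <=
  C * (L ^+ 2 * \sum_(i < N) \sum_(j < N) `|cov (k i) (k j)|) ^+ p.+1.
Proof.
move=> HC C0; set W := L ^+ 2 * _.
have W0 : 0 <= W by rewrite mulr_ge0 ?sqr_ge0// sumr_ge0// => i _; rewrite sumr_ge0.
have G x : intg P (fun y => grad (x, y) ^+ p.+1.*2) /\ Ex P (fun y => grad (x, y) ^+ p.+1.*2) <= C * W ^+ p.+1.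
  pose s := [seq (c m (U x), k m) | m <- iota 0 N].
  have [I H] := HC _ _ (gauss_lincomb s).
  have E : (fun y => grad (x, y) ^+ p.+1.*2) = fun y => lincomb s (U y) ^+ p.+1.*2.
    apply/funext => y; rewrite /grad /lincomb /s big_map -(big_mkord xpredT (fun m => c m (U x) * U y (k m))).
    by rewrite /index_iota subn0.
  rewrite E; split=> //; apply: (le_trans H); rewrite ler_wpM2l//.
  have [_ v0 _] := gauss_lincomb s.
  rewrite lerXn2r ?nnegrE// /lin_var /W /s big_map mulr_sumr.
  rewrite -{1}[N]subn0 -/(index_iota 0 N) big_mkord; apply: ler_sum => i _.
  rewrite big_map mulr_sumr -{1}[N]subn0 -/(index_iota 0 N) big_mkord; apply: ler_sum => j _ /=.
  rewrite (le_trans (ler_norm _))// !normrM ler_wpM2r// expr2 ler_pM//.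
have [|-> I] := @Ex_fubini1 _ _ _ _ _ P P _ (intg_grad p).
  by move=> x; case: (G x).
rewrite -[leRHS](Ex_cst P); apply: Ex_le => // [|x]; first exact: intg_cst.
by case: (G x).
Qed.

(** Centering is an average over the independent copy, so Jensen's inequality reduces the centered
    moment to that of the difference of the copies, and [rot_limit] applies. *)
Lemma concentration_moment j C : (forall V v, gauss P V v ->
    intg P (fun w => V w ^+ (2 ^ j).*2) /\ Ex P (fun w => V w ^+ (2 ^ j).*2) <= C * v ^+ (2 ^ j)) -> 0 <= C ->
  Ex P (fun w => (F (U w) - Ex P (fun w => F (U w))) ^+ (2 ^ j).*2) <=
  (pi / 2) ^+ (2 ^ j).*2 * (C * (L ^+ 2 * \sum_(i < N) \sum_(j < N) `|cov (k i) (k j)|) ^+ (2 ^ j)).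
Proof.
have [p pE] : exists p, (2 ^ j)%N = p.+1 by exists (2 ^ j).-1; rewrite prednK// expn_gt0.
move=> HC C0.
have mF1 : measurable_fun setT (fun w => F (U w)).
  by apply: intg_meas; apply: (@intg_trigp _ _ _ P U) tF; exact: mU.
have [M HM] : exists M, forall u, `|F u| <= M.
  have [l lE] := tF; exists (\sum_(x <- l) `|x.1.1|) => u; rewrite lE.
  rewrite (le_trans (ler_norm_sum _ _ _))//; apply: ler_sum => x _.
  by rewrite normrM ler_piMr// ler_norml cos_geN1 cos_le1.
have IF : intg P (fun w => F (U w)) by apply: (@intg_bnd _ _ _ _ _ M).
pose D (z : T * T) := F (U z.1) - F (U z.2).
have mD : measurable_fun setT D.
  have -> : D = fun z => F (rot 0 z) - F (rot (pi / 2) z).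
    by apply/funext => z; rewrite rot0 rot_pihalf.
  by apply: measurable_funB; exact: measurable_F.
have bD z : `|D z| <= M + M by rewrite (le_trans (ler_normB _ _))// lerD.
have M0 : 0 <= M by apply: le_trans (HM (fun=> 0)).
have J x : (F (U x) - Ex P (fun w => F (U w))) ^+ (2 ^ j).*2 <= Ex P (fun y => D (x, y) ^+ (2 ^ j).*2).
  have -> : F (U x) - Ex P (fun w => F (U w)) = Ex P (fun y => D (x, y)).
    rewrite -[X in X - _](Ex_cst P) -ExB//; exact: intg_cst.
  rewrite -mul2n -expnS; apply: (@Ex_jensen _ _ _ P _ (M + M)) => //.
  exact: (measurable_pair_l x mD).
have mp (e : nat) : measurable_fun setT (fun z => D z ^+ e) by exact: measurable_funX.
have bp (e : nat) z : `|D z ^+ e| <= (M + M) ^+ e by rewrite normrX lerXn2r ?nnegrE ?addr_ge0.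
have [||E I] := @Ex_fubini1 _ _ _ _ _ P P (fun z => D z ^+ (2 ^ j).*2).
- by apply: (@intg_bnd _ _ _ _ _ ((M + M) ^+ (2 ^ j).*2)).
- move=> x; apply: (@intg_bnd _ _ _ _ _ ((M + M) ^+ (2 ^ j).*2)) => //.
  exact: (measurable_pair_l x (mp _)).
apply: (@le_trans _ _ (Ex PP (fun z => D z ^+ (2 ^ j).*2))).
  rewrite E; apply: Ex_le => //.
  apply: (@intg_le _ _ _ _ _ _ _ _ I); last first.
    move=> x; rewrite ger0_norm; first exact: J.
    by rewrite -mul2n exprM exprn_ge0// sqr_ge0.
  by apply: measurable_funX; apply: measurable_funB.
move: HC; rewrite pE doubleS => HC.
apply: (le_trans (rot_limit p)); rewrite ler_wpM2l ?exprn_ge0 ?divr_ge0 ?pi_ge0//.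
exact: Ex_grad.
Qed.

End rotation.
End gaussian_family.

(** * Cells with many zeros *)

Import HBNNSimple.

Section domination.
Context {d : measure_display} {T : measurableType d} {R : realType} (P : probability T R).

(** [g] is the lower limit made real-valued. Fatou's lemma bounds its expectation, and any lower
    bound that holds for all large n passes to it. *)
Lemma liminf_dom (F : nat -> T -> R) C :
  (forall n, intg P (F n)) -> (forall n w, 0 <= F n w) -> (forall n, Ex P (F n) <= C) ->
  exists g, [/\ intg P g, forall w, 0 <= g w, Ex P g <= C &
    {ae P, forall w, forall x, (\forall n \near \oo, x <= F n w) -> x <= g w}].
Proof.
move=> IF F0 FC.
pose f n w : \bar R := (F n w)%:E.
have mf n : measurable_fun setT (f n) by apply/measurable_EFinP; exact: intg_meas.
pose l w := limn_einf (f ^~ w).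
have lE w : l w = limn (einfs (f ^~ w)) by rewrite /l limn_einf_lim.
have ml : measurable_fun setT l.
  rewrite /l /limn_einf; apply: measurableT_comp => //.
  by apply: measurable_fun_limn_esup => n; apply: measurableT_comp => //; exact: mf.
have l0 w : (0 <= l w)%E.
  rewrite lE; apply: lime_ge; first exact: is_cvg_einfs.
  by apply: nearW => n; apply: le_ereal_inf_tmp => _ [k _ <-]; rewrite lee_fin.
have Il : (\int[P]_w l w <= C%:E)%E.
  apply: (le_trans (@fatou _ _ _ P setT measurableT f mf _)).
    by move=> n w _; rewrite lee_fin.
  rewrite limn_einf_lim; apply: lime_le; first exact: is_cvg_einfs.
  apply: nearW => n; apply: le_trans (ereal_inf_lbound _) _.
    by exists n => //=; exact: leqnn.
  by rewrite ExE// lee_fin.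
have il : P.-integrable setT l.
  apply/integrableP; split=> //; apply: le_lt_trans (ltry C); apply: le_trans Il.
  by under eq_integral do rewrite gee0_abs//.
have mg : measurable_fun setT (fun w => fine (l w)).
  by apply: measurableT_comp ml; exact: fine_measurable.
have g0 w : 0 <= fine (l w) by exact: fine_ge0.
have gl : (\int[P]_w (fine (l w))%:E <= C%:E)%E.
  apply: le_trans Il; apply: ge0_le_integral => //.
  - by move=> w _; rewrite lee_fin.
  - exact/measurable_EFinP.
  - by move=> w _; move: (l0 w); case: (l w) => //= _; rewrite leey.
have ig : intg P (fun w => fine (l w)) by apply: intg_lt => //; exact: le_lt_trans gl (ltry C).
exists (fun w => fine (l w)); split=> //; first by rewrite -lee_fin -ExE.
have := integrable_ae measurableT il; apply: filterS => w /(_ I) lw x xF.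
rewrite -lee_fin fineK// lE; apply: lime_ge; first exact: is_cvg_einfs.
case: xF => N _ HN; exists N => // n /= Nn; apply: le_ereal_inf_tmp => _ [k /= nk <-].
by rewrite lee_fin; apply: HN; rewrite /= (leq_trans Nn).
Qed.

(* [N] is a zero count, not known to be measurable: its integral is the supremum
   over simple functions below it. *)
Lemma integral_ge (N : T -> \bar R) g : (forall w, 0 <= N w)%E -> intg P g ->
  (forall w, (g w)%:E <= N w)%E -> ((Ex P g)%:E <= \int[P]_w N w)%E.
Proof.
move=> N0 Ig gN; pose h w := Num.max (g w) 0.
have mh : measurable_fun setT h := measurable_maxr (intg_meas Ig) (measurable_cst _).
have Ih : intg P h.
  apply: (intg_le mh) (intg_norm Ig) => w; rewrite /h ger0_norm ?le_max ?lexx ?orbT//.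
  by rewrite ge_max ler_norm normr_ge0.
apply: (@le_trans _ _ (Ex P h)%:E).
  by rewrite lee_fin; apply: Ex_le => // w; rewrite /h le_max lexx.
rewrite -ExE// !ge0_integralTE//; last by move=> w; rewrite lee_fin /h le_max lexx orbT.
apply: ereal_sup_le => _ /= [s sh <-]; exists s => // w; apply: (le_trans (sh w)).
by rewrite /h; have [g0|g0] := leP (g w) 0; [exact: N0|exact: gN].
Qed.

(** The integral of a possibly non-measurable [N] is tested on the simple functions below it, each
    of which is almost surely below the positive part of [g]. *)
Lemma integral_le (N : T -> \bar R) g : (forall w, 0 <= N w)%E -> intg P g ->
  {ae P, forall w, (N w <= (g w)%:E)%E} -> (\int[P]_w N w <= (Ex P g)%:E)%E.
Proof.
move=> N0 Ig Ng; pose h w := Num.max (g w) 0.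
have mh : measurable_fun setT h := measurable_maxr (intg_meas Ig) (measurable_cst _).
have -> : (Ex P g)%:E = (\int[P]_w (h w)%:E)%E.
  rewrite -ExE//; apply: ae_eq_integral => //.
  - by apply/measurable_EFinP; exact: intg_meas Ig.
  - exact/measurable_EFinP.
  - apply: filterS Ng => w Ng _; rewrite /h max_l// -lee_fin; exact: le_trans Ng.
rewrite ge0_integralTE//; apply: ge_ereal_sup => _ /= [s sh <-].
rewrite -integralT_nnsfun; apply: ae_ge0_le_integral => //.
- by move=> w _; rewrite lee_fin; exact: fun_ge0.
- by apply/measurable_EFinP.
- by move=> w _; rewrite lee_fin /h le_max lexx orbT.
- exact/measurable_EFinP.
- apply: filterS Ng => w Ng _; apply: (le_trans (sh w)); apply: (le_trans Ng).
  by rewrite lee_fin /h le_max lexx.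
Qed.

Lemma Ex_indicator (A : set T) c : measurable A -> (P A <= c%:E)%E ->
  intg P (\1_A : T -> R) /\ Ex P (\1_A : T -> R) <= c.
Proof.
move=> mA PA; have I : intg P (\1_A : T -> R).
  apply: (@intg_bnd _ _ _ _ _ 1); first exact: measurable_indic.
  by move=> w; rewrite indicE ger0_norm// lern1 leq_b1.
by split=> //; rewrite -lee_fin -ExE// integral_indic// setIT.
Qed.

End domination.

(** * Probability of a large oscillation *)

Section oscillation.
Context {d : measure_display} {T : measurableType d} {R : realType} (P : probability T R).
Variables (O : set R) (Y : R -> T -> R) (C Cp : R) (i p : nat).
Hypotheses (gsY : gaussian_smooth P O Y) (C0 : 0 <= C) (Cp0 : 0 <= Cp)
  (HC : forall t, O t -> Ex P (fun w => pderive i.+1 Y t w ^+ 2) <= C)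
  (HCp : forall V v, gauss P V v ->
    intg P (fun w => V w ^+ p.+1.*2) /\ Ex P (fun w => V w ^+ p.+1.*2) <= Cp * v ^+ p.+1).

(** Each increment has variance at most C h^2 with h = (v - u) / (n + 2); the power mean inequality
    over n terms turns h back into v - u, so the bound is uniform in n. *)
Lemma total_var_moment u v n : u < v -> (forall t, u < t < v -> O t) ->
  intg P (fun w => total_var (fun t => pderive i Y t w) u v n ^+ p.*2.+2) /\
  Ex P (fun w => total_var (fun t => pderive i Y t w) u v n ^+ p.*2.+2) <=
    Cp * (C * (v - u) ^+ 2) ^+ p.+1.
Proof.
move=> uv uvO; set h := (v - u) / n.+2%:R.
have h0 : 0 <= h by rewrite divr_ge0// subr_ge0 ltW.
have gO j : (j <= n)%N -> O (grid u v n j) by move=> jn; apply: uvO; exact: grid_in.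
pose D (j : 'I_n) w := pderive i Y (grid u v n j.+1) w - pderive i Y (grid u v n j) w.
have gD j : exists2 s, gauss P (D j) s & s <= C * h ^+ 2.
  have [|s gs] := gauss_comb gsY (l := [:: (1, i, grid u v n j.+1); (-1, i, grid u v n j)]).
    by apply: points_in_cons; [exact: gO|apply: points_in_cons => //; apply: gO; exact: ltnW].
  have E : comb Y [:: (1, i, grid u v n j.+1); (-1, i, grid u v n j)] = D j.
    by apply/funext => w; rewrite /comb big_cons big_seq1 /D /=; ring.
  rewrite E in gs; exists s => //; rewrite -(gauss_var gs).
  have -> : C * h ^+ 2 = (Num.sqrt C * (grid u v n j.+1 - grid u v n j)) ^+ 2.
    by rewrite grid_step [RHS]exprMn sqr_sqrtr.
  have IN t : grid u v n j <= t <= grid u v n j.+1 -> O t.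
    move=> /andP[t1 t2]; apply: uvO.
    have /andP[q1 _] := grid_in uv (ltnW (ltn_ord j)).
    have /andP[_ q2] := grid_in uv (ltn_ord j).
    by rewrite (lt_le_trans q1)//= (le_lt_trans t2).
  apply: (pderive_lipschitz gsY) => //.
  - by move=> t /IN/HC; rewrite sqr_sqrtr.
  - by rewrite -subr_ge0 grid_step.
have mD j : measurable_fun setT (D j) by have [s []] := gD j.
have ID j : intg P (fun w => `|D j w| ^+ p.*2.+2).
  by have [s /HCp[I _] _] := gD j; under eq_fun do rewrite even_pow_norm.
have mN j : measurable_fun setT (fun w => `|D j w|).
  exact: (measurableT_comp (@normr_measurable R setT)).
have tvE : (fun w => total_var (fun t => pderive i Y t w) u v n ^+ p.*2.+2) =
    fun w => (\sum_j `|D j w|) ^+ p.*2.+2 by [].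
have I := @intg_sum_pow _ _ _ P n (fun j w => `|D j w|) p mN ID.
rewrite tvE; split=> //.
apply: (@le_trans _ _ (Ex P (fun w => n%:R ^+ p.*2.+1 * \sum_j `|D j w| ^+ p.*2.+2))).
  apply: Ex_le => // [|w]; last exact: power_mean.
  by apply: intgZ; apply: intg_sum => j _; exact: ID.
rewrite ExZ; last by apply: intg_sum => j _; exact: ID.
rewrite Ex_sum; last by move=> j _; exact: ID.
apply: (@le_trans _ _ (n%:R ^+ p.*2.+1 * \sum_(j < n) (Cp * (C * h ^+ 2) ^+ p.+1))).
  rewrite ler_wpM2l ?exprn_ge0//; apply: ler_sum => j _.
  have [s gs sC] := gD j; have [_] := HCp gs; have [_ s0 _] := gs.
  under eq_fun do rewrite -even_pow_norm; move=> H; apply: (le_trans H).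
  by rewrite ler_wpM2l// lerXn2r ?nnegrE// (le_trans s0).
rewrite sumr_const card_ord mulrnAr -mulrnAl -[X in X * _]mulr_natr -exprSr.
rewrite mulrCA ler_wpM2l//.
have -> : n%:R ^+ p.*2.+2 = (n%:R ^+ 2) ^+ p.+1 :> R by rewrite -exprM mul2n doubleS.
have nh : n%:R * h <= v - u.
  by rewrite /h mulrCA ler_piMr ?subr_ge0 ?(ltW uv)// ler_pdivrMr// mul1r ler_nat ltnW.
have uv0 : 0 <= v - u by rewrite subr_ge0 ltW.
rewrite -exprMn mulrCA -exprMn; apply: lerXn2r; rewrite ?nnegrE ?mulr_ge0 ?exprn_ge0 ?mulr_ge0//.
by rewrite ler_wpM2l// lerXn2r// nnegrE mulr_ge0.
Qed.

(** The event [osc_gt] is represented by an integrable majorant of its indicator, obtained as the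
    lower limit of the Markov bounds on grids. *)
Lemma osc_dom u v B : u < v -> (forall t, u < t < v -> O t) -> 0 < B ->
  exists g, [/\ intg P g, forall w, 0 <= g w, Ex P g <= Cp * (C * ((v - u) / B) ^+ 2) ^+ p.+1 &
    {ae P, forall w, osc_gt (fun t => pderive i Y t w) u v B -> 1 <= g w}].
Proof.
move=> uv uvO B0.
pose F n w := (total_var (fun t => pderive i Y t w) u v n / B) ^+ p.*2.+2.
have tv0 n w : 0 <= total_var (fun t => pderive i Y t w) u v n by exact: sumr_ge0.
have FE n : F n = fun w => (B^-1) ^+ p.*2.+2 * total_var (fun t => pderive i Y t w) u v n ^+ p.*2.+2.
  by apply/funext => w; rewrite /F exprMn mulrC.
have [|||g [Ig g0 Eg ae]] := @liminf_dom _ _ _ P F (Cp * (C * ((v - u) / B) ^+ 2) ^+ p.+1).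
- by move=> n; rewrite FE; apply: intgZ; have [] := total_var_moment n uv uvO.
- by move=> n w; rewrite exprn_ge0// divr_ge0// ltW.
- move=> n; have [I H] := total_var_moment n uv uvO; rewrite FE ExZ//.
  apply: (le_trans (ler_wpM2l _ H)); first by rewrite exprn_ge0// invr_ge0 ltW.
  rewrite mulrCA ler_wpM2l//.
  have -> : B^-1 ^+ p.*2.+2 = (B^-1 ^+ 2) ^+ p.+1 by rewrite -exprM mul2n doubleS.
  by rewrite -exprMn (_ : B^-1 ^+ 2 * _ = C * ((v - u) / B) ^+ 2)//; ring.
exists g; split=> //; apply: filterS ae => w gw osc; apply: gw; apply: filterS osc => n Bn.
by rewrite /F exprn_ege1// ler_pdivlMr// mul1r ltW.
Qed.

End oscillation.

(** * Expected number of bad dyadic intervals *)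

Section dyadic.
Context {d : measure_display} {T : measurableType d} {R : realType} (P : probability T R).
Variables (a b : R) (Y : R -> T -> R) (C Cp lam K : R) (m p : nat).
Local Notation O := (`]a, b[%classic : set R).
Hypotheses (gsY : gaussian_smooth P O Y) (C0 : 0 <= C) (Cp0 : 0 <= Cp) (lam0 : 0 < lam) (K0 : 0 < K)
  (m2 : (2 <= m)%N) (p0 : (0 < p)%N)
  (HC : forall t, O t -> Ex P (fun w => pderive m.+1 Y t w ^+ 2) <= C)
  (HCp : forall V v, gauss P V v ->
    intg P (fun w => V w ^+ p.+1.*2) /\ Ex P (fun w => V w ^+ p.+1.*2) <= Cp * v ^+ p.+1)
  (Hlam : forall t, O t -> forall a0 a1 a2 : R, lam * (a0 ^+ 2 + a1 ^+ 2 + a2 ^+ 2) <=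
    Ex P (fun w => (a0 * pderive 0 Y t w + (a1 * pderive 1 Y t w + a2 * pderive 2 Y t w)) ^+ 2)).

Lemma small_ball_jet (t r0 r1 r2 : R) : O t -> 0 < r0 -> 0 < r1 -> 0 < r2 ->
  let A := [set w | `|pderive 0 Y t w| <= r0 /\ `|pderive 1 Y t w| <= r1 /\ `|pderive 2 Y t w| <= r2] in
  measurable A /\ (P A <= (expR (3 / 2) * (r0 * r1 * r2) / Num.sqrt lam ^+ 3)%:E)%E.
Proof.
move=> Ot r00 r10 r20 A.
have mp n : measurable_fun setT (pderive n Y t) by have [] := pderive_sqr gsY n Ot.
have mA1 n (r : R) : measurable [set w | `|pderive n Y t w| <= r].
  have mn : measurable_fun setT (fun w => `|pderive n Y t w|).
    exact: (measurableT_comp (@normr_measurable R setT)).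
  have -> : [set w | `|pderive n Y t w| <= r] = (fun w => `|pderive n Y t w|) @^-1` `]-oo, r]%classic.
    by apply/seteqP; split=> w /=; rewrite in_itv.
  by have := mn measurableT _ (measurable_itv `]-oo, r]); rewrite setTI.
have -> : A = [set w | forall x, List.In x [:: (pderive 0 Y t, r0); (pderive 1 Y t, r1); (pderive 2 Y t, r2)] ->
    `|x.1 w| <= x.2].
  apply/seteqP; split => w /=; first by move=> [h0 [h1 h2]] x [<-//|[<-//|[<-//|[]]]].
  by move=> h; split; [|split]; [exact: (h (pderive 0 Y t, r0) (or_introl erefl))|exact: (h (pderive 1 Y t, r1) (or_intror (or_introl erefl)))|exact: (h (pderive 2 Y t, r2) (or_intror (or_intror (or_introl erefl))))].
split.
  have -> : [set w | forall x, List.In x [:: (pderive 0 Y t, r0); (pderive 1 Y t, r1); (pderive 2 Y t, r2)] ->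
    `|x.1 w| <= x.2] = [set w | `|pderive 0 Y t w| <= r0] `&` ([set w | `|pderive 1 Y t w| <= r1] `&`
     [set w | `|pderive 2 Y t w| <= r2]).
    apply/seteqP; split => w /=; last by move=> [h0 [h1 h2]] x [<-//|[<-//|[<-//|[]]]].
    by move=> h; split; [|split]; [exact: (h (pderive 0 Y t, r0) (or_introl erefl))|exact: (h (pderive 1 Y t, r1) (or_intror (or_introl erefl)))|exact: (h (pderive 2 Y t, r2) (or_intror (or_intror (or_introl erefl))))].
  by do 2 ![apply: measurableI => //].
apply: le_trans (small_ball (l := [:: (pderive 0 Y t, r0); (pderive 1 Y t, r1); (pderive 2 Y t, r2)]) lam0 _ _ _) _.
- by move=> x [<-//|[<-//|[<-//|[]]]].
- by move=> x [<-|[<-|[<-|[]]]] /=; exact: mp.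
- case=> [//|a0 [//|a1 [//|a2 [|//]]]] _.
  have [|v gv] := gauss_comb gsY (l := [:: (a0, 0, t); (a1, 1, t); (a2, 2, t)]).
    by do 3 apply: points_in_cons => //.
  exists v; last first.
    rewrite /sqr_list !big_cons big_nil addr0 addrA (le_trans (Hlam Ot a0 a1 a2))// -(gauss_var gv).
    by rewrite le_eqVlt; apply/orP; left; apply/eqP; congr Ex; apply/funext => w; rewrite /comb !big_cons big_nil addr0.
  rewrite (_ : lin_list _ _ = comb Y [:: (a0, 0, t); (a1, 1, t); (a2, 2, t)])//.
  by apply/funext => w; rewrite /comb !big_cons big_nil.
- rewrite lee_fin !big_cons big_nil mulr1 /=.
  rewrite le_eqVlt; apply/orP; left; apply/eqP; have s0 : Num.sqrt lam != 0 by rewrite gt_eqF// sqrtr_gt0.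
  by move: s0; set s := Num.sqrt lam => s0; field.
Qed.

Definition jet_const := expR (3 / 2) / Num.sqrt lam ^+ 3.

(** The height doubles with the level, so that the oscillation probabilities are summable over the
    2^r intervals of level r; the factor K^2 makes them small at level 0. *)
Definition dyadic_height (r : nat) : R := K ^+ 2 * 2 ^+ r.

Definition dyadic_prob (r : nat) (h : R) : R :=
  Cp * (C * (dyadic_height r)^-1 ^+ 2) ^+ p.+1 + jet_const * (dyadic_height r ^+ 3 * h ^+ (3 * m)).

Lemma dyadic_height_gt0 r : 0 < dyadic_height r.
Proof. by rewrite mulr_gt0 ?exprn_gt0. Qed.

Lemma bad_dyadic_dom r u v : a <= u -> v <= b -> u < v ->
  exists g, [/\ intg P g, forall w, 0 <= g w, Ex P g <= dyadic_prob r (v - u) &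
    {ae P, forall w, bad_dyadic (Y ^~ w) m dyadic_height r u v -> 1 <= g w}].
Proof.
move=> au vb uv.
have uvO t : u < t < v -> O t.
  by move=> /andP[ut tv]; rewrite /= in_itv/= (le_lt_trans au)// (lt_le_trans tv).
have A0 := dyadic_height_gt0 r; set h := v - u; have h0 : 0 < h by rewrite subr_gt0.
have B0 : 0 < h * dyadic_height r by rewrite mulr_gt0.
have [g1 [I1 p1 E1 ae1]] := osc_dom gsY C0 Cp0 HC HCp uv uvO B0.
pose t := (u + v) / 2; have Ot : O t by apply: uvO; rewrite /t; lra.
pose rr j := h ^+ (m - j) * (h * dyadic_height r).
have rr0 j : 0 < rr j by rewrite mulr_gt0 ?exprn_gt0.
have [mA PA] := small_ball_jet Ot (rr0 0) (rr0 1) (rr0 2).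
have [I2 E2] := Ex_indicator mA PA.
exists (fun w => g1 w + \1_[set w | `|pderive 0 Y t w| <= rr 0 /\ `|pderive 1 Y t w| <= rr 1 /\ `|pderive 2 Y t w| <= rr 2] w).
split.
- exact: intgD.
- by move=> w; rewrite addr_ge0.
- rewrite ExD// /dyadic_prob lerD//.
    by rewrite (_ : (dyadic_height r)^-1 = (v - u) / (h * dyadic_height r))// -/h; field; rewrite !gt_eqF.
  apply: (le_trans E2); rewrite /jet_const le_eqVlt; apply/orP; left; apply/eqP.
  have -> : rr 0 * rr 1 * rr 2 = dyadic_height r ^+ 3 * h ^+ (3 * m).
    rewrite /rr; have -> : (3 * m = (m - 0) + (m - 1) + (m - 2) + 3)%N by clear -m2; lia.
    by rewrite !exprD; ring.
  by rewrite mulrAC.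
- apply: filterS ae1 => w h1 /asboolP[osc|sm].
    by rewrite (le_trans (h1 osc))// lerDl.
  rewrite indicE mem_set ?lerDr//=.
  by split; [exact: (sm 0)|split; [exact: (sm 1)|exact: (sm 2)]].
Qed.

Lemma jet_const_ge0 : 0 <= jet_const.
Proof. by rewrite divr_ge0 ?expR_ge0 ?exprn_ge0 ?sqrtr_ge0. Qed.

Lemma dyadic_prob_ge0 r (h : R) : 0 <= h -> 0 <= dyadic_prob r h.
Proof.
move=> h0; have A0 := dyadic_height_gt0 r; apply: addr_ge0; apply: mulr_ge0 => //.
- by apply: exprn_ge0; apply: mulr_ge0 => //; exact: sqr_ge0.
- exact: jet_const_ge0.
- by apply: mulr_ge0; apply: exprn_ge0 => //; exact: ltW.
Qed.

(** From one level to the next the oscillation term shrinks by 16 at least, as p >= 1, and the small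
    ball term by 8 at least, as m >= 2. With a factor 4 the two halves together cost at most half of
    the parent, which sums to the 2 of [dyadic_count_dom]. *)
Lemma dyadic_probS r (h : R) : 0 <= h -> 4 * dyadic_prob r.+1 (h / 2) <= dyadic_prob r h.
Proof.
move=> h0; have A0 := dyadic_height_gt0 r.
have AE : dyadic_height r.+1 = 2 * dyadic_height r by rewrite /dyadic_height mulrCA -exprS.
have J0 := jet_const_ge0.
rewrite /dyadic_prob AE !mulrDr; apply: lerD.
  have -> : C * (2 * dyadic_height r)^-1 ^+ 2 = (1 / 4) * (C * (dyadic_height r)^-1 ^+ 2).
    by field; rewrite gt_eqF.
  rewrite exprMn; set X := _ ^+ p.+1; set Z := (C * _) ^+ p.+1.
  have Z0 : 0 <= Z by rewrite exprn_ge0// mulr_ge0// exprn_ge0// invr_ge0 ltW.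
  have X4 : X <= 1 / 16.
    by rewrite /X -(prednK p0) 2!exprS mulrA (_ : 1 / 4 * (1 / 4) = 1 / 16) ?ler_piMr ?exprn_ile1//; lra.
  have : X * Z <= 1 / 16 * Z by rewrite ler_wpM2r.
  have : 0 <= Cp * Z by rewrite mulr_ge0.
  move=> h1 h2; have := ler_wpM2l Cp0 h2; lra.
have e6 : (3 * m = 3 * (m - 2) + 6)%N by clear -m2; lia.
rewrite exprMn [(h / 2) ^+ _]exprMn; set H := h ^+ (3 * m); set X := 2^-1 ^+ _.
have H0 : 0 <= H by exact: exprn_ge0.
have X0 : 0 <= X by rewrite exprn_ge0.
have X6 : X <= 1 / 64.
  rewrite /X e6 exprD (_ : 2^-1 ^+ 6 = 1 / 64); last by field.
  by rewrite ler_piMl// exprn_ile1//; lra.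
have -> : 4 * (jet_const * (2 ^+ 3 * dyadic_height r ^+ 3 * (H * X))) =
  32 * X * (jet_const * (dyadic_height r ^+ 3 * H)) by ring.
apply: ler_piMl; last by lra.
by rewrite mulr_ge0// mulr_ge0// exprn_ge0// ltW.
Qed.

Lemma dyadic_count_dom n r u v : a <= u -> v <= b -> u < v ->
  exists g, [/\ intg P g, forall w, 0 <= g w, Ex P g <= 2 * dyadic_prob r (v - u) &
    {ae P, forall w, (dyadic_count (bad_dyadic (Y ^~ w) m dyadic_height) n r u v)%:R <= g w}].
Proof.
elim: n r u v => [|n IH] r u v au vb uv.
  exists (cst 0); split=> //; first exact: intg_cst.
    by rewrite Ex_cst mulr_ge0// dyadic_prob_ge0// subr_ge0 ltW.
  by apply: aeW.
have um : u < (u + v) / 2 by lra.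
have mv : (u + v) / 2 < v by lra.
have [g0 [I0 p0' E0 ae0]] := bad_dyadic_dom r au vb uv.
have [g1 [I1 p1 E1 ae1]] := IH r.+1 u ((u + v) / 2) au (ltW (lt_le_trans mv vb)) um.
have [g2 [I2 p2' E2 ae2]] := IH r.+1 ((u + v) / 2) v (ltW (le_lt_trans au um)) vb mv.
exists (fun w => g0 w + (g1 w + g2 w)); split.
- by apply: intgD => //; exact: intgD.
- by move=> w; rewrite addr_ge0// addr_ge0.
- rewrite ExD//; last exact: intgD.
  rewrite ExD//; have := @dyadic_probS r (v - u); rewrite subr_ge0 => /(_ (ltW uv)).
  have -> : (v - u) / 2 = (u + v) / 2 - u by lra.
  move: E2; have -> : v - (u + v) / 2 = (u + v) / 2 - u by lra.
  by move: E0 E1; set q := dyadic_prob r _; set q' := dyadic_prob r.+1 _; lra.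
- apply: filterS3 ae0 ae1 ae2 => w h0 h1 h2 /=.
  rewrite !natrD lerD ?lerD//.
  by case: bad_dyadic h0 => [->|_].
Qed.

Variable (M : nat).
Hypotheses (ab : a < b) (M2 : (1 < M)%N).

(** One integrable function bounds the counts at all depths: they increase with the depth, so each
    lies below the lower limit of the majorants. *)
Lemma dyadic_total_dom : exists g, [/\ intg P g, forall w, 0 <= g w,
   Ex P g <= M%:R * (2 * dyadic_prob 0 ((b - a) / M%:R)) &
   {ae P, forall w, forall n, (\sum_(i < M) dyadic_bad a b M (Y ^~ w) m dyadic_height n i)%:R <= g w}].
Proof.
have H n (i : 'I_M) : exists g, [/\ intg P g, forall w, 0 <= g w, Ex P g <= 2 * dyadic_prob 0 ((b - a) / M%:R) &
    {ae P, forall w, (dyadic_bad a b M (Y ^~ w) m dyadic_height n i)%:R <= g w}].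
  rewrite -(node_step ab M2 i); apply: dyadic_count_dom.
  - by rewrite -[leLHS](@node0 _ a b M) node_le.
  - by rewrite -[leRHS](nodeM ab M2) node_le.
  - exact: node_lt.
have H' n : exists g : 'I_M -> T -> R, forall i, [/\ intg P (g i), forall w, 0 <= g i w,
    Ex P (g i) <= 2 * dyadic_prob 0 ((b - a) / M%:R) &
    {ae P, forall w, (dyadic_bad a b M (Y ^~ w) m dyadic_height n i)%:R <= g i w}].
  by have [f Hf] := choice (H n); exists f.
have [g Hg] := choice H'.
have [|||G [IG G0 EG aeG]] := @liminf_dom _ _ _ P (fun n w => \sum_(i < M) g n i w) (M%:R * (2 * dyadic_prob 0 ((b - a) / M%:R))).
- by move=> n; apply: intg_sum => i _; have [] := Hg n i.
- by move=> n w; apply: sumr_ge0 => i _; have [] := Hg n i.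
- move=> n; rewrite Ex_sum; last by move=> i _; have [] := Hg n i.
  apply: (@le_trans _ _ (\sum_(i < M) (2 * dyadic_prob 0 ((b - a) / M%:R)))).
    by apply: ler_sum => i _; have [] := Hg n i.
  by rewrite sumr_const card_ord [leRHS]mulr_natl.
exists G; split=> //.
have ae' : {ae P, forall w, forall n (i : 'I_M), (dyadic_bad a b M (Y ^~ w) m dyadic_height n i)%:R <= g n i w}.
  apply/ae_foralln => n; apply: filterS (_ : {ae P, forall w, forall i : nat, forall iM : (i < M)%N,
     (dyadic_bad a b M (Y ^~ w) m dyadic_height n i)%:R <= g n (Ordinal iM) w}).
    by move=> w h [i iM]; exact: h.
  apply/ae_foralln => i; have [iM|iM] := pselect (i < M)%N; last by apply: aeW => w iM'; case: iM.
  have [_ _ _] := Hg n (Ordinal iM); apply: filterS => w h iM'.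
  by rewrite (bool_irrelevance iM' iM).
apply: filterS2 aeG ae' => w h1 h2 n; apply: h1; exists n => // n' /= nn'.
rewrite natr_sum; apply: ler_sum => i _; apply: le_trans (h2 n' i).
by rewrite ler_nat; exact: dyadic_count_mono.
Qed.

End dyadic.

(** * Summable correlations and concentration of the product statistics *)

Section decay_sum.
Context {R : realType}.
Variable l : R.
Hypotheses (l0 : 0 < l) (l1 : l <= 1).

Lemma sum_decay_half n : \sum_(0 <= j < n) (1 + (j%:R * l) ^+ 2)^-1 <= 4 / l.
Proof.
(* For consecutive points x and y = x + l, the term at y is at most 2 / ((1 + x) (1 + y)), which
   telescopes to this bound. *)
suff H m : \sum_(0 <= j < m.+1) (1 + (j%:R * l) ^+ 2)^-1 <= 2 + 2 / l * (1 - (1 + m%:R * l)^-1).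
  case: n => [|n]; first by rewrite big_geq// divr_ge0// ltW.
  apply: (le_trans (H n)).
  have n0 : 0 <= (1 + n%:R * l)^-1 by rewrite invr_ge0 addr_ge0// mulr_ge0// ltW.
  have h1 : 2 / l * (1 - (1 + n%:R * l)^-1) <= 2 / l.
    by apply: ler_piMr; [rewrite divr_ge0// ltW|lra].
  have h2 : 2 <= 2 / l by rewrite ler_pdivlMr// ler_piMr.
  have -> : 4 / l = 2 / l + 2 / l by field; rewrite gt_eqF.
  by lra.
elim: m => [|m IH].
  rewrite big_nat1 mul0r expr0n /= addr0 invr1 subrr mulr0; lra.
rewrite big_nat_recr//= (le_trans (lerD IH (lexx _)))// -[m.+1%:R]natr1.
set x := m%:R * l; have x0 : 0 <= x by rewrite mulr_ge0// ltW.
have -> : (m%:R + 1) * l = x + l by rewrite mulrDl mul1r.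
set y := x + l; have y0 : 0 < y by rewrite ltr_wpDl.
rewrite -subr_ge0.
have x1 : 0 < 1 + x by rewrite ltr_pwDl.
have y1 : 0 < 1 + y by rewrite ltr_pwDl// ltW.
have y2 : 0 < 1 + y ^+ 2 by rewrite ltr_pwDl// sqr_ge0.
have -> : 2 + 2 / l * (1 - (1 + y)^-1) - (2 + 2 / l * (1 - (1 + x)^-1) + (1 + y ^+ 2)^-1) =
   (2 * (1 + y ^+ 2) - (1 + x) * (1 + y)) / ((1 + x) * (1 + y) * (1 + y ^+ 2)).
  by rewrite /y in y1 y2 *; field; rewrite ?gt_eqF.
rewrite divr_ge0//; last by rewrite mulr_ge0 ?mulr_ge0// ltW.
have : (1 + x) * (1 + y) <= (1 + y) * (1 + y) by rewrite ler_wpM2r ?(ltW y1)// lerD2l /y lerDl ltW.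
by have := sqr_ge0 (1 - y); nra.
Qed.

Lemma sum_decay n i : \sum_(0 <= j < n) (1 + ((j%:R - i%:R) * l) ^+ 2)^-1 <= 8 / l.
Proof.
have f0 (x : R) : 0 <= (1 + x ^+ 2)^-1 by rewrite invr_ge0 addr_ge0// sqr_ge0.
apply: (@le_trans _ _ (\sum_(0 <= j < n + i) (1 + ((j%:R - i%:R) * l) ^+ 2)^-1)).
  by rewrite (@big_cat_nat _ _ _ n 0 (n + i)) ?leq_addr//= lerDl sumr_ge0.
rewrite (@big_cat_nat _ _ _ i 0 (n + i)) ?leq_addl//=.
have -> : 8 / l = 4 / l + 4 / l by rewrite -mulrDl; congr (_ / _); ring.
apply: lerD.
  rewrite big_nat_rev /=; apply: le_trans (sum_decay_half i.+1).
  rewrite [X in _ <= X]big_nat_recl//= -[leLHS]add0r lerD//.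
  rewrite big_nat [X in _ <= X]big_nat; apply: ler_sum => j /andP[_ ji].
  rewrite add0n natrB// le_eqVlt; apply/orP; left; apply/eqP; congr ((1 + _)^-1).
  by rewrite -sqrrN; congr (_ ^+ 2); ring.
rewrite -{1}(add0n i) big_addn addnK; apply: le_trans (sum_decay_half n).
by apply: ler_sum => j _; rewrite natrD addrK.
Qed.

End decay_sum.

Section statistics.
Context {d : measure_display} {T : measurableType d} {R : realType} (P : probability T R).
Variables (a b : R) (Y : R -> T -> R) (C eps : R) (M : nat) (nchi : nat) (r : R).
Local Notation O := (`]a, b[%classic : set R).
Hypotheses (gsY : gaussian_smooth P O Y) (ab : a < b) (M2 : (1 < M)%N) (r0 : 0 < r)
  (C0 : 0 <= C) (eps0 : 0 <= eps) (step1 : (b - a) / M%:R <= 1)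
  (HC : forall s t, O s -> O t ->
     `|Ex P (fun w => Y s w * Y t w)| <= C / (1 + (t - s) ^+ 2) + C * eps).

(** Index i stands for node i + 1, capped at M - 1 so that every natural number gives a point of the
    open interval. *)
Definition inner i := node a b M (minn i.+1 M.-1).
Definition samples (w : T) i := Y (inner i) w.

Lemma inner_in i : O (inner i).
Proof.
rewrite /= in_itv/= /inner -{1}(node0 a b M) node_lt//=; last by rewrite leq_min //; case: (M) M2 => [|[]].
rewrite -[ltRHS](nodeM ab M2) node_lt// gtn_min prednK ?leqnn ?orbT//.
exact: ltn_trans M2.
Qed.

Lemma gauss_samples s : exists v, gauss P (fun w => lincomb s (samples w)) v.
Proof.
have [_ _ H] := gsY; have [|v gv] := H [seq (y.1, inner y.2) | y <- s].
  by move=> _ /mapP[y _ ->]; exact: inner_in.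
exists v; rewrite (_ : (fun w => _) = (fun w => \sum_(y <- [seq (y.1, inner y.2) | y <- s]) y.1 * Y y.2 w))//.
by apply/funext => w; rewrite big_map.
Qed.

Local Notation chi := (chi nchi r).
Local Notation dchi := (dchi nchi r).
Local Notation slope := (sign_slope nchi / r).

Variables (n e : nat).
Hypothesis neM : (n + e < M)%N.

Definition stat (u : nat -> R) := M%:R^-1 * \sum_(j < n) chi (u j) * chi (u (j + e)%N).

(** The gradient of [stat] as a list of n + n terms: index m < n differentiates the first factor of
    term m, index n + j the second factor of term j. [stat_index] gives the coordinate concerned. *)
Definition stat_coef m (u : nat -> R) := M%:R^-1 *
  (if (m < n)%N then dchi (u m) * chi (u (m + e)%N) else chi (u (m - n)%N) * dchi (u (m - n + e)%N)).

Definition stat_index m := if (m < n)%N then m else (m - n + e)%N.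

Let M0 : 0 < M%:R :> R. Proof. by rewrite ltr0n (ltn_trans _ M2). Qed.
Let slope0 : 0 <= slope. Proof. by rewrite divr_ge0 ?sign_slope_ge0// ltW. Qed.

Lemma trigp_stat : trigp stat.
Proof.
apply: trigpZ; apply: (@trigp_sum _ n (fun j u => chi (u j) * chi (u (j + e)%N))) => j.
by apply: trigpM; exact: chi_trigp.
Qed.

Lemma sum_split_index (V : nat -> R) : \sum_(m < n + n) V m = \sum_(j < n) (V j + V (j + n)%N).
Proof.
rewrite -(big_mkord xpredT V) (@big_cat_nat _ _ _ n 0 (n + n)) ?leq_addr//= big_split /=.
rewrite -{2}[n]add0n big_addn addnK !big_mkord; congr (_ + _).
Qed.

Lemma is_derive_stat u h : is_derive (0 : R) 1 (fun t : R => stat (fun i => cos t * u i + sin t * h i))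
   (\sum_(m < n + n) stat_coef m u * h (stat_index m)).
Proof.
have dj j : is_derive (0 : R) 1 (fun t : R => chi (cos t * u j + sin t * h j)) (dchi (u j) * h j).
  pose g (t : R) := cos t * u j + sin t * h j.
  have h1 : is_derive (0 : R) 1 g (h j).
    have := is_deriveD (is_deriveZ (u j) (is_derive_cos (0 : R))) (is_deriveZ (h j) (is_derive_sin (0 : R))).
    rewrite (_ : _ + _ = g); last first.
      by apply/funext => t; rewrite /g !fctE /= [cos t * _]mulrC [sin t * _]mulrC.
    by move=> hh; apply: (is_derive_eq hh); rewrite /GRing.scale /= sin0 cos0 oppr0 mulr0 add0r mulr1.
  have h2 : is_derive (g 0) 1 chi (dchi (g 0)) by exact: is_derive_chi.
  have := is_derive1_comp (f := chi) (g := g) h2 h1.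
  by rewrite {2}/g cos0 sin0 mul1r mul0r addr0; apply.
rewrite (sum_split_index (fun m => stat_coef m u * h (stat_index m))).
have -> : (fun t : R => stat (fun i => cos t * u i + sin t * h i)) =
  M%:R^-1 \*: (\sum_(j < n) ((fun t : R => chi (cos t * u j + sin t * h j)) *
     (fun t : R => chi (cos t * u (j + e)%N + sin t * h (j + e)%N)))).
  apply/funext => t; rewrite /stat /= /GRing.scale /=; congr (_ * _).
  by rewrite fct_sumE.
have D j := is_deriveM (dj j) (dj (j + e)%N).
have := is_deriveZ M%:R^-1 (is_derive_sum (fun j : 'I_n => D j)).
move=> h1; apply: (is_derive_eq h1); rewrite /GRing.scale /= mulr_sumr; apply: eq_bigr => j _.
rewrite /stat_coef /stat_index ltn_ord ltnNge leq_addl /= addnK cos0 sin0.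
by rewrite !mul1r !mul0r !addr0; ring.
Qed.

Lemma stat_lip u v : `|stat u - stat v| <= slope / M%:R * \sum_(m < n + n) `|u (stat_index m) - v (stat_index m)|.
Proof.
rewrite (sum_split_index (fun m => `|u (stat_index m) - v (stat_index m)|)) /stat -mulrBr normrM.
rewrite ger0_norm ?invr_ge0// mulrC mulrAC ler_wpM2r ?invr_ge0// -sumrB mulr_sumr.
rewrite (le_trans (ler_norm_sum _ _ _))//; apply: ler_sum => j _.
rewrite /stat_index ltn_ord ltnNge leq_addl /= addnK.
have -> : chi (u j) * chi (u (j + e)%N) - chi (v j) * chi (v (j + e)%N) =
  (chi (u j) - chi (v j)) * chi (u (j + e)%N) + chi (v j) * (chi (u (j + e)%N) - chi (v (j + e)%N)) by ring.
rewrite (le_trans (ler_normD _ _))// [leRHS]mulrDr !normrM lerD//.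
  by rewrite -[leRHS]mulr1 ler_pM ?chi_norm// chi_lip.
by rewrite -[leRHS]mul1r ler_pM ?chi_norm// chi_lip.
Qed.

Lemma stat_coef_le m u : `|stat_coef m u| <= slope / M%:R.
Proof.
rewrite /stat_coef normrM ger0_norm ?invr_ge0// mulrC ler_wpM2r ?invr_ge0//.
case: ifP => _; rewrite normrM.
  by rewrite -[leRHS]mulr1 ler_pM ?chi_norm// dchi_norm.
by rewrite -[leRHS]mul1r ler_pM ?chi_norm// dchi_norm.
Qed.

Lemma measurable_samples i : measurable_fun setT (fun w => samples w i).
Proof. exact: (mU gauss_samples). Qed.

Lemma measurable_chi i : measurable_fun setT (fun w => chi (samples w i)).
Proof.
apply: intg_meas; apply: (@intg_trigp _ _ _ P samples) (chi_trigp nchi r i) => j.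
exact: measurable_samples.
Qed.

Lemma measurable_stat_coef m : measurable_fun setT (fun w => stat_coef m (samples w)).
Proof.
have mc := measurable_chi.
have md i : measurable_fun setT (fun w => dchi (samples w i)).
  apply: measurable_funM => //; apply: measurable_funM => //; apply: measurable_funX.
  have := measurable_cos_shift 0 (measurable_funM (measurable_cst r^-1) (measurable_samples i)).
  by under eq_fun do rewrite addr0.
apply: measurable_funM => //; rewrite /stat_coef; case: (m < n)%N; exact: measurable_funM.
Qed.

Lemma cov_samples i j : (i.+1 < M)%N -> (j.+1 < M)%N ->
  `|cov P samples i j| <= C / (1 + ((j%:R - i%:R) * ((b - a) / M%:R)) ^+ 2) + C * eps.
Proof.
move=> iM jM; apply: (le_trans (HC (inner_in i) (inner_in j))).
have mi k : (k.+1 < M)%N -> inner k = node a b M k.+1.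
  by move=> kM; rewrite /inner (minn_idPl _)// -ltnS prednK// (ltn_trans _ M2).
rewrite (mi _ iM) (mi _ jM) (_ : node a b M j.+1 - node a b M i.+1 = (j%:R - i%:R) * ((b - a) / M%:R))//.
by rewrite /node -!natr1; ring.
Qed.

(** For spacing l = (b - a) / M, the decay of correlations contributes at most C (8 / l) to a row of
    n terms, and the comparison error at most M C eps. *)
Lemma sum_cov_samples :
  \sum_(i < n + n) \sum_(j < n + n) `|cov P samples (stat_index i) (stat_index j)| <=
  4 * M%:R ^+ 2 * (C * (8 / (b - a) + eps)).
Proof.
set l := (b - a) / M%:R; have l0 : 0 < l by rewrite divr_gt0// subr_gt0.
have idx i : (i < n + n)%N -> ((stat_index i).+1 < M)%N.
  by move=> h2; rewrite /stat_index; case: (ltnP i n) => h1; clear -neM h1 h2; lia.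
have S1 i e' : (i.+1 < M)%N -> (n + e' < M)%N -> \sum_(j < n) `|cov P samples i (j + e')%N| <= C * (8 / l) + M%:R * (C * eps).
  move=> iM neM'.
  apply: (@le_trans _ _ (\sum_(j < n) (C * (1 + (((j + e')%:R - i%:R) * l) ^+ 2)^-1 + C * eps))).
    apply: ler_sum => j _; apply: cov_samples => //.
    by rewrite (leq_trans _ neM')// ltnS -addSn leq_add2r.
  rewrite big_split /= sumr_const card_ord -[_ *+ n]mulr_natl lerD//; last first.
    by rewrite ler_wpM2r ?mulr_ge0// ler_nat (leq_trans _ (ltnW neM'))// leq_addr.
  rewrite -mulr_sumr ler_wpM2l//.
  apply: le_trans (sum_decay l0 step1 (n + e') i).
  rewrite (@big_cat_nat _ _ _ e' 0 (n + e')) ?leq_addl//= -[leLHS]add0r lerD//.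
    by apply: sumr_ge0 => j _; rewrite invr_ge0 addr_ge0// sqr_ge0.
  by rewrite -[X in \sum_(X <= _ < _) _]add0n big_addn addnK big_mkord.
have nM : (n < M)%N by rewrite (leq_ltn_trans _ neM)// leq_addr.
have S2 i : (i.+1 < M)%N -> \sum_(j < n + n) `|cov P samples i (stat_index j)| <= 2 * (C * (8 / l) + M%:R * (C * eps)).
  move=> iM; rewrite (sum_split_index (fun j => `|cov P samples i (stat_index j)|)) big_split /= mulr2n mulrDl mul1r lerD//.
    rewrite (le_trans _ (S1 i 0%N iM _)) ?addn0//; apply: ler_sum => j _.
    by rewrite /stat_index ltn_ord addn0.
  rewrite (le_trans _ (S1 i e iM neM))//; apply: ler_sum => j _.
  by rewrite /stat_index ltnNge leq_addl /= addnK.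
apply: (@le_trans _ _ (\sum_(i < n + n) (2 * (C * (8 / l) + M%:R * (C * eps))))).
  by apply: ler_sum => i _; apply: S2; apply: idx.
rewrite sumr_const card_ord -[_ *+ (n + n)]mulr_natl.
have -> : 4 * M%:R ^+ 2 * (C * (8 / (b - a) + eps)) = 2 * M%:R * (2 * (C * (8 / l) + M%:R * (C * eps))).
  by rewrite /l; field; rewrite !gt_eqF ?subr_gt0.
rewrite ler_wpM2r//.
  apply: mulr_ge0 => //; apply: addr_ge0; last by apply: mulr_ge0 => //; exact: mulr_ge0.
  by apply: mulr_ge0 => //; rewrite divr_ge0// ltW.
by rewrite -natrM ler_nat mulSn mul1n leq_add// ltnW.
Qed.

Lemma stat_concentration Cp j : (forall V v, gauss P V v ->
    intg P (fun w => V w ^+ (2 ^ j).*2) /\ Ex P (fun w => V w ^+ (2 ^ j).*2) <= Cp * v ^+ (2 ^ j)) -> 0 <= Cp ->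
  Ex P (fun w => (stat (samples w) - Ex P (fun w => stat (samples w))) ^+ (2 ^ j).*2) <=
  (pi / 2) ^+ (2 ^ j).*2 * (Cp * (slope ^+ 2 * (4 * (C * (8 / (b - a) + eps)))) ^+ (2 ^ j)).
Proof.
move=> HCp Cp0.
have L0 : 0 <= slope / M%:R by rewrite divr_ge0.
apply: (le_trans (concentration_moment gauss_samples trigp_stat is_derive_stat stat_lip L0 stat_coef_le
  measurable_stat_coef HCp Cp0)).
rewrite ler_wpM2l ?exprn_ge0 ?divr_ge0 ?pi_ge0// ler_wpM2l//; apply: lerXn2r; rewrite ?nnegrE.
- by rewrite mulr_ge0 ?sqr_ge0// sumr_ge0// => i _; exact: sumr_ge0.
- apply: mulr_ge0; first exact: sqr_ge0.
  by apply: mulr_ge0 => //; apply: mulr_ge0 => //; apply: addr_ge0 => //; rewrite divr_ge0// subr_ge0 ltW.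
- apply: (le_trans (ler_wpM2l (sqr_ge0 _) sum_cov_samples)).
  by rewrite le_eqVlt; apply/orP; left; apply/eqP; field; rewrite !gt_eqF ?subr_gt0.
Qed.

End statistics.

(** * Lower bound for the mean number of zeros *)

Section sign_pair.
Context {d : measure_display} {T : measurableType d} {R : realType} (P : probability T R).
Variables (U V : T -> R) (vU vV c C lam C3 s : R).
Hypotheses (gUV : forall x y : R, gauss P (fun w => x * U w + y * V w) (x ^+ 2 * vU + 2 * x * y * c + y ^+ 2 * vV))
  (lamU : lam <= vU) (lamV : lam <= vV) (UC : vU <= C) (VC : vV <= C) (lam0 : 0 < lam) (s0 : 0 < s)
  (slam : 2 * s ^+ 2 * lam <= 1) (C30 : 0 <= C3)
  (HC3 : forall W v, gauss P W v ->
    intg P (fun w => W w ^+ 6) /\ Ex P (fun w => W w ^+ 6) <= C3 * v ^+ 3).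

Lemma expRN_sub_le (x y : R) : 0 <= x -> expR (- x) - expR (- y) <= `|y - x|.
Proof.
move=> x0; have [xy|yx] := leP x y; last first.
  by rewrite (@le_trans _ _ 0)// subr_le0 ler_expR lerN2 ltW.
rewrite ger0_norm ?subr_ge0//.
have -> : expR (- x) - expR (- y) = expR (- x) * (1 - expR (- (y - x))).
  by rewrite mulrBr mulr1 -expRD; congr (_ - expR _); ring.
have e1 : expR (- x) <= 1 by rewrite -expR0 ler_expR oppr_le0.
have e2 : 1 - expR (- (y - x)) <= y - x by have := expR_ge1Dx (- (y - x)); lra.
have e3 : 0 <= 1 - expR (- (y - x)) by rewrite subr_ge0 -expR0 ler_expR oppr_le0 subr_ge0.
by rewrite (le_trans _ e2)// ler_piMl.
Qed.

Lemma one_sub_expRN_ge (x : R) : 0 <= x <= 1 -> x / 2 <= 1 - expR (- x).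
Proof.
move=> /andP[x0 x1]; have e := expR_ge1Dx x.
have p : 0 < 1 + x by lra.
have : expR (- x) <= (1 + x)^-1 by rewrite expRN lef_pV2 ?posrE ?expR_gt0.
have : (1 + x)^-1 <= 1 - x / 2.
  rewrite -[leLHS]mul1r ler_pdivrMr//; nra.
by lra.
Qed.

Let cf x y : Ex P (fun w => cos (x * U w + y * V w)) = expR (- ((x ^+ 2 * vU + 2 * x * y * c + y ^+ 2 * vV) / 2)).
Proof.
have [_ _ /(_ 1 0)] := gUV x y; rewrite expr1n mul1r cos0 mulr1 => <-.
by congr Ex; apply/funext => w; rewrite mul1r addr0.
Qed.

Let Icos x y : intg P (fun w => cos (x * U w + y * V w)).
Proof.
have [m _ _] := gUV x y; have := intg_cos_shift P 0 m.
by under eq_fun do rewrite addr0.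
Qed.

Let S w := sin (s * U w) * sin (s * V w).

Let SE w : S w = 2^-1 * (cos (s * U w + (- s) * V w) - cos (s * U w + s * V w)).
Proof. by rewrite /S cosD mulNr cosN sinN cosD; field. Qed.

Let S2E w : S w ^+ 2 = 4^-1 * (1 - cos (2 * s * U w + 0 * V w) - cos (0 * U w + 2 * s * V w) +
   2^-1 * (cos (2 * s * U w + - (2 * s) * V w) + cos (2 * s * U w + 2 * s * V w))).
Proof.
have c2 (x : R) : cos (2 * s * x) = 1 - 2 * sin (s * x) ^+ 2.
  have -> : 2 * s * x = s * x + s * x by ring.
  by rewrite cosD -[cos (s * x) * _]expr2 cos2sin2; ring.
have -> : cos (2 * s * U w + - (2 * s) * V w) + cos (2 * s * U w + 2 * s * V w) =
   2 * (cos (2 * s * U w) * cos (2 * s * V w)).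
  by rewrite mulNr !cosD cosN sinN; ring.
by rewrite !mul0r addr0 add0r !c2 /S; field.
Qed.

Let IS : intg P S.
Proof. by rewrite (funext SE); apply: intgZ; exact: intgB. Qed.

Let IS2 : intg P (fun w => S w ^+ 2).
Proof.
under [X in intg _ X]eq_fun do rewrite S2E; apply: intgZ; apply: intgD.
  by apply: intgB => //; apply: intgB => //; exact: intg_cst.
by apply: intgZ; exact: intgD.
Qed.

Let ES : Ex P S <= s ^+ 2 * `|c|.
Proof.
rewrite (funext SE).
rewrite ExZ ?ExB//; last exact: intgB.
rewrite !cf; set x := (_ / 2); set y := (_ / 2).
have x0 : 0 <= x by have [_ v0 _] := gUV s (- s); rewrite /x divr_ge0.
have := expRN_sub_le y x0.
have -> : y - x = 2 * (s ^+ 2 * c) by rewrite /y /x; field.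
by rewrite normrM (@ger0_norm _ 2)// normrM (@ger0_norm _ (s ^+ 2)) ?sqr_ge0//; lra.
Qed.

(** The covariance enters only through e^t + e^(-t) >= 2, so the bound is the one for independent
    variables, (1 - A) (1 - B) / 4. *)
Let ES2 : s ^+ 4 * lam ^+ 2 / 4 <= Ex P (fun w => S w ^+ 2).
Proof.
have I1 := Icos (2 * s) 0; have I2 := Icos 0 (2 * s).
have I3 := Icos (2 * s) (- (2 * s)); have I4 := Icos (2 * s) (2 * s).
under [X in _ <= Ex P X]eq_fun do rewrite S2E.
rewrite ExZ; last first.
  apply: intgD; first by apply: intgB => //; apply: intgB => //; exact: intg_cst.
  by apply: intgZ; exact: intgD.
rewrite ExD; last 2 first.
- by apply: intgB => //; apply: intgB => //; exact: intg_cst.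
- by apply: intgZ; exact: intgD.
rewrite ExB//; last by apply: intgB => //; exact: intg_cst.
rewrite ExB//; last exact: intg_cst.
rewrite ExZ; last exact: intgD.
rewrite ExD// Ex_cst !cf.
set x := 2 * s ^+ 2 * vU; set y := 2 * s ^+ 2 * vV; set t := 4 * s ^+ 2 * c.
have -> : ((2 * s) ^+ 2 * vU + 2 * (2 * s) * 0 * c + 0 ^+ 2 * vV) / 2 = x by rewrite /x; field.
have -> : (0 ^+ 2 * vU + 2 * 0 * (2 * s) * c + (2 * s) ^+ 2 * vV) / 2 = y by rewrite /y; field.
have -> : - (((2 * s) ^+ 2 * vU + 2 * (2 * s) * - (2 * s) * c + (- (2 * s)) ^+ 2 * vV) / 2) = - x + - y + t.
  by rewrite /x /y /t; field.
have -> : - (((2 * s) ^+ 2 * vU + 2 * (2 * s) * (2 * s) * c + (2 * s) ^+ 2 * vV) / 2) = - x + - y + - t.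
  by rewrite /x /y /t; field.
rewrite !expRD.
have t2 : 2 <= expR t + expR (- t) by have := expR_ge1Dx t; have := expR_ge1Dx (- t); lra.
have low v : lam <= v -> s ^+ 2 * lam <= 1 - expR (- (2 * s ^+ 2 * v)).
  move=> lv; apply: (@le_trans _ _ (1 - expR (- (2 * s ^+ 2 * lam)))).
    have q2 : 0 <= 2 * s ^+ 2 * lam by rewrite mulr_ge0 ?(ltW lam0)// mulr_ge0// sqr_ge0.
    rewrite (_ : s ^+ 2 * lam = 2 * s ^+ 2 * lam / 2); last by field.
    by apply: one_sub_expRN_ge; rewrite q2.
  by rewrite lerD2l lerN2 ler_expR lerN2 ler_wpM2l// mulr_ge0// sqr_ge0.
have := low _ lamU; have := low _ lamV; rewrite -/x -/y.
have e0 : 0 < expR (- x) * expR (- y) by rewrite mulr_gt0 ?expR_gt0.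
move: e0; set A := expR (- x); set B := expR (- y); set G := expR t; set H := expR (- t).
have q0 : 0 <= s ^+ 2 * lam by rewrite mulr_ge0 ?sqr_ge0 ?ltW.
move=> e0 hB hA.
have h1 : (s ^+ 2 * lam) * (s ^+ 2 * lam) <= (1 - A) * (1 - B) by rewrite ler_pM.
have h2 : A * B * 2 <= A * B * (G + H) by rewrite ler_wpM2l// ltW.
have -> : s ^+ 4 * lam ^+ 2 / 4 = 4^-1 * ((s ^+ 2 * lam) * (s ^+ 2 * lam)) by field.
rewrite ler_wpM2l// (le_trans h1)//; move: h2; set Z := A * B; rewrite (_ : A * B * G + A * B * H = Z * (G + H)); last by rewrite /Z; ring.
rewrite -/Z => h2; have E : (1 - A) * (1 - B) = 1 - A - B + Z by rewrite /Z; ring.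
by rewrite E; lra.
Qed.

(** For S = sin (s U) sin (s V), the variable (S^2 - S) / 2 is at most 1, and at most 0 when U V >=
    0 and both arguments lie in [-pi, pi]; the sixth powers pay for larger arguments. E[S^2] is of
    order s^4 while E[S] is at most s^2 |c|, so a small covariance leaves a positive mean. *)
Lemma sign_pair : exists X : T -> R, [/\ intg P X, forall w, X w <= ((U w * V w < 0)%R)%:R &
  s ^+ 4 * lam ^+ 2 / 8 - s ^+ 2 * `|c| / 2 - 2 * (C3 * C ^+ 3 * s ^+ 6) <= Ex P X].
Proof.
have gU : gauss P U vU.
  have := gUV 1 0; rewrite (_ : (fun w => _) = U); last by apply/funext => w; rewrite mul1r mul0r addr0.
  by rewrite (_ : _ + _ = vU)//; ring.
have gV : gauss P V vV.
  have := gUV 0 1; rewrite (_ : (fun w => _) = V); last by apply/funext => w; rewrite mul1r mul0r add0r.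
  by rewrite (_ : _ + _ = vV)//; ring.
have [IU EU] := HC3 gU; have [IV EV] := HC3 gV.
have [_ vU0 _] := gU; have [_ vV0 _] := gV.
have pi0 : 0 < pi :> R by exact: pi_gt0.
have pi1 : 1 <= pi :> R by have := @pi_ge2 R; lra.
pose X w := 2^-1 * (S w ^+ 2 - S w) - (s / pi) ^+ 6 * (U w ^+ 6 + V w ^+ 6).
have I1 : intg P (fun w => 2^-1 * (S w ^+ 2 - S w)) by apply: intgZ; exact: intgB.
have I2 : intg P (fun w => (s / pi) ^+ 6 * (U w ^+ 6 + V w ^+ 6)) by apply: intgZ; exact: intgD.
exists X; split; first exact: intgB.
- have S1 w : `|S w| <= 1.
    rewrite normrM -[leRHS]mulr1 ler_pM// ler_norml sin_geN1 sin_le1//.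
  have ev (x : R) : 0 <= x ^+ 6 by rewrite (exprM x 2 3) exprn_ge0// sqr_ge0.
  have big (x : R) : pi < `|s * x| -> 1 <= (s / pi) ^+ 6 * x ^+ 6.
    move=> h; rewrite -exprMn; have -> : s / pi * x = s * x / pi by rewrite mulrAC.
    have -> : (s * x / pi) ^+ 6 = `|s * x / pi| ^+ 6 by rewrite -normrX ger0_norm.
    by rewrite exprn_ege1// normf_div (gtr0_norm pi0) ler_pdivlMr// mul1r ltW.
  move=> w; have := S1 w; rewrite ler_norml => /andP[h1 h2].
  have a0 : 0 <= (s / pi) ^+ 6 * U w ^+ 6 by rewrite mulr_ge0.
  have b0 : 0 <= (s / pi) ^+ 6 * V w ^+ 6 by rewrite mulr_ge0.
  have SS : 2^-1 * (S w ^+ 2 - S w) <= 1 by nra.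
  have ind : 0 <= ((U w * V w < 0)%R)%:R :> R by [].
  rewrite /X mulrDr.
  have [hu|hu] := ltP pi `|s * U w|; first by have := big _ hu; lra.
  have [hv|hv] := ltP pi `|s * V w|; first by have := big _ hv; lra.
  case: ltP => [_|uv] /=; first by lra.
  suff : 0 <= S w by nra.
  move: hu hv; rewrite !ler_norml /S => /andP[u1 u2] /andP[v1 v2].
  have [U0|U0] := leP 0 (U w); have [V0|V0] := leP 0 (V w).
  - by rewrite mulr_ge0// sin_ge0_pi// mulr_ge0// ltW.
  - have -> : U w = 0 by apply/eqP; rewrite eq_le U0 andbT -(nmulr_lge0 _ V0).
    by rewrite mulr0 sin0 mul0r.
  - have -> : V w = 0 by apply/eqP; rewrite eq_le V0 andbT -(nmulr_rge0 _ U0).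
    by rewrite mulr0 sin0 mulr0.
  - have nU : 0 <= - (s * U w) <= pi.
      by apply/andP; split; [rewrite oppr_ge0 pmulr_rle0// ltW|lra].
    have nV : 0 <= - (s * V w) <= pi.
      by apply/andP; split; [rewrite oppr_ge0 pmulr_rle0// ltW|lra].
    by rewrite -mulrNN -!sinN mulr_ge0// sin_ge0_pi.
- have -> : Ex P X = 2^-1 * (Ex P (fun w => S w ^+ 2) - Ex P S) -
      (s / pi) ^+ 6 * (Ex P (fun w => U w ^+ 6) + Ex P (fun w => V w ^+ 6)).
    by rewrite -(ExB IS2 IS) -(ExD IU IV) -(ExZ _ (intgB IS2 IS)) -(ExZ _ (intgD IU IV)) -(ExB I1 I2).
  have h3 : (s / pi) ^+ 6 * (Ex P (fun w => U w ^+ 6) + Ex P (fun w => V w ^+ 6)) <= 2 * (C3 * C ^+ 3 * s ^+ 6).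
    have cub v : 0 <= v -> v <= C -> C3 * v ^+ 3 <= C3 * C ^+ 3.
      by move=> v0 vC; rewrite ler_wpM2l// lerXn2r ?nnegrE// (le_trans v0).
    have hs : (s / pi) ^+ 6 <= s ^+ 6.
      by rewrite lerXn2r ?nnegrE ?divr_ge0 ?(ltW s0) ?(ltW pi0)// ler_pdivrMr// ler_peMr// ltW.
    have -> : 2 * (C3 * C ^+ 3 * s ^+ 6) = s ^+ 6 * (C3 * C ^+ 3 + C3 * C ^+ 3) by ring.
    apply: ler_pM => //.
    - by rewrite exprn_ge0// divr_ge0// ltW.
    - by rewrite addr_ge0//; apply: Ex_ge0 => w; rewrite (exprM _ 2 3) exprn_ge0// sqr_ge0.
    - by rewrite lerD// ?(le_trans EU)// ?(le_trans EV)// cub.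
  by move: ES ES2 h3; lra.
Qed.

End sign_pair.

Section mean_zeros.
Context {d : measure_display} {T : measurableType d} {R : realType} (P : probability T R).

(** Pairs of points at distance [L], placed in disjoint blocks of length 2 L, change sign with
    probability at least [c0], because [L] is so large that the two points are almost
    uncorrelated. *)
Lemma mean_zeros_ge (C lam C3 : R) : 0 <= C -> 0 < lam -> 0 <= C3 ->
  (forall W v, gauss P W v -> intg P (fun w => W w ^+ 6) /\ Ex P (fun w => W w ^+ 6) <= C3 * v ^+ 3) ->
  exists L k c, [/\ 0 < L, 0 < k, 0 < c & forall a b (Y : R -> T -> R) eps,
    gaussian_smooth P `]a, b[%classic Y ->
    (forall t, a < t < b -> lam <= Ex P (fun w => Y t w ^+ 2) <= C) ->
    (forall t u, a < t < b -> a < u < b ->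
       `|Ex P (fun w => Y t w * Y u w)| <= C / (1 + (u - t) ^+ 2) + C * eps) ->
    C * eps <= k -> 4 * L <= b - a ->
    ((c * (b - a))%:E <= \int[P]_w (counting (zero_set (Y ^~ w) a b) : \bar R))%E].
Proof.
move=> C0 lam0 C30 HC3.
(* The first bound keeps 2 s^2 lam <= 1; the second makes the sixth power term at most a quarter of
   s^4 lam^2 / 8. *)
pose s2 := Num.min (1 / (2 * lam)) (lam ^+ 2 / (64 * (C3 * C ^+ 3 + 1))).
have q0 : 0 < C3 * C ^+ 3 + 1 by rewrite ltr_wpDl// mulr_ge0// exprn_ge0.
have s20 : 0 < s2 by rewrite lt_min !divr_gt0 ?mulr_gt0 ?exprn_gt0.
pose s := Num.sqrt s2; have s0 : 0 < s by rewrite sqrtr_gt0.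
have ss : s ^+ 2 = s2 by rewrite sqr_sqrtr// ltW.
have slam : 2 * s ^+ 2 * lam <= 1.
  rewrite ss mulrAC -ler_pdivlMl ?mulr_gt0// mulrC.
  by rewrite /s2 ge_min lexx.
have s6 : 2 * (C3 * C ^+ 3 * s ^+ 6) <= s ^+ 4 * lam ^+ 2 / 32.
  have h : s2 * (64 * (C3 * C ^+ 3 + 1)) <= lam ^+ 2.
    by rewrite -ler_pdivlMr ?mulr_gt0// /s2 ge_min lexx orbT.
  have -> : s ^+ 6 = s2 * s ^+ 4 by rewrite -ss; ring.
  have s4 : 0 <= s ^+ 4 by rewrite exprn_ge0// ltW.
  have h2 : s ^+ 4 * (s2 * (64 * (C3 * C ^+ 3 + 1))) <= s ^+ 4 * lam ^+ 2 by rewrite ler_wpM2l.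
  have h3 : 0 <= s ^+ 4 * s2 by rewrite mulr_ge0// ltW.
  by move: h2 h3; set A := s ^+ 4 * lam ^+ 2; set D := C3 * C ^+ 3; set B := s ^+ 4; nra.
(* [L] makes C / (1 + L^2) <= k, and C eps <= k, so the covariance is at most 2 k and costs s^4
   lam^2 / 32. Of s^4 lam^2 / 8 there remains s^4 lam^2 / 16, which is [c0]. *)
pose k := s ^+ 2 * lam ^+ 2 / 32.
have k0 : 0 < k by rewrite divr_gt0// mulr_gt0 ?exprn_gt0.
pose L := C / k + 1; have L1 : 1 <= L by rewrite lerDr divr_ge0// ltW.
have L0 : 0 < L by lra.
pose c0 := s ^+ 4 * lam ^+ 2 / 16; have c00 : 0 < c0 by rewrite divr_gt0// mulr_gt0 ?exprn_gt0.
exists L, k, (c0 / (4 * L)); split=> //; first by rewrite divr_gt0// mulr_gt0.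
move=> a b Y eps gsY HV HC Ck Lab.
have [oO sY gY] := gsY.
pose n := Num.truncn ((b - a) / (2 * L)).
pose u (i : nat) := a + (2 * i%:R + 1 / 2) * L.
pose v (i : nat) := a + (2 * i%:R + 3 / 2) * L.
have /truncn_itv /andP[n1 n2] : 0 <= (b - a) / (2 * L) by rewrite divr_ge0; lra.
rewrite -/n ler_pdivlMr ?mulr_gt0// in n1.
rewrite -/n ltr_pdivrMr ?mulr_gt0// -natr1 in n2.
have uvin (i : nat) : (i < n)%N -> [/\ a < u i, u i < v i & v i < b].
  move=> i_n; have i1 : i%:R + 1 <= n%:R :> R by rewrite natr1 ler_nat.
  have i0 : 0 <= i%:R :> R by [].
  have h : (i%:R + 1) * (2 * L) <= b - a by rewrite (le_trans _ n1)// ler_wpM2r// mulr_ge0// ltW.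
  have h' : 0 <= i%:R * L by rewrite mulr_ge0// ltW.
  have uE : u i = a + 2 * (i%:R * L) + L / 2 by rewrite /u; field.
  have vE : v i = a + 2 * (i%:R * L) + 3 * L / 2 by rewrite /v; field.
  have hE : (i%:R + 1) * (2 * L) = 2 * (i%:R * L) + 2 * L by ring.
  by rewrite uE vE; rewrite hE in h; split; lra.
have SP (i : nat) : (i < n)%N -> exists X : T -> R, [/\ intg P X, forall w, X w <= ((Y (u i) w * Y (v i) w < 0)%R)%:R & c0 <= Ex P X].
  move=> i_n; have [au uv vb] := uvin i i_n.
  have Ou : a < u i < b by rewrite au (lt_trans uv).
  have Ov : a < v i < b by rewrite vb andbT (lt_trans au).
  have /andP[lu uC] := HV _ Ou; have /andP[lv vC] := HV _ Ov.
  pose c := Ex P (fun w => Y (u i) w * Y (v i) w).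
  have Ou' : `]a, b[%classic (u i) by rewrite /= in_itv.
  have Ov' : `]a, b[%classic (v i) by rewrite /= in_itv.
  have [mU IU] := pderive_sqr gsY 0 Ou'; have [mV IV] := pderive_sqr gsY 0 Ov'.
  have IUV : intg P (fun w => Y (u i) w * Y (v i) w) by exact: intg_sqr_mul.
  have g (x y : R) : gauss P (fun w => x * Y (u i) w + y * Y (v i) w)
     (x ^+ 2 * Ex P (fun w => Y (u i) w ^+ 2) + 2 * x * y * c + y ^+ 2 * Ex P (fun w => Y (v i) w ^+ 2)).
    have [|vv gv] := gY [:: (x, u i); (y, v i)].
      by move=> z; rewrite !inE => /orP[] /eqP ->.
    have E : (fun w => \sum_(z <- [:: (x, u i); (y, v i)]) z.1 * Y z.2 w) = fun w => x * Y (u i) w + y * Y (v i) w.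
      by apply/funext => w; rewrite big_cons big_seq1.
    rewrite E in gv; rewrite (_ : _ + _ = vv)// -(gauss_var gv).
    rewrite (_ : (fun w => (x * _ + _) ^+ 2) = fun w => x ^+ 2 * Y (u i) w ^+ 2 + (2 * x * y) * (Y (u i) w * Y (v i) w) + y ^+ 2 * Y (v i) w ^+ 2); last first.
      by apply/funext => w; ring.
    rewrite ExD; [|by apply: intgD; exact: intgZ|exact: intgZ].
    rewrite ExD; [|exact: intgZ|exact: intgZ].
    by rewrite !ExZ.
  have [X [IX X1 X2]] := sign_pair g lu lv uC vC lam0 s0 slam C30 HC3.
  exists X; split=> //; apply: le_trans X2.
  have c2 : `|c| <= 2 * k.
    apply: (le_trans (HC _ _ Ou Ov)); rewrite mulr2n mulrDl mul1r lerD//.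
    have -> : v i - u i = L by rewrite /u /v; field.
    rewrite ler_pdivrMr; last by rewrite ltr_pwDl// sqr_ge0.
    rewrite -ler_pdivrMl// mulrC; apply: (@le_trans _ _ L); first by rewrite /L lerDl.
    by have := mulr_ege1 L1 L1; nra.
  have : s ^+ 2 * `|c| / 2 <= s ^+ 4 * lam ^+ 2 / 32.
    have := ler_wpM2l (sqr_ge0 s) c2; rewrite /k.
    have -> : s ^+ 2 * (2 * (s ^+ 2 * lam ^+ 2 / 32)) = s ^+ 4 * lam ^+ 2 / 16 by field.
    by lra.
  by rewrite /c0; move: s6; lra.
have [X HX] : exists X : 'I_n -> T -> R, forall i, [/\ intg P (X i), forall w, X i w <= ((Y (u i) w * Y (v i) w < 0)%R)%:R & c0 <= Ex P (X i)].
  by have [X HX] := choice (fun i : 'I_n => SP i (ltn_ord i)); exists X.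
apply: (@le_trans _ _ (Ex P (fun w => \sum_i X i w))%:E); last first.
  apply: integral_ge.
  - by move=> w; exact: measure_ge0.
  - by apply: intg_sum => i _; have [] := HX i.
  - move=> w; apply: (le_trans _ (@sign_changes_le R (Y ^~ w) a b n u v (@sY w) _ _)).
    + by rewrite lee_fin natr_sum; apply: ler_sum => i _; have [_ /(_ w)] := HX i.
    + by move=> i i_n; have [? [? ?]] := uvin i i_n.
    + move=> i j /andP[ij jn]; rewrite /u /v lerD2l ler_wpM2r ?(ltW L0)//.
      have : i%:R + 1 <= j%:R :> R by rewrite natr1 ler_nat.
      by lra.
rewrite lee_fin Ex_sum; last by move=> i _; have [] := HX i.
apply: (@le_trans _ _ (\sum_(i < n) c0)).
  rewrite sumr_const card_ord -[_ *+ n]mulr_natl.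
  rewrite mulrAC ler_pdivrMr ?mulr_gt0// (_ : n%:R * c0 * (4 * L) = c0 * (2 * (n%:R * (2 * L)))); last by ring.
  by rewrite ler_wpM2l ?(ltW c00)//; move: n2; rewrite mulrDl mul1r; lra.
by apply: ler_sum => i _; have [] := HX i.
Qed.

End mean_zeros.

(** * Zeros on a long interval *)

Section scales.
Context {R : realType}.
Variable K : R.
Hypothesis K4 : 4 <= K.
Local Notation kap := (K^-1).

Lemma K_gt0 : 0 < K. Proof. exact: lt_le_trans K4. Qed.
Lemma K_ge1 : 1 <= K. Proof. by apply: le_trans K4; rewrite ler1n. Qed.
Lemma kap_gt0 : 0 < kap. Proof. by rewrite invr_gt0 K_gt0. Qed.
Lemma kap_le1 : kap <= 1. Proof. by rewrite invf_le1 ?K_gt0// K_ge1. Qed.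
Lemma kapX_gt0 n : 0 < kap ^+ n. Proof. by rewrite exprn_gt0// kap_gt0. Qed.
Lemma kapX_le m n : (n <= m)%N -> kap ^+ m <= kap ^+ n.
Proof. by move=> nm; rewrite ler_wiXn2l// ?kap_le1// ltW// kap_gt0. Qed.
Lemma kapXK n : K ^+ n * kap ^+ n = 1.
Proof. by rewrite -exprMn mulfV ?expr1n// gt_eqF// K_gt0. Qed.

(** For this degree the slope is at most 2 K^18. At distance kap^17 from 0 the exponent in [chi_pos]
    has reached K^2 / 8, while up to distance kap^19 the value stays below 1 / 2. *)
Definition chi_degree := Num.truncn (K ^+ 38).

Lemma chi_degree_le : chi_degree%:R <= K ^+ 38 :> R.
Proof. by rewrite truncn_le exprn_ge0// ltW// K_gt0. Qed.

Lemma chi_degree_ge : K ^+ 38 / 2 <= chi_degree%:R :> R.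
Proof.
have h : K ^+ 38 < chi_degree.+1%:R by exact: truncnS_gt.
have : 1 <= K ^+ 37 by rewrite exprn_ege1// K_ge1.
rewrite -natr1 in h; rewrite exprS in h *; move: h; set x := K ^+ 37.
move=> h x1; have h2 : 4 * x <= K * x by apply: ler_wpM2r K4; lra.
by lra.
Qed.

Lemma sign_slope_chi : sign_slope chi_degree <= 2 * K ^+ 19.
Proof.
have K19 : 0 <= K ^+ 19 by rewrite exprn_ge0// ltW// K_gt0.
apply: (le_trans (sign_slope_le _)); rewrite -(@ler_pXn2r _ 2) ?nnegrE ?sqrtr_ge0//; last lra.
rewrite sqr_sqrtr// exprMn -exprM -natr1 -muln2 natrM.
have := chi_degree_le; set x := K ^+ (19 * 2); rewrite -/(K ^+ 38) -/x.
have : 1 <= x by rewrite exprn_ege1// K_ge1.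
by lra.
Qed.

Local Notation chi := (chi chi_degree K).

Lemma slope_chi : sign_slope chi_degree / K <= 2 * K ^+ 18.
Proof.
rewrite ler_pdivrMr ?K_gt0// (le_trans sign_slope_chi)//.
by rewrite -mulrA -exprSr.
Qed.

Lemma one_sub_chi2_ge0 x : 0 <= 1 - chi x ^+ 2.
Proof. by rewrite subr_ge0 -[chi x ^+ 2]real_normK ?num_real// exprn_ile1// chi_norm// K_gt0. Qed.

Lemma chi_near0 x : `|x| <= kap ^+ 19 -> 1 / 2 <= 1 - chi x ^+ 2.
Proof.
move=> x19; have h : `|chi x| <= 1 / 2.
  apply: (le_trans (chi_le chi_degree K_gt0 x)).
  apply: (@le_trans _ _ (2 * K ^+ 18 * kap ^+ 19)).
    by rewrite ler_pM ?slope_chi// divr_ge0 ?sign_slope_ge0// ltW// K_gt0.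
  rewrite [kap ^+ 19]exprSr mulrA -[2 * _ * _]mulrA kapXK mulr1.
  by rewrite ler_pdivrMr ?K_gt0//; have k4 := K4; lra.
have : `|chi x| ^+ 2 <= (1 / 2) ^+ 2 by rewrite lerXn2r ?nnegrE.
by rewrite real_normK ?num_real//; lra.
Qed.

Definition tail_const : R := 2 * (8 ^+ 18 * 18`!%:R).

Lemma tail_const_ge0 : 0 <= tail_const.
Proof. by apply: mulr_ge0; [exact: ler0n|apply: mulr_ge0; [apply: exprn_ge0; exact: ler0n|exact: ler0n]]. Qed.

Lemma chi_far x : kap ^+ 17 <= `|x| -> `|x| <= K -> 1 - `|chi x| <= tail_const * kap ^+ 17.
Proof.
wlog x0 : x / 0 <= x => [H|] h1 h2.
  have [x0|x0] := leP 0 x; first exact: H.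
  by rewrite -normrN -chiN H ?normrN// oppr_ge0 ltW.
rewrite (ger0_norm x0) in h1 h2.
have [|chi0 H] := @chi_pos R chi_degree K K_gt0 x; first by rewrite x0.
rewrite (ger0_norm chi0) (le_trans H)//.
set E := expR _.
have EE : E <= expR (- (K ^+ 2 / 8)).
  rewrite ler_expR lerN2.
  have -> : K ^+ 2 / 8 = K ^+ 38 / 2 * (kap ^+ 18) ^+ 2 / 4.
    by field; rewrite gt_eqF// K_gt0.
  rewrite ler_wpM2r//; apply: ler_pM.
  - by rewrite divr_ge0// exprn_ge0// ltW// K_gt0.
  - exact: sqr_ge0.
  - exact: chi_degree_ge.
  - rewrite lerXn2r ?nnegrE ?divr_ge0 ?(ltW K_gt0) ?(ltW (kapX_gt0 _))//.
    by rewrite exprSr ler_wpM2r// ltW// kap_gt0.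
apply: (le_trans (ler_wpM2l (sign_slope_ge0 _) EE)).
apply: (le_trans (ler_wpM2r (expR_ge0 _) sign_slope_chi)).
have q0 : 0 <= K ^+ 2 / 8 by rewrite divr_ge0// sqr_ge0.
(* The power 18 bounds K^36 by a multiple of exp (K^2 / 8); dividing the slope K^19 by it leaves
   kap^17. *)
have := pow_fact_le_expR 18 q0; rewrite expRN.
have e0 := expR_gt0 (K ^+ 2 / 8); move: e0; set e := expR _ => e0 h.
rewrite ler_pdivrMr// /tail_const.
have {h} : K ^+ 36 <= 8 ^+ 18 * 18`!%:R * e.
  move: h; rewrite expr_div_n -exprM ler_pdivrMr ?exprn_gt0//.
  by move=> h; apply: (le_trans h); rewrite mulrC mulrA.
set D := 8 ^+ 18 * _ => h.
have -> : 2 * D * kap ^+ 17 * e = 2 * (D * e) * kap ^+ 17 by ring.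
have -> : 2 * K ^+ 19 = 2 * K ^+ 36 * kap ^+ 17.
  by rewrite -mulrA; congr (2 * _); rewrite -[36%N]/(19 + 17)%N exprD -mulrA kapXK mulr1.
by rewrite ler_wpM2r ?(ltW (kapX_gt0 _))// ler_wpM2l.
Qed.

(** With the exact sign in place of chi the difference would vanish for nonzero x and y. On [-K, K]
    chi has the right sign and the error is half of 1 - |chi x chi y|; beyond K one of the even
    powers exceeds 1, and the error never does. *)
Lemma sign_change_chi p x y :
  `| ((x * y < 0)%R)%:R - (1 - chi x * chi y) / 2| <=
  (1 - chi x ^+ 2) + (1 - chi y ^+ 2) + (kap * x) ^+ p.*2.+2 + (kap * y) ^+ p.*2.+2.
Proof.
have sx0 := one_sub_chi2_ge0 x; have sy0 := one_sub_chi2_ge0 y.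
have ev (z : R) : 0 <= z ^+ p.*2.+2 by rewrite -even_pow_norm exprn_ge0.
have big z : K < `|z| -> 1 <= (kap * z) ^+ p.*2.+2.
  move=> h; rewrite -even_pow_norm exprn_ege1// normrM gtr0_norm ?kap_gt0//.
  by rewrite ler_pdivlMl ?K_gt0// mulr1 ltW.
have st : `|chi x * chi y| <= 1 by rewrite normrM mulr_ile1// chi_norm// K_gt0.
have ub : `| ((x * y < 0)%R)%:R - (1 - chi x * chi y) / 2| <= 1.
  by move: st; rewrite !ler_norml; case: (_ < 0) => /=; move=> /andP[? ?]; apply/andP; split; lra.
have [hx|hx] := ltP K `|x|.
  by apply: (le_trans ub); have := big _ hx; have := ev (kap * y); lra.
have [hy|hy] := ltP K `|y|.
  by apply: (le_trans ub); have := big _ hy; have := ev (kap * x); lra.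
suff : `| ((x * y < 0)%R)%:R - (1 - chi x * chi y) / 2| <= (1 - chi x ^+ 2) + (1 - chi y ^+ 2).
  by have := ev (kap * y); have := ev (kap * x); lra.
have pos z : `|z| <= K -> 0 <= z -> 0 <= chi z.
  by move=> zK z0; have [|//] := @chi_pos R chi_degree K K_gt0 z; rewrite z0 -(ger0_norm z0).
have neg z : `|z| <= K -> z <= 0 -> chi z <= 0.
  by move=> zK z0; rewrite -oppr_ge0 -chiN pos ?normrN// oppr_ge0.
have key (u v : R) : `|u| <= 1 -> `|v| <= 1 -> 1 - `|u| * `|v| <= 1 - u ^+ 2 + (1 - v ^+ 2).
  move=> u1 v1; rewrite -[u ^+ 2]real_normK ?num_real// -[v ^+ 2]real_normK ?num_real//.
  by move: u1 v1 (normr_ge0 u) (normr_ge0 v); set a := `|u|; set b := `|v|; nra.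
have := key _ _ (chi_norm chi_degree K x) (chi_norm chi_degree K y).
rewrite -normrM; case: ltP => xy /=.
  have cc : chi x * chi y <= 0.
    have [x0|x0] := leP 0 x.
      by rewrite mulr_ge0_le0 ?pos ?neg//; move: xy; rewrite ltNge; apply: contraNT; rewrite -ltNge => /ltW; exact: mulr_ge0.
    by rewrite mulr_le0_ge0 ?neg ?(ltW x0) ?pos//; move: xy; rewrite nmulr_rlt0// => /ltW.
  by rewrite (ler0_norm cc) => h; rewrite ger0_norm; [lra|move: st; rewrite (ler0_norm cc); lra].
have cc : 0 <= chi x * chi y.
  have [x0|x0] := ltP 0 x.
    by rewrite mulr_ge0 ?pos ?(ltW x0)//; move: xy; rewrite pmulr_rge0.
  have [y0|y0] := leP y 0; first by rewrite mulr_le0 ?neg.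
  have -> : x = 0 by apply/eqP; rewrite eq_le x0 -(pmulr_lge0 _ y0).
  by rewrite chi0 mul0r.
rewrite (ger0_norm cc) => h; rewrite sub0r normrN ger0_norm; first by lra.
by move: st; rewrite (ger0_norm cc); lra.
Qed.

End scales.

Lemma chi_tail {R : realType} : exists2 c : R, 0 <= c &
  forall K x, 4 <= K -> K^-1 ^+ 17 <= `|x| -> `|x| <= K ->
    1 - `|chi (chi_degree K) K x| <= c * K^-1 ^+ 17.
Proof. by exists (@tail_const R); [exact: tail_const_ge0|move=> K x K4; exact: chi_far]. Qed.

Section long_interval.
Context {d : measure_display} {T : measurableType d} {R : realType} (P : probability T R).
Variables (a b : R) (Y : R -> T -> R) (C lam eps K Cp ct : R) (k p : nat).
Local Notation O := (`]a, b[%classic : set R).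
Local Notation kap := (K^-1).
Hypotheses (gsY : gaussian_smooth P O Y) (k0 : (0 < k)%N) (C0 : 0 <= C) (lam0 : 0 < lam)
  (eps0 : 0 <= eps) (K4 : 4 <= K) (TK : K ^+ 72 <= b - a) (epsK : eps <= kap ^+ 72)
  (HC2 : forall j t, (j <= (2 * k).+1)%N -> O t -> Ex P (fun w => pderive j Y t w ^+ 2) <= C)
  (Hlam : forall t, O t -> forall a0 a1 a2 : R, lam * (a0 ^+ 2 + a1 ^+ 2 + a2 ^+ 2) <=
    Ex P (fun w => (a0 * pderive 0 Y t w + (a1 * pderive 1 Y t w + a2 * pderive 2 Y t w)) ^+ 2))
  (HC4 : forall s t, O s -> O t ->
     `|Ex P (fun w => Y s w * Y t w)| <= C / (1 + (t - s) ^+ 2) + C * eps)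
  (ct0 : 0 <= ct) (Hct : forall x, kap ^+ 17 <= `|x| -> `|x| <= K ->
    1 - `|chi (chi_degree K) K x| <= ct * kap ^+ 17)
  (Cp0 : 0 <= Cp) (pk : (72 * k + 20 <= p)%N)
  (HCp : forall V v, gauss P V v ->
    intg P (fun w => V w ^+ p.+1.*2) /\ Ex P (fun w => V w ^+ p.+1.*2) <= Cp * v ^+ p.+1).

(* All scales are powers of [kap]: cells have width at most [kap ^+ 16], and the
   smooth sign is [kap ^+ 17]-close to the sign outside [-kap^17, kap^17]. *)
Definition cells := (Num.truncn ((b - a) * K ^+ 16)).+1.
Local Notation M := cells.
Local Notation L := (b - a).

Let K0 : 0 < K. Proof. exact: K_gt0. Qed.
Let K1 : 1 <= K. Proof. exact: K_ge1. Qed.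
Let kap0 : 0 < kap. Proof. exact: kap_gt0. Qed.

Lemma len_ge1 : 1 <= L. Proof. by apply: le_trans TK; rewrite exprn_ege1. Qed.
Let L0 : 0 < L. Proof. exact: lt_le_trans len_ge1. Qed.
Let ab : a < b. Proof. by rewrite -subr_gt0. Qed.

Lemma cells_gt : L * K ^+ 16 < M%:R.
Proof. exact: truncnS_gt. Qed.

Lemma cells_kap : M%:R * kap ^+ 16 <= 2 * L.
Proof.
have h : M%:R <= 2 * (L * K ^+ 16).
  rewrite (_ : 2 * (L * K ^+ 16) = L * K ^+ 16 + L * K ^+ 16); last by ring.
  rewrite /cells -[(Num.truncn _).+1%:R]natr1 lerD//.
    by rewrite truncn_le mulr_ge0 ?exprn_ge0// ltW.
  by rewrite mulr_ege1 ?len_ge1// exprn_ege1.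
apply: (le_trans (ler_wpM2r (ltW (kapX_gt0 K4 16)) h)).
by rewrite -mulrA -[L * _ * _]mulrA kapXK// mulr1.
Qed.

Lemma cells_kapX n y : (16 + y <= n)%N -> M%:R * kap ^+ n <= 2 * L * kap ^+ y.
Proof.
move=> ny; apply: (@le_trans _ _ (M%:R * kap ^+ (16 + y))).
  by rewrite ler_wpM2l// kapX_le.
by rewrite exprD mulrA ler_wpM2r ?cells_kap// ltW// kapX_gt0.
Qed.

Lemma cells_gt1 : (1 < M)%N.
Proof.
rewrite -(ltr_nat R); apply: le_lt_trans cells_gt.
by rewrite mulr_ege1 ?len_ge1// exprn_ege1.
Qed.
Let M2 := cells_gt1.
Let M0 : 0 < M%:R :> R. Proof. by []. Qed.

Lemma cell_width : L / M%:R <= kap ^+ 16.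
Proof.
rewrite ler_pdivrMr// mulrC; have := ler_wpM2r (ltW (kapX_gt0 K4 16)) (ltW cells_gt).
by rewrite -mulrA kapXK// mulr1.
Qed.

Lemma cell_width1 : L / M%:R <= 1.
Proof. by apply: (le_trans cell_width); rewrite exprn_ile1 ?kap_le1// ltW. Qed.

Local Notation U := (samples a b Y M).

Definition sgn_chi (x : R) := chi (chi_degree K) K x.

(** It measures how far sample i is from having a clear sign. Its sum is an affine function of the
    product statistic with shift 0, so it concentrates just as the sign changes do. *)
Definition flat i w := 1 - sgn_chi (U w i) ^+ 2.
Definition large i w := (kap * U w i) ^+ p.*2.+2.

Lemma gauss_sample i : exists2 v, gauss P (fun w => U w i) v & v <= C.
Proof.
have [v gv] := gU1 (gauss_samples gsY ab M2) i; exists v => //.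
by rewrite -(gauss_var gv); have := HC2 (leq0n _) (inner_in ab M2 i).
Qed.

Lemma large_ge0 i w : 0 <= large i w.
Proof. by rewrite /large -even_pow_norm exprn_ge0. Qed.

Lemma Ex_large i : intg P (large i) /\ Ex P (large i) <= Cp * C ^+ p.+1 * kap ^+ p.*2.+2.
Proof.
have [v gv vC] := gauss_sample i; have [I E] := HCp gv; have [_ v0 _] := gv.
have -> : large i = fun w => kap ^+ p.*2.+2 * U w i ^+ p.*2.+2.
  by apply/funext => w; rewrite /large exprMn.
split; first exact: intgZ.
rewrite ExZ// mulrC ler_wpM2r ?(ltW (kapX_gt0 K4 _))// (le_trans E)// ler_wpM2l//.
by rewrite lerXn2r ?nnegrE// (le_trans v0).
Qed.

Lemma flat_ge0 i w : 0 <= flat i w.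
Proof. exact: one_sub_chi2_ge0. Qed.

Lemma intg_flat i : intg P (flat i).
Proof.
have m : measurable_fun setT (fun w => sgn_chi (U w i)).
  exact: (measurable_chi (chi_degree K) K gsY ab M2 i).
apply: (@intg_bnd _ _ _ P _ 1).
  by apply: measurable_funB => //; exact: measurable_funX.
by move=> w; rewrite ger0_norm ?flat_ge0// /flat gerBl sqr_ge0.
Qed.

Definition flat_const := 2 * (expR (1 / 2) / Num.sqrt lam + ct + Cp * C ^+ p.+1).

(** Three cases: samples below kap^17 are rare by the small ball estimate, samples above K by the
    moment bound, and in between 1 - |chi| is at most ct kap^17. *)
Lemma Ex_flat i : Ex P (flat i) <= flat_const * kap ^+ 17.
Proof.
have mU : measurable_fun setT (fun w => U w i) by exact: measurable_samples gsY ab M2 i.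
pose l := [:: ((fun w => U w i), kap ^+ 17)].
pose A := [set w | forall x, List.In x l -> `|x.1 w| <= x.2].
have AE : A = (fun w => `|U w i|) @^-1` `]-oo, kap ^+ 17]%classic.
  apply/seteqP; split => w /=; rewrite in_itv /=; last by move=> h x [<-|[]].
  by move=> h; exact: (h ((fun w => U w i), kap ^+ 17) (or_introl erefl)).
have mA : measurable A.
  have mn : measurable_fun setT (fun w => `|U w i|) by exact: (measurableT_comp (@normr_measurable R setT)).
  by rewrite AE; have := mn measurableT _ (measurable_itv `]-oo, kap ^+ 17]); rewrite setTI.
have PA : (P A <= (expR (1 / 2) / Num.sqrt lam * kap ^+ 17)%:E)%E.
  apply: le_trans (small_ball (l := l) lam0 _ _ _) _.
  - by move=> x [<-|[]] /=; exact: kapX_gt0.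
  - by move=> x [<-|[]].
  - case=> [//|a0 [|//]] _.
    have [v gv] := gauss_samples gsY ab M2 [:: (a0, i)].
    exists v; last first.
      rewrite /sqr_list big_seq1 -(gauss_var gv).
      have := Hlam (inner_in ab M2 i) a0 0 0; rewrite expr0n /= !addr0 => h; apply: (le_trans h).
      rewrite le_eqVlt; apply/orP; left; apply/eqP; congr Ex; apply/funext => w.
      by rewrite /lincomb big_seq1 /= !mul0r !addr0.
    rewrite (_ : lin_list _ _ = (fun w => lincomb [:: (a0, i)] (U w)))//.
    by apply/funext => w; rewrite /lincomb big_seq1 /= addr0.
  - by rewrite lee_fin big_seq1 /= mulrA mulrAC.
have [IA EA] := Ex_indicator mA PA.
have [IL EL] := Ex_large i.
have point w : flat i w <= 2 * (\1_A w + ct * kap ^+ 17 + large i w).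
  have c1 : `|sgn_chi (U w i)| <= 1 by exact: chi_norm.
  have h1 : flat i w <= 2 * (1 - `|sgn_chi (U w i)|).
    rewrite /flat -[sgn_chi _ ^+ 2]real_normK ?num_real//.
    by move: c1 (normr_ge0 (sgn_chi (U w i))); set s := `|_|; nra.
  apply: (le_trans h1); rewrite ler_wpM2l//.
  have t0 : 0 <= ct * kap ^+ 17 by exact: mulr_ge0 ct0 (ltW (kapX_gt0 K4 _)).
  have l0 := large_ge0 i w; have i0 : 0 <= \1_A w :> R by rewrite indicE.
  have c0 := normr_ge0 (sgn_chi (U w i)).
  have [hs|hs] := leP `|U w i| (kap ^+ 17).
    rewrite indicE mem_set; last by rewrite AE /= in_itv.
    by rewrite /=; lra.
  have [hl|hl] := leP `|U w i| K.
    by have := Hct (ltW hs) hl; rewrite -/(sgn_chi (U w i)); lra.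
  have : 1 <= large i w.
    rewrite /large -even_pow_norm exprn_ege1// normrM gtr0_norm//.
    by rewrite ler_pdivlMl// mulr1 ltW.
  by lra.
have IR : intg P (fun w => \1_A w + ct * kap ^+ 17 + large i w).
  by apply: intgD => //; apply: intgD => //; exact: intg_cst.
apply: (@le_trans _ _ (Ex P (fun w => 2 * (\1_A w + ct * kap ^+ 17 + large i w)))).
  by apply: Ex_le => //; [exact: intg_flat|exact: intgZ].
rewrite ExZ// ExD//; last by apply: intgD => //; exact: intg_cst.
rewrite ExD//; last exact: intg_cst.
have -> : Ex P (fun=> ct * kap ^+ 17) = ct * kap ^+ 17 := Ex_cst P _.
rewrite /flat_const -mulrA ler_wpM2l// !mulrDl lerD// ?lerD//.
apply: (le_trans EL); rewrite ler_wpM2l ?mulr_ge0 ?exprn_ge0// kapX_le//.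
by rewrite (leq_trans _ (leqnSn _))//; clear -pk; lia.
Qed.

Definition flat_sum w := \sum_(i < M.-1) flat i w.
Definition large_sum w := \sum_(i < M.-1) large i w.
Definition corr e := stat M (chi_degree K) K (M.-1 - e) e.

Lemma flat_sumE w : flat_sum w = (M.-1)%:R - M%:R * corr 0 (U w).
Proof.
rewrite /corr /stat mulrA divff ?gt_eqF// mul1r subn0 /flat_sum /flat sumrB sumr_const card_ord.
by congr (_ - _); apply: eq_bigr => i _; rewrite addn0 expr2.
Qed.

Definition sign_changes w := (\sum_(1 <= i < M.-1) sign_change a b M (Y ^~ w) i)%N.

Lemma innerE i : (i < M.-1)%N -> inner a b M i = node a b M i.+1.
Proof. by move=> iM; rewrite /inner (minn_idPl _). Qed.

Lemma sign_changes_approx w :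
  `|(sign_changes w)%:R - ((M.-1 - 1)%:R - M%:R * corr 1 (U w)) / 2| <= 2 * flat_sum w + 2 * large_sum w.
Proof.
have -> : (sign_changes w)%:R - ((M.-1 - 1)%:R - M%:R * corr 1 (U w)) / 2 =
  \sum_(i < M.-1 - 1) (((U w i * U w i.+1 < 0)%R)%:R - (1 - sgn_chi (U w i) * sgn_chi (U w i.+1)) / 2).
  rewrite sumrB -mulr_suml sumrB sumr_const card_ord; congr (_ - (_ - _) / 2).
    rewrite subn1 /sign_changes big_add1 natr_sum big_mkord.
    apply: eq_bigr => i _; have iM := ltn_ord i.
    by rewrite /sign_change /samples !innerE//; clear -iM; lia.
  rewrite /corr /stat mulrA divff ?gt_eqF// mul1r.
  by apply: eq_bigr => i _; rewrite addn1.
apply: (le_trans (ler_norm_sum _ _ _)).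
apply: (@le_trans _ _ (\sum_(i < M.-1 - 1) ((flat i w + large i w) + (flat i.+1 w + large i.+1 w)))).
  apply: ler_sum => i _; have := sign_change_chi K4 p (U w i) (U w i.+1).
  rewrite -/(sgn_chi (U w i)) -/(sgn_chi (U w i.+1)) -/(flat i w) -/(flat i.+1 w) -/(large i w) -/(large i.+1 w).
  by lra.
have f0 i : 0 <= flat i w + large i w by rewrite addr_ge0 ?flat_ge0 ?large_ge0.
have M1 : (0 < M.-1)%N by rewrite -ltnS prednK.
have S : \sum_(0 <= i < M.-1) (flat i w + large i w) = flat_sum w + large_sum w by rewrite big_mkord big_split.
rewrite big_split /= (_ : 2 * flat_sum w + 2 * large_sum w = (flat_sum w + large_sum w) + (flat_sum w + large_sum w)); last by ring.
rewrite -S; apply: lerD.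
  rewrite -(big_mkord xpredT (fun i => flat i w + large i w)).
  rewrite [leRHS](@big_cat_nat _ _ _ (M.-1 - 1) 0 M.-1) ?leq_subr//= lerDl.
  by apply: sumr_ge0 => i _.
rewrite [leRHS]big_ltn// -[leLHS]add0r lerD// big_add1 -subn1 big_mkord.
exact: ler_sum.
Qed.

Lemma near_zero_flat w : (\sum_(1 <= i < M) near_zero a b M (Y ^~ w) (kap ^+ 19) i)%:R <= 2 * flat_sum w.
Proof.
rewrite big_add1 natr_sum big_mkord /flat_sum mulr_sumr; apply: ler_sum => i _.
have := flat_ge0 i w; rewrite /near_zero -innerE// -/(U w i).
move=> f0; case h : (`|U w i| <= _) => /=; move: f0.
  by have := chi_near0 K4 h; rewrite -/(sgn_chi (U w i)) -/(flat i w); lra.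
by lra.
Qed.

Definition rest_const := 2 * (4 * (Cp * C ^+ p.+1) + 2 * jet_const lam).
Definition zero_mult := (2 * k).+1.*2.+1.

(** The errors are of two kinds. [V] gathers those of mean O(L kap^(72 k + 2)), for which Markov's
    inequality at level L kap costs O(kap^(72 k)). The mean of [flat_sum] is only O(L kap), so it is
    kept apart and left to concentration. *)
Lemma zeros_sandwich : exists V, [/\ intg P V, forall w, large_sum w <= V w,
   Ex P V <= rest_const * L * kap ^+ (72 * k + 2) &
   {ae P, forall w, (counting (zero_set (Y ^~ w) a b) <=
      ((sign_changes w)%:R + zero_mult%:R * (6 * flat_sum w + V w + 1))%:E)%E}].
Proof.
have [oO sY _] := gsY; set m := (2 * k)%N.
have m2 : (2 <= m)%N by rewrite /m; clear -k0; lia.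
have p0 : (0 < p)%N by clear -pk; lia.
have HCm t : O t -> Ex P (fun w => pderive m.+1 Y t w ^+ 2) <= C by exact: HC2.
have HCo t : O t -> Ex P (fun w => pderive 2 Y t w ^+ 2) <= C by apply: HC2; rewrite ltnW.
have [gD [ID D0 ED aeD]] := dyadic_total_dom gsY C0 Cp0 lam0 K0 m2 p0 HCm HCp Hlam ab M2.
(* Over a cell the derivative typically varies by O(kap^16), so kap^3 is a generous threshold; times
   the cell width it gives kap^19, the level of [chi_near0]. *)
have B0 : 0 < kap ^+ 3 by exact: kapX_gt0.
have CC : 0 <= Cp * C ^+ p.+1 by rewrite mulr_ge0// exprn_ge0.
have HO i : exists g, [/\ intg P g, forall w, 0 <= g w, Ex P g <= Cp * C ^+ p.+1 * kap ^+ p.*2.+2 &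
    {ae P, forall w, (i < M)%N -> big_osc a b M (Y ^~ w) (kap ^+ 3) i -> 1 <= g w}].
  have [iM|iM] := ltnP i M; last first.
    exists (cst 0); split=> //; [exact: intg_cst| |exact: aeW].
    by rewrite Ex_cst; apply: mulr_ge0 CC (ltW (kapX_gt0 K4 _)).
  have [|g [Ig g0 Eg aeg]] := osc_dom gsY C0 Cp0 HCo HCp (node_lt ab M2 (ltnSn i)) _ B0.
    move=> t /andP[h1 h2]; rewrite /= in_itv/= (le_lt_trans _ h1)/= ?(lt_le_trans h2)//.
      by rewrite -[leRHS](nodeM ab M2) node_le.
    by rewrite -[leLHS](node0 a b M) node_le.
  exists g; split=> //; last by apply: filterS aeg => w h _ /asboolP.
  apply: (le_trans Eg); rewrite node_step// -[Cp * _ * kap ^+ _]mulrA ler_wpM2l//.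
  have -> : kap ^+ p.*2.+2 = (kap ^+ 2) ^+ p.+1 by rewrite -exprM mul2n doubleS.
  have w0 : 0 <= L / M%:R by rewrite divr_ge0// ltW.
  have w1 : 0 <= L / M%:R / kap ^+ 3 by rewrite divr_ge0// ltW.
  rewrite -exprMn; apply: lerXn2r; rewrite ?nnegrE; [exact: mulr_ge0 C0 (sqr_ge0 _)|exact: mulr_ge0 C0 (sqr_ge0 _)|].
  rewrite ler_wpM2l//; apply: lerXn2r; rewrite ?nnegrE ?(ltW kap0)//.
  rewrite ler_pdivrMr// (le_trans cell_width)// -exprS kapX_le//.
have [gO HgO] := choice HO.
pose V w := large_sum w + (\sum_(i < M) gO i w + gD w).
have IO : intg P (fun w => \sum_(i < M) gO i w) by apply: intg_sum => i _; have [] := HgO i.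
have IL : intg P large_sum by apply: intg_sum => i _; have [] := Ex_large i.
have gO0 w : 0 <= \sum_(i < M) gO i w by apply: sumr_ge0 => i _; have [] := HgO i.
have kd : (16 + (72 * k + 2) <= p.*2.+2)%N by clear -pk; lia.
exists V; split.
- by apply: intgD => //; exact: intgD.
- by move=> w; rewrite /V lerDl addr_ge0.
- rewrite /V ExD//; last exact: intgD.
  rewrite ExD//.
  have E1 : Ex P large_sum <= 2 * L * kap ^+ (72 * k + 2) * (Cp * C ^+ p.+1).
    rewrite Ex_sum; last by move=> i _; have [] := Ex_large i.
    apply: (@le_trans _ _ (\sum_(i < M.-1) (Cp * C ^+ p.+1 * kap ^+ p.*2.+2))).
      by apply: ler_sum => i _; have [] := Ex_large i.
    rewrite sumr_const card_ord -[_ *+ _]mulr_natl mulrCA mulrC ler_wpM2r//.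
    apply: le_trans (cells_kapX kd); rewrite ler_wpM2r ?(ltW (kapX_gt0 K4 _))//.
    by rewrite ler_nat leq_pred.
  have E2 : Ex P (fun w => \sum_(i < M) gO i w) <= 2 * L * kap ^+ (72 * k + 2) * (Cp * C ^+ p.+1).
    rewrite Ex_sum; last by move=> i _; have [] := HgO i.
    apply: (@le_trans _ _ (\sum_(i < M) (Cp * C ^+ p.+1 * kap ^+ p.*2.+2))).
      by apply: ler_sum => i _; have [] := HgO i.
    rewrite sumr_const card_ord -[_ *+ _]mulr_natl mulrCA mulrC ler_wpM2r//.
    exact: cells_kapX kd.
  have E3 : Ex P gD <= 2 * L * kap ^+ (72 * k + 2) * (2 * (Cp * C ^+ p.+1 + jet_const lam)).
    apply: (le_trans ED); rewrite /dyadic_prob /dyadic_height expr0 mulr1.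
    have J0 := jet_const_ge0 lam.
    have h1 : Cp * (C * (K ^+ 2)^-1 ^+ 2) ^+ p.+1 <= Cp * C ^+ p.+1 * kap ^+ (16 + (72 * k + 2)).
      rewrite exprMn mulrA ler_wpM2l// -exprVn -!exprM kapX_le//.
      by clear -pk; lia.
    have h2 : jet_const lam * ((K ^+ 2) ^+ 3 * (L / M%:R) ^+ (3 * m)) <= jet_const lam * kap ^+ (16 + (72 * k + 2)).
      rewrite ler_wpM2l//.
      apply: (@le_trans _ _ (K ^+ 6 * kap ^+ (16 * (3 * m)))).
        rewrite -[(K ^+ 2) ^+ 3]exprM [kap ^+ (16 * _)]exprM ler_wpM2l ?exprn_ge0 ?(ltW K0)//.
        apply: lerXn2r; rewrite ?nnegrE ?(ltW (kapX_gt0 K4 _)) ?cell_width//.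
        by rewrite divr_ge0// ltW.
      (* With m = 2 k the exponent left is 96 k - 6, at least 72 k + 18 because k >= 1. *)
      have -> : (16 * (3 * m) = 6 + (16 * (3 * m) - 6))%N by rewrite /m; clear -k0; lia.
      by rewrite exprD mulrA kapXK// mul1r kapX_le// /m; clear -k0; lia.
    have h3 := cells_kapX (leqnn (16 + (72 * k + 2))).
    apply: (@le_trans _ _ (M%:R * (2 * (Cp * C ^+ p.+1 * kap ^+ (16 + (72 * k + 2)) + jet_const lam * kap ^+ (16 + (72 * k + 2)))))).
      by rewrite ler_wpM2l// ler_wpM2l// lerD.
    have -> : M%:R * (2 * (Cp * C ^+ p.+1 * kap ^+ (16 + (72 * k + 2)) + jet_const lam * kap ^+ (16 + (72 * k + 2)))) =
      M%:R * kap ^+ (16 + (72 * k + 2)) * (2 * (Cp * C ^+ p.+1 + jet_const lam)) by ring.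
    by rewrite ler_wpM2r// mulr_ge0// addr_ge0.
  rewrite /rest_const; move: E1 E2 E3; set X := kap ^+ _; set Z := Cp * _; set J := jet_const lam.
  have -> : 2 * (4 * Z + 2 * J) * L * X = 2 * L * X * Z + 2 * L * X * Z + 2 * L * X * (2 * (Z + J)) by ring.
  by lra.
have aeO : {ae P, forall w, forall i, (i < M)%N -> big_osc a b M (Y ^~ w) (kap ^+ 3) i -> 1 <= gO i w}.
  by apply/ae_foralln => i; have [] := HgO i.
apply: filterS2 aeO aeD => w hO hD.
have A0 r : 0 <= dyadic_height K r by rewrite ltW// dyadic_height_gt0.
have Brho : L / M%:R * kap ^+ 3 <= kap ^+ 19.
  by rewrite -[19%N]/(16 + 3)%N exprD ler_wpM2r ?cell_width// ltW.
have Gn n : (\sum_(i < M) dyadic_bad a b M (Y ^~ w) m (dyadic_height K) n i <= Num.truncn (gD w))%N.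
  by rewrite truncn_ge_nat.
apply: (le_trans (zeros_le ab M2 (@sY w) A0 (ltW B0) m2 Brho Gn)).
rewrite lee_fin -/(sign_changes w) -addnA natrD lerD2l.
have -> : zero_mult = m.+1.*2.+1 by [].
have OS : (\sum_(1 <= i < M.-1) big_osc a b M (Y ^~ w) (kap ^+ 3) i)%:R <= \sum_(i < M) gO i w.
  apply: (@le_trans _ _ (\sum_(0 <= i < M) gO i w)); last by rewrite big_mkord.
  rewrite natr_sum (@big_cat_nat _ _ _ 1 0 M)//= -[leLHS]add0r lerD//.
    by apply: sumr_ge0 => i _; have [] := HgO i.
  have M1 : (1 <= M.-1)%N := M2.
  rewrite (big_cat_nat M1 (leq_pred M)) /=.
  rewrite -[leLHS]addr0 lerD//; last by apply: sumr_ge0 => i _; have [] := HgO i.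
  rewrite big_nat [leRHS]big_nat; apply: ler_sum => i /andP[i1 iM].
  have [_ g0 _ _] := HgO i; case bo : big_osc => //=.
  by apply: hO => //; rewrite (leq_trans iM)// leq_pred.
have TG : (Num.truncn (gD w))%:R <= gD w by rewrite truncn_le.
have NZ := near_zero_flat w; have l0 : 0 <= large_sum w by apply: sumr_ge0 => i _; exact: large_ge0.
rewrite natrD natrM (le_trans (_ : _ <= (m.+1.*2.+1)%:R * 1 + (m.+1.*2.+1)%:R * (6 * flat_sum w + V w)))//; last first.
  by rewrite -mulrDr ler_wpM2l//; lra.
rewrite lerD//; first by rewrite mulr1 -natrM ler_nat mul2n.
move: OS NZ; set z := (\sum_(1 <= i < M) _)%N; set o := (\sum_(1 <= i < M.-1) _)%N; set t := Num.truncn _ in TG *.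
move=> OS NZ; rewrite natrM ler_wpM2l//.
by rewrite (natrD _ (3 * z + o) t) (natrD _ (3 * z) o) (natrM _ 3 z) /V; lra.
Qed.

Lemma sign_changes_count w : (((sign_changes w)%:R : R)%:E <= counting (zero_set (Y ^~ w) a b))%E.
Proof.
have [oO sY _] := gsY.
rewrite /sign_changes big_add1 big_mkord.
apply: (@sign_changes_le R (Y ^~ w) a b M.-2 (fun i => node a b M i.+1) (fun i => node a b M i.+2) (@sY w)).
  move=> i iM; split; last split; [|rewrite -[ltRHS](nodeM ab M2)|]; rewrite ?node_lt//.
    by rewrite -[ltLHS](node0 a b M) node_lt.
  by clear -iM; lia.
by move=> i j /andP[ij _]; rewrite node_le.
Qed.

Definition deviation e w := corr e (U w) - Ex P (fun w => corr e (U w)).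

Lemma corr_size e : (e <= 1)%N -> (M.-1 - e + e < M)%N.
Proof. by move=> e1; have M1 : (1 <= M.-1)%N := M2; rewrite subnK// (leq_trans e1). Qed.

Lemma intg_corr e : intg P (fun w => corr e (U w)).
Proof.
apply: (@intg_trigp _ _ _ P U) (trigp_stat M (chi_degree K) K (M.-1 - e) e) => i.
exact: (mU (gauss_samples gsY ab M2)).
Qed.

Lemma measurable_deviation e : measurable_fun setT (deviation e).
Proof. by apply: measurable_funB => //; exact: intg_meas (intg_corr e). Qed.

(** The squared slope is at most 4 K^36 and 8 / L + eps at most 9 kap^72, so the variance bound of
    [stat_concentration] becomes 144 C kap^36. *)
Lemma deviation_moment e j CJ : (e <= 1)%N -> 0 <= CJ -> (forall V v, gauss P V v ->
    intg P (fun w => V w ^+ (2 ^ j).*2) /\ Ex P (fun w => V w ^+ (2 ^ j).*2) <= CJ * v ^+ (2 ^ j)) ->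
  Ex P (fun w => deviation e w ^+ (2 ^ j).*2) <=
    (pi / 2) ^+ (2 ^ j).*2 * (CJ * (144 * C) ^+ (2 ^ j)) * kap ^+ (36 * 2 ^ j).
Proof.
move=> e1 CJ0 HCJ.
have := stat_concentration (chi_degree K) gsY ab M2 K0 C0 eps0 cell_width1 HC4 (corr_size e1) HCJ CJ0.
move=> h; apply: (le_trans h); rewrite -[(pi / 2) ^+ _ * _ * kap ^+ _]mulrA -[CJ * _ * kap ^+ _]mulrA.
have s0 : 0 <= sign_slope (chi_degree K) / K by rewrite divr_ge0 ?sign_slope_ge0// ltW.
have t0 : 0 <= 8 / L + eps by rewrite addr_ge0// divr_ge0// ltW.
rewrite ler_wpM2l ?exprn_ge0 ?divr_ge0 ?pi_ge0// ler_wpM2l// [kap ^+ (36 * _)]exprM -exprMn.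
apply: lerXn2r; rewrite ?nnegrE.
- exact: mulr_ge0 (sqr_ge0 _) (mulr_ge0 (ler0n _ 4) (mulr_ge0 C0 t0)).
- exact: mulr_ge0 (mulr_ge0 (ler0n _ 144) C0) (ltW (kapX_gt0 K4 36)).
have h1 : (sign_slope (chi_degree K) / K) ^+ 2 <= (2 * K ^+ 18) ^+ 2.
  by apply: lerXn2r; rewrite ?nnegrE ?slope_chi// mulr_ge0// exprn_ge0// ltW.
have h2 : 8 / L + eps <= 9 * kap ^+ 72.
  have : L^-1 <= kap ^+ 72.
    by rewrite exprVn lef_pV2 ?posrE ?exprn_gt0.
  by move: epsK; lra.
apply: (@le_trans _ _ ((2 * K ^+ 18) ^+ 2 * (4 * (C * (9 * kap ^+ 72))))).
  apply: ler_pM => //; first exact: sqr_ge0.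
    exact: mulr_ge0 (ler0n _ 4) (mulr_ge0 C0 t0).
  by rewrite ler_wpM2l// ler_wpM2l.
have -> : (2 * K ^+ 18) ^+ 2 * (4 * (C * (9 * kap ^+ 72))) = 144 * C * kap ^+ 36 * (K ^+ 36 * kap ^+ 36).
  by field; rewrite gt_eqF.
by rewrite kapXK// mulr1.
Qed.

Section bounds.
Variables (j : nat) (C1 CJ : R).
Hypotheses (jk : (36 * k <= 2 ^ j)%N) (C10 : 0 <= C1) (CJ0 : 0 <= CJ)
  (HC1 : forall V v, gauss P V v ->
    intg P (fun w => V w ^+ (2 ^ 0).*2) /\ Ex P (fun w => V w ^+ (2 ^ 0).*2) <= C1 * v ^+ (2 ^ 0))
  (HCJ : forall V v, gauss P V v ->
    intg P (fun w => V w ^+ (2 ^ j).*2) /\ Ex P (fun w => V w ^+ (2 ^ j).*2) <= CJ * v ^+ (2 ^ j)).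

Definition mean_const := (pi / 2) ^+ 2 * (C1 * (144 * C)).
Definition prob_const := (pi / 2) ^+ (2 ^ j).*2 * (CJ * (144 * C) ^+ (2 ^ j)).

Lemma prob_const_ge0 : 0 <= prob_const.
Proof.
have p0 : 0 <= pi / 2 :> R by rewrite divr_ge0// pi_ge0.
exact: mulr_ge0 (exprn_ge0 _ p0) (mulr_ge0 CJ0 (exprn_ge0 _ (mulr_ge0 (ler0n _ 144) C0))).
Qed.

Lemma mean_const_ge0 : 0 <= mean_const.
Proof.
have p0 : 0 <= pi / 2 :> R by rewrite divr_ge0// pi_ge0.
exact: mulr_ge0 (exprn_ge0 _ p0) (mulr_ge0 C10 (mulr_ge0 (ler0n _ 144) C0)).
Qed.

Lemma intg_deviation_pow e i : (e <= 1)%N -> intg P (fun w => deviation e w ^+ i).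
Proof.
move=> e1; have [l lE] := trigp_stat M (chi_degree K) K (M.-1 - e) e.
have tr : trigp (fun u => (corr e u - Ex P (fun w => corr e (U w))) ^+ i).
  by apply: trigpX; apply: trigpB; [exact: trigp_stat|exact: trigp_cst].
apply: (@intg_trigp _ _ _ P U) tr => n; exact: (mU (gauss_samples gsY ab M2)).
Qed.

Lemma Ex_deviation e : (e <= 1)%N -> Ex P (fun w => `|deviation e w|) <= (1 + mean_const) * kap ^+ 17.
Proof.
move=> e1; have t0 := kapX_gt0 K4 17.
have I2 := intg_deviation_pow 2 e1.
have E := deviation_moment e1 C10 HC1; rewrite muln1 !expn0 expr1 in E.
(* From |x| <= t + x^2 / t with t = kap^17; the second moment, of order kap^36, leaves kap^19. *)
apply: (@le_trans _ _ (Ex P (fun w => kap ^+ 17 + (kap ^+ 17)^-1 * deviation e w ^+ 2))).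
  apply: Ex_le => [| |w].
  - by apply: intg_norm; have := intg_deviation_pow 1 e1; under eq_fun do rewrite expr1.
  - by apply: intgD; [exact: intg_cst|exact: intgZ].
  - rewrite -[deviation e w ^+ 2]real_normK ?num_real//; set x := `|_|; have x0 : 0 <= x by exact: normr_ge0.
    have [xt|tx] := leP x (kap ^+ 17).
      by rewrite (le_trans xt)// lerDl mulr_ge0 ?invr_ge0 ?(ltW t0)// sqr_ge0.
    apply: (@le_trans _ _ ((kap ^+ 17)^-1 * x ^+ 2)); last by rewrite lerDr ltW.
    by rewrite mulrC ler_pdivlMr// expr2 ler_wpM2l// ltW.
rewrite ExD; [|exact: intg_cst|exact: intgZ].
rewrite (ExZ (kap ^+ 17)^-1 I2).
have -> : Ex P (fun=> kap ^+ 17) = kap ^+ 17 := Ex_cst P _.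
rewrite mulrDl mul1r lerD2l ler_pdivrMl//.
apply: (le_trans E); rewrite -/mean_const [leRHS]mulrCA.
by rewrite ler_wpM2l ?mean_const_ge0// -exprD kapX_le.
Qed.

(** Markov's inequality for the moment of order 2^(j + 1): with q = 2^j, kap^(36 q) over kap^(34 q)
    is kap^(2 q), and 36 k <= q brings this below kap^(72 k). *)
Lemma deviation_prob e : (e <= 1)%N ->
  (P [set w | (kap ^+ 17 <= `|deviation e w|)%R] <= (prob_const * kap ^+ (72 * k))%:E)%E.
Proof.
move=> e1; have t0 := kapX_gt0 K4 17; pose N := (2 ^ j).*2.
have ev w : `|deviation e w| ^+ N = deviation e w ^+ N.
  by rewrite -normrX ger0_norm// /N -mul2n exprM exprn_ge0// sqr_ge0.
have IN : intg P (fun w => `|deviation e w| ^+ N).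
  by under eq_fun do rewrite ev; exact: intg_deviation_pow.
have N0 : (0 < N)%N by rewrite double_gt0 expn_gt0.
have -> : [set w | kap ^+ 17 <= `|deviation e w|] = [set w | kap ^+ 17 ^+ N <= `|deviation e w| ^+ N].
  by apply/seteqP; split => w /=; rewrite ler_pXn2r ?nnegrE// ltW.
apply: (le_trans (Pr_markov (exprn_gt0 N t0) IN _)); first by move=> w; rewrite exprn_ge0.
rewrite lee_fin ler_pdivrMr ?exprn_gt0//.
under eq_fun do rewrite ev.
apply: (le_trans (deviation_moment e1 CJ0 HCJ)); rewrite -/prob_const -[prob_const * _ * (kap ^+ 17) ^+ N]mulrA ler_wpM2l ?prob_const_ge0//.
rewrite -exprM -exprD kapX_le// /N -muln2.
by move: jk; set q := (2 ^ j)%N; clear; lia.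
Qed.

Definition mean_bound := (1 + mean_const) + (6 * zero_mult%:R + 2) * (2 * flat_const + rest_const + 1).
Definition path_bound := 1 + (6 * zero_mult%:R + 2) * (2 * flat_const + 4).

(** [mu] is the centering of the sign statistic; the path and the mean of the count are each
    compared with it. The constant [e] inside the last integral makes room for zeros at the
    endpoints of the original interval, as the integral of a possibly non-measurable count cannot be
    split afterwards. *)
Lemma zero_count_bounds : exists mu (Bad : set T), [/\ measurable Bad,
   (P Bad <= ((2 * prob_const + rest_const) * kap ^+ (72 * k))%:E)%E,
   {ae P, forall w, ~ Bad w ->
      ((mu - path_bound * (L * kap))%:E <= counting (zero_set (Y ^~ w) a b))%E /\
      (counting (zero_set (Y ^~ w) a b) <= (mu + path_bound * (L * kap))%:E)%E},
   ((mu - mean_bound * (L * kap))%:E <= \int[P]_w counting (zero_set (Y ^~ w) a b))%E &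
   forall e, 0 <= e -> (\int[P]_w (counting (zero_set (Y ^~ w) a b) + e%:E) <= (mu + mean_bound * (L * kap) + e)%:E)%E].
Proof.
have [V [IV LV EV aeV]] := zeros_sandwich.
pose EF := Ex P (fun w => corr 1 (U w)).
pose mu := ((M.-1 - 1)%:R - M%:R * EF) / 2.
set zm : R := zero_mult%:R in aeV *.
have zm0 : 0 <= zm by [].
pose W w := M%:R / 2 * `|deviation 1 w| + (6 * zm + 2) * (flat_sum w + V w + 1).
have l0 w : 0 <= large_sum w by apply: sumr_ge0 => i _; exact: large_ge0.
have V0 w : 0 <= V w by apply: le_trans (LV w).
have Q0 w : 0 <= flat_sum w by apply: sumr_ge0 => i _; exact: flat_ge0.
have Ssmu w : `|(sign_changes w)%:R - mu| <= 2 * flat_sum w + 2 * V w + M%:R / 2 * `|deviation 1 w|.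
  have h1 := sign_changes_approx w.
  have -> : (sign_changes w)%:R - mu = ((sign_changes w)%:R - ((M.-1 - 1)%:R - M%:R * corr 1 (U w)) / 2) -
     M%:R / 2 * deviation 1 w by rewrite /mu /deviation -/EF; field.
  apply: (le_trans (ler_normB _ _)); rewrite normrM (@ger0_norm _ (M%:R / 2)) ?divr_ge0// lerD2r.
  by apply: (le_trans h1); have := LV w; lra.
have zQ w : 0 <= zm * flat_sum w by rewrite mulr_ge0.
have zV w : 0 <= zm * V w by rewrite mulr_ge0.
have lowW w : ((mu - W w)%:E <= counting (zero_set (Y ^~ w) a b))%E.
  apply: le_trans (sign_changes_count w); rewrite lee_fin.
  have := Ssmu w; rewrite ler_norml => /andP[h _]; rewrite /W.
  move: (zQ w) (zV w) (Q0 w) (V0 w) zm0 h.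
  by set q := flat_sum w; set v := V w; set dv := M%:R / 2 * _; lra.
have upW : {ae P, forall w, (counting (zero_set (Y ^~ w) a b) <= (mu + W w)%:E)%E}.
  apply: filterS aeV => w h; apply: (le_trans h); rewrite lee_fin.
  have := Ssmu w; rewrite ler_norml => /andP[_ h']; rewrite /W.
  move: (zQ w) (zV w) (Q0 w) (V0 w) zm0 h'.
  by set q := flat_sum w; set v := V w; set dv := M%:R / 2 * _; lra.
have ID : intg P (fun w => `|deviation 1 w|).
  by apply: intg_norm; have := intg_deviation_pow 1 (leqnn 1); under eq_fun do rewrite expr1.
have IQ : intg P flat_sum by apply: intg_sum => i _; exact: intg_flat.
have IQV : intg P (fun w => flat_sum w + V w + 1) by apply: intgD; [exact: intgD|exact: intg_cst].
have IW : intg P W by apply: intgD; exact: intgZ.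
have Lk : 1 <= L * kap.
  rewrite ler_pdivlMr// mul1r (le_trans _ TK)// exprS ler_peMr ?(ltW K0)// exprn_ege1//.
have Mk : M%:R * kap ^+ 17 <= 2 * (L * kap).
  by have := @cells_kapX 17 1 (leqnn _); rewrite expr1 -mulrA.
have fc0 : 0 <= flat_const.
  apply: mulr_ge0 => //; apply: addr_ge0; last exact: mulr_ge0 Cp0 (exprn_ge0 _ C0).
  by apply: addr_ge0 => //; rewrite divr_ge0 ?expR_ge0// sqrtr_ge0.
have rc0 : 0 <= rest_const.
  apply: mulr_ge0 => //; apply: addr_ge0; apply: mulr_ge0 => //; last exact: jet_const_ge0.
  exact: mulr_ge0 Cp0 (exprn_ge0 _ C0).
have EQ : Ex P flat_sum <= flat_const * (2 * (L * kap)).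
  rewrite Ex_sum; last by move=> i _; exact: intg_flat.
  apply: (@le_trans _ _ (\sum_(i < M.-1) (flat_const * kap ^+ 17))); first by apply: ler_sum => i _; exact: Ex_flat.
  rewrite sumr_const card_ord -[_ *+ _]mulr_natl mulrCA ler_wpM2l//; apply: le_trans Mk.
  by rewrite ler_wpM2r ?(ltW (kapX_gt0 K4 _))// ler_nat leq_pred.
have EV1 : Ex P V <= rest_const * (L * kap).
  apply: (le_trans EV); rewrite -mulrA ler_wpM2l// ler_wpM2l ?(ltW L0)//.
  by rewrite -[leRHS]expr1 kapX_le// addn2.
have EW : Ex P W <= mean_bound * (L * kap).
  rewrite ExD; [|exact: intgZ|exact: intgZ].
  rewrite !ExZ// ExD; [|exact: intgD|exact: intg_cst].
  rewrite ExD//; have -> : Ex P (fun=> 1) = 1 := Ex_cst P _.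
  have h1 : M%:R / 2 * Ex P (fun w => `|deviation 1 w|) <= (1 + mean_const) * (L * kap).
    have := ler_wpM2l (ltW M0) (Ex_deviation (leqnn 1)); rewrite mulrCA.
    have m1 : 0 <= 1 + mean_const by rewrite addr_ge0// mean_const_ge0.
    have := ler_wpM2l m1 Mk; set x := (1 + _) * (M%:R * _); set y := M%:R * Ex P _.
    have -> : M%:R / 2 * Ex P (fun w => `|deviation 1 w|) = y / 2 by rewrite /y mulrAC.
    by lra.
  have h2 : Ex P flat_sum + Ex P V + 1 <= (2 * flat_const + rest_const + 1) * (L * kap).
    by move: EQ EV1 Lk; lra.
  rewrite /mean_bound -/zm [leRHS]mulrDl lerD// -[leRHS]mulrA ler_wpM2l//.
  by rewrite addr_ge0// mulr_ge0.
(* Off this set the statistics of shift 1 (sign changes) and shift 0 (flat samples) are close to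
   their means, and [V] is small. *)
pose Bad := [set w | kap ^+ 17 <= `|deviation 1 w|] `|` ([set w | kap ^+ 17 <= `|deviation 0 w|] `|` [set w | L * kap <= V w]).
have mset (f : T -> R) (t : R) : measurable_fun setT f -> measurable [set w | t <= f w].
  move=> mf; have -> : [set w | t <= f w] = f @^-1` `[t, +oo[%classic.
    by apply/seteqP; split => w /=; rewrite in_itv /= andbT.
  by have := mf measurableT _ (measurable_itv `[t, +oo[); rewrite setTI.
have mdev e : measurable_fun setT (fun w => `|deviation e w|).
  by apply: (measurableT_comp (@normr_measurable R setT)); exact: measurable_deviation.
have mB1 := mset _ (kap ^+ 17) (mdev 1%N); have mB0 := mset _ (kap ^+ 17) (mdev 0%N).
have mBV := mset _ (L * kap) (intg_meas IV).
exists mu, Bad; split.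
- by apply: measurableU => //; exact: measurableU.
- apply: (le_trans (measureU2 _ _ _)) => //; first exact: measurableU.
  have -> : (2 * prob_const + rest_const) * kap ^+ (72 * k) = prob_const * kap ^+ (72 * k) +
    (prob_const * kap ^+ (72 * k) + rest_const * kap ^+ (72 * k)) by ring.
  rewrite !EFinD; apply: leeD; first exact: deviation_prob.
  apply: (le_trans (measureU2 _ _ _)) => //; apply: leeD; first exact: deviation_prob.
  have Lk0 : 0 < L * kap by exact: mulr_gt0.
  apply: (le_trans (Pr_markov Lk0 IV V0)); rewrite lee_fin ler_pdivrMr//.
  apply: (le_trans EV).
  have -> : rest_const * kap ^+ (72 * k) * (L * kap) = rest_const * L * kap ^+ (72 * k).+1 by rewrite [in RHS]exprS; ring.
  by apply: ler_wpM2l; [exact: mulr_ge0 rc0 (ltW L0)|apply: kapX_le => //; clear; lia].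
- apply: filterS upW => w up nB.
  suff Wb : W w <= path_bound * (L * kap).
    split; first by apply: le_trans (lowW w); rewrite lee_fin lerD2l lerN2.
    by apply: (le_trans up); rewrite lee_fin lerD2l.
  have d1 : `|deviation 1 w| <= kap ^+ 17 by rewrite leNgt; apply/negP => /ltW h; apply: nB; left.
  have d0 : `|deviation 0 w| <= kap ^+ 17 by rewrite leNgt; apply/negP => /ltW h; apply: nB; right; left.
  have dV : V w <= L * kap by rewrite leNgt; apply/negP => /ltW h; apply: nB; right; right.
  have Qw : flat_sum w <= (2 * flat_const + 2) * (L * kap).
    have -> : flat_sum w = Ex P flat_sum - M%:R * deviation 0 w.
      have -> : Ex P flat_sum = (M.-1)%:R - M%:R * Ex P (fun w => corr 0 (U w)).
        rewrite (funext flat_sumE) ExB; [|exact: intg_cst|by apply: intgZ; exact: intg_corr].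
        by rewrite (ExZ M%:R (intg_corr 0)); have -> : Ex P (fun=> M.-1%:R) = M.-1%:R := Ex_cst P _.
      by rewrite flat_sumE /deviation; ring.
    have : - (M%:R * deviation 0 w) <= M%:R * kap ^+ 17.
      by rewrite -mulrN ler_wpM2l//; move: d0; rewrite ler_norml => /andP[h _]; lra.
    by move: EQ Mk; lra.
  rewrite /W /path_bound -/zm [leRHS]mulrDl mul1r lerD//.
    have := ler_wpM2l (ltW M0) d1; rewrite mulrAC.
    by move: Mk; lra.
  rewrite -[leRHS]mulrA ler_wpM2l ?addr_ge0 ?mulr_ge0//.
  by move: Qw dV Lk; lra.
- apply: le_trans (integral_ge _ (intgB (intg_cst P mu) IW) _) => //.
    by rewrite lee_fin ExB//; [rewrite [Ex P (cst mu)]Ex_cst lerD2l lerN2|exact: intg_cst].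
- move=> e e0; have Ie := intgD (intgD (intg_cst P mu) IW) (intg_cst P e).
  apply: le_trans (integral_le _ Ie _) _.
  + by move=> w; rewrite adde_ge0 ?lee_fin.
  + by apply: filterS upW => w up; rewrite EFinD leeD2r.
  + rewrite lee_fin (ExD (intgD (intg_cst P mu) IW) (intg_cst P e)) (ExD (intg_cst P mu) IW).
    by rewrite [Ex P (cst mu)]Ex_cst [Ex P (cst e)]Ex_cst lerD2r lerD2l.
Qed.

End bounds.

End long_interval.

(** * Constants uniform over the admissible processes *)

Section uniform.
Context {d : measure_display} {T : measurableType d} {R : realType} (P : probability T R).

Definition tame (a b : R) (Y : R -> T -> R) (k : nat) (C lam eps : R) : Prop :=
  [/\ gaussian_smooth P `]a, b[%classic Y,
   forall j t, (j <= (2 * k).+1)%N -> a < t < b -> Ex P (fun w => pderive j Y t w ^+ 2) <= C,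
   forall t, a < t < b -> forall a0 a1 a2 : R, lam * (a0 ^+ 2 + a1 ^+ 2 + a2 ^+ 2) <=
    Ex P (fun w => (a0 * pderive 0 Y t w + (a1 * pderive 1 Y t w + a2 * pderive 2 Y t w)) ^+ 2) &
   forall s t, a < s < b -> a < t < b ->
     `|Ex P (fun w => Y s w * Y t w)| <= C / (1 + (t - s) ^+ 2) + C * eps].

Lemma zero_count_concentration k (C lam : R) : (0 < k)%N -> 0 <= C -> 0 < lam ->
  exists K0 B c : R, [/\ 4 <= K0, 0 <= B, 0 < c &
   forall a b Y eps K, tame a b Y k C lam eps -> 0 <= eps -> K0 <= K -> K ^+ 72 <= b - a ->
    eps <= K^-1 ^+ 72 ->
    exists mu (Bad : set T), [/\ measurable Bad, (P Bad <= (B * K^-1 ^+ (72 * k))%:E)%E,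
     c * (b - a) <= mu,
     {ae P, forall w, ~ Bad w ->
      ((mu - B * ((b - a) * K^-1))%:E <= counting (zero_set (Y ^~ w) a b))%E /\
      (counting (zero_set (Y ^~ w) a b) <= (mu + B * ((b - a) * K^-1))%:E)%E} &
     ((mu - B * ((b - a) * K^-1))%:E <= \int[P]_w counting (zero_set (Y ^~ w) a b))%E /\
     forall e, 0 <= e -> (\int[P]_w (counting (zero_set (Y ^~ w) a b) + e%:E) <= (mu + B * ((b - a) * K^-1) + e)%:E)%E]].
Proof.
move=> k0 C0 lam0; have [ct ct0 Hct] := @chi_tail R.
have mom n : exists2 M : R, 0 <= M & forall V v, gauss P V v ->
    intg P (fun w => V w ^+ n.*2) /\ Ex P (fun w => V w ^+ n.*2) <= M * v ^+ n.
  have [M HM] := @gauss_moment _ _ _ P n; exists `|M|; first exact: normr_ge0.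
  move=> V v g; have [h1 h2] := HM _ _ g; split=> //; apply: (le_trans h2).
  by rewrite ler_wpM2r ?ler_norm//; case: g => _ v0 _; rewrite exprn_ge0.
have [p pk] : exists p, (72 * k + 20 <= p)%N by exists (72 * k + 20)%N.
have [j j36] : exists j, (36 * k <= 2 ^ j)%N.
  by exists (36 * k)%N; apply: ltnW; apply: ltn_expl.
have [Cp Cp0 HCp] := mom p.+1.
have [C1 C10 HC1] := mom (2 ^ 0)%N.
have [CJ CJ0 HCJ] := mom (2 ^ j)%N.
have [C3 C30 HC3] := mom 3.
have [L0 [k1 [c [L00 k10 c0 Hc]]]] := mean_zeros_ge C0 lam0 C30 HC3.
pose B0 := 2 * prob_const C j CJ + rest_const C lam Cp p.
pose B1 := path_bound C lam Cp ct k p.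
pose B2 := mean_bound C lam Cp ct k p C1.
pose B := `|B0| + `|B1| + `|B2|.
have B_0 : 0 <= B by rewrite !addr_ge0.
have BB0 : B0 <= B by have := ler_norm B0; have := normr_ge0 B1; have := normr_ge0 B2; rewrite /B; lra.
have BB1 : B1 <= B by have := ler_norm B1; have := normr_ge0 B0; have := normr_ge0 B2; rewrite /B; lra.
have BB2 : B2 <= B by have := ler_norm B2; have := normr_ge0 B1; have := normr_ge0 B0; rewrite /B; lra.
have x1 : 0 <= 4 * L0 by lra.
have x2 : 0 <= C / k1 by apply: divr_ge0 => //; exact: ltW.
have x3 : 0 <= B / (c / 2) by rewrite divr_ge0// ltW// divr_gt0.
(* The summands ensure in turn K >= 4, room for the pairs of [mean_zeros_ge], C eps <= k1, and an
   error B (b - a) / K of at most half the lower bound c (b - a) for the mean; the other half bounds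
   mu from below. *)
exists (4 + 4 * L0 + C / k1 + B / (c / 2)), B, (c / 2); split=> //.
- by move: x1 x2 x3; clear; set u := 4 * L0; set v := C / k1; set z := B / _ => *; lra.
- by rewrite divr_gt0.
move=> a b Y eps K [gY h2 h3 h4] eps0 KK TK epsK.
have [K4 [KL [Kk KB]]] : 4 <= K /\ (4 * L0 <= K /\ (C / k1 <= K /\ B / (c / 2) <= K)).
  move: KK x1 x2 x3; clear; set u := 4 * L0; set v := C / k1; set z := B / _ => *; repeat split; lra.
have [K_1 K_0] : 1 <= K /\ 0 < K by move: K4; clear => ?; split; lra.
have kap0 : 0 < K^-1 by rewrite invr_gt0.
have L_0 : 0 <= b - a by apply: le_trans TK; rewrite exprn_ge0// ltW.
have itv t : (`]a, b[%classic : set R) t <-> a < t < b by rewrite /= in_itv /=.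
have Lk0 : 0 <= (b - a) * K^-1 by apply: mulr_ge0 => //; exact: ltW.
have [mu [Bad [mB PB ae lo up]]] := @zero_count_bounds _ _ _ P a b Y C lam eps K Cp ct k _ gY k0 C0 lam0 eps0 K4 TK epsK
  (fun j t jk Ot => h2 j t jk ((itv t).1 Ot)) (fun t Ot => h3 t ((itv t).1 Ot))
  (fun s t Os Ot => h4 s t ((itv s).1 Os) ((itv t).1 Ot)) ct0 (fun x => Hct K x K4) Cp0 pk HCp
  _ C1 CJ j36 C10 CJ0 HC1 HCJ.
have up' e : 0 <= e -> (\int[P]_w (counting (zero_set (Y ^~ w) a b) + e%:E) <= (mu + B * ((b - a) * K^-1) + e)%:E)%E.
  by move=> e0; apply: (le_trans (up e e0)); rewrite lee_fin lerD2r lerD2l ler_wpM2r.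
exists mu, Bad; split=> //.
- by apply: (le_trans PB); rewrite lee_fin ler_wpM2r// exprn_ge0// ltW.
- have hc : ((c * (b - a))%:E <= \int[P]_w (counting (zero_set (Y ^~ w) a b) : \bar R))%E.
    apply: (Hc a b Y eps gY) => //.
    + move=> t tab; apply/andP; split; last exact: (h2 0%N t).
      have := h3 t tab 1 0 0; rewrite expr1n !expr0n /= !addr0 mulr1.
      by under eq_fun do rewrite !mul0r !addr0 mul1r.
    + apply: (@le_trans _ _ (C * K^-1)).
        rewrite ler_wpM2l// (le_trans epsK)// -[leRHS]expr1; apply: kapX_le => //.
      rewrite ler_pdivrMr// mulrC -ler_pdivrMr//.
    + apply: le_trans TK; apply: (@le_trans _ _ K); first by [].
      by rewrite -[leLHS]expr1 ler_weXn2l.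
  have := up' 0 (lexx 0); under eq_integral do rewrite adde0; rewrite addr0 => /(le_trans hc); rewrite lee_fin => hmu.
  have : B * ((b - a) * K^-1) <= c / 2 * (b - a).
    have c20 : 0 < c / 2 by rewrite divr_gt0.
    by rewrite mulrCA mulrC ler_wpM2r// ler_pdivrMr// mulrC -ler_pdivrMr.
  by move: hmu; clear; set u := B * _; set v := b - a => *; lra.
- apply: filterS ae => w hw nB; have [l u] := hw nB; split.
    by apply: le_trans l; rewrite lee_fin lerD2l lerN2 ler_wpM2r.
  by apply: (le_trans u); rewrite lee_fin lerD2l ler_wpM2r.
- by split=> //; apply: le_trans lo; rewrite lee_fin lerD2l lerN2 ler_wpM2r.
Qed.

End uniform.

(** * Gaussian series *)

Section laws.
Context {R : realType}.

Lemma sum_lt_minn (n t : nat) : (\sum_(i < n) (i < t))%N = minn n t.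
Proof.
elim: n => [|n IH]; first by rewrite big_ord0 min0n.
by rewrite big_ord_recr /= IH; lia.
Qed.

(** For 0 <= x <= 1 this is x rounded down to a multiple of 1 / (n + 1), written as an average of
    indicators so that identities known on sets extend to it by linearity. *)
Definition staircase (n : nat) (x : R) : R :=
  n.+1%:R^-1 * \sum_(i < n.+1) (((i.+1%:R : R) <= n.+1%:R * x)%R : nat)%:R.

Lemma staircaseE n x : 0 <= x <= 1 -> staircase n x = n.+1%:R^-1 * (Num.truncn (n.+1%:R * x))%:R.
Proof.
move=> /andP[x0 x1]; rewrite /staircase; congr (_ * _).
have nx0 : 0 <= n.+1%:R * x by rewrite mulr_ge0.
rewrite -natr_sum; congr (_%:R).
under eq_bigr do rewrite -truncn_ge_nat//.
rewrite sum_lt_minn; apply/minn_idPr.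
have : (Num.truncn (n.+1%:R * x))%:R <= n.+1%:R * x by rewrite truncn_le.
by rewrite -(ler_nat R) => /le_trans->//; rewrite ler_piMr.
Qed.

Lemma staircase_cvg x : 0 <= x <= 1 -> staircase n x @[n --> \oo] --> x.
Proof.
move=> x01; have x0 : 0 <= x by case/andP: x01.
apply: (@squeeze_cvgr _ _ _ _ (fun n => x - n.+1%:R^-1) (cst x)).
- apply: nearW => n; rewrite staircaseE//.
  have nx0 : 0 <= n.+1%:R * x by rewrite mulr_ge0.
  have n0 : 0 < n.+1%:R :> R by [].
  have := truncn_le (n.+1%:R * x); rewrite nx0 => h1.
  have h2 := truncnS_gt (n.+1%:R * x); move: h1 h2; set t := Num.truncn _ => h1 h2.
  rewrite ler_pdivrMl// h1 andbT -(ler_pM2l n0) mulrBr mulfV ?gt_eqF// mulrA mulfV ?gt_eqF// mul1r.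
  by move: h2; rewrite -[t.+1%:R]natr1; set y := _ * x; lra.
- by rewrite -[X in _ --> X]subr0; apply: cvgB; [exact: cvg_cst|exact: cvg_invS].
- exact: cvg_cst.
Qed.

Lemma staircase01 n x : 0 <= x <= 1 -> 0 <= staircase n x <= 1.
Proof.
move=> /andP[x0 x1]; rewrite /staircase; apply/andP; split.
  by rewrite mulr_ge0 ?invr_ge0// sumr_ge0.
rewrite ler_pdivrMl// mulr1.
apply: (@le_trans _ _ (\sum_(i < n.+1) 1)); first by apply: ler_sum => i _; rewrite lern1 leq_b1.
by rewrite sumr_const card_ord.
Qed.

Context {d : measure_display} {T : measurableType d} (P : probability T R) (N : probability (measurableTypeR R) R).

(* It is enough to check the identity on indicators, since bounded functions are limits of staircases. *)
Lemma Ex_law (H V : T -> R) (M kap : R) : measurable_fun setT H -> measurable_fun setT V ->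
  (forall w, `|H w| <= M) ->
  (forall B, measurable B -> Ex P (fun w => H w * \1_B (V w)) = kap * Ex N \1_B) ->
  forall f : R -> R, measurable_fun setT f -> (forall x, `|f x| <= 1) ->
  Ex P (fun w => H w * f (V w)) = kap * Ex N f.
Proof.
move=> mH mV HM HB f mf f1.
pose g x := (f x + 1) / 2.
have mg : measurable_fun setT g by apply: measurable_funM => //; exact: measurable_funD.
have g01 x : 0 <= g x <= 1 by have := f1 x; rewrite /g ler_norml => /andP[? ?]; apply/andP; split; lra.
pose s n x := staircase n (g x).
pose A n (i : 'I_n.+1) := [set x | i.+1%:R <= n.+1%:R * g x].
have mA n i : measurable (@A n i).
  have -> : @A n i = (fun x => n.+1%:R * g x) @^-1` `[i.+1%:R, +oo[%classic.
    by apply/seteqP; split => x /=; rewrite in_itv /= andbT.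
  have : measurable_fun setT (fun x => n.+1%:R * g x) by exact: measurable_funM.
  by move=> /(_ measurableT _ (measurable_itv `[i.+1%:R, +oo[)); rewrite setTI.
have sE n x : s n x = n.+1%:R^-1 * \sum_(i < n.+1) \1_(@A n i) x.
  rewrite /s /staircase; congr (_ * _); apply: eq_bigr => i _; rewrite indicE.
  congr (nat_of_bool _)%:R; apply/idP/idP; first by move=> h; rewrite inE.
  by rewrite inE.
have m1 n i : measurable_fun setT (\1_(@A n i) : R -> R) by exact: measurable_indic.
have m1V n i : measurable_fun setT (fun w => \1_(@A n i) (V w) : R) by exact: measurableT_comp.
have ind1 (B : set R) x : `|\1_B x : R| <= 1 by rewrite indicE ger0_norm// lern1 leq_b1.
have I1 n i : intg P (fun w => H w * \1_(@A n i) (V w)).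
  apply: (@intg_bnd _ _ _ _ _ M); first exact: measurable_funM.
  move=> w; rewrite normrM -[leRHS]mulr1; apply: ler_pM => //.
have I2 n i : intg N (\1_(@A n i) : R -> R) by exact: (@intg_bnd _ (measurableTypeR R) R N _ 1 (m1 n i) (ind1 _)).
have mid n : Ex P (fun w => H w * s n (V w)) = kap * Ex N (s n).
  transitivity (Ex P (fun w => n.+1%:R^-1 * \sum_(i < n.+1) (H w * \1_(@A n i) (V w)))).
    by congr Ex; apply/funext => w; rewrite sE -mulr_sumr; ring.
  rewrite (funext (sE n)) ExZ; last by apply: intg_sum => i _; exact: I1.
  rewrite ExZ; last by apply: intg_sum => i _; exact: I2.
  rewrite !Ex_sum//; under eq_bigr do rewrite HB//.
  by rewrite -mulr_sumr; ring.
have msn n : measurable_fun setT (s n).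
  by rewrite (funext (sE n)); apply: measurable_funM => //; apply: measurable_sum.
have gE : Ex P (fun w => H w * g (V w)) = kap * Ex N g.
  have c1 : Ex P (fun w => H w * s n (V w)) @[n --> \oo] --> Ex P (fun w => H w * g (V w)).
    apply: (@Ex_bnd_cvg _ _ _ P _ _ M).
    - by move=> n; apply: measurable_funM => //; exact: measurableT_comp.
    - by apply: measurable_funM => //; exact: measurableT_comp.
    - move=> n w; rewrite normrM -[leRHS]mulr1; apply: ler_pM => //.
      by have /andP[? ?] := staircase01 n (g01 (V w)); rewrite ger0_norm.
    - by apply: aeW => w; apply: cvgMr; exact: staircase_cvg.
  have c2 : kap * Ex N (s n) @[n --> \oo] --> kap * Ex N g.
    apply: cvgMr; apply: (@Ex_bnd_cvg _ _ _ N _ _ 1) => //.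
    - by move=> n x; have /andP[? ?] := staircase01 n (g01 x); rewrite ger0_norm.
    - by apply: aeW => x; exact: staircase_cvg.
  by rewrite (funext mid) in c1; exact: (cvg_unique _ c1 c2).
have H1 : Ex P H = kap.
  have := HB setT measurableT; rewrite indicT [Ex N _]Ex_cst mulr1 => <-.
  by congr Ex; apply/funext => w; rewrite mulr1.
have IH : intg P H by exact: intg_bnd HM.
have fE x : f x = 2 * g x - 1 by rewrite /g; field.
have Ig : intg N g.
  by apply: (@intg_bnd _ _ _ _ _ 1) => // x; have /andP[? ?] := g01 x; rewrite ger0_norm.
have IHg : intg P (fun w => H w * g (V w)).
  apply: (@intg_bnd _ _ _ _ _ M); first by apply: measurable_funM => //; exact: measurableT_comp.
  move=> w; rewrite normrM -[leRHS]mulr1; apply: ler_pM => //.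
  by have /andP[? ?] := g01 (V w); rewrite ger0_norm.
rewrite [f in RHS](funext fE) ExB ?ExZ//; [|exact: intgZ|exact: intg_cst].
have -> : Ex N (fun=> 1) = 1 := Ex_cst N _.
transitivity (Ex P (fun w => 2 * (H w * g (V w)) - H w)).
  by congr Ex; apply/funext => w; rewrite fE; ring.
by rewrite ExB ?(ExZ 2 IHg) ?gE ?H1//; [ring|exact: intgZ].
Qed.

Lemma Ex_indic_fine (B : set T) : measurable B -> Ex P (\1_B : T -> R) = fine (P B).
Proof. by move=> mB; rewrite /Ex /Rintegral integral_indic// setIT. Qed.

End laws.

Section gaussian_laws.
Context {R : realType} {d : measure_display} {T : measurableType d} (P : probability T R).

Lemma gauss_normal (V : T -> R) (s : R) : 0 < s -> measurable_fun setT V ->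
  (forall B, measurable B -> P (V @^-1` B) = normal_prob 0 s B) -> gauss P V (s ^+ 2).
Proof.
move=> s0 mV HB; split=> // [|t th]; first exact: sqr_ge0.
rewrite -(normal_cf s0).
rewrite -[RHS]mul1r -[LHS](_ : Ex P (fun w => cst 1 w * cos (t * V w + th)) = _); last first.
  by congr Ex; apply/funext => w; rewrite mul1r.
apply: (@Ex_law _ _ _ P _ (cst 1) V 1) => //.
- by move=> w; rewrite normr1.
- move=> B mB; rewrite mul1r.
  have -> : Ex (normal_prob 0 s) (\1_B : R -> R) = fine (normal_prob 0 s B) by exact: Ex_indic_fine.
  rewrite -HB//.
  rewrite -(Ex_indic_fine P); last by rewrite -[_ @^-1` _]setTI; exact: mV.
  by congr Ex; apply/funext => w; rewrite mul1r !indicE.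
- exact: measurable_cos_affine.
- by move=> x; rewrite ler_norml cos_geN1 cos_le1.
Qed.

Lemma gauss_dirac (V : T -> R) : measurable_fun setT V ->
  (forall B, measurable B -> P (V @^-1` B) = \d_(0 : R) B) -> gauss P V 0.
Proof.
move=> mV HB; split=> // t th; rewrite mulr0 mul0r oppr0 expR0 mul1r.
rewrite -[RHS](Ex_cst P); rewrite /Ex /Rintegral; congr fine; apply: ae_eq_integral => //.
- by apply/measurable_EFinP; apply: measurable_cos_shift; exact: measurable_funM.
- exact/measurable_EFinP.
- exists (V @^-1` (~` [set 0])); split.
  + by rewrite -[_ @^-1` _]setTI; apply: mV => //; exact: measurableC.
  + have /HB : measurable (~` [set (0 : R)]) by exact: measurableC.
    by rewrite diracE memNset//= => ->; rewrite indicE.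
  + move=> w /=; apply: contra_not => V0 _ /=.
    by rewrite V0 mulr0 add0r.
Qed.

Lemma gauss_ae (V W : T -> R) v : measurable_fun setT W -> {ae P, forall w, V w = W w} ->
  gauss P V v -> gauss P W v.
Proof.
move=> mW VW [mV v0 H]; split=> // s th; rewrite -H /Ex /Rintegral; congr fine.
apply: ae_eq_integral => //.
- by apply/measurable_EFinP; apply: measurable_cos_shift; exact: measurable_funM.
- by apply/measurable_EFinP; apply: measurable_cos_shift; exact: measurable_funM.
- by apply: filterS VW => w -> _.
Qed.

Lemma centered_gaussian_gauss V : centered_gaussian P V -> exists v, gauss P V v.
Proof.
move=> [mV [H|[s s0 H]]]; first by exists 0; exact: gauss_dirac.
by exists (s ^+ 2); exact: gauss_normal.
Qed.

(** Independence is given on events. In [claim] the indicators give way to cosines one variable at a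
    time: the first m variables enter through the cosine of their sum, the others through
    indicators. *)
Lemma gauss_independent_sum (omega : nat -> {RV P >-> R}) (a : nat -> R) n :
  mutually_independent omega -> (forall j, standard_gaussian (omega j)) ->
  gauss P (fun w => \sum_(0 <= j < n) a j * omega j w) (\sum_(0 <= j < n) a j ^+ 2).
Proof.
move=> ind std.
have mo j : measurable_fun setT (omega j) by exact: measurable_funPT.
have law j B : measurable B -> P (omega j @^-1` B) = normal_prob 0 1 B by move=> mB; rewrite -(std j B mB).
have mpre j B : measurable B -> measurable (omega j @^-1` B).
  by move=> mB; rewrite -[_ @^-1` _]setTI; exact: mo.
have claim m : (m <= n)%N -> forall (b : nat -> R) th (B : nat -> set R), (forall j, measurable (B j)) ->
   Ex P (fun w => cos (\sum_(0 <= j < m) b j * omega j w + th) * \prod_(m <= j < n) (\1_(B j) (omega j w) : R)) =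
   expR (- ((\sum_(0 <= j < m) b j ^+ 2) / 2)) * cos th * \prod_(m <= j < n) Ex (normal_prob 0 1) (\1_(B j) : R -> R).
  elim: m => [_ b th B mB|m IH mn b th B mB].
    rewrite !(big_geq (leqnn 0)) mul0r oppr0 expR0 mul1r.
    under eq_fun do rewrite (big_geq (leqnn 0)).
    pose F := [fset j | j in index_iota 0 n]%fset.
    have FE j : (j \in F) = (j \in index_iota 0 n) by rewrite in_fset.
    have indE w : \prod_(0 <= j < n) \1_(B j) (omega j w) = \1_(\bigcap_(j in [set` F]) (omega j @^-1` B j)) w :> R.
      rewrite indicE; have [h|h] := pselect ((\bigcap_(j in [set` F]) (omega j @^-1` B j)) w).
        rewrite mem_set//= big_seq big1// => j jn; rewrite indicE mem_set//.
        by apply: (h j); rewrite /= FE.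
      rewrite memNset//=; apply/eqP; rewrite prodf_seq_eq0; apply/hasP.
      move/existsNP: h => [j /not_implyP[jF jB]].
      by exists j; [rewrite -FE|rewrite indicE memNset//=].
    under [X in Ex _ X]eq_fun do rewrite add0r indE.
    have mF : measurable (\bigcap_(j in [set` F]) (omega j @^-1` B j)).
      by apply: fin_bigcap_measurable; [exact: finite_fset|move=> j _; exact: mpre].
    rewrite ExZ; last by apply: (@intg_bnd _ _ _ _ _ 1); [exact: measurable_indic|move=> w; rewrite indicE ger0_norm// lern1 leq_b1].
    rewrite Ex_indic_fine// ind//; congr (_ * _).
    rewrite (_ : (\prod_(j <- F) P (omega j @^-1` B j))%E = (\prod_(0 <= j < n) (Ex (normal_prob 0 1) \1_(B j))%:E)%E).
      by rewrite prodEFin.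
    rewrite (perm_big (index_iota 0 n)) /=; last first.
      by apply: uniq_perm; [exact: fset_uniq|exact: iota_uniq|exact: FE].
    apply: eq_bigr => j _; rewrite (law _ _ (mB j)).
    have -> : Ex (normal_prob 0 1) (\1_(B j) : R -> R) = fine (normal_prob 0 1 (B j)) by apply: Ex_indic_fine; exact: mB.
    rewrite fineK//.
    exact: (fin_num_measure (normal_prob 0 1) _ (mB j)).
  pose G w : R := \prod_(m.+1 <= j < n) \1_(B j) (omega j w).
  have mG : measurable_fun setT G.
    apply: measurable_prod => j _; have m1 : measurable_fun setT (\1_(B j) : R -> R) by exact: measurable_indic.
    exact: (measurableT_comp m1 (mo j)).
  have G1 w : `|G w| <= 1.
    rewrite /G; elim/big_rec: _ => [|j x _ x1]; first by rewrite normr1.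
    by rewrite normrM mulr_ile1// indicE ger0_norm// lern1 leq_b1.
  pose S w := \sum_(0 <= j < m) b j * omega j w.
  have mS : measurable_fun setT S.
    by apply: measurable_sum => j; exact: measurable_funM.
  pose e := expR (- ((\sum_(0 <= j < m) b j ^+ 2) / 2)).
  pose g := \prod_(m.+1 <= j < n) Ex (normal_prob 0 1) (\1_(B j) : R -> R).
  (* [Ex_law] in variable m with the other factors as weight; its identity on indicators is the
     induction hypothesis with the set of index m replaced. *)
  have step th1 th2 : Ex P (fun w => cos (S w + th1) * G w * cos (b m * omega m w + th2)) =
      e * cos th1 * g * (expR (- (b m ^+ 2 / 2)) * cos th2).
    have cN : Ex (normal_prob 0 1) (fun x => cos (b m * x + th2)) = expR (- (b m ^+ 2 / 2)) * cos th2.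
      by rewrite (normal_cf (@ltr01 R)) expr1n mulr1.
    rewrite -cN; apply: (@Ex_law _ _ _ P _ (fun w => cos (S w + th1) * G w) (omega m) 1).
    - by apply: measurable_funM => //; exact: measurable_cos_shift.
    - exact: mo.
    - by move=> w; rewrite normrM mulr_ile1// ler_norml cos_geN1 cos_le1.
    - move=> B0 mB0; pose B' j := if j == m then B0 else B j.
      have mB' j : measurable (B' j) by rewrite /B'; case: ifP.
      have := IH (ltnW mn) b th1 B' mB'; rewrite big_ltn// /B' eqxx.
      have -> : \prod_(m.+1 <= j < n) Ex (normal_prob 0 1) (\1_(if j == m then B0 else B j) : R -> R) = g.
        by apply: eq_big_nat => j /andP[mj _]; rewrite gtn_eqF.
      move=> h; rewrite [RHS](_ : _ = e * cos th1 * (Ex (normal_prob 0 1) \1_B0 * g)); last by ring.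
      rewrite -h; congr Ex; apply/funext => w; rewrite big_ltn// eqxx.
      have -> : \prod_(m.+1 <= j < n) \1_(if j == m then B0 else B j) (omega j w) = G w.
        by apply: eq_big_nat => j /andP[mj _]; rewrite gtn_eqF.
      by rewrite /S; ring.
    - exact: measurable_cos_affine.
    - by move=> x; rewrite ler_norml cos_geN1 cos_le1.
  have I th1 th2 : intg P (fun w => cos (S w + th1) * G w * cos (b m * omega m w + th2)).
    apply: (@intg_bnd _ _ _ _ _ 1).
      apply: measurable_funM; last by apply: measurable_cos_shift; exact: measurable_funM.
      by apply: measurable_funM => //; exact: measurable_cos_shift.
    by move=> w; rewrite !normrM !mulr_ile1// ler_norml cos_geN1 cos_le1.
  (* The addition formula for the cosine, with both sines written as cosines shifted by pi / 2. *)
  transitivity (Ex P (fun w => cos (S w + th) * G w * cos (b m * omega m w + 0) -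
      cos (S w + (th + pi / 2)) * G w * cos (b m * omega m w + (0 + pi / 2)))).
    congr Ex; apply/funext => w; rewrite big_nat_recr//= -/(S w) -/(G w).
    rewrite (_ : S w + b m * omega m w + th = (S w + th) + (b m * omega m w + 0)); last by ring.
    by rewrite cosD (addrA (S w)) (addrA (b m * _)) !cosDpihalf; ring.
  rewrite ExB// !step !cosDpihalf sin0 cos0 oppr0 !mulr0 subr0 mulr1.
  rewrite big_nat_recr//= -/g /e mulrDl opprD expRD; ring.
split=> [||s th].
- by apply: measurable_sum => j; exact: measurable_funM.
- by apply: sumr_ge0 => j _; exact: sqr_ge0.
have := claim n (leqnn n) (fun j => s * a j) th (fun=> setT) (fun=> measurableT).
rewrite (big_geq (leqnn n)) [_ * 1]mulr1.
under eq_bigr do rewrite exprMn.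
rewrite -mulr_sumr => <-; congr Ex; apply/funext => w.
rewrite (big_geq (leqnn n)) mulr1 mulr_sumr.
by under eq_bigr do rewrite mulrA.
Qed.

End gaussian_laws.

(** * Smoothness of paths and variances *)

Section restriction_to_the_line.
Local Open Scope complex_scope.
Context {R : realType}.

Lemma ReD (x y : R[i]) : complex.Re (x + y) = complex.Re x + complex.Re y.
Proof. by case: x => a b; case: y. Qed.

Lemma ReB (x y : R[i]) : complex.Re (x - y) = complex.Re x - complex.Re y.
Proof. by case: x => a b; case: y. Qed.

Lemma Re_sum I (s : seq I) (F : I -> R[i]) :
  complex.Re (\sum_(i <- s) F i) = \sum_(i <- s) complex.Re (F i).
Proof.
elim: s => [|i s IH]; first by rewrite !big_nil.
by rewrite !big_cons ReD IH.
Qed.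

Lemma ReMc (z : R[i]) (y : R) : complex.Re (z * y%:C) = complex.Re z * y.
Proof. by case: z => a b /=; rewrite mulr0 subr0. Qed.

Lemma cvg_Re (u : nat -> (R[i])^o) (l : (R[i])^o) : u @ \oo --> l ->
  complex.Re (u n) @[n --> \oo] --> complex.Re l.
Proof.
move=> ul; apply/cvgrPdist_lt => /= e e0.
have ec0 : 0 < e%:C by rewrite ltcR.
have /cvgrPdist_lt/(_ _ ec0) := ul; apply: filterS => n /= h.
by rewrite -ltcR -ReB; apply: le_lt_trans h; exact: normc_ge_Re.
Qed.

Definition real_analytic (f : R -> R) := forall x0, exists (c : nat -> R) (r : R), 0 < r /\
  forall y, `|y| < r -> pseries c y @ \oo --> f (x0 + y).

Lemma entire_real_analytic (f : (R[i])^o -> (R[i])^o) : entire f ->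
  real_analytic (fun x => complex.Re (f x%:C)).
Proof.
move=> ef x0; have [a] := ef x0%:C => /nbhs_ballP[e /= e0 H].
have er : (complex.Re e)%:C = e by rewrite RRe_real// gtr0_real.
exists (fun j => complex.Re (a j)), (complex.Re e); split; first by rewrite -ltcR er.
move=> y ye; have := H (x0 + y)%:C; rewrite -ball_normE /=.
have -> : (x0%:C - (x0 + y)%:C : R[i]) = (- y)%:C by rewrite -rmorphB; congr (_%:C); ring.
have -> : `|(- y)%:C : R[i]| = `|y|%:C by rewrite normc_def /= expr0n addr0 sqrtr_sqr normrN.
rewrite -er ltcR => /(_ ye) /cvg_Re.
have E n : complex.Re (\sum_(0 <= j < n) a j * ((x0 + y)%:C - x0%:C) ^+ j) = pseries (fun j => complex.Re (a j)) y n.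
  rewrite Re_sum /pseries /series /=; apply: eq_bigr => j _.
  have -> : ((x0 + y)%:C - x0%:C : R[i]) = y%:C by rewrite -rmorphB; congr (_%:C); ring.
  by rewrite -rmorphXn ReMc.
by rewrite (funext E).
Qed.

(** The factor n + 1 of the derived series is absorbed by 2^n, and the radius K / 4 leaves a
    geometric series of ratio 1 / 2. The loss of radius is harmless for a local statement. *)
Lemma cvg_pseries_diffs (c : nat -> R) (K x : R) : 0 < K -> cvgn (pseries c K) -> `|x| <= K / 4 ->
  cvgn (pseries (pseries_diffs c) x).
Proof.
move=> K0 cK xK; have /cvg_series_cvg_0/cvgP/cvg_seq_bounded[M [_ HM]] := cK.
pose B := `|M| + 1.
have BM n : `|c n * K ^+ n| <= B.
  have MB : M < B by rewrite /B; have := ler_norm M; lra.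
  exact: (HM B MB n I).
have B0 : 0 <= B by apply: le_trans (BM 0%N).
apply: normed_cvg; apply: (@series_le_cvg _ _ (geometric (B / K) (2^-1))).
- by move=> n; exact: normr_ge0.
- by move=> n; rewrite /= mulr_ge0 ?exprn_ge0 ?divr_ge0 ?invr_ge0// ltW.
- move=> n; rewrite /= /pseries_diffs !normrM normrX.
  have h1 : `|c n.+1| * K ^+ n.+1 <= B by have := BM n.+1; rewrite normrM normrX (gtr0_norm K0).
  have h2 : `|x| ^+ n <= (K / 4) ^+ n by apply: lerXn2r; rewrite ?nnegrE// divr_ge0 ?ltW.
  apply: (@le_trans _ _ (n.+1%:R * `|c n.+1| * (K / 4) ^+ n)).
    by rewrite normr_nat ler_wpM2l// mulr_ge0.
  have h3 : (n.+1%:R : R) <= 2 ^+ n by rewrite -natrX ler_nat ltn_expl.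
  have Kn : 0 < K ^+ n.+1 by exact: exprn_gt0.
  have -> : n.+1%:R * `|c n.+1| * (K / 4) ^+ n = (n.+1%:R / 2 ^+ n) * (`|c n.+1| * K ^+ n.+1) * (K^-1 * 2^-1 ^+ n).
    rewrite exprMn (_ : (4 : R) = 2 * 2); last by ring.
    by rewrite invfM exprMn exprVn exprS; field; rewrite !gt_eqF// exprn_gt0.
  rewrite [leRHS](_ : _ = 1 * B * (K^-1 * 2^-1 ^+ n)); last by ring.
  apply: ler_wpM2r; first by rewrite mulr_ge0 ?exprn_ge0 ?invr_ge0// ltW.
  apply: ler_pM => //; rewrite ?divr_ge0 ?exprn_ge0 ?mulr_ge0 ?exprn_ge0 ?(ltW K0)//.
  by rewrite ler_pdivrMr ?exprn_gt0// mul1r.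
- by apply: is_cvg_geometric_series; rewrite ger0_norm ?invr_ge0// invf_lt1// ltr1n.
Qed.

Lemma real_analytic_derive f : real_analytic f ->
  (forall x, derivable f x 1) /\ real_analytic f^`()%classic.
Proof.
move=> af.
suff H (x0 : R) : exists (c : nat -> R) (r : R), 0 < r /\ forall y : R, `|y| < r ->
    is_derive (x0 + y) 1 f (limn (pseries c y)) /\ cvgn (pseries c y).
  split=> [x|x0].
    by have [c [r [r0 /(_ 0)]]] := H x; rewrite normr0 addr0 => /(_ r0)[d _]; exact: ex_derive.
  have [c [r [r0 h]]] := H x0; exists c, r; split=> // y /h[d cv].
  by rewrite derive1E derive_val; exact: cv.
have [c [r [r0 h]]] := af x0.
have cv y : `|y| < r -> cvgn (pseries c y) by move=> /h/cvgP.
have rr : `|r / 2| < r by rewrite ger0_norm ?divr_ge0 ?ltW//; lra.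
(* Termwise differentiation asks for the convergence of two derived series; each takes a quarter of
   the previous radius, r / 2, r / 8, r / 32. *)
have c1 y : `|y| <= r / 8 -> cvgn (pseries (pseries_diffs c) y).
  by move=> yr; apply: (cvg_pseries_diffs _ (cv _ rr)); [lra|apply: (le_trans yr); lra].
have c1r : cvgn (pseries (pseries_diffs c) (r / 8)) by apply: c1; rewrite ger0_norm//; lra.
have c2 : cvgn (pseries (pseries_diffs (pseries_diffs c)) (r / 32)).
  by apply: (cvg_pseries_diffs _ c1r); [lra|rewrite ger0_norm; lra].
exists (pseries_diffs c), (r / 32); split; first by lra.
move=> y yr; split; last by apply: c1; lra.
have r32 : `|r / 32| = r / 32 by rewrite ger0_norm ?divr_ge0 ?ltW.
have D : is_derive y 1 (fun x => limn (pseries c x)) (limn (pseries (pseries_diffs c) y)).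
  apply: (@pseries_snd_diffs _ _ (r / 32)) => //; last by rewrite r32.
    by apply: cv; rewrite r32; lra.
  by apply: c1; rewrite r32; lra.
have D2 : is_derive (x0 + y) 1 ((fun x => limn (pseries c x)) \o (fun x => x - x0)) (limn (pseries (pseries_diffs c) y) * 1).
  apply: is_derive1_comp; first by rewrite (addrC x0) addrK.
  by apply: is_derive_eq; rewrite ?subr0 ?oppr0 ?addr0.
rewrite mulr1 in D2; apply: near_eq_is_derive D2.
have : \forall z \near x0 + y, `|x0 + y - z| < r / 32 by apply: nbhsx_ballx => //; lra.
apply: filterS => z zr /=.
have zr' : `|z - x0| < r.
  have -> : z - x0 = y - (x0 + y - z) by ring.
  by apply: (le_lt_trans (ler_normB _ _)); lra.
have := h _ zr'; rewrite (addrC x0) subrK => /cvg_lim; exact.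
Qed.

Lemma real_analytic_smooth f : real_analytic f -> smooth_in setT f.
Proof.
move=> af n; have : real_analytic (f^`(n)%classic).
  by elim: n => [//|n IH]; rewrite derive1nS; have [] := real_analytic_derive IH.
by move=> /real_analytic_derive[h _] t _; exact: h.
Qed.

End restriction_to_the_line.

Section smooth_closure.
Context {R : realType}.
Implicit Types (f g h : R -> R) (O : set R) (F G : (R -> R) -> Prop).

(** A class stable under differentiation on [O] consists of smooth functions. Derivatives agree with
    members of the class on [O] only, which suffices because [O] is open. *)
Lemma smooth_closed O F : open O ->
  (forall f, F f -> exists2 g, F g & forall t, O t -> is_derive t 1 f (g t)) ->
  forall f, F f -> smooth_in O f.
Proof.
move=> oO HF f Ff n t Ot.
have [g Fg fg] : exists2 g, F g & forall t, O t -> f^`(n)%classic t = g t.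
  elim: n => [|n [g Fg IH]]; first by exists f.
  have [h Fh gh] := HF g Fg; exists h => // s Os.
  rewrite derive1nS derive1E; have := gh s Os => ghs; have := @derive_val _ _ _ _ _ _ _ ghs => <-.
  apply: near_eq_derive; have := open_nbhs_nbhs (conj oO Os); apply: filterS => z; exact: IH.
have [h _ gh] := HF g Fg.
apply: (@near_eq_derivable _ _ _ g); last by have := gh t Ot => ?; exact: ex_derive.
by have := open_nbhs_nbhs (conj oO Ot); apply: filterS => z Oz; rewrite fg.
Qed.

(** With this closure, stability under differentiation has to be checked on the generators [G]
    only. *)
Inductive polynomial_in G : (R -> R) -> Prop :=
| poly_gen f of G f : polynomial_in G f
| poly_cst c : polynomial_in G (cst c)
| poly_add f g of polynomial_in G f & polynomial_in G g : polynomial_in G (fun t => f t + g t)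
| poly_mul f g of polynomial_in G f & polynomial_in G g : polynomial_in G (fun t => f t * g t).

Lemma smooth_polynomial O G : open O ->
  (forall f, G f -> exists2 g, polynomial_in G g & forall t, O t -> is_derive t 1 f (g t)) ->
  forall f, polynomial_in G f -> smooth_in O f.
Proof.
move=> oO HG; apply: smooth_closed => // f; elim=> {f}.
- exact: HG.
- by move=> c; exists (cst 0); [exact: poly_cst|move=> t _; exact: is_derive_cst].
- move=> f g _ [f' Pf' df] _ [g' Pg' dg]; exists (fun t => f' t + g' t); first exact: poly_add.
  by move=> t Ot; have := df t Ot; have := dg t Ot => ? ?; apply: is_deriveD.
- move=> f g Pf [f' Pf' df] Pg [g' Pg' dg].
  exists (fun t => f t * g' t + g t * f' t); first by apply: poly_add; exact: poly_mul.
  by move=> t Ot; have := df t Ot; have := dg t Ot => ? ?; exact: is_deriveM.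
Qed.

Lemma smooth_inM O f g : open O -> smooth_in O f -> smooth_in O g -> smooth_in O (fun t => f t * g t).
Proof.
move=> oO sf sg; apply: (@smooth_polynomial O (smooth_in O)) => //; last first.
  by apply: poly_mul; exact: poly_gen.
move=> h sh; exists h^`()%classic.
  by apply: poly_gen => n t Ot; rewrite -derive1Sn; exact: sh.
by move=> t Ot; have := is_derive_smooth 0 sh Ot.
Qed.

End smooth_closure.

Section covariance.
Context {d : measure_display} {T : measurableType d} {R : realType} (P : probability T R).
Variables (O : set R) (X : R -> T -> R).
Hypothesis gX : gaussian_smooth P O X.

Lemma comb_sqr_cvg (L : nat -> seq (R * nat * R)) l :
  (forall n, points_in O (L n)) -> points_in O l ->
  (forall w, comb X (L n) w @[n --> \oo] --> comb X l w) ->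
  Ex P (fun w => comb X (L n) w ^+ 2) @[n --> \oo] --> Ex P (fun w => comb X l w ^+ 2).
Proof.
move=> OL Ol LC; have [v gv] := choice (fun n => gauss_comb gX (OL n)).
have ml : measurable_fun setT (comb X l) by have [] := comb_sqr gX Ol.
have [|l' gl vl] := gauss_lim gv ml; first exact: aeW.
rewrite (gauss_var gl); under eq_fun do rewrite (gauss_var (gv _)).
exact: vl.
Qed.

(** Polarization reduces products to squares, and expectations of squares are variances, which
    converge by [gauss_lim]. *)
Lemma comb_mul_cvg (L M : nat -> seq (R * nat * R)) l m :
  (forall n, points_in O (L n)) -> (forall n, points_in O (M n)) -> points_in O l -> points_in O m ->
  (forall w, comb X (L n) w @[n --> \oo] --> comb X l w) ->
  (forall w, comb X (M n) w @[n --> \oo] --> comb X m w) ->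
  Ex P (fun w => comb X (L n) w * comb X (M n) w) @[n --> \oo] --> Ex P (fun w => comb X l w * comb X m w).
Proof.
move=> OL OM Ol Om LC MC.
have pol a b : points_in O a -> points_in O b -> Ex P (fun w => comb X a w * comb X b w) =
    4^-1 * (Ex P (fun w => comb X (a ++ b) w ^+ 2) - Ex P (fun w => comb X (a ++ scale_pts (-1) b) w ^+ 2)).
  move=> Oa Ob; have [_ I1] := comb_sqr gX (points_in_cat Oa Ob).
  have [_ I2] := comb_sqr gX (points_in_cat Oa (@points_in_scale _ _ (-1) _ Ob)).
  rewrite -ExB// -ExZ; last exact: intgB.
  by congr Ex; apply/funext => w; rewrite !comb_cat combZ; field.
under eq_fun do rewrite pol//.
rewrite pol//; apply: cvgnZ; apply: cvgB; apply: comb_sqr_cvg.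
- by move=> n; exact: points_in_cat.
- exact: points_in_cat.
- by move=> w; under eq_fun do rewrite comb_cat; rewrite comb_cat; exact: cvgD.
- by move=> n; apply: points_in_cat => //; exact: points_in_scale.
- by apply: points_in_cat => //; exact: points_in_scale.
- move=> w; under eq_fun do rewrite comb_cat combZ; rewrite comb_cat combZ.
  by apply: cvgD => //; exact: cvgnZ.
Qed.

Lemma derive_variance i j t : O t ->
  is_derive t 1 (fun s => Ex P (fun w => pderive i X s w * pderive j X s w))
    (Ex P (fun w => pderive i.+1 X t w * pderive j X t w) + Ex P (fun w => pderive i X t w * pderive j.+1 X t w)).
Proof.
move=> Ot; apply: is_derive_quotient => u u0 ul.
have [r r0 Hr] := near_points gX (@points_in1 _ O 1 0%N t Ot).
have [N _ HN] : \forall k \near \oo, `|u k| <= r.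
  have /cvgrPdist_le/(_ _ r0) := ul; apply: filterS => k.
  by rewrite sub0r normrN.
have Otu k : O (t + u (k + N)%N).
  by apply: (Hr (1, 0%N, t)); rewrite ?mem_head//; apply: HN => /=; rewrite leq_addl.
have uN : u (k + N)%N @[k --> \oo] --> 0 by rewrite (cvg_shiftn N u).
pose q (n k : nat) := [:: ((u (k + N)%N)^-1, n, t + u (k + N)%N); (- (u (k + N)%N)^-1, n, t)].
have qE n k w : comb X (q n k) w = (u (k + N)%N)^-1 * (pderive n X (t + u (k + N)%N) w - pderive n X t w).
  by rewrite /comb !big_cons big_nil /=; ring.
have Oq n k : points_in O (q n k) by do 2 apply: points_in_cons => //.
have qC n w : comb X (q n k) w @[k --> \oo] --> comb X [:: (1, n.+1, t)] w.
  under eq_fun do rewrite qE; rewrite comb1 mul1r.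
  have sX : smooth_in O (X ^~ w) by case: gX.
  exact: (cvg_quotient (is_derive_smooth n sX Ot) (fun k => u0 (k + N)%N) uN).
have O1 n : points_in O [:: (1, n, t)] by exact: points_in1.
have c1 n w : comb X [:: (1, n, t)] w = pderive n X t w by rewrite comb1 mul1r.
have S l : points_in O l -> measurable_fun setT (comb X l) /\ intg P (fun w => comb X l w ^+ 2).
  exact: comb_sqr gX l.
have I l m : points_in O l -> points_in O m -> intg P (fun w => comb X l w * comb X m w).
  by move=> /S[? ?] /S[? ?]; exact: intg_sqr_mul.
(* The difference quotient of a product: with q the quotients of the factors it is u q_i q_j + q_i
   X_j + X_i q_j, whose first term vanishes in the limit. *)
have E k : (u (k + N)%N)^-1 * (Ex P (fun w => pderive i X (t + u (k + N)%N) w * pderive j X (t + u (k + N)%N) w) -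
    Ex P (fun w => pderive i X t w * pderive j X t w)) =
    u (k + N)%N * Ex P (fun w => comb X (q i k) w * comb X (q j k) w) +
     (Ex P (fun w => comb X (q i k) w * comb X [:: (1, j, t)] w) + Ex P (fun w => comb X [:: (1, i, t)] w * comb X (q j k) w)).
  have [m5 I5] := pderive_sqr gX i (Otu k); have [m6 I6] := pderive_sqr gX j (Otu k).
  have [m3 I3] := pderive_sqr gX i Ot; have [m4 I4] := pderive_sqr gX j Ot.
  have J4 := intg_sqr_mul m5 m6 I5 I6; have J5 := intg_sqr_mul m3 m4 I3 I4.
  rewrite -(ExB J4 J5) -(ExZ _ (intgB J4 J5)).
  rewrite -(ExD (I _ _ (Oq i k) (O1 j)) (I _ _ (O1 i) (Oq j k))) -(ExZ (u (k + N)%N) (I _ _ (Oq i k) (Oq j k))).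
  rewrite -ExD; [|by apply: intgZ; exact: I|by apply: intgD; exact: I].
  by congr Ex; apply/funext => w; rewrite !qE !c1; field; exact: u0.
have e1 : Ex P (fun w => pderive i.+1 X t w * pderive j X t w) = Ex P (fun w => comb X [:: (1, i.+1, t)] w * comb X [:: (1, j, t)] w).
  by congr Ex; apply/funext => w; rewrite !c1.
have e2 : Ex P (fun w => pderive i X t w * pderive j.+1 X t w) = Ex P (fun w => comb X [:: (1, i, t)] w * comb X [:: (1, j.+1, t)] w).
  by congr Ex; apply/funext => w; rewrite !c1.
have lim : u (k + N)%N * Ex P (fun w => comb X (q i k) w * comb X (q j k) w) +
     (Ex P (fun w => comb X (q i k) w * comb X [:: (1, j, t)] w) + Ex P (fun w => comb X [:: (1, i, t)] w * comb X (q j k) w))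
     @[k --> \oo] --> 0 * Ex P (fun w => comb X [:: (1, i.+1, t)] w * comb X [:: (1, j.+1, t)] w) +
     (Ex P (fun w => pderive i.+1 X t w * pderive j X t w) + Ex P (fun w => pderive i X t w * pderive j.+1 X t w)).
  rewrite e1 e2; apply: cvgD; first by apply: cvgM => //; exact: comb_mul_cvg.
  by apply: cvgD; apply: comb_mul_cvg => // w; exact: cvg_cst.
rewrite mul0r add0r -(funext E) in lim.
by rewrite -(cvg_shiftn N); exact: lim.
Qed.

(** For s = v^(-1/2) one has s' = - v' s^3 / 2, so polynomials in s and the covariances [v i j] of
    derivatives form a class closed under differentiation. *)
Lemma smooth_inv_std : (forall t, O t -> 0 < Ex P (fun w => X t w ^+ 2)) ->
  smooth_in O (fun t => (Num.sqrt (Ex P (fun w => X t w ^+ 2)))^-1).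
Proof.
move=> v0; have oO : open O by case: gX.
pose v i j t := Ex P (fun w => pderive i X t w * pderive j X t w).
pose s t := (Num.sqrt (v 0%N 0%N t))^-1.
have -> : (fun t => (Num.sqrt (Ex P (fun w => X t w ^+ 2)))^-1) = s by [].
apply: (@smooth_polynomial _ O (fun f => f = s \/ exists i j, f = v i j)) => //; last first.
  by apply: poly_gen; left.
have vP i j : polynomial_in (fun f => f = s \/ exists i j, f = v i j) (v i j).
  by apply: poly_gen; right; exists i, j.
have sP : polynomial_in (fun f => f = s \/ exists i j, f = v i j) s by apply: poly_gen; left.
move=> f [->|[i [j ->]]]; last first.
  exists (fun t => v i.+1 j t + v i j.+1 t); first exact: poly_add.
  by move=> t Ot; exact: derive_variance.
exists (fun t => (cst (- 2^-1) t * (v 1%N 0%N t + v 0%N 1%N t)) * (s t * (s t * s t))).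
  by apply: poly_mul; [apply: poly_mul; [exact: poly_cst|exact: poly_add]|do 2 apply: poly_mul => //].
move=> t Ot; have vt : 0 < v 0%N 0%N t by exact: v0.
have sv : 0 < Num.sqrt (v 0%N 0%N t) by rewrite sqrtr_gt0.
have D0 := derive_variance 0 0 Ot.
have D1 := is_derive1_sqrt vt.
have D2 : is_derive t 1 (Num.sqrt \o v 0%N 0%N) ((2 * Num.sqrt (v 0%N 0%N t))^-1 * (v 1%N 0%N t + v 0%N 1%N t)).
  exact: is_derive1_comp.
have D3 : is_derive t 1 s (- (Num.sqrt (v 0%N 0%N t)) ^- 2 *: ((2 * Num.sqrt (v 0%N 0%N t))^-1 * (v 1%N 0%N t + v 0%N 1%N t))).
  by apply: is_deriveV => //; rewrite gt_eqF.
apply: is_derive_eq; rewrite /s /GRing.scale /=; field.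
by rewrite gt_eqF.
Qed.

Lemma gaussian_smoothM g : smooth_in O g -> gaussian_smooth P O (fun t w => g t * X t w).
Proof.
move=> sg; have [oO sX gs] := gX; split; [exact: oO|by move=> w; exact: (smooth_inM oO sg (sX w))|move=> s sO].
have [|v gv] := gs [seq (y.1 * g y.2, y.2) | y <- s].
  by move=> _ /mapP[z zs ->] /=; exact: sO.
exists v; move: gv; congr (gauss P _ v); apply/funext => w.
by rewrite big_map; apply: eq_bigr => y _ /=; rewrite mulrA.
Qed.

End covariance.

(** * Hermite interpolation *)

Section hermite.
Context {R : realType}.
Implicit Types (f : R -> R) (p q : {poly R}).

Lemma double_roots_eq0 (s : seq R) p : uniq s -> all (root p) s -> all (root p^`()) s ->
  (size p <= (size s).*2)%N -> p = 0.
Proof.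
elim: s p => [|a s IH] p /=; first by rewrite leqn0 size_poly_eq0 => _ _ _ /eqP.
move=> /andP[nas us] /andP[ra rs] /andP[ra' rs'] sp.
have /factor_theorem[q1 p1] := ra.
have : root q1 a.
  move: ra'; rewrite p1 derivM derivXsubC mulr1 /root !hornerE subrr mulr0 add0r.
  by [].
move=> /factor_theorem[q q1E].
have pE : p = q * ('X - a%:P) ^+ 2 by rewrite p1 q1E expr2 mulrA.
suff q0 : q = 0 by rewrite pE q0 mul0r.
have neq b : b \in s -> b - a != 0.
  by move=> bs; rewrite subr_eq0; apply: contraNneq nas => <-.
have rq b : b \in s -> q.[b] = 0.
  move=> bs; have := allP rs _ bs; rewrite pE /root hornerM horner_exp hornerXsubC mulf_eq0 expf_eq0 /=.
  by rewrite (negbTE (neq _ bs)) orbF => /eqP.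
apply: IH => //.
- by apply/allP => b /rq; rewrite /root => ->.
- apply/allP => b bs; have := allP rs' _ bs; rewrite pE derivM /root hornerD (hornerM q) (rq b bs) mul0r addr0 hornerM horner_exp hornerXsubC.
  by rewrite mulf_eq0 expf_eq0 /= (negbTE (neq _ bs)) orbF.
- have [->|q0] := eqVneq q 0; first by rewrite size_poly0.
  move: sp; rewrite pE size_Mmonic ?monic_exp ?monicXsubC// size_exp_XsubC; lia.
Qed.

(** These weights on values and first derivatives at 0, ..., N - 1 extract the coefficient j of any
    polynomial of degree below 2 N. They exist because a vector in the left kernel of the matrix is
    such a polynomial with N double roots, hence 0. *)
Lemma hermite_weights N j : (j < N + N)%N -> exists A B : 'I_N -> R, forall m, (m < N + N)%N ->
  \sum_(i < N) (A i * i%:R ^+ m + B i * (m%:R * i%:R ^+ m.-1)) = (m == j)%:R.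
Proof.
move=> jN.
pose M1 := \matrix_(m < N + N, i < N) (i%:R ^+ m : R).
pose M2 := \matrix_(m < N + N, i < N) (m%:R * i%:R ^+ m.-1 : R).
pose M := row_mx M1 M2.
have inj (u : 'rV[R]_(N + N)) : u *m M = 0 -> u = 0.
  rewrite mul_mx_row => /eqP; rewrite row_mx_eq0 => /andP[/eqP h1 /eqP h2].
  pose p := \poly_(m < N + N) (if insub m is Some i then u 0 (i : 'I_(N + N)) else 0).
  have pc (m : 'I_(N + N)) : p`_m = u 0 m by rewrite coef_poly ltn_ord valK.
  have s0 : (size p <= N + N)%N by exact: size_poly.
  have hp x : p.[x] = \sum_(m < N + N) u 0 m * x ^+ m.
    by rewrite (horner_coef_wide _ s0); apply: eq_bigr => m _; rewrite pc.
  have hp' x : p^`().[x] = \sum_(m < N + N) u 0 m * (m%:R * x ^+ m.-1).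
    have pE : p = \sum_(m < N + N) (u 0 m)%:P * 'X^m.
      apply/polyP => i; rewrite coef_sum; have [iN|iN] := ltnP i (N + N).
        rewrite (bigD1 (Ordinal iN)) //= coefCM coefXn eqxx mulr1 big1 ?addr0 -?pc//.
        move=> m mi; rewrite coefCM coefXn (_ : (i == m) = false) ?mulr0//.
        by apply/negbTE; apply: contra mi => /eqP im; apply/eqP/val_inj; rewrite /= im.
      rewrite nth_default ?(leq_trans s0)// big1// => m _.
      by rewrite coefCM coefXn gtn_eqF ?mulr0// (leq_trans (ltn_ord m)).
    rewrite pE linear_sum horner_sum; apply: eq_bigr => m _.
    by rewrite /= derivM derivC mul0r add0r derivXn hornerM hornerC hornerMn hornerXn -[_ *+ m]mulr_natl.
  have p0 : p = 0.
    apply: (@double_roots_eq0 [seq (i%:R : R) | i <- iota 0 N]).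
    - by rewrite map_inj_uniq ?iota_uniq// => a b /eqP; rewrite eqr_nat => /eqP.
    - apply/allP => _ /mapP[i iN ->]; rewrite mem_iota /= add0n in iN; rewrite /root hp.
      have /matrixP/(_ 0 (Ordinal iN)) := h1; rewrite !mxE => h; apply/eqP; rewrite -[RHS]h.
      by apply: eq_bigr => m _; rewrite mxE.
    - apply/allP => _ /mapP[i iN ->]; rewrite mem_iota /= add0n in iN; rewrite /root hp'.
      have /matrixP/(_ 0 (Ordinal iN)) := h2; rewrite !mxE => h; apply/eqP; rewrite -[RHS]h.
      by apply: eq_bigr => m _; rewrite mxE.
    - by rewrite size_map size_iota -addnn.
  by apply/rowP => m; rewrite -pc p0 coef0 mxE.
have Mu : M \in unitmx.
  rewrite -row_free_unit -kermx_eq0; apply/eqP/row_matrixP => i; rewrite row0.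
  by apply: inj; rewrite -row_mul mulmx_ker row0.
pose v := invmx M *m delta_mx (Ordinal jN) (0 : 'I_1).
exists (fun i => usubmx v i 0), (fun i => dsubmx v i 0) => m mN.
have : M *m v = delta_mx (Ordinal jN) 0 by rewrite mulKVmx.
rewrite -[v]vsubmxK mul_row_col => /matrixP/(_ (Ordinal mN) 0); rewrite !mxE andbT.
rewrite (_ : (Ordinal mN == Ordinal jN) = (m == j))// => <-.
by rewrite col_mxKu col_mxKd big_split /=; congr (_ + _); apply: eq_bigr => i _; rewrite !mxE mulrC.
Qed.

Lemma is_derive_sum_pow n (c : nat -> R) (s : R) :
  is_derive s 1 (fun s => \sum_(m < n) c m * s ^+ m) (\sum_(m < n) c m * (m%:R * s ^+ m.-1)).
Proof.
elim: n => [|n IH].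
  by under eq_fun do rewrite big_ord0; rewrite big_ord0; exact: is_derive_cst.
under eq_fun do rewrite big_ord_recr; rewrite big_ord_recr /=.
apply: is_deriveD; have := is_deriveZ (c n) (@is_deriveX _ _ id n s 1 1 (is_derive_id s 1)).
by rewrite /GRing.scale /= mulr1 (_ : _ \*: _ = (fun x => c n * x ^+ n))//; apply/funext => x; rewrite fctE.
Qed.

Lemma taylor_bound n f t r M : (forall m s, 0 <= s <= r -> derivable (f^`(m)%classic) (t + s) 1) ->
  (forall s, 0 <= s <= r -> `|f^`(n)%classic (t + s)| <= M) ->
  forall s, 0 <= s <= r -> `|f (t + s) - \sum_(m < n) f^`(m)%classic t / m`!%:R * s ^+ m| <= M * s ^+ n.
Proof.
elim: n f => [|n IH] f df HM s sr.
  by rewrite big_ord0 subr0 mulr1; exact: HM.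
have rec (F : nat -> R) : \sum_(m < n.+1) F m = F 0%N + \sum_(m < n) F m.+1.
  by rewrite big_ord_recl; under eq_bigr do rewrite lift0.
have /andP[s0 srr] := sr; have M0 : 0 <= M by apply: le_trans (HM s sr).
have := s0; rewrite le_eqVlt => /predU1P[s00|s_gt0].
  rewrite -s00 addr0 (rec (fun m => f^`(m)%classic t / m`!%:R * 0 ^+ m)) expr0 fact0 divr1 mulr1 /= big1.
    by rewrite addr0 subrr normr0 exprS mul0r mulr0.
  by move=> m _; rewrite exprS mul0r mulr0.
pose g s := f (t + s) - \sum_(m < n.+1) f^`(m)%classic t / m`!%:R * s ^+ m.
pose g' s := f^`()%classic (t + s) - \sum_(m < n) (f^`()%classic)^`(m)%classic t / m`!%:R * s ^+ m.
have dg (x : R) : 0 <= x <= r -> is_derive x 1 g (g' x).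
  move=> xr; have D1 : is_derive (t + x) 1 f (f^`()%classic (t + x)).
    by apply: DeriveDef; [exact: (df 0%N)|rewrite derive1E].
  have D2 : is_derive x 1 (f \o (fun s => t + s)) (f^`()%classic (t + x) * 1).
    apply: is_derive1_comp; have -> : (fun s => t + s) = (fun s => s + t) by apply/funext => z; rewrite addrC.
    by apply: is_derive_eq; rewrite addr0.
  rewrite mulr1 in D2.
  have D3 := is_derive_sum_pow n.+1 (fun m => f^`(m)%classic t / m`!%:R) x.
  have -> : g' x = f^`()%classic (t + x) - \sum_(m < n.+1) f^`(m)%classic t / m`!%:R * (m%:R * x ^+ m.-1).
    rewrite /g' (rec (fun m => f^`(m)%classic t / m`!%:R * (m%:R * x ^+ m.-1))) mul0r mulr0 add0r.
    congr (_ - _); apply: eq_bigr => m _.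
    rewrite derive1Sn factS natrM; field.
    by rewrite pnatr_eq0 -lt0n fact_gt0 /= addrC natr1 pnatr_eq0.
  exact: is_deriveB.
have cg : {within `[0, s], continuous g}.
  apply: derivable_within_continuous => x; rewrite in_itv /= => /andP[x0 xs].
  have xr : 0 <= x <= r by rewrite x0 (le_trans xs).
  by have := dg x xr => ?; exact: ex_derive.
have [|c] := @MVT _ g g' 0 s s_gt0 _ cg.
  by move=> x; rewrite in_itv /= => /andP[x0 xs]; apply: dg; rewrite !ltW// (lt_le_trans xs).
rewrite in_itv /= => /andP[c0 cs]; have -> : g 0 = 0.
  rewrite /g addr0 (rec (fun m => f^`(m)%classic t / m`!%:R * 0 ^+ m)) expr0 fact0 divr1 mulr1 /= big1.
    by rewrite addr0 subrr.
  by move=> m _; rewrite exprS mul0r mulr0.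
rewrite !subr0 -/(g s) => ->; rewrite normrM (gtr0_norm s_gt0) exprSr mulrA ler_wpM2r//.
have cr : 0 <= c <= r by rewrite !ltW// (lt_le_trans cs).
apply: (@le_trans _ _ (M * c ^+ n)); last by rewrite ler_wpM2l// lerXn2r ?nnegrE// ltW.
apply: IH => //.
- by move=> m x xr; rewrite -derive1Sn; exact: df.
- by move=> x xr; rewrite -derive1Sn; exact: HM.
Qed.

(** Rescaled to a step tau, the weights are exact on the Taylor polynomial of degree below 2 N, and
    the remainder, of order tau^(2 N) / tau^j, is O(tau). They are chosen before f, so the same
    combinations serve all paths of both processes. *)
Lemma hermite_limit N j r : (j < N + N)%N -> 0 < r -> exists x y : nat -> 'I_N -> R,
  forall (O : set R) f t, open O -> smooth_in O f -> O t ->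
  \sum_(i < N) (x n i * f (t + i%:R * (r / n.+1%:R)) + y n i * f^`()%classic (t + i%:R * (r / n.+1%:R)))
    @[n --> \oo] --> f^`(j)%classic t.
Proof.
move=> jN r0; have [A [B AB]] := hermite_weights jN.
have N0 : (0 < N)%N by lia.
pose tau n := r / n.+1%:R; have tau0 n : 0 < tau n by rewrite divr_gt0.
exists (fun n i => j`!%:R * ((tau n ^+ j)^-1 * A i)), (fun n i => j`!%:R * (tau n / tau n ^+ j * B i)).
move=> O f t oO sf Ot.
have smth m s : O s -> {for s, continuous f^`(m)%classic}.
  by move=> Os; apply/differentiable_continuous/derivable1_diffP; exact: sf.
pose D := (N + N)%N; pose M := `|f^`(D)%classic t| + 1.
have [q q0 Hq] : exists2 q, 0 < q & forall s, `|s - t| < q -> O s /\ `|f^`(D)%classic s| <= M.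
  have : \forall s \near t, O s /\ `|f^`(D)%classic s| <= M.
    have h1 := open_nbhs_nbhs (conj oO Ot).
    have /cvgrPdist_le/(_ _ (@ltr01 R)) := smth D t Ot; apply: filterS2 h1 => s Os hs; split=> //.
    by have := ler_normB (f^`(D)%classic t) (f^`(D)%classic t - f^`(D)%classic s); rewrite opprB addrC subrK /M; lra.
  move=> /nbhs_ballP[q /= q0 Hq]; exists q => // s sq; apply: Hq.
  by rewrite -ball_normE /= distrC.
have itv s : 0 <= s <= q / 2 -> O (t + s) /\ `|f^`(D)%classic (t + s)| <= M.
  by move=> /andP[s0 sq]; apply: Hq; rewrite addrC addKr ger0_norm//; lra.
have RA s : 0 <= s <= q / 2 -> `|f (t + s) - \sum_(m < D) f^`(m)%classic t / m`!%:R * s ^+ m| <= M * s ^+ D.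
  by apply: taylor_bound => [m u|u] /itv[Ou ?] //; exact: sf.
have RB s : 0 <= s <= q / 2 -> `|f^`()%classic (t + s) - \sum_(m < D.-1) f^`(m.+1)%classic t / m`!%:R * s ^+ m| <= M * s ^+ D.-1.
  move=> sq; have := @taylor_bound D.-1 f^`()%classic t (q / 2) M.
  under [X in _ -> _ -> X]eq_forall do under eq_bigr do rewrite -derive1Sn.
  apply=> // [m u|u] /itv[Ou h]; rewrite -derive1Sn; first exact: sf.
  by rewrite prednK// /D; lia.
pose PA s := \sum_(m < D) f^`(m)%classic t / m`!%:R * s ^+ m.
pose PB s := \sum_(m < D.-1) f^`(m.+1)%classic t / m`!%:R * s ^+ m.
have D1 : D = D.-1.+1 by rewrite prednK// /D; lia.
have fact_neq0 m : (m`!%:R : R) != 0 by rewrite pnatr_eq0 -lt0n fact_gt0.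
have PBE s (i : R) : s * PB (i * s) = \sum_(m < D) f^`(m)%classic t / m`!%:R * (m%:R * i ^+ m.-1) * s ^+ m.
  rewrite D1 big_ord_recl mul0r mulr0 mul0r add0r mulr_sumr; apply: eq_bigr => m _.
  rewrite lift0 exprMn factS natrM [in RHS]exprS; field.
  by rewrite fact_neq0 /= addrC natr1 pnatr_eq0.
have exact n : \sum_(i < N) (j`!%:R * ((tau n ^+ j)^-1 * A i) * PA (i%:R * tau n) +
      j`!%:R * (tau n / tau n ^+ j * B i) * PB (i%:R * tau n)) = f^`(j)%classic t.
  have tj : tau n ^+ j != 0 by rewrite expf_neq0// gt_eqF.
  transitivity (j`!%:R * (tau n ^+ j)^-1 * \sum_(m < D) f^`(m)%classic t / m`!%:R * tau n ^+ m *
      \sum_(i < N) (A i * i%:R ^+ m + B i * (m%:R * i%:R ^+ m.-1))).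
    under [in RHS]eq_bigr do rewrite mulr_sumr.
    rewrite exchange_big /= mulr_sumr; apply: eq_bigr => i _.
    transitivity (j`!%:R * (tau n ^+ j)^-1 * (A i * PA (i%:R * tau n) + B i * (tau n * PB (i%:R * tau n)))).
      by ring.
    congr (_ * _); rewrite PBE /PA !mulr_sumr -big_split /=; apply: eq_bigr => m _.
    by rewrite exprMn; ring.
  rewrite (bigD1 (Ordinal jN)) //= AB// eqxx big1 ?addr0 ?mulr1; first by field; rewrite tj fact_neq0.
  move=> m mj; rewrite AB; last exact: ltn_ord.
  by rewrite (_ : (m == j :> nat) = false) ?mulr0//; apply/negbTE; apply: contra mj => /eqP mj; apply/eqP/val_inj.
pose Cst := j`!%:R * \sum_(i < N) (`|A i| * (M * i%:R ^+ D) + `|B i| * (M * i%:R ^+ D.-1)).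
have key n : N%:R * tau n <= q / 2 -> tau n <= 1 ->
   `|f^`(j)%classic t - \sum_(i < N) (j`!%:R * ((tau n ^+ j)^-1 * A i) * f (t + i%:R * tau n) +
      j`!%:R * (tau n / tau n ^+ j * B i) * f^`()%classic (t + i%:R * tau n))| <= Cst * tau n.
  move=> Nq t1; rewrite -(exact n) -sumrB; apply: (le_trans (ler_norm_sum _ _ _)).
  rewrite /Cst mulr_sumr mulr_suml; apply: ler_sum => i _.
  have M0 : 0 <= M by rewrite /M addr_ge0.
  have iq : 0 <= i%:R * tau n <= q / 2.
    rewrite mulr_ge0 ?(ltW (tau0 n))//=; apply: le_trans Nq.
    by rewrite ler_wpM2r ?(ltW (tau0 n))// ler_nat ltnW.
  have /RA := iq; have /RB := iq; rewrite -/(PA _) -/(PB _).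
  set a := f _; set b := f^`()%classic _; set pa := PA _; set pb := PB _ => hb ha.
  have tj : 0 < (tau n ^+ j)^-1 by rewrite invr_gt0 exprn_gt0.
  have -> : j`!%:R * ((tau n ^+ j)^-1 * A i) * pa + j`!%:R * (tau n / tau n ^+ j * B i) * pb -
     (j`!%:R * ((tau n ^+ j)^-1 * A i) * a + j`!%:R * (tau n / tau n ^+ j * B i) * b) =
     j`!%:R * (tau n ^+ j)^-1 * (A i * (pa - a) + tau n * (B i * (pb - b))) by ring.
  rewrite normrM (ger0_norm (mulr_ge0 (ler0n R j`!) (ltW tj))) -[leRHS]mulrA -[leLHS]mulrA.
  rewrite ler_wpM2l// ler_pdivrMl ?exprn_gt0//.
  apply: (@le_trans _ _ ((`|A i| * (M * i%:R ^+ D) + `|B i| * (M * i%:R ^+ D.-1)) * tau n ^+ D)); last first.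
    rewrite [leRHS]mulrCA ler_wpM2l//.
      by apply: addr_ge0; apply: mulr_ge0 => //; apply: mulr_ge0 => //; exact: exprn_ge0.
    by rewrite -exprSr ler_wiXn2l// ltW.
  apply: (le_trans (ler_normD _ _)); rewrite [leRHS]mulrDl; apply: lerD.
    rewrite normrM -[leRHS]mulrA ler_wpM2l// distrC; apply: (le_trans ha).
    by rewrite exprMn mulrA.
  rewrite normrM (gtr0_norm (tau0 n)) normrM [leLHS]mulrCA -[leRHS]mulrA ler_wpM2l// distrC.
  have -> : tau n ^+ D = tau n * tau n ^+ D.-1 by rewrite [in LHS]D1 exprS.
  rewrite [leRHS]mulrCA ler_wpM2l ?(ltW (tau0 n))//.
  by apply: (le_trans hb); rewrite exprMn mulrA.
have ct : tau @ \oo --> 0 by exact: cvg_invS_scale.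
have cC : Cst * tau n @[n --> \oo] --> 0 by rewrite -(mulr0 Cst); exact: cvgnZ.
have cN : N%:R * tau n @[n --> \oo] --> (0 : R) by rewrite -(mulr0 (N%:R : R)); exact: cvgnZ.
have q20 : 0 < q / 2 by rewrite divr_gt0.
apply/cvgrPdist_le => /= e e0.
have h1 : \forall n \near \oo, tau n <= 1 by exact: (cvgr_le _ ct 1 ltr01).
have h2 : \forall n \near \oo, N%:R * tau n <= q / 2 by exact: (cvgr_le _ cN (q / 2) q20).
have h3 : \forall n \near \oo, Cst * tau n <= e by exact: (cvgr_le _ cC e e0).
by apply: filterS3 h1 h2 h3 => n t1 nq; apply: le_trans; exact: key.
Qed.

(* [N] double nodes give access to all derivatives of order less than [2 N]. *)
Lemma hermite_confluence N (l : seq (R * nat)) r : (forall y, y \in l -> (y.2 < N + N)%N) -> 0 < r ->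
  exists x y : nat -> 'I_N -> R, forall (O : set R) f t, open O -> smooth_in O f -> O t ->
  \sum_(i < N) (x n i * f (t + i%:R * (r / n.+1%:R)) + y n i * f^`()%classic (t + i%:R * (r / n.+1%:R)))
    @[n --> \oo] --> \sum_(z <- l) z.1 * f^`(z.2)%classic t.
Proof.
move=> + r0; elim: l => [_|[a j] l IH jl].
  exists (fun _ _ => 0), (fun _ _ => 0) => O f t _ _ _; rewrite big_nil.
  rewrite (_ : (fun n => _) = fun=> 0); first exact: cvg_cst.
  by apply/funext => n; rewrite big1// => i _; rewrite !mul0r addr0.
have [|x1 [y1 H1]] := IH; first by move=> y yl; apply: jl; rewrite inE yl orbT.
have [x2 [y2 H2]] := hermite_limit (jl (a, j) (mem_head _ _)) r0.
exists (fun n i => a * x2 n i + x1 n i), (fun n i => a * y2 n i + y1 n i) => O f t oO sf Ot.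
rewrite big_cons /=.
rewrite (_ : (fun n => \sum_(i < N) _) = (fun n => a * \sum_(i < N) (x2 n i * f (t + i%:R * (r / n.+1%:R)) + y2 n i * f^`()%classic (t + i%:R * (r / n.+1%:R))) +
  \sum_(i < N) (x1 n i * f (t + i%:R * (r / n.+1%:R)) + y1 n i * f^`()%classic (t + i%:R * (r / n.+1%:R))))); last first.
  by apply/funext => n; rewrite mulr_sumr -big_split /=; apply: eq_bigr => i _; ring.
exact: cvgD (@cvgnZ _ a _ _ (H2 O f t oO sf Ot)) (H1 O f t oO sf Ot).
Qed.

End hermite.

(** * Comparison with the model process *)

Section modification.
Context {d : measure_display} {T : measurableType d} {R : realType} (P : probability T R).

Lemma ae_null_set (A : T -> Prop) : {ae P, forall w, A w} ->
  exists N : set T, [/\ measurable N, P N = 0%E & forall w, ~ N w -> A w].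
Proof.
move=> [N [mN N0 AN]]; exists N; split=> // w nN.
by apply: contrapT => nA; apply: nN; exact: AN.
Qed.

(** Setting the paths to 0 on a null set turns almost sure smoothness into smoothness of every path
    without changing finite-dimensional laws. *)
Definition vanish_on (N : set T) (X : R -> T -> R) : R -> T -> R :=
  fun t w => \1_(~` N) w * X t w.

Lemma vanish_onE (N : set T) X t w : ~ N w -> vanish_on N X t w = X t w.
Proof. by move=> nN; rewrite /vanish_on indicE mem_set// mul1r. Qed.

Lemma gaussian_smooth_vanish_on O X (N : set T) : open O -> measurable N -> P N = 0%E ->
  (forall w, ~ N w -> smooth_in O (X ^~ w)) ->
  (forall s : seq (R * R), (forall y, y \in s -> O y.2) ->
     exists v, gauss P (fun w => \sum_(y <- s) y.1 * X y.2 w) v) ->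
  gaussian_smooth P O (vanish_on N X).
Proof.
move=> oO mN N0 sX gX; split=> // [w|s sO].
  have [Nw|Nw] := pselect (N w).
    have -> : (vanish_on N X) ^~ w = cst 0.
      by apply/funext => t; rewrite /vanish_on indicE memNset ?mul0r//; exact.
    apply: (@smooth_polynomial _ O (fun=> False)) => //; exact: poly_cst.
  have -> : (vanish_on N X) ^~ w = X ^~ w by apply/funext => t; rewrite vanish_onE.
  exact: sX.
have [v gv] := gX s sO; exists v.
have E w : \sum_(y <- s) y.1 * vanish_on N X y.2 w = \1_(~` N) w * \sum_(y <- s) y.1 * X y.2 w.
  by rewrite mulr_sumr; apply: eq_bigr => y _; rewrite /vanish_on; ring.
have [mV _ _] := gv; rewrite (funext E); apply: gauss_ae gv.
  apply: measurable_funM => //.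
  by apply: measurable_indic; exact: measurableC.
exists N; split=> // w /=; apply: contra_notP => nN.
by rewrite indicE mem_set// mul1r.
Qed.

(** [f] stands for a functional of the original paths and may be non-measurable, so the two
    inequalities go through suprema over simple functions. *)
Lemma expectation_sqr_ae (f g : T -> R) : intg P (fun w => g w ^+ 2) -> {ae P, forall w, f w = g w} ->
  ('E_P[(fun w => `|f w| ^+ 2)%R] = (Ex P (fun w => g w ^+ 2))%:E)%E.
Proof.
move=> Ig fg; rewrite unlock; have [N [mN N0 HN]] := ae_null_set fg.
apply/eqP; rewrite eq_le; apply/andP; split.
  by apply: integral_le => //; apply: filterS fg => w ->; rewrite real_normK ?num_real.
have aeN : {ae P, forall w, \1_(~` N) w * g w ^+ 2 = g w ^+ 2}.
  exists N; split=> // w /=; apply: contra_notP => nN.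
  by rewrite indicE mem_set// mul1r.
have mI : measurable_fun setT (fun w => \1_(~` N) w * g w ^+ 2).
  apply: measurable_funM; last exact: intg_meas Ig.
  by apply: measurable_indic; exact: measurableC.
have II : intg P (fun w => \1_(~` N) w * g w ^+ 2).
  apply: intg_le Ig => // w; rewrite indicE ger0_norm; last exact: mulr_ge0 (ler0n _ _) (sqr_ge0 _).
  by rewrite ler_piMl ?sqr_ge0// lern1 leq_b1.
have -> : Ex P (fun w => g w ^+ 2) = Ex P (fun w => \1_(~` N) w * g w ^+ 2).
  rewrite /Ex /Rintegral; congr fine; apply: ae_eq_integral => //.
  - by apply/measurable_EFinP; exact: intg_meas Ig.
  - exact/measurable_EFinP.
  - by apply: filterS aeN => w ->.
apply: integral_ge => // w.
rewrite lee_fin indicE; have [Nw|Nw] := pselect (N w).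
  by rewrite memNset ?mul0r ?exprn_ge0//; exact.
by rewrite mem_set// mul1r HN// real_normK ?num_real.
Qed.

End modification.

Section comparison.
Context {d0 d : measure_display} {T0 : measurableType d0} {T : measurableType d} {R : realType}.
Variables (P0 : probability T0 R) (P : probability T R).

Definition jet_sum {S : Type} N (x y xi : 'I_N -> R) (X : R -> S -> R) w : R :=
  \sum_(j < N) (x j * X (xi j) w + y j * (X ^~ w)^`()%classic (xi j)).

Definition comparable (O : set R) N (eps : R) (X0 : R -> T0 -> R) (X : R -> T -> R) : Prop :=
  forall x y xi : 'I_N -> R, (forall j, O (xi j)) ->
   (1 - eps) * Ex P0 (fun w => jet_sum x y xi X0 w ^+ 2) <= Ex P (fun w => jet_sum x y xi X w ^+ 2) /\
   Ex P (fun w => jet_sum x y xi X w ^+ 2) <= (1 + eps) * Ex P0 (fun w => jet_sum x y xi X0 w ^+ 2).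

(** By the product rule, multiplication by [g] only changes the coefficients of the functional. As
    the comparison is required for all coefficients, it survives the normalization. *)
Lemma jet_sumM {S : Type} N (x y xi : 'I_N -> R) (X : R -> S -> R) O g w :
  smooth_in O g -> smooth_in O (X ^~ w) -> (forall j, O (xi j)) ->
  jet_sum x y xi (fun t w => g t * X t w) w =
  jet_sum (fun j => x j * g (xi j) + y j * g^`()%classic (xi j)) (fun j => y j * g (xi j)) xi X w.
Proof.
move=> sg sX Oxi; apply: eq_bigr => j _.
have D1 := is_derive_smooth 0 sg (Oxi j); have D2 := is_derive_smooth 0 sX (Oxi j).
have D := is_deriveM D1 D2.
have -> : (fun t => g t * X t w)^`()%classic (xi j) = g (xi j) * (X ^~ w)^`()%classic (xi j) + X (xi j) w * g^`()%classic (xi j).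
  by rewrite derive1E; exact: (@derive_val _ _ _ _ _ _ _ D).
by ring.
Qed.

Lemma comparableM O N eps X0 X g : smooth_in O g ->
  (forall w, smooth_in O (X0 ^~ w)) -> (forall w, smooth_in O (X ^~ w)) -> comparable O N eps X0 X ->
  comparable O N eps (fun t w => g t * X0 t w) (fun t w => g t * X t w).
Proof.
move=> sg s0 s H x y xi Oxi.
under eq_fun do rewrite (jet_sumM _ _ sg (s0 _) Oxi).
under [X in _ <= Ex _ X /\ _]eq_fun do rewrite (jet_sumM _ _ sg (s _) Oxi).
under [X in _ /\ Ex _ X <= _]eq_fun do rewrite (jet_sumM _ _ sg (s _) Oxi).
exact: H.
Qed.

Definition jet_list N (x y xi : 'I_N -> R) : seq (R * nat * R) :=
  [seq (x j, 0%N, xi j) | j <- index_enum 'I_N] ++ [seq (y j, 1%N, xi j) | j <- index_enum 'I_N].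

Lemma comb_jet_list {d1} {T1 : measurableType d1} N (x y xi : 'I_N -> R) (X : R -> T1 -> R) w :
  comb X (jet_list x y xi) w = jet_sum x y xi X w.
Proof.
by rewrite /jet_list comb_cat /comb !big_map -big_split.
Qed.

Lemma points_in_jet_list N (x y xi : 'I_N -> R) (O : set R) : (forall j, O (xi j)) ->
  points_in O (jet_list x y xi).
Proof. by move=> Oxi; apply: points_in_cat => _ /mapP[j _ ->] /=. Qed.

(** The comparison concerns values and first derivatives at N points; letting the points collide at
    t extends it to all derivatives of order below 2 N. *)
Lemma comparable_jet O N eps X0 X l t : gaussian_smooth P0 O X0 -> gaussian_smooth P O X ->
  comparable O N eps X0 X -> O t -> (forall z, z \in l -> (z.2 < N + N)%N) ->
  (1 - eps) * Ex P0 (fun w => (\sum_(z <- l) z.1 * pderive z.2 X0 t w) ^+ 2) <=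
    Ex P (fun w => (\sum_(z <- l) z.1 * pderive z.2 X t w) ^+ 2) /\
  Ex P (fun w => (\sum_(z <- l) z.1 * pderive z.2 X t w) ^+ 2) <=
    (1 + eps) * Ex P0 (fun w => (\sum_(z <- l) z.1 * pderive z.2 X0 t w) ^+ 2).
Proof.
move=> g0 g HC Ot lN; have oO : open O by case: g.
have [q q0 Hq] : exists2 q, 0 < q & forall s, `|s - t| < q -> O s.
  have := open_nbhs_nbhs (conj oO Ot) => /nbhs_ballP[q /= q0 Hq]; exists q => // s sq.
  by apply: Hq; rewrite -ball_normE /= distrC.
(* Division by N + 1 keeps all N nodes within distance q of t. *)
have r0 : 0 < q / N.+1%:R by rewrite divr_gt0.
have [x [y H]] := hermite_confluence lN r0.
pose xi n (i : 'I_N) := t + i%:R * (q / N.+1%:R / n.+1%:R).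
have Oxi n i : O (xi n i).
  apply: Hq; rewrite addrC addKr ger0_norm; last by rewrite mulr_ge0// ltW// !divr_gt0.
  rewrite -mulrA mulrCA gtr_pMr// -invfM -natrM ltr_pdivrMr// mul1r ltr_nat.
  by rewrite (leq_trans (ltn_ord i))// (leq_trans (leqnSn N))// leq_pmulr.
pose L n := jet_list (x n) (y n) (xi n).
pose l' := [seq (z.1, z.2, t) | z <- l].
have Ol' : points_in O l' by move=> _ /mapP[z _ ->].
have OL n : points_in O (L n) by exact: points_in_jet_list.
have lE d1 (T1 : measurableType d1) (Z : R -> T1 -> R) w : comb Z l' w = \sum_(z <- l) z.1 * pderive z.2 Z t w.
  by rewrite /comb big_map.
have cv d1 (T1 : measurableType d1) (P1 : probability T1 R) (Z : R -> T1 -> R) : gaussian_smooth P1 O Z ->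
    Ex P1 (fun w => jet_sum (x n) (y n) (xi n) Z w ^+ 2) @[n --> \oo] -->
    Ex P1 (fun w => (\sum_(z <- l) z.1 * pderive z.2 Z t w) ^+ 2).
  move=> gZ; have := comb_sqr_cvg gZ OL Ol'.
  under [in X in _ -> X]eq_fun do under eq_fun do rewrite -comb_jet_list.
  under [in X in _ -> X]eq_fun do rewrite -lE.
  apply=> w; rewrite lE; under eq_fun do rewrite comb_jet_list.
  by apply: (H O) => //; case: gZ.
have c0 := cv _ _ _ _ g0; have c := cv _ _ _ _ g.
split.
  apply: (ler_cvg_to (@cvgnZ _ (1 - eps) _ _ c0) c).
  by apply: nearW => n; have [] := HC (x n) (y n) (xi n) (Oxi n).
apply: (ler_cvg_to c (@cvgnZ _ (1 + eps) _ _ c0)).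
by apply: nearW => n; have [] := HC (x n) (y n) (xi n) (Oxi n).
Qed.

Lemma jet_sum2 {S : Type} N s t (a b : R) (X : R -> S -> R) w :
  jet_sum (fun i : 'I_N.+2 => if i == 0%N :> nat then a else if i == 1%N :> nat then b else 0) (fun=> 0)
    (fun i : 'I_N.+2 => if i == 0%N :> nat then s else t) X w = a * X s w + b * X t w.
Proof.
by rewrite /jet_sum big_ord_recl big_ord_recl big1 /= ?mul0r ?addr0// => i _; rewrite !mul0r addr0.
Qed.

(** Polarization with the coefficients 1 and -1; for unit variances the error terms add up to
    exactly eps. *)
Lemma comparable_cov O N eps X0 X s t : gaussian_smooth P0 O X0 -> gaussian_smooth P O X ->
  comparable O N.+2 eps X0 X -> O s -> O t -> 0 <= eps ->
  Ex P0 (fun w => X0 s w ^+ 2) = 1 -> Ex P0 (fun w => X0 t w ^+ 2) = 1 ->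
  `|Ex P (fun w => X s w * X t w)| <= `|Ex P0 (fun w => X0 s w * X0 t w)| + eps.
Proof.
move=> g0 g HC Os Ot eps0 v1 v2.
have Oi (i : 'I_N.+2) : O (if i == 0%N :> nat then s else t) by case: ifP.
have sq d1 (T1 : measurableType d1) (P1 : probability T1 R) (Z : R -> T1 -> R) (a b : R) : gaussian_smooth P1 O Z ->
    Ex P1 (fun w => (a * Z s w + b * Z t w) ^+ 2) =
    a ^+ 2 * Ex P1 (fun w => Z s w ^+ 2) + (2 * a * b) * Ex P1 (fun w => Z s w * Z t w) + b ^+ 2 * Ex P1 (fun w => Z t w ^+ 2).
  move=> gZ; have [m1 I1] := pderive_sqr gZ 0 Os; have [m2 I2] := pderive_sqr gZ 0 Ot.
  have I12 := intg_sqr_mul m1 m2 I1 I2.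
  rewrite -(ExZ (a ^+ 2) I1) -(ExZ (2 * a * b) I12) -(ExZ (b ^+ 2) I2).
  rewrite -!ExD; try by [exact: intgZ|apply: intgD; exact: intgZ].
  by congr Ex; apply/funext => w; rewrite /pderive /=; ring.
pose x (a : R) (i : 'I_N.+2) : R := if i == 0%N :> nat then 1 else if i == 1%N :> nat then a else 0.
have H a := HC (x a) (fun=> 0) _ Oi.
have {H} H a : (1 - eps) * Ex P0 (fun w => (1 * X0 s w + a * X0 t w) ^+ 2) <= Ex P (fun w => (1 * X s w + a * X t w) ^+ 2) /\
   Ex P (fun w => (1 * X s w + a * X t w) ^+ 2) <= (1 + eps) * Ex P0 (fun w => (1 * X0 s w + a * X0 t w) ^+ 2).
  have := H a; under eq_fun do rewrite jet_sum2.
  by under [X in _ <= Ex _ X /\ _]eq_fun do rewrite jet_sum2; under [X in _ /\ Ex _ X <= _]eq_fun do rewrite jet_sum2.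
have [l1 u1] := H 1; have [l2 u2] := H (-1).
move: l1 u1 l2 u2; rewrite !(sq _ _ _ _ _ _ g0) !(sq _ _ _ _ _ _ g) v1 v2.
set c0 := Ex P0 _; set c := Ex P (fun w => X s w * _); set p := Ex P _; set q := Ex P _.
rewrite !expr1n sqrrN expr1n => l1 u1 l2 u2.
have := ler_norm c0; have := ler_norm (- c0); rewrite normrN => h1 h2.
by rewrite ler_norml; apply/andP; split; nra.
Qed.

End comparison.

Section tame_comparison.
Context {d0 d : measure_display} {T0 : measurableType d0} {T : measurableType d} {R : realType}.
Variables (P0 : probability T0 R) (P : probability T R).

(** With k + 1 points, derivatives up to order 2 k + 1 are compared, and k >= 1 puts order 2 within
    reach for the lower bound. The bound eps <= 1 / 2 costs at most factors of two. *)
Lemma tame_of_comparable k (C lam eps a b : R) (Z : R -> T0 -> R) (Y : R -> T -> R) :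
  (0 < k)%N -> 0 <= C -> 0 < lam -> 0 <= eps -> eps <= 1 / 2 ->
  gaussian_smooth P0 setT Z -> gaussian_smooth P `]a, b[%classic Y ->
  comparable P0 P `]a, b[%classic k.+1 eps Z Y ->
  (forall t, Ex P0 (fun w => Z t w ^+ 2) = 1) ->
  (forall s t, `|Ex P0 (fun w => Z s w * Z t w)| <= C / (1 + (t - s) ^+ 2)) ->
  (forall j t, (j <= (2 * k).+1)%N -> Ex P0 (fun w => pderive j Z t w ^+ 2) <= C) ->
  (forall t a0 a1 a2 : R, lam * (a0 ^+ 2 + a1 ^+ 2 + a2 ^+ 2) <=
    Ex P0 (fun w => (a0 * pderive 0 Z t w + (a1 * pderive 1 Z t w + a2 * pderive 2 Z t w)) ^+ 2)) ->
  tame P a b Y k (2 * C + 1) (lam / 2) eps.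
Proof.
move=> k0 C0 lam0 eps0 eps2 gZ gY HC v1 rho jets pos.
have oI : open (`]a, b[%classic : set R) by case: gY.
have gZ' : gaussian_smooth P0 `]a, b[%classic Z.
  case: gZ => _ s g; split=> // [w n t _|l _]; [exact: s|exact: g].
have itv t : a < t < b -> (`]a, b[%classic : set R) t by rewrite /= in_itv.
split=> //.
- move=> j t jk tab.
  have [|_] := comparable_jet (l := [:: (1, j)]) gZ' gY HC (itv t tab).
    by move=> z; rewrite inE => /eqP -> /=; lia.
  under eq_fun do rewrite big_seq1 mul1r; under [X in _ <= _ * Ex _ X]eq_fun do rewrite big_seq1 mul1r.
  move=> /= h; apply: (le_trans h); have := jets j t jk; set e := Ex P0 _ => eC.
  have e0 : 0 <= e by apply: Ex_ge0 => w; exact: sqr_ge0.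
  by nra.
- move=> t tab a0 a1 a2.
  have [|+ _] := comparable_jet (l := [:: (a0, 0%N); (a1, 1%N); (a2, 2%N)]) gZ' gY HC (itv t tab).
    by move=> z; rewrite !inE => /or3P[] /eqP -> /=; lia.
  under eq_fun do rewrite !big_cons big_nil addr0.
  under [X in _ -> _ <= Ex _ X]eq_fun do rewrite -[X in (_ + (_ + X)) ^+ 2]addr0.
  under [X in _ <= Ex _ X -> _]eq_fun do rewrite !big_cons big_nil.
  move=> /= h; apply: le_trans h; have := pos t a0 a1 a2; set e := Ex P0 _ => eC.
  have s0 : 0 <= a0 ^+ 2 + a1 ^+ 2 + a2 ^+ 2 by rewrite !addr_ge0 ?sqr_ge0.
  move: s0 eC; set s := _ + _ + _ => s0 eC.
  have : 0 <= lam * s by rewrite mulr_ge0 ?(ltW lam0).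
  have : lam / 2 * s = lam * s / 2 by ring.
  by move=> ->; nra.
- move=> s t sab tab; have := rho s t.
  case: k k0 HC jets => // k _ HC _ h.
  apply: (le_trans (comparable_cov gZ' gY HC (itv s sab) (itv t tab) eps0 (v1 s) (v1 t))).
  have D0 : 0 < 1 + (t - s) ^+ 2 by have := sqr_ge0 (t - s); lra.
  apply: lerD; last by nra.
  by apply: (le_trans h); rewrite ler_pdivrMr// mulrAC mulfK ?gt_eqF//; lra.
Qed.

End tame_comparison.

(** * Normalization of the model process *)

Section gaf.
Local Open Scope complex_scope.
Context {d : measure_display} {T : measurableType d} {R : realType} (P : probability T R).
Variable Q : R[i] -> T -> R[i].

(** Partial sums are combinations of independent standard Gaussian variables, and [gauss_lim]
    carries Gaussianity through the almost sure limit. *)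
Lemma gaf_gauss : real_GAF P Q -> forall s : seq (R * R),
  exists v, gauss P (fun w => \sum_(y <- s) y.1 * on_real Q y.2 w) v.
Proof.
move=> [mRe _ _ [omega [q [ind std _ _ ser]]]] s.
pose F n w := \sum_(y <- s) y.1 * \sum_(0 <= j < n) omega j w * complex.Re (q j y.2%:C).
have FE n w : F n w = \sum_(0 <= j < n) (\sum_(y <- s) y.1 * complex.Re (q j y.2%:C)) * omega j w.
  under [RHS]eq_bigr do rewrite mulr_suml.
  rewrite exchange_big /=; apply: eq_bigr => y _; rewrite mulr_sumr.
  by apply: eq_bigr => j _; ring.
have cv : {ae P, forall w, F ^~ w @ \oo --> \sum_(y <- s) y.1 * on_real Q y.2 w}.
  rewrite /F; elim: s {F FE} => [|y s IH].
    by apply: aeW => w; under eq_fun do rewrite big_nil; rewrite big_nil; exact: cvg_cst.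
  apply: filterS2 IH (ser y.2%:C) => w h1 h2.
  under eq_fun do rewrite big_cons; rewrite big_cons; apply: cvgD h1; apply: cvgnZ.
  have := cvg_Re h2; rewrite /on_real.
  rewrite (_ : (fun n => complex.Re _) = (fun n => \sum_(0 <= j < n) omega j w * complex.Re (q j y.2%:C)))//.
  apply/funext => n; rewrite Re_sum; apply: eq_bigr => j _.
  by rewrite mulrC ReMc mulrC.
have gF n : gauss P (F n) (\sum_(0 <= j < n) (\sum_(y <- s) y.1 * complex.Re (q j y.2%:C)) ^+ 2).
  by rewrite (funext (FE n)); exact: (gauss_independent_sum (fun j => \sum_(y <- s) y.1 * complex.Re (q j y.2%:C)) n ind std).
have mV : measurable_fun setT (fun w => \sum_(y <- s) y.1 * on_real Q y.2 w).
  by apply: measurable_sum => y; apply: measurable_funM => //; exact: mRe.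
by have [l g _] := gauss_lim gF mV cv; exists l.
Qed.

Lemma gaf_smooth : real_GAF P Q -> exists N : set T, [/\ measurable N, P N = 0%E &
  gaussian_smooth P setT (vanish_on N (on_real Q))].
Proof.
move=> gaf; have [_ _ ent _] := gaf.
have [N [mN N0 HN]] := ae_null_set ent.
exists N; split=> //; apply: gaussian_smooth_vanish_on => //; first exact: openT.
  by move=> w /HN /entire_real_analytic; exact: real_analytic_smooth.
by move=> s _; exact: gaf_gauss.
Qed.

End gaf.

Section quadratic_form.
Context {R : realType}.

(** Completing the square twice gives an explicit constant, in place of compactness of the unit
    sphere. *)
Lemma quad3_lower (q : R -> R -> R -> R) g00 g11 g22 g01 g02 g12 :
  (forall a b c, q a b c = g00 * a ^+ 2 + g11 * b ^+ 2 + g22 * c ^+ 2 +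
     2 * (g01 * a * b + g02 * a * c + g12 * b * c)) ->
  (forall a b c, 0 <= q a b c) ->
  (forall a b c, q a b c = 0 -> [/\ a = 0, b = 0 & c = 0]) ->
  exists2 lam, 0 < lam & forall a b c, lam * (a ^+ 2 + b ^+ 2 + c ^+ 2) <= q a b c.
Proof.
move=> qE q0 qpos.
have pos a b c : a != 0 \/ b != 0 \/ c != 0 -> 0 < q a b c.
  move=> abc; rewrite lt_neqAle q0 andbT eq_sym; apply/eqP => /qpos[a0 b0 c0].
  by move: abc; rewrite a0 b0 c0 eqxx => -[|[]].
have p0 : 0 < g00.
  have : 0 < q 1 0 0 by apply: pos; left; exact: oner_neq0.
  by rewrite qE (_ : _ + _ = g00)//; ring.
pose al := g01 / g00; pose be := g02 / g00.
pose h11 := g11 - g01 ^+ 2 / g00; pose h12 := g12 - g01 * g02 / g00; pose h22 := g22 - g02 ^+ 2 / g00.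
have n0 : g00 != 0 by rewrite gt_eqF.
have hp0 : 0 < h11.
  have : 0 < q (- al) 1 0 by apply: pos; right; left; exact: oner_neq0.
  by rewrite qE (_ : _ + _ = h11)// /h11 /al; field.
have n1 : h11 != 0 by rewrite gt_eqF.
pose ga := h12 / h11; pose r := h22 - h12 ^+ 2 / h11.
have r0 : 0 < r.
  have : 0 < q (al * ga - be) (- ga) 1 by apply: pos; right; right; exact: oner_neq0.
  rewrite qE (_ : _ + _ = r)// /r /ga /al /be.
  have -> : h22 = g22 - g02 ^+ 2 / g00 by [].
  have e1 : g11 = h11 + g01 ^+ 2 / g00 by rewrite /h11 subrK.
  have e2 : g12 = h12 + g01 * g02 / g00 by rewrite /h12 subrK.
  by rewrite e1 e2; field; rewrite n0 n1.
have sq a b c : q a b c = g00 * (a + al * b + be * c) ^+ 2 + h11 * (b + ga * c) ^+ 2 + r * c ^+ 2.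
  have e1 : g11 = h11 + g01 ^+ 2 / g00 by rewrite /h11 subrK.
  have e2 : g12 = h12 + g01 * g02 / g00 by rewrite /h12 subrK.
  have e3 : g22 = r + h12 ^+ 2 / h11 + g02 ^+ 2 / g00 by rewrite /r /h22; ring.
  by rewrite qE e1 e2 e3 /al /be /ga; field; rewrite n0 n1.
(* They are such that a^2 <= S m0, b^2 <= S m1 and c^2 <= S m2, by (x - y)^2 <= 2 x^2 + 2 y^2 and
   its analogue with three terms. *)
pose m2 := r^-1; pose m1 := 2 / h11 + 2 * ga ^+ 2 * m2; pose m0 := 3 / g00 + 3 * al ^+ 2 * m1 + 3 * be ^+ 2 * m2.
have m20 : 0 < m2 by rewrite invr_gt0.
have m10 : 0 < m1 by apply: ltr_pwDl; [rewrite divr_gt0|rewrite mulr_ge0 ?(ltW m20)// mulr_ge0// sqr_ge0].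
have m00 : 0 <= m0.
  apply: addr_ge0; last by apply: mulr_ge0 (ltW m20); apply: mulr_ge0 => //; exact: sqr_ge0.
  apply: addr_ge0; first by rewrite divr_ge0// ltW.
  by apply: mulr_ge0 (ltW m10); apply: mulr_ge0 => //; exact: sqr_ge0.
have m_gt0 : 0 < m0 + m1 + m2 by apply: ltr_wpDl => //; apply: addr_ge0 => //; exact: ltW.
exists (m0 + m1 + m2)^-1; first by rewrite invr_gt0.
move=> a b c; rewrite mulrC ler_pdivrMr//.
set S := q a b c; pose A := a + al * b + be * c; pose B := b + ga * c.
have SE : S = g00 * A ^+ 2 + h11 * B ^+ 2 + r * c ^+ 2 := sq a b c.
have t1 : 0 <= g00 * A ^+ 2 by rewrite mulr_ge0 ?sqr_ge0// ltW.
have t2 : 0 <= h11 * B ^+ 2 by rewrite mulr_ge0 ?sqr_ge0// ltW.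
have t3 : 0 <= r * c ^+ 2 by rewrite mulr_ge0 ?sqr_ge0// ltW.
have A2 : A ^+ 2 <= S / g00 by rewrite ler_pdivlMr// mulrC; lra.
have B2 : B ^+ 2 <= S / h11 by rewrite ler_pdivlMr// mulrC; lra.
have c2 : c ^+ 2 <= S * m2 by rewrite ler_pdivlMr// mulrC; lra.
have b2 : b ^+ 2 <= S * m1.
  have -> : b = B - ga * c by rewrite /B; ring.
  have : (B - ga * c) ^+ 2 <= 2 * B ^+ 2 + 2 * ga ^+ 2 * c ^+ 2 by have := sqr_ge0 (B + ga * c); lra.
  have : ga ^+ 2 * c ^+ 2 <= ga ^+ 2 * (S * m2) by rewrite ler_wpM2l// sqr_ge0.
  have -> : S * m1 = 2 * (S / h11) + 2 * (ga ^+ 2 * (S * m2)) by rewrite /m1; ring.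
  by lra.
have a2 : a ^+ 2 <= S * m0.
  have -> : a = A - al * b - be * c by rewrite /A; ring.
  have : (A - al * b - be * c) ^+ 2 <= 3 * A ^+ 2 + 3 * (al ^+ 2 * b ^+ 2) + 3 * (be ^+ 2 * c ^+ 2).
    by have := sqr_ge0 (A + al * b); have := sqr_ge0 (A + be * c); have := sqr_ge0 (al * b - be * c); lra.
  have : al ^+ 2 * b ^+ 2 <= al ^+ 2 * (S * m1) by rewrite ler_wpM2l// sqr_ge0.
  have : be ^+ 2 * c ^+ 2 <= be ^+ 2 * (S * m2) by rewrite ler_wpM2l// sqr_ge0.
  have -> : S * m0 = 3 * (S / g00) + 3 * (al ^+ 2 * (S * m1)) + 3 * (be ^+ 2 * (S * m2)) by rewrite /m0; ring.
  by lra.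
rewrite (mulrDr S (m0 + m1)) (mulrDr S m0); apply: lerD => //; exact: lerD.
Qed.

End quadratic_form.

Section decreasing.
Context {R : realType}.

Lemma ge0_integral_le {d} {T : measurableType d} (mu : {measure set T -> \bar R}) (h f : T -> \bar R) :
  (forall x, 0 <= h x)%E -> (forall x, h x <= f x)%E -> (\int[mu]_x h x <= \int[mu]_x f x)%E.
Proof.
move=> h0 hf; rewrite !ge0_integralTE//; last by move=> x; exact: le_trans (hf x).
by apply: ereal_sup_le => _ /= [s sh <-]; exists s => // x; exact: le_trans (sh x) (hf x).
Qed.

(** On [x / 2, x] the integrand is at least psi x (x / 2)^k, so psi x (x / 2)^(k + 1) is at most the
    whole integral; k >= 1 and x >= 2 reduce the exponent to 2, which makes the correlations
    summable. *)
Lemma Psi_decay k (psi : R -> R) : (0 < k)%N -> Psi k.+1 psi ->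
  exists2 B, 0 <= B & forall x, 2 <= x -> psi x <= B / x ^+ 2.
Proof.
move=> k0 [p0 pd]; set I0 := integral _ _ _ => I0_lt.
have I0_ge : (0 <= I0)%E.
  by apply: integral_ge0 => x /=; rewrite in_itv /= andbT => x0; rewrite lee_fin mulr_ge0 ?p0 ?exprn_ge0.
have I0E : (fine I0)%:E = I0 by rewrite fineK// ge0_fin_numE.
exists (4 * fine I0); first by rewrite mulr_ge0// fine_ge0.
move=> x x2; have x0 : 0 < x by lra.
have h0 : 0 <= psi x * (x / 2) ^+ k by rewrite mulr_ge0 ?p0 ?exprn_ge0 ?divr_ge0// ltW.
pose J := `[x / 2, x]%classic : set R; pose v := psi x * (x / 2) ^+ k.
have mJ : measurable J by exact: measurable_itv.
have key : ((psi x * (x / 2) ^+ k * (x / 2))%:E <= I0)%E.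
  have -> : ((psi x * (x / 2) ^+ k * (x / 2))%:E = \int[lebesgue_measure]_y ((cst v%:E) \_ J) y)%E.
    have lJ : lebesgue_measure J = (x / 2)%:E.
      rewrite lebesgue_measure_itv /= lte_fin; have -> : x / 2 < x by lra.
      by rewrite -EFinD; congr (_%:E); field.
    transitivity (v%:E * lebesgue_measure J)%E; first by rewrite lJ -EFinM.
    by rewrite -integral_mkcond integral_cst.
  rewrite /I0 [leRHS]integral_mkcond; apply: ge0_integral_le => y; rewrite /patch.
    by case: ifP => // _; rewrite lee_fin.
  case: ifPn => [|_].
    move=> /set_mem; rewrite /J /= in_itv /= => /andP[xy yx].
    rewrite mem_set /= ?in_itv /= ?andbT; last by lra.
    rewrite lee_fin ler_pM ?exprn_ge0 ?p0 ?divr_ge0 ?(ltW x0)//.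
      by apply: pd => //; lra.
    by rewrite lerXn2r ?nnegrE//; lra.
  case: ifPn => // /set_mem; rewrite /= in_itv /= andbT => y0.
  by rewrite lee_fin mulr_ge0 ?p0 ?exprn_ge0.
rewrite -I0E lee_fin in key; rewrite ler_pdivlMr ?exprn_gt0//.
have x1 : 1 <= x / 2 by lra.
have : x / 2 <= (x / 2) ^+ k by rewrite -{1}[x / 2]expr1; apply: ler_weXn2l.
move=> hk; have : psi x * (x / 2) * (x / 2) <= psi x * (x / 2) ^+ k * (x / 2).
  by rewrite ler_wpM2r ?ler_wpM2l ?p0//; lra.
have -> : psi x * x ^+ 2 = 4 * (psi x * (x / 2) * (x / 2)) by field.
by move=> h; rewrite ler_pM2l//; exact: le_trans h key.
Qed.

End decreasing.

Section normalization.
Context {d : measure_display} {T : measurableType d} {R : realType} (P : probability T R).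

(** The invariance of the covariance is differentiated in one argument and then, by symmetry, in the
    other. *)
Lemma cov_shift (Z : R -> T -> R) : gaussian_smooth P setT Z ->
  (forall x s t, Ex P (fun w => Z (s + x) w * Z (t + x) w) = Ex P (fun w => Z s w * Z t w)) ->
  forall i j x s t, Ex P (fun w => pderive i Z (s + x) w * pderive j Z (t + x) w) =
     Ex P (fun w => pderive i Z s w * pderive j Z t w).
Proof.
move=> gZ st i j x.
have dshift (f : R -> R) (l s : R) : is_derive (s + x) 1 f l -> is_derive s 1 (fun s => f (s + x)) l.
  move=> D; rewrite -[l]mulr1; apply: (@is_derive1_comp _ f (fun s => s + x)).
  by apply: is_derive_eq; rewrite addr0.
have sym i' j' s t : Ex P (fun w => pderive i' Z s w * pderive j' Z t w) = Ex P (fun w => pderive j' Z t w * pderive i' Z s w).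
  by congr Ex; apply/funext => w; rewrite mulrC.
have H0 i' s t : Ex P (fun w => pderive i' Z (s + x) w * pderive 0 Z (t + x) w) =
     Ex P (fun w => pderive i' Z s w * pderive 0 Z t w).
  elim: i' s t => [|n IH] s t; first exact: st.
  have D1 := derive_cov gZ n 0 (I : setT s) (I : setT t).
  have D2 := dshift _ _ _ (derive_cov gZ n 0 (I : setT (s + x)) (I : setT (t + x))).
  rewrite (funext (fun s => IH s t)) in D2.
  by rewrite -(@derive_val _ _ _ _ _ _ _ D2) (@derive_val _ _ _ _ _ _ _ D1).
elim: j => [|n IH] s t; first exact: H0.
have D1 := derive_cov gZ n i (I : setT t) (I : setT s).
have D2 := dshift _ _ _ (derive_cov gZ n i (I : setT (t + x)) (I : setT (s + x))).
have E u : Ex P (fun w => pderive n Z (u + x) w * pderive i Z (s + x) w) = Ex P (fun w => pderive n Z u w * pderive i Z s w).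
  by rewrite sym IH sym.
rewrite (funext E) in D2.
by rewrite sym [RHS]sym -(@derive_val _ _ _ _ _ _ _ D2) (@derive_val _ _ _ _ _ _ _ D1).
Qed.

Lemma Ex_sqr3 (V0 V1 V2 : T -> R) a b c (e00 e11 e22 e01 e02 e12 : R) :
  (forall V, V = V0 \/ V = V1 \/ V = V2 -> measurable_fun setT V /\ intg P (fun w => V w ^+ 2)) ->
  Ex P (fun w => V0 w * V0 w) = e00 -> Ex P (fun w => V1 w * V1 w) = e11 -> Ex P (fun w => V2 w * V2 w) = e22 ->
  Ex P (fun w => V0 w * V1 w) = e01 -> Ex P (fun w => V0 w * V2 w) = e02 -> Ex P (fun w => V1 w * V2 w) = e12 ->
  Ex P (fun w => (a * V0 w + (b * V1 w + c * V2 w)) ^+ 2) =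
  e00 * a ^+ 2 + e11 * b ^+ 2 + e22 * c ^+ 2 + 2 * (e01 * a * b + e02 * a * c + e12 * b * c).
Proof.
move=> HV <- <- <- <- <- <-.
have [m0 I0] := HV V0 (or_introl erefl); have [m1 I1] := HV V1 (or_intror (or_introl erefl)).
have [m2 I2] := HV V2 (or_intror (or_intror erefl)).
have J00 := intgZ (a ^+ 2) (intg_sqr_mul m0 m0 I0 I0); have J11 := intgZ (b ^+ 2) (intg_sqr_mul m1 m1 I1 I1).
have J22 := intgZ (c ^+ 2) (intg_sqr_mul m2 m2 I2 I2); have J01 := intgZ (2 * a * b) (intg_sqr_mul m0 m1 I0 I1).
have J02 := intgZ (2 * a * c) (intg_sqr_mul m0 m2 I0 I2); have J12 := intgZ (2 * b * c) (intg_sqr_mul m1 m2 I1 I2).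
transitivity (Ex P (fun w => a ^+ 2 * (V0 w * V0 w) + (b ^+ 2 * (V1 w * V1 w) + (c ^+ 2 * (V2 w * V2 w) +
   (2 * a * b * (V0 w * V1 w) + (2 * a * c * (V0 w * V2 w) + 2 * b * c * (V1 w * V2 w))))))).
  by congr Ex; apply/funext => w; ring.
have K1 := intgD J02 J12; have K2 := intgD J01 K1; have K3 := intgD J22 K2; have K4 := intgD J11 K3.
rewrite (ExD J00 K4) (ExD J11 K3) (ExD J22 K2) (ExD J01 K1) (ExD J02 J12).
rewrite (ExZ (a ^+ 2) (intg_sqr_mul m0 m0 I0 I0)) (ExZ (b ^+ 2) (intg_sqr_mul m1 m1 I1 I1)).
rewrite (ExZ (c ^+ 2) (intg_sqr_mul m2 m2 I2 I2)) (ExZ (2 * a * b) (intg_sqr_mul m0 m1 I0 I1)).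
rewrite (ExZ (2 * a * c) (intg_sqr_mul m0 m2 I0 I2)) (ExZ (2 * b * c) (intg_sqr_mul m1 m2 I1 I2)).
ring.
Qed.

Lemma Ex_sqr_eq0 (V : T -> R) : intg P (fun w => V w ^+ 2) -> Ex P (fun w => V w ^+ 2) = 0 ->
  {ae P, forall w, V w = 0}.
Proof.
move=> IV V0; have mV : measurable_fun setT (EFin \o (fun w => V w ^+ 2)).
  by apply/measurable_EFinP; exact: intg_meas IV.
have [/(_ _)/= h _] := ae_eq_integral_abs P measurableT mV.
have : {ae P, forall w, setT w -> (V w ^+ 2)%:E = 0%E}.
  apply: h; rewrite -[RHS](congr1 EFin V0) -ExE//; apply: eq_integral => w _.
  by rewrite /= ger0_norm ?sqr_ge0.
by apply: filterS => w /(_ I) [] /eqP; rewrite sqrf_eq0 => /eqP.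
Qed.

End normalization.

Section class_A_normalization.
Context {d : measure_display} {T : measurableType d} {R : realType} (P : probability T R).
Variables (Q : R[i] -> T -> R[i]) (k : nat).
Hypotheses (k0 : (0 < k)%N) (clQ : class_A P Q k.+1).
Variable (N : set T).
Local Notation Qr := (on_real Q).
Local Notation X := (vanish_on N Qr).
Hypotheses (mN : measurable N) (N0 : P N = 0%E) (gX : gaussian_smooth P setT X).

Let aeN : {ae P, forall w, ~ N w}.
Proof. by exists N; split=> // w /= /contrapT. Qed.

Lemma pderive_vanish_on n t w : ~ N w -> pderive n X t w = (Qr ^~ w)^`(n)%classic t.
Proof.
move=> nN; rewrite /pderive (_ : X ^~ w = Qr ^~ w)//.
by apply/funext => s; exact: vanish_onE.
Qed.

Lemma jet_nondegenerate t a b c :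
  {ae P, forall w, a * pderive 0 X t w + (b * pderive 1 X t w + c * pderive 2 X t w) = 0} ->
  [/\ a = 0, b = 0 & c = 0].
Proof.
case: clQ => _ nd _ _ h0.
(* One point of multiplicity 3, which is at most 2 (k + 1) because k >= 1. *)
pose m (i : 'I_1) := 3%N; pose co (i : 'I_1) (l : 'I_(m i)) := nth 0 [:: a; b; c] l.
have H : forall i l, co i l = 0.
  apply: (nd 1%N (fun=> t) m _ _ _ co).
  - by move=> i j _; rewrite !ord1.
  - by [].
  - by rewrite big_ord_recl big_ord0 /m; lia.
  - apply: filterS2 h0 aeN => w h nN.
    rewrite big_ord_recl big_ord0 addr0 !big_ord_recl big_ord0 addr0 /co /=.
    by move: h; rewrite !pderive_vanish_on.
split; [exact: (H ord0 (Ordinal (isT : 0 < 3)%N))|exact: (H ord0 (Ordinal (isT : 1 < 3)%N))|].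
exact: (H ord0 (Ordinal (isT : 2 < 3)%N)).
Qed.

Let v t := Ex P (fun w => X t w ^+ 2).
Let g t := (Num.sqrt (v t))^-1.
Let Z t w := g t * X t w.

Lemma variance_gt0 t : 0 < v t.
Proof.
rewrite lt_neqAle eq_sym andbC Ex_ge0 /=; last by move=> w; exact: sqr_ge0.
apply/eqP => v0; have [_ I2] := pderive_sqr gX 0 (I : setT t).
have ae0 := Ex_sqr_eq0 I2 v0.
have [/eqP] : [/\ (1 : R) = 0, (0 : R) = 0 & (0 : R) = 0].
  apply: (@jet_nondegenerate t); apply: filterS ae0 => w h.
  by rewrite !mul0r !addr0 mul1r.
by rewrite oner_eq0.
Qed.

Lemma normalizer_gt0 t : 0 < g t.
Proof. by rewrite /g invr_gt0 sqrtr_gt0 variance_gt0. Qed.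

Lemma normalizer_smooth : smooth_in setT g.
Proof. by apply: (smooth_inv_std gX) => t _; exact: variance_gt0. Qed.

Lemma normalized_smooth : gaussian_smooth P setT Z.
Proof. by apply: gaussian_smoothM => //; exact: normalizer_smooth. Qed.

Let XX s t : intg P (fun w => X s w * X t w).
Proof.
have [m1 I1] := pderive_sqr gX 0 (I : setT s); have [m2 I2] := pderive_sqr gX 0 (I : setT t).
exact: intg_sqr_mul m1 m2 I1 I2.
Qed.

Let ZZ s t : Ex P (fun w => Z s w * Z t w) = g s * g t * Ex P (fun w => X s w * X t w).
Proof. by rewrite -(ExZ (g s * g t) (XX s t)); congr Ex; apply/funext => w; rewrite /Z; ring. Qed.

Let gv t : g t ^+ 2 * v t = 1.
Proof.
have v0 := variance_gt0 t.
by rewrite /g exprVn sqr_sqrtr ?(ltW v0)// mulVf// gt_eqF.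
Qed.

Lemma normalized_variance t : Ex P (fun w => Z t w ^+ 2) = 1.
Proof.
by under eq_fun do rewrite expr2; rewrite ZZ -(gv t) expr2; congr (_ * _).
Qed.

Let mQ t : measurable_fun setT (Qr t).
Proof. by case: clQ => -[mRe _ _ _] _ _ _; exact: mRe. Qed.

Let expectation_cov (c : R) s t : ('E_P[(fun w => c * (Qr s w * Qr t w))%R] = (c * Ex P (fun w => X s w * X t w))%:E)%E.
Proof.
rewrite unlock -(ExZ c (XX s t)) -ExE; last exact: intgZ.
apply: ae_eq_integral => //.
- by apply/measurable_EFinP; apply: measurable_funM => //; exact: measurable_funM.
- by apply/measurable_EFinP; exact: intg_meas (intgZ c (XX s t)).
- by apply: filterS aeN => w nN _; rewrite !vanish_onE.
Qed.

(** On the diagonal the hypothesis identifies the deterministic factor as a ratio of standard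
    deviations, so it cancels once the variance is 1. *)
Lemma normalized_stationary_cov x s t :
  Ex P (fun w => Z (s + x) w * Z (t + x) w) = Ex P (fun w => Z s w * Z t w).
Proof.
case: clQ => _ _ st _; have [q [q0 H]] := st x.
have E a b : q a * q b * Ex P (fun w => X (a + x) w * X (b + x) w) = Ex P (fun w => X a w * X b w).
  have := H a b; have -> : (fun w => Qr a w * Qr b w) = (fun w => 1 * (Qr a w * Qr b w)).
    by apply/funext => w; rewrite mul1r.
  have -> : (fun w => q a * Qr (a + x) w * q b * Qr (b + x) w) = (fun w => (q a * q b) * (Qr (a + x) w * Qr (b + x) w)).
    by apply/funext => w; ring.
  by rewrite !expectation_cov mul1r => -[].
have vE a : v a = q a ^+ 2 * v (a + x).
  have -> : v a = Ex P (fun w => X a w * X a w) by congr Ex; apply/funext => w; rewrite expr2.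
  by rewrite -E expr2; congr (_ * _); congr Ex; apply/funext => w; rewrite expr2.
have gE a : q a * g a = g (a + x).
  rewrite /g vE sqrtrM ?sqr_ge0// sqrtr_sqr gtr0_norm// invfM mulrA mulfV ?mul1r// gt_eqF//.
by rewrite !ZZ -(E s t) -(gE s) -(gE t); ring.
Qed.

Lemma normalized_jet_cov i j t : Ex P (fun w => pderive i Z t w * pderive j Z t w) =
  Ex P (fun w => pderive i Z 0 w * pderive j Z 0 w).
Proof.
have := cov_shift normalized_smooth normalized_stationary_cov i j t 0 0.
by rewrite add0r.
Qed.

Lemma normalized_cov_le1 s t : `|Ex P (fun w => Z s w * Z t w)| <= 1.
Proof.
have [m1 I1] := pderive_sqr normalized_smooth 0 (I : setT s).
have [m2 I2] := pderive_sqr normalized_smooth 0 (I : setT t).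
have := Ex_cauchy m1 m2 I1 I2.
have -> : Ex P (fun w => pderive 0 Z s w ^+ 2) = 1 := normalized_variance s.
have -> : Ex P (fun w => pderive 0 Z t w ^+ 2) = 1 := normalized_variance t.
by rewrite mulr1 => h; rewrite -(@ler_pXn2r _ 2) ?nnegrE// real_normK ?num_real// expr1n.
Qed.

Lemma decorrelated : exists c tau psi, [/\ 0 < c, 0 < tau, Psi k.+1 psi &
  forall s t, 2 * tau <= `|t - s| -> `|Ex P (fun w => Z s w * Z t w)| <= 2 * c * psi (`|t - s| - tau)].
Proof.
case: clQ => _ _ _ [c [tau [psi [c0 tau0 Hpsi H]]]]; exists c, tau, psi; split=> // s t st.
have [k' kE] : exists k', k = k'.+1 by exists k.-1; rewrite prednK.
(* Index 0 is one block, at t; all other indices sit at s, and among them only index 1 has a nonzero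
   coefficient. The blocks are then at distance |t - s|. *)
pose a (i : 'I_k.+1) : R := if i == 0%N :> nat then g t else if i == 1%N :> nat then g s else 0.
pose xi (i : 'I_k.+1) : R := if i == 0%N :> nat then t else s.
pose A : {set 'I_k.+1} := [set ord0]%SET; pose B : {set 'I_k.+1} := (~: A)%SET.
have i1 : (1 < k.+1)%N by rewrite kE.
have B1 : Ordinal i1 \in B by rewrite !inE.
have dist : index_dist xi A B = `|t - s|.
  rewrite /index_dist (_ : [set r | _] = [set `|t - s|]) ?inf1//.
  apply/seteqP; split=> [r [i [j [iA jB ->]]]|_ ->] /=.
    move: iA jB; rewrite !inE => /eqP -> /negbTE j0; rewrite /xi eqxx.
    by rewrite (_ : (j == 0%N :> nat) = false)//; apply: contraFF j0 => /eqP j0; apply/eqP/val_inj.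
  by exists ord0, (Ordinal i1); split=> //; rewrite !inE.
have LA w : linear_functional Qr (path_derive Qr) a (fun=> 0) xi A w = g t * Qr t w.
  by rewrite /linear_functional big_set1 /a /xi eqxx mul0r addr0.
have LB w : linear_functional Qr (path_derive Qr) a (fun=> 0) xi B w = g s * Qr s w.
  rewrite /linear_functional (bigD1 (Ordinal i1)) //= big1 ?addr0.
    by rewrite /a /xi /= mul0r addr0.
  move=> j /andP[]; rewrite !inE /a => j0 j1; rewrite (_ : (j == 0%N :> nat) = false).
    rewrite (_ : (j == 1%N :> nat) = false) ?mul0r ?addr0//.
    by apply: contraNF j1 => /eqP j1; apply/eqP/val_inj.
  by apply: contraNF j0 => /eqP j0; apply/eqP/val_inj.
have := H a (fun=> 0) xi A B; rewrite dist.
have -> : A :|: B = finset.setT by apply/setP => i; rewrite !inE orbN.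
have -> : A :&: B = finset.set0 by apply/setP => i; rewrite !inE andbN.
move=> /(_ erefl erefl); rewrite (funext LA) (funext LB).
have -> : (A != finset.set0) by apply/set0Pn; exists ord0; rewrite inE.
have -> : (B != finset.set0) by apply/set0Pn; exists (Ordinal i1).
have V1 u : ('E_P[(fun w => `|(g u * Qr u w)%R| ^+ 2)%R] = 1%:E)%E.
  rewrite (@expectation_sqr_ae _ _ _ P _ (Z u)) ?normalized_variance//.
    by have [] := pderive_sqr normalized_smooth 0 (I : setT u).
  by apply: filterS aeN => w nN; rewrite /Z vanish_onE.
move=> /(_ isT isT st); rewrite !V1.
have -> : (fun w => g t * Qr t w * (g s * Qr s w)) = (fun w => g s * g t * (Qr s w * Qr t w)).
  by apply/funext => w; ring.
rewrite expectation_cov -ZZ abse_EFin -EFinD -EFinM lee_fin => h.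
have -> : 2 * c * psi (`|t - s| - tau) = c * psi (`|t - s| - tau) * (1 + 1) by ring.
exact: h.
Qed.

Lemma normalized_decay : exists2 C, 0 <= C & forall s t,
  `|Ex P (fun w => Z s w * Z t w)| <= C / (1 + (t - s) ^+ 2).
Proof.
have [c [tau [psi [c0 tau0 Hpsi H]]]] := decorrelated.
have [B B0 HB] := Psi_decay k0 Hpsi.
(* Beyond [D], both [decorrelated] and [Psi_decay] apply and |t - s| - tau is at least half of |t -
   s|; up to [D] the bound 1 is enough. *)
pose D := 2 * tau + 4; have D4 : 4 <= D by rewrite /D; lra.
exists (16 * (c * B) + (1 + D ^+ 2)).
  by rewrite !addr_ge0 ?sqr_ge0// !mulr_ge0// ltW.
move=> s t; rewrite ler_pdivlMr; last by have := sqr_ge0 (t - s); lra.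
rewrite -[(t - s) ^+ 2]real_normK ?num_real//; set u := `|t - s|.
have u0 : 0 <= u by exact: normr_ge0.
have cB0 : 0 <= c * B by rewrite mulr_ge0// ltW.
have [uD|uD] := leP u D.
  have h1 := normalized_cov_le1 s t.
  apply: (@le_trans _ _ (1 * (1 + D ^+ 2))); last by lra.
  by apply: ler_pM => //; [have := sqr_ge0 u; lra|rewrite lerD2l lerXn2r ?nnegrE//; lra].
have u2 : 2 * tau <= u by rewrite /D in uD; lra.
have ut : 2 <= u - tau by rewrite /D in uD; lra.
have uu : 0 < u / 2 by lra.
have h1 : psi (u - tau) <= B / (u / 2) ^+ 2.
  apply: (le_trans (HB _ ut)); rewrite ler_wpM2l// lef_pV2 ?posrE ?exprn_gt0//; last by lra.
  by rewrite lerXn2r ?nnegrE//; rewrite /D in uD; lra.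
have h2 : `|Ex P (fun w => Z s w * Z t w)| <= 2 * c * (B / (u / 2) ^+ 2).
  by apply: (le_trans (H s t u2)); rewrite ler_wpM2l// mulr_ge0// ltW.
have u1 : 1 <= u by lra.
have h3 : 1 + u ^+ 2 <= 2 * u ^+ 2 by have : 1 <= u ^+ 2 := exprn_ege1 _ u1; lra.
have D20 : 0 <= 1 + D ^+ 2 by have := sqr_ge0 D; lra.
apply: (@le_trans _ _ (2 * c * (B / (u / 2) ^+ 2) * (2 * u ^+ 2))); first by apply: ler_pM => //; have := sqr_ge0 u; lra.
by rewrite (_ : _ * _ = 16 * (c * B)); [lra|field; lra].
Qed.

(** Stationarity makes the quadratic form independent of t. At 0 the jet of [Z] is a triangular
    image of the jet of the unnormalized process with diagonal g 0 > 0, so nondegeneracy is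
    inherited. *)
Lemma normalized_positive : exists2 lam, 0 < lam & forall t a0 a1 a2, lam * (a0 ^+ 2 + a1 ^+ 2 + a2 ^+ 2) <=
    Ex P (fun w => (a0 * pderive 0 Z t w + (a1 * pderive 1 Z t w + a2 * pderive 2 Z t w)) ^+ 2).
Proof.
pose G i j := Ex P (fun w => pderive i Z 0 w * pderive j Z 0 w).
have HV t (V : T -> R) : V = pderive 0 Z t \/ V = pderive 1 Z t \/ V = pderive 2 Z t ->
    measurable_fun setT V /\ intg P (fun w => V w ^+ 2).
  by move=> [->|[->|->]]; exact: pderive_sqr normalized_smooth _ _ (I : setT t).
pose q t a b c := Ex P (fun w => (a * pderive 0 Z t w + (b * pderive 1 Z t w + c * pderive 2 Z t w)) ^+ 2).
have qE t a b c : q t a b c = G 0%N 0%N * a ^+ 2 + G 1%N 1%N * b ^+ 2 + G 2%N 2%N * c ^+ 2 +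
     2 * (G 0%N 1%N * a * b + G 0%N 2%N * a * c + G 1%N 2%N * b * c).
  exact: (Ex_sqr3 a b c (HV t) (normalized_jet_cov 0 0 t) (normalized_jet_cov 1 1 t) (normalized_jet_cov 2 2 t)
    (normalized_jet_cov 0 1 t) (normalized_jet_cov 0 2 t) (normalized_jet_cov 1 2 t)).
have q_ge0 t a b c : 0 <= q t a b c by apply: Ex_ge0 => w; exact: sqr_ge0.
have qpos a b c : q 0 a b c = 0 -> [/\ a = 0, b = 0 & c = 0].
  move=> q0.
  have Iq : intg P (fun w => (a * pderive 0 Z 0 w + (b * pderive 1 Z 0 w + c * pderive 2 Z 0 w)) ^+ 2).
    have := @comb_sqr _ _ _ P _ _ normalized_smooth [:: (a, 0%N, 0); (b, 1%N, 0); (c, 2%N, 0)].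
    move=> []; first by move=> y; rewrite !inE => /or3P[] /eqP ->.
    by move=> _; congr (intg P _); apply/funext => w; rewrite /comb !big_cons big_nil /= addr0.
  have ae0 := Ex_sqr_eq0 Iq q0.
  pose g1 := g^`()%classic; pose g2 := g1^`()%classic.
  have sX w : smooth_in setT (X ^~ w) by case: gX.
  have sg := normalizer_smooth.
  have p0 w : pderive 0 Z 0 w = g 0 * pderive 0 X 0 w by [].
  have d1 w t : pderive 1 Z t w = g t * pderive 1 X t w + X t w * g1 t.
    rewrite /pderive /= derive1E; apply: (@derive_val _ _ _ _ _ _ _ (is_deriveM (is_derive_smooth 0 sg (I : setT t)) (is_derive_smooth 0 (sX w) (I : setT t)))).
  have p2 w : pderive 2 Z 0 w = g 0 * pderive 2 X 0 w + 2 * g1 0 * pderive 1 X 0 w + g2 0 * X 0 w.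
    have -> : pderive 2 Z 0 w = (pderive 1 Z ^~ w)^`()%classic 0 by [].
    rewrite (funext (d1 w)) derive1E.
    have D := is_deriveD (is_deriveM (is_derive_smooth 0 sg (I : setT 0)) (is_derive_smooth 1 (sX w) (I : setT 0)))
      (is_deriveM (is_derive_smooth 0 (sX w) (I : setT 0)) (is_derive_smooth 1 sg (I : setT 0))).
    rewrite (@derive_val _ _ _ _ _ _ _ D) /GRing.scale /= /pderive /= -/g1 -/g2; ring.
  have g0 : g 0 != 0 by rewrite gt_eqF// normalizer_gt0.
  have [|h0 h1 h2] := @jet_nondegenerate 0 (a * g 0 + b * g1 0 + c * g2 0) (b * g 0 + c * (2 * g1 0)) (c * g 0).
    apply: filterS ae0 => w; rewrite p0 d1 p2 => h; rewrite -[RHS]h.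
    have -> : X 0 w = pderive 0 X 0 w by []; ring.
  have c0 : c = 0 by apply/eqP; move/eqP: h2; rewrite mulf_eq0 (negbTE g0) orbF.
  have b0 : b = 0 by apply/eqP; move/eqP: h1; rewrite c0 mul0r addr0 mulf_eq0 (negbTE g0) orbF.
  by split=> //; apply/eqP; move/eqP: h0; rewrite b0 c0 !mul0r !addr0 mulf_eq0 (negbTE g0) orbF.
have [lam lam0 Hlam] := quad3_lower (qE 0) (q_ge0 0) qpos.
exists lam; first exact: lam0.
by move=> t a0 a1 a2; have := Hlam a0 a1 a2; rewrite (qE 0) -(qE t).
Qed.

End class_A_normalization.

(** * The strong law *)

Section interior.
Context {R : realType}.
Implicit Types (f : R -> R) (J O : set R).

Lemma derive1_in_interior J O f t : open O -> O `<=` J -> O t -> cvg (quotient_in f t @ within J t^') ->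
  is_derive t 1 f (derive1_in J f t).
Proof.
move=> oO OJ Ot cv; apply: is_derive_quotient => u u0 ul.
have sh : (fun n => t + u n) @ \oo --> within J t^'.
  move=> A /= HA; have tu : t + u n @[n --> \oo] --> t.
    by rewrite -[X in _ --> X]addr0; apply: cvgD => //; exact: cvg_cst.
  have H1 : \forall n \near \oo, O (t + u n) by exact: (tu _ (open_nbhs_nbhs (conj oO Ot))).
  have H2 : \forall n \near \oo, t + u n != t -> J (t + u n) -> A (t + u n) by exact: (tu _ HA).
  change (\forall n \near \oo, A (t + u n)).
  apply: filterS2 H1 H2 => n /= On h; apply: h; last exact: OJ.
  by apply: contraNneq (u0 n) => h; apply/eqP; apply: (addrI t); rewrite addr0.
have := cvg_comp _ _ sh cv; apply: cvg_trans; rewrite /quotient_in.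
rewrite (_ : (fun n => _) = (fun n => quotient_in f t (t + u n)))//.
by apply/funext => n; rewrite /quotient_in (addrC t) addrK mulrC addrC.
Qed.

Lemma smooth_on_interior J O f : open O -> O `<=` J -> smooth_on J f ->
  smooth_in O f /\ forall t, O t -> f^`()%classic t = derive1_in J f t.
Proof.
move=> oO OJ sf.
have D n t : O t -> is_derive t 1 (iter n (derive1_in J) f) (iter n.+1 (derive1_in J) f t).
  by move=> Ot; apply: (derive1_in_interior oO OJ Ot); apply: sf; exact: OJ.
split.
  apply: (@smooth_closed _ O (fun h => exists n, h = iter n (derive1_in J) f)) => //; last by exists 0%N.
  by move=> _ [n ->]; exists (iter n.+1 (derive1_in J) f); [exists n.+1|exact: D].
move=> t Ot; rewrite derive1E; exact: (@derive_val _ _ _ _ _ _ _ (D 0%N t Ot)).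
Qed.

Lemma counting_endpoints (A B : set R) a b : A `<=` B `|` [set a; b] ->
  (counting A <= counting B + 2%:E :> \bar R)%E.
Proof.
move=> AB; rewrite {2}/counting; case: asboolP => [fB|_]; last by rewrite addye ?leey.
rewrite -EFinD -[2]/(2%:R) -natrD; apply: counting_le => s us sA.
pose s1 := [seq x <- s | x \in [:: a; b]]; pose s2 := [seq x <- s | x \notin [:: a; b]].
have -> : size s = (size s2 + size s1)%N.
  by rewrite addnC !size_filter; exact/esym/count_predC.
apply: leq_add; last first.
  by apply: (@leq_trans (size [:: a; b])) => //; apply: uniq_leq_size; [exact: filter_uniq|move=> x; rewrite mem_filter => /andP[]].
rewrite -[leqLHS]/(size s2).
have : ((size s2)%:R%:E <= counting B :> \bar R)%E.
  apply: counting_ge; first exact: filter_uniq.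
  move=> z; rewrite mem_filter !inE negb_or => /andP[/andP[za zb] /sA /AB[//|[]]] /eqP; first by rewrite (negbTE za).
  by rewrite (negbTE zb).
by rewrite /counting; case: asboolP => // _; rewrite lee_fin ler_nat.
Qed.

Lemma interval_endpoints (A : set R) : is_interval A -> (lebesgue_measure A < +oo)%E -> (0 < lebesgue_measure A)%E ->
  exists a b, [/\ a < b, lebesgue_measure A = (b - a)%:E, `]a, b[%classic `<=` A & A `<=` `]a, b[%classic `|` [set a; b]].
Proof.
move=> /is_intervalP ->; case: (Rhull A) => x y.
rewrite -[[set x0 | _]]/([set` Interval x y]).
rewrite lebesgue_measure_itv /=.
case: x => [c a|[]]; case: y => [e b|[]] //=; rewrite ?lte_fin ?ltxx//;
  try by case: ifP => //; rewrite ?ltxx.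
case: ifPn => [ab _ _|_ _]; last by rewrite ltxx.
exists a, b; split=> //.
  by move=> z /=; rewrite !in_itv /= => /andP[az zb]; case: c; case: e; rewrite /= ?(ltW az) ?(ltW zb) ?az ?zb.
move=> z /=; rewrite !in_itv /=; have [->|za] := eqVneq z a; first by right; left.
have [->|zb] := eqVneq z b; first by right; right.
move=> /andP[az bz]; left; apply/andP; split.
  by case: c az => //= az; rewrite lt_neqAle eq_sym za.
by case: e bz => //= bz; rewrite lt_neqAle zb.
Qed.

Lemma counting_subset (A B : set R) : A `<=` B -> (counting A <= counting B :> \bar R)%E.
Proof.
move=> AB; rewrite {2}/counting; case: asboolP => [fB|_]; last by rewrite leey.
apply: counting_le => s us sA; have := counting_ge us (fun z zs => AB z (sA z zs)).
by rewrite /counting asboolT// lee_fin ler_nat.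
Qed.

End interior.

Section null_sets.
Context {d : measure_display} {T : measurableType d} {R : realType} (P : probability T R).

Lemma ge0_integral_le_null (N : set T) (h f : T -> \bar R) : measurable N -> P N = 0%E ->
  (forall w, 0 <= h w)%E -> (forall w, 0 <= f w)%E -> (forall w, ~ N w -> h w <= f w)%E ->
  (\int[P]_w h w <= \int[P]_w f w)%E.
Proof.
move=> mN N0 h0 f0 hf; rewrite [leLHS]ge0_integralTE//.
apply: ge_ereal_sup => _ /= [s sh <-]; rewrite -integralT_nnsfun.
pose s' w := (s w * \1_(~` N) w)%:E.
have -> : (\int[P]_w (s w)%:E = \int[P]_w s' w)%E.
  apply: ae_eq_integral => //.
  - exact/measurable_EFinP.
  - apply/measurable_EFinP; apply: measurable_funM => //.
    by apply: measurable_indic; exact: measurableC.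
  - exists N; split=> // w /=; apply: contra_notP => nN _.
    by rewrite /s' indicE mem_set// mulr1.
apply: ge0_integral_le => w; first by rewrite /s' lee_fin mulr_ge0//; exact: fun_ge0.
rewrite /s' indicE; have [Nw|Nw] := pselect (N w).
  by rewrite memNset ?mulr0//; exact.
by rewrite mem_set// mulr1; apply: le_trans (sh w) (hf w Nw).
Qed.

End null_sets.

Section transfer.
Context {d0 d : measure_display} {T0 : measurableType d0} {T : measurableType d} {R : realType}.
Variables (P0 : probability T0 R) (P : probability T R).
Variables (Q : R[i] -> T0 -> R[i]) (k : nat) (N0 : set T0).
Hypotheses (mN0 : measurable N0) (PN0 : P0 N0 = 0%E) (gX0 : gaussian_smooth P0 setT (vanish_on N0 (on_real Q))).

(** Inside the open interval derivatives along [J] are ordinary derivatives, so the hypothesis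
    becomes a comparison of the modified processes, whose paths are all smooth. *)
Lemma class_AQ_comparable J eps X a b : `]a, b[%classic `<=` J -> class_AQ P0 Q P k J eps X ->
  exists N : set T, [/\ measurable N, P N = 0%E, gaussian_smooth P `]a, b[%classic (vanish_on N X) &
    comparable P0 P `]a, b[%classic k eps (vanish_on N0 (on_real Q)) (vanish_on N X)].
Proof.
move=> abJ [cg sm H4].
have [N [mN PN HN]] := ae_null_set sm.
pose O : set R := `]a, b[%classic; have oO : open O by exact: itv_open.
have gX : gaussian_smooth P O (vanish_on N X).
  apply: gaussian_smooth_vanish_on => //.
    by move=> w /HN sw; have [] := smooth_on_interior oO abJ sw.
  move=> s sO; have Jt (i : 'I_(size s)) : J (tnth (in_tuple s) i).2.
    by apply: abJ; apply: sO; exact: mem_tnth.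
  have [v gv] := centered_gaussian_gauss (cg (size s) (fun i => (tnth (in_tuple s) i).2) (fun i => (tnth (in_tuple s) i).1) Jt).
  exists v; move: gv; congr (gauss P _ v); apply/funext => w.
  by rewrite [RHS]big_tnth.
exists N; split=> // x y xi Oxi.
have ae0 : {ae P0, forall w, linear_functional (on_real Q) (path_derive (on_real Q)) x y xi finset.setT w =
    jet_sum x y xi (vanish_on N0 (on_real Q)) w}.
  exists N0; split=> // w /=; apply: contra_notP => nN.
  rewrite /linear_functional /jet_sum; apply: eq_big => [j|j _]; first by rewrite inE.
  rewrite vanish_onE// /path_derive (_ : (vanish_on N0 (on_real Q)) ^~ w = on_real Q ^~ w)//.
  by apply/funext => t; rewrite vanish_onE.
have ae1 : {ae P, forall w, linear_functional X (path_derive_in J X) x y xi finset.setT w =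
    jet_sum x y xi (vanish_on N X) w}.
  exists N; split=> // w /=; apply: contra_notP => nN.
  rewrite /linear_functional /jet_sum; apply: eq_big => [j|j _]; first by rewrite inE.
  have [_ h] := smooth_on_interior oO abJ (HN w nN).
  rewrite vanish_onE// /path_derive_in -h//; last exact: Oxi.
  rewrite (_ : (vanish_on N X) ^~ w = X ^~ w)//.
  by apply/funext => t; rewrite vanish_onE.
have I0 : intg P0 (fun w => jet_sum x y xi (vanish_on N0 (on_real Q)) w ^+ 2).
  have [|_] := comb_sqr gX0 (l := jet_list x y xi); first by apply: points_in_jet_list.
  by under eq_fun do rewrite comb_jet_list.
have I1 : intg P (fun w => jet_sum x y xi (vanish_on N X) w ^+ 2).
  have [|_] := comb_sqr gX (l := jet_list x y xi); first exact: points_in_jet_list.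
  by under eq_fun do rewrite comb_jet_list.
have := H4 x y xi (fun j => abJ _ (Oxi j)); rewrite /=.
by rewrite (expectation_sqr_ae I0 ae0) (expectation_sqr_ae I1 ae1) -!EFinM !lee_fin.
Qed.

End transfer.

Section zero_count.
Context {d0 d : measure_display} {T0 : measurableType d0} {T : measurableType d} {R : realType}.
Variables (P0 : probability T0 R) (P : probability T R).

(** Concentration is applied to g X, where g > 0 normalizes the model: the zeros are the same. The
    added 2 allows for zeros at the endpoints of [A]. The constants precede [J], [A] and [X], hence
    are uniform in n. *)
Lemma zero_count_class_AQ (Q : R[i] -> T0 -> R[i]) k : (0 < k)%N -> class_A P0 Q k.+1 ->
  exists K0 B c : R, [/\ 4 <= K0, 0 <= B, 0 < c & forall J A eps X a b K,
    `]a, b[%classic `<=` A -> A `<=` `]a, b[%classic `|` [set a; b] -> A `<=` J ->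
    class_AQ P0 Q P k.+1 J eps X -> 0 < eps -> eps <= 1 / 2 -> K0 <= K -> K ^+ 72 <= b - a -> eps <= K^-1 ^+ 72 ->
    exists mu (Bad : set T), [/\ measurable Bad, (P Bad <= (B * K^-1 ^+ (72 * k))%:E)%E,
     c * (b - a) <= mu,
     {ae P, forall w, ~ Bad w ->
      ((mu - (B * ((b - a) * K^-1) + 2))%:E <= nb_zeros X A w)%E /\
      (nb_zeros X A w <= (mu + (B * ((b - a) * K^-1) + 2))%:E)%E} &
     ((mu - (B * ((b - a) * K^-1) + 2))%:E <= \int[P]_w nb_zeros X A w)%E /\
     (\int[P]_w nb_zeros X A w <= (mu + (B * ((b - a) * K^-1) + 2))%:E)%E]].
Proof.
move=> k0 clQ; have gaf : real_GAF P0 Q by case: clQ.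
have [N0 [mN0 PN0 gX0]] := gaf_smooth gaf.
set X0 := vanish_on N0 (on_real Q) in gX0.
pose g t := (Num.sqrt (Ex P0 (fun w => X0 t w ^+ 2)))^-1.
pose Z t w := g t * X0 t w.
have g0 t : 0 < g t := normalizer_gt0 k0 clQ mN0 PN0 gX0 t.
have sg : smooth_in setT g := normalizer_smooth k0 clQ mN0 PN0 gX0.
have gZ : gaussian_smooth P0 setT Z := normalized_smooth k0 clQ mN0 PN0 gX0.
have v1 t : Ex P0 (fun w => Z t w ^+ 2) = 1 := normalized_variance k0 clQ mN0 PN0 gX0 t.
have [C1 C10 rho] := normalized_decay k0 clQ mN0 PN0 gX0.
have [lam lam0 pos] := normalized_positive k0 clQ mN0 PN0 gX0.
have jc := normalized_jet_cov k0 clQ mN0 PN0 gX0.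
pose jet j := Ex P0 (fun w => pderive j Z 0 w * pderive j Z 0 w).
have jet0 j : 0 <= jet j by apply: Ex_ge0 => w; rewrite -expr2 sqr_ge0.
pose C := C1 + \sum_(j < (2 * k).+2) jet j.
have S0 : 0 <= \sum_(j < (2 * k).+2) jet j by apply: sumr_ge0.
have C0 : 0 <= C by rewrite addr_ge0.
have rhoC s t : `|Ex P0 (fun w => Z s w * Z t w)| <= C / (1 + (t - s) ^+ 2).
  apply: (le_trans (rho s t)); rewrite ler_wpM2r ?lerDl// invr_ge0.
  by have := sqr_ge0 (t - s); lra.
have jetC j t : (j <= (2 * k).+1)%N -> Ex P0 (fun w => pderive j Z t w ^+ 2) <= C.
  move=> jk; have -> : Ex P0 (fun w => pderive j Z t w ^+ 2) = jet j.
    by rewrite /jet -(jc j j t); congr Ex; apply/funext => w; rewrite expr2.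
  rewrite /C (bigD1 (Ordinal (jk : (j < (2 * k).+2)%N))) //= addrCA lerDl addr_ge0//.
  by apply: sumr_ge0.
have C2 : 0 <= 2 * C + 1 by lra.
have l2 : 0 < lam / 2 by rewrite divr_gt0.
have [K0 [B [c [K04 B0 c0 H]]]] := @zero_count_concentration _ _ _ P k _ _ k0 C2 l2.
exists K0, B, c; split=> // J A eps X a b K abA Aab AJ cl eps0 eps2 KK TK epsK.
have abJ : `]a, b[%classic `<=` J by apply: subset_trans AJ.
have [N [mN PN gX cmp]] := class_AQ_comparable mN0 PN0 gX0 abJ cl.
pose O : set R := `]a, b[%classic; have oO : open O by exact: itv_open.
have sgO : smooth_in O g by move=> n t _; exact: sg.
pose Y t w := g t * vanish_on N X t w.
have gY : gaussian_smooth P O Y by exact: gaussian_smoothM.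
have cmpY : comparable P0 P O k.+1 eps Z Y.
  have s0 w : smooth_in O (X0 ^~ w) by case: gX0 => _ s _ n t _; exact: s.
  have s1 w : smooth_in O ((vanish_on N X) ^~ w) by case: gX.
  exact: (comparableM sgO s0 s1 cmp).
have tY : tame P a b Y k (2 * C + 1) (lam / 2) eps.
  exact: (tame_of_comparable k0 C0 lam0 (ltW eps0) eps2 gZ gY cmpY v1 rhoC jetC pos).
have [mu [Bad [mB PB cmu ae [lo up]]]] := H a b Y eps K tY (ltW eps0) KK TK epsK.
have zE w : ~ N w -> zero_set (Y ^~ w) a b = `]a, b[%classic `&` [set t | X t w = 0].
  move=> nN; rewrite /zero_set; apply/seteqP; split=> t /= [tab]; rewrite /Y vanish_onE//.
    by move=> /eqP; rewrite mulf_eq0 gt_eqF ?g0//= => /eqP.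
  by move=> ->; rewrite mulr0.
have cnt0 (S : set R) : (0 <= counting S :> \bar R)%E by exact: measure_ge0.
have low w : ~ N w -> (counting (zero_set (Y ^~ w) a b) <= nb_zeros X A w)%E.
  move=> nN; rewrite /nb_zeros zE//; apply: counting_subset.
  by move=> t [/abA].
have high w : ~ N w -> (nb_zeros X A w <= counting (zero_set (Y ^~ w) a b) + 2%:E)%E.
  move=> nN; rewrite /nb_zeros zE//; apply: (@counting_endpoints _ _ _ a b).
  by move=> t [/Aab[tab|tab] xt]; [left|right].
exists mu, Bad; split=> //.
  have aeN : {ae P, forall w, ~ N w} by exists N; split=> // w /= /contrapT.
  apply: filterS2 ae aeN => w hw nN nB; have [l u] := hw nB; split.
    by apply: le_trans (low w nN); apply: le_trans l; rewrite lee_fin; lra.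
  by apply: (le_trans (high w nN)); rewrite (addrA mu) [leRHS]EFinD; apply: leeD.
split.
  apply: (@le_trans _ _ (mu - B * ((b - a) * K^-1))%:E); first by rewrite lee_fin; lra.
  by apply: (le_trans lo); apply: (ge0_integral_le_null mN PN).
rewrite (addrA mu); apply: le_trans (up 2 _) => //.
by apply: (ge0_integral_le_null mN PN) => // w; rewrite adde_ge0// lee_fin.
Qed.

End zero_count.

(** * Ratio estimate and the Borel-Cantelli lemma *)

Section summation.
Context {R : realType}.

(** Both numbers are within E of mu and E <= c l / 2, so y is at least c l / 2 and the relative gap
    at most 2 E over that. *)
Lemma ratio_close (x y mu E rho c l : R) : 0 < c -> 0 < l -> c * l <= mu -> E <= rho * l -> rho <= c / 2 ->
  mu - E <= x -> x <= mu + E -> mu - E <= y -> y <= mu + E ->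
  0 < y /\ `|x / y - 1| <= 4 / c * rho.
Proof.
move=> c0 l0 cmu Er rc x1 x2 y1 y2.
have E2 : rho * l <= c * l / 2.
  by rewrite (_ : c * l / 2 = c / 2 * l); [rewrite ler_wpM2r// ltW|ring].
have cl : 0 < c * l by exact: mulr_gt0.
have y0 : c * l / 2 <= y by lra.
have yp : 0 < y by lra.
split=> //; have -> : x / y - 1 = (x - y) / y by field; rewrite gt_eqF.
rewrite normrM normfV (gtr0_norm yp) ler_pdivrMr//.
apply: (@le_trans _ _ (2 * E)); first by rewrite ler_norml; apply/andP; split; lra.
have E0 : 0 <= E by lra.
have r0 : 0 <= rho.
  have : 0 <= rho * l by lra.
  by rewrite pmulr_lge0.
apply: (@le_trans _ _ (4 / c * rho * (c * l / 2))).
  have -> : 4 / c * rho * (c * l / 2) = 2 * (rho * l) by field; rewrite gt_eqF.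
  by rewrite ler_pM2l.
by rewrite ler_wpM2l// mulr_ge0// divr_ge0// ltW.
Qed.

Lemma powR_root (x : R) n : 0 <= x -> (0 < n)%N -> (x `^ (n%:R^-1)) ^+ n = x.
Proof.
move=> x0 n0; rewrite -powR_mulrn ?powR_ge0// -powRrM mulVf ?powRr1// pnatr_eq0 -lt0n//.
Qed.

Lemma powRV (x r : R) : 0 <= x -> (x^-1) `^ r = (x `^ r)^-1.
Proof. by move=> x0; rewrite -powR_inv1// -powRrM mulN1r powRN. Qed.

Lemma eventually_small (u : nat -> R) (e : R) : u @ \oo --> 0 -> 0 < e -> \forall n \near \oo, u n <= e.
Proof. by move=> u0 e0; apply: (cvgr_le _ u0). Qed.

End summation.

Lemma borel_cantelli {d : measure_display} {T : measurableType d} {R : realType} (P : probability T R)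
    (Bad : nat -> set T) (u : nat -> \bar R) :
  (forall n, measurable (Bad n)) -> (forall n, 0 <= u n)%E -> (forall n, P (Bad n) <= u n)%E ->
  (\sum_(n <oo) u n < +oo)%E -> {ae P, forall w, \forall n \near \oo, ~ Bad n w}.
Proof.
move=> mB u0 Bu su; have z : P (lim_sup_set Bad) = 0%E.
  apply: lim_sup_set_cvg0 => //; apply: le_lt_trans su.
  by apply: lee_nneseries => [n _ _|n _]; [exact: measure_ge0|exact: Bu].
exists (lim_sup_set Bad); split=> //.
  by apply: bigcap_measurable => // n _; exact: bigcup_measurable.
move=> w /= H n _; apply: contrapT => nb; apply: H; exists n => // j /= nj bj.
by apply: nb; exists j.
Qed.

Theorem corollary1p22 (R : realType)
    (d0 : measure_display) (T0 : measurableType d0) (P0 : probability T0 R)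
    (d : measure_display) (T : measurableType d) (P : probability T R)
    (k : nat) (Q : R[i] -> T0 -> R[i])
    (J : nat -> set R) (eps : nat -> R) (Qn : nat -> R -> T -> R)
    (I : nat -> set R) (m : R) :
  (0 < k)%N ->
  class_A P0 Q k.+1 ->
  (forall n, (1 <= n)%N -> is_interval (J n)) ->
  (forall n, (1 <= n)%N -> 0 < eps n) ->
  eps @ \oo --> (0 : R) ->
  (forall n, (1 <= n)%N -> class_AQ P0 Q P k.+1 (J n) (eps n) (Qn n)) ->
  (forall n, (1 <= n)%N -> is_interval (I n)) ->
  (forall n, (1 <= n)%N -> I n `<=` J n) ->
  (forall n, (1 <= n)%N -> (lebesgue_measure (I n) < +oo)%E) ->
  0 < m -> m <= k%:R ->
  (\sum_(1 <= n <oo)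
     maxe ((lebesgue_measure (I n) `^ m)^-1) ((eps n)%:E `^ m) < +oo)%E ->
  {ae P, forall w,
    (fun n => nb_zeros (Qn n) (I n) w /
              \int[P]_w' nb_zeros (Qn n) (I n) w')%E @ \oo --> 1%E}.
Proof.
move=> k0 clQ _ eps0 epsc clX iI IJ finI m0 mk; set S := (\sum_(1 <= n <oo) _)%E => Slt.
have [K0 [B [c [K04 B0 c0 H]]]] := zero_count_class_AQ P k0 clQ.
pose u n := maxe ((lebesgue_measure (I n) `^ m)^-1)%E ((eps n)%:E `^ m)%E.
have u0 n : (0 <= u n)%E by rewrite le_max poweR_ge0 orbT.
have uS N : (\sum_(1 <= n < N) u n <= S)%E by exact: nneseries_lim_ge.
have ufin n : (1 <= n)%N -> (u n < +oo)%E.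
  move=> n1; apply: le_lt_trans Slt; apply: le_trans (uS n.+1).
  by rewrite big_nat_recr//= leeDr//; apply: sume_ge0.
(* A null interval would give an infinite term, the inverse of 0 being +oo. *)
have Lpos n : (1 <= n)%N -> (0 < lebesgue_measure (I n))%E.
  move=> n1; rewrite lt0e measure_ge0 andbT; apply/eqP => l0.
  by have := ufin n n1; rewrite /u l0 poweR0r ?gt_eqF// inve0 maxye ltxx.
pose L n := fine (lebesgue_measure (I n)).
have LE n : (1 <= n)%N -> lebesgue_measure (I n) = (L n)%:E.
  by move=> n1; rewrite fineK// ge0_fin_numE ?finI// measure_ge0.
have L0 n : (1 <= n)%N -> 0 < L n by move=> n1; rewrite -lte_fin -LE// Lpos.
pose de n := Num.max (L n)^-1 (eps n).
have de0 n : (1 <= n)%N -> 0 < de n by move=> n1; rewrite lt_max eps0 ?orbT.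
have uE n : (1 <= n)%N -> u n = (de n `^ m)%:E.
  move=> n1; have Lm : L n `^ m != 0 by rewrite gt_eqF// powR_gt0// L0.
  have iL : 0 <= (L n)^-1 by rewrite invr_ge0 ltW// L0.
  rewrite /u LE// !poweR_EFin inver (negbTE Lm) -powRV ?(ltW (L0 _ n1))// -EFin_max; congr (_%:E).
  rewrite /de; have [h|h] := leP (L n)^-1 (eps n).
    by rewrite max_r// ge0_ler_powR ?nnegrE ?(ltW m0)// ltW// eps0.
  by rewrite max_l// ge0_ler_powR ?nnegrE ?(ltW m0) ?(ltW h)// ltW// eps0.
have dec : de @ \oo --> 0.
  have rc : de n.+1 `^ m @[n --> \oo] --> 0.
    apply: cvg_series_cvg_0; apply: nondecreasing_is_cvgn.
      by apply: nondecreasing_series => n _ _; exact: powR_ge0.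
    exists (fine S) => _ [N _ <-]; rewrite -lee_fin fineK; last first.
      by rewrite ge0_fin_numE//; apply: le_trans (uS 1%N); rewrite big_geq.
    apply: le_trans (uS N.+1); rewrite big_add1 /= /series /= -sumEFin.
    by rewrite le_eqVlt; apply/orP; left; apply/eqP; apply: eq_bigr => i _; rewrite uE.
  rewrite -cvg_shiftS; apply/cvgrPdist_le => /= e e0.
  have em : 0 < e `^ m by exact: powR_gt0.
  apply: filterS (eventually_small rc em) => n h; rewrite sub0r normrN gtr0_norm ?de0//.
  rewrite leNgt; apply/negP => ed; move: h; rewrite leNgt => /negP; apply.
  by apply: gt0_ltr_powR => //; rewrite nnegrE ltW// de0.
(* The exponent makes K^(-72) equal to [de], so that K^72 <= |I_n| and eps <= K^(-72). *)
pose K n := (de n)^-1 `^ (72%:R^-1).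
have K72 n : (1 <= n)%N -> K n ^+ 72 = (de n)^-1.
  by move=> n1; rewrite /K powR_root// invr_ge0 ltW// de0.
have Kp n : (1 <= n)%N -> 0 < K n by move=> n1; rewrite powR_gt0// invr_gt0 de0.
have kap n : (1 <= n)%N -> (K n)^-1 ^+ 72 = de n by move=> n1; rewrite exprVn K72// invrK.
have kapc : (fun n => (K n)^-1) @ \oo --> 0.
  apply/cvgrPdist_le => /= e e0; have e72 : 0 < e ^+ 72 by exact: exprn_gt0.
  have [n1 _ hn1] := eventually_small dec e72; exists (maxn 1 n1) => // n /=.
  rewrite geq_max => /andP[n_1 nn]; rewrite sub0r normrN gtr0_norm ?invr_gt0 ?Kp//.
  rewrite -(@ler_pXn2r _ 72) ?nnegrE ?invr_ge0 ?(ltW e0) ?(ltW (Kp _ n_1))//.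
  by rewrite kap//; exact: hn1.
(* The relative error: B / K from concentration, and 2 / |I_n| <= 2 de from the endpoints. *)
pose rho n := B * (K n)^-1 + 2 * de n.
have rhoc : rho @ \oo --> 0.
  by rewrite -[X in _ --> X]addr0 -[X in _ --> X + _](mulr0 B) -[X in _ --> _ + X](mulr0 2); apply: cvgD; exact: cvgnZ.
pose good n := [/\ (1 <= n)%N, K0 <= K n, eps n <= 1 / 2, de n <= 1 & rho n <= c / 2].
have K0p : 0 < K0 by lra.
have good_near : \forall n \near \oo, good n.
  have h1 : \forall n \near \oo, (1 <= n)%N by exists 1%N.
  have h2 : \forall n \near \oo, (K n)^-1 <= K0^-1 by apply: eventually_small => //; rewrite invr_gt0.
  have h3 : \forall n \near \oo, eps n <= 1 / 2 by apply: eventually_small.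
  have h4 : \forall n \near \oo, de n <= 1 by apply: eventually_small.
  have h5 : \forall n \near \oo, rho n <= c / 2 by apply: eventually_small => //; rewrite divr_gt0.
  apply: filterS2 (filterI h1 h2) (filterI h3 (filterI h4 h5)) => n [n1 hK] [e2 [d1 r2]]; split=> //.
  by move: hK; rewrite lef_pV2 ?posrE// Kp.
(* The assumptions start at n = 1; index 0 is not good and gets the empty exceptional set, with
   bound 0. *)
pose v n := if (1 <= n)%N then (B%:E * u n)%E else 0%E.
pose close n w := exists x y : R, [/\ nb_zeros (Qn n) (I n) w = x%:E,
   (\int[P]_w' nb_zeros (Qn n) (I n) w' = y%:E)%E, 0 < y & `|x / y - 1| <= 4 / c * rho n].
have step n : exists Bad : set T, [/\ measurable Bad, (P Bad <= v n)%E &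
    {ae P, forall w, ~ Bad w -> good n -> close n w}].
  have [[n1 KK e2 d1 r2]|ng] := pselect (good n); last first.
    exists set0; split; [exact: measurable0|rewrite measure0 /v; case: ifP => // _|by apply: aeW].
    by rewrite mule_ge0 ?lee_fin.
  have [a [b [ab lab abI Iab]]] := interval_endpoints (iI n n1) (finI n n1) (Lpos n n1).
  have Lab : L n = b - a by rewrite /L lab.
  have TK : K n ^+ 72 <= b - a.
    rewrite K72// -Lab -[leRHS]invrK lef_pV2 ?posrE ?invr_gt0 ?L0 ?de0//.
    by rewrite /de le_max lexx.
  have epsK : eps n <= (K n)^-1 ^+ 72 by rewrite kap// /de le_max lexx orbT.
  have [mu [Bad [mB PB cmu ae [lo up]]]] := H (J n) (I n) (eps n) (Qn n) a b (K n) abI Iab (IJ n n1) (clX n n1) (eps0 n n1) e2 KK TK epsK.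
  exists Bad; split=> //.
    (* The probability is at most B de^k, and de^k <= de^m because de <= 1 and m <= k. *)
    apply: (le_trans PB); rewrite /v n1 uE// -EFinM lee_fin ler_wpM2l//.
    rewrite exprM kap// -powR_mulrn ?(ltW (de0 _ n1))//.
    by apply: ger_powR => //; rewrite de0.
  pose E := B * ((b - a) * (K n)^-1) + 2.
  have ElE : E <= rho n * (b - a).
    rewrite /E /rho [leRHS]mulrDl; apply: lerD; first by rewrite le_eqVlt; apply/orP; left; apply/eqP; ring.
    rewrite -mulrA ler_peMr// -Lab -ler_pdivrMr ?L0// mul1r.
    by rewrite /de le_max lexx.
  have fn (z : \bar R) : ((mu - E)%:E <= z)%E -> (z <= (mu + E)%:E)%E -> z = (fine z)%:E.
    by move=> h1 h2; rewrite fineK// fin_real// (lt_le_trans (ltNyr _) h1) (le_lt_trans h2 (ltry _)).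
  apply: filterS ae => w hw nB _; have [l1 u1] := hw nB.
  have e1 := fn _ l1 u1; have e3 := fn _ lo up.
  exists (fine (nb_zeros (Qn n) (I n) w)), (fine (\int[P]_w' nb_zeros (Qn n) (I n) w')%E).
  rewrite e1 lee_fin in l1; rewrite e1 lee_fin in u1; rewrite e3 lee_fin in lo; rewrite e3 lee_fin in up.
  have ba : 0 < b - a by rewrite subr_gt0.
  by have [] := ratio_close c0 ba cmu ElE r2 l1 u1 lo up; split.
have [Bad HBad] : exists Bad : nat -> set T, forall n, [/\ measurable (Bad n), (P (Bad n) <= v n)%E &
    {ae P, forall w, ~ Bad n w -> good n -> close n w}] by have [f Hf] := choice step; exists f.
have bc : {ae P, forall w, \forall n \near \oo, ~ Bad n w}.
  apply: (@borel_cantelli _ _ _ P Bad v).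
  - by move=> n; have [] := HBad n.
  - by move=> n; rewrite /v; case: ifP => // _; rewrite mule_ge0 ?lee_fin.
  - by move=> n; have [] := HBad n.
  - have -> : (\sum_(n <oo) v n = B%:E * S)%E.
      rewrite -nneseriesZl; last by move=> i _; exact: u0.
      by rewrite [RHS]ereal_series_cond [RHS]eseries_mkcond; apply: eq_eseriesr => i _; rewrite /v andbT.
    by apply: lte_mul_pinfty => //; rewrite lee_fin.
have ca : {ae P, forall w, forall n, ~ Bad n w -> good n -> close n w}.
  by apply: ae_foralln => n; have [] := HBad n.
apply: filterS2 bc ca => w hb hc.
have nc : \forall n \near \oo, close n w.
  by apply: filterS2 hb good_near => n nB gn; exact: hc.
apply/fine_cvgP; split.
  apply: filterS nc => n [x [y [-> -> y0 _]]].
  by rewrite inver gt_eqF// -EFinM.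
have rc : 4 / c * rho n @[n --> \oo] --> 0 by rewrite -(mulr0 (4 / c)); exact: cvgnZ.
apply/cvgrPdist_le => /= e e0; apply: filterS2 nc (eventually_small rc e0) => n [x [y [-> -> y0 h]]] re.
by rewrite inver gt_eqF// -EFinM /= distrC (le_trans h).
Qed.
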